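(* Assume the Riemann Hypothesis. Let $\xi\in\mathbb{R}^+$, $\mathcal{B}\in C_c^\infty(\mathbb{R}^+)$, and $X>X_{\mathcal{B}}$. Then $$ \sum_{n\ge1}\Lambda(n)\,e(-n\xi)\,\mathcal{B}\Big(\frac nX\Big)=-\sum_{\rho=\frac12+i\gamma}\xi^{-1/2-i\gamma}\,\mathcal{Z}(\rho)\,\mathcal{B}\Big(\frac{\gamma}{2\pi\xi X}\Big)+O_{\xi,\mathcal{B}}(X^{9/10}), $$ where the sum on the right runs over all complex (nontrivial) zeros $\rho=\frac12+i\gamma$ of $\zeta(s)$ and the implied constant depends only on $\xi$ and $\mathcal{B}$.
   Context: $C_c^\infty(\mathbb{R}^+)$ is the space of smooth functions $f:\mathbb{R}^+\to\mathbb{C}$ with compact support in $\mathbb{R}^+=(0,\infty)$; such a function is extended by $0$ to $(-\infty,0]$ (so terms with $\gamma<0$ vanish). $\Lambda$ is the von Mangoldt function and $e(u)=e^{2\pi i u}$. For each $\mathcal{B}\in C_c^\infty(\mathbb{R}^+)$, $X_{\mathcal{B}}\ge 10$ is a fixed number such that $1\notin\{Xu:u\in\mathrm{supp}(\mathcal{B})\}$ for all $X>X_{\mathcal{B}}$. For $T>0$ not the ordinate of a zero of $\zeta$, $S(T)=\frac1\pi\arg\zeta(\tfrac12+iT)$ (argument defined by continuous variation along the segments from $2$ to $2+iT$ to $\tfrac12+iT$, starting with $\arg\zeta(2)=0$); $S$ has only integer jumps at ordinates of zeros. For a complex zero $\rho=\beta+i\gamma$ of $\zeta$ with $\gamma>0$,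 $\mathcal{Z}(\rho)=\lim_{T\to\gamma}\overline{e(S(T))}$ (the left and right limits agree). *)

(* Defs.v *)
From Stdlib Require Export Reals List ZArith Znumtheory.
From Stdlib Require Import ClassicalEpsilon.
From Coquelicot Require Export Coquelicot.
Open Scope R_scope.

Definition Cexp (z : C) : C :=
  (exp (Re z) * cos (Im z), exp (Re z) * sin (Im z)).

(* [a ^ s] for [a > 0]. *)
Definition rcpow (a : R) (s : C) : C := Cexp (s * RtoC (ln a)).

Definition e (u : R) : C := Cexp (0, 2 * PI * u).

Definition von_Mangoldt (n : nat) : R :=
  match excluded_middle_informative
          (exists p : nat, prime (Z.of_nat p) /\
             exists k : nat, (1 <= k)%nat /\ n = (p ^ k)%nat) with
  | left H => ln (INR (proj1_sig (constructive_indefinite_description _ H)))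
  | right _ => 0
  end.

(* Functions on (0, oo) are represented by their extension by 0 to all of R. *)

Definition support (B : R -> C) : R -> Prop := adherence (fun x => B x <> 0).

Definition smooth_at (B : R -> C) (x : R) : Prop :=
  forall n : nat,
    ex_derive_n (fun y => Re (B y)) n x /\ ex_derive_n (fun y => Im (B y)) n x.

Definition Cc_infty_pos (B : R -> C) : Prop :=
  (forall x, x <= 0 -> B x = 0) /\
  (forall x, 0 < x -> smooth_at B x) /\
  compact (support B) /\
  included (support B) (fun x => 0 < x).

Definition admissible_threshold (B : R -> C) (XB : R) : Prop :=
  10 <= XB /\
  forall X, XB < X -> ~ exists u, support B u /\ 1 = X * u.

Definition holomorphic_at (f : C -> C) (s : C) : Prop :=
  locally (T := C_UniformSpace) s
    (fun z => ex_derive (K := C_AbsRing) (V := C_NormedModule) f z).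

(* These two properties determine [f] everywhere except at the pole [s = 1],
   where the value of [zeta] below is arbitrary. *)
Definition continues_Dirichlet_series (f : C -> C) : Prop :=
  (forall s, 1 < Re s ->
     is_series (K := C_AbsRing) (V := C_NormedModule)
       (fun n => rcpow (INR (S n)) (- s)) (f s)) /\
  (forall s, s <> RtoC 1 -> holomorphic_at f s).

Definition zeta : C -> C :=
  epsilon (inhabits (fun _ => RtoC 0)) continues_Dirichlet_series.

Definition nontrivial_zero (rho : C) : Prop :=
  rho <> RtoC 1 /\ zeta rho = 0 /\
  forall k : nat, rho <> RtoC (-2 * INR (S k)).

Definition Riemann_hypothesis : Prop :=
  forall rho, nontrivial_zero rho -> Re rho = 1 / 2.

Definition has_order (f : C -> C) (z : C) (m : nat) : Prop :=
  exists g : C -> C,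
    holomorphic_at g z /\ g z <> 0 /\
    locally (T := C_UniformSpace) z (fun s => f s = ((s - z) ^ m * g s)%C).

Definition multiplicity (rho : C) : nat :=
  epsilon (inhabits 0%nat) (has_order zeta rho).

Definition zero_ordinate (T : R) : Prop :=
  exists rho, nontrivial_zero rho /\ Im rho = T.

(* The broken line 2 -> 2 + iT -> 1/2 + iT, parametrised by [0, 2]. *)
Definition arg_path (T u : R) : C :=
  if Rle_dec u 1 then (2, u * T) else (2 - 3 / 2 * (u - 1), T).

Definition is_arg_zeta (T a : R) : Prop :=
  exists theta : R -> R,
    continuous_on (fun u => 0 <= u <= 2) theta /\
    theta 0 = 0 /\
    (forall u, 0 <= u <= 2 ->
       zeta (arg_path T u)
       = (RtoC (Cmod (zeta (arg_path T u))) * Cexp (0%R, theta u))%C) /\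
    theta 2 = a.

(* Meaningful when [T > 0] is not the ordinate of a zero. *)
Definition S_arg (T : R) : R :=
  / PI * epsilon (inhabits 0) (is_arg_zeta T).

(* Meaningful when [Im rho > 0]; the limit is taken over the domain of S. *)
Definition calZ (rho : C) : C :=
  epsilon (inhabits (RtoC 0))
    (fun z => filterlim (fun T => Cconj (e (S_arg T)))
                (within (fun T => 0 < T /\ ~ zero_ordinate T)
                        (locally (Im rho)))
                (locally (T := C_UniformSpace) z)).

Definition list_sum (f : C -> C) (l : list C) : C :=
  fold_right (fun z acc => (f z + acc)%C) (RtoC 0) l.

(* [f] is unconditionally summable over the set [P], with sum [L]. *)
Definition has_sum_over (P : C -> Prop) (f : C -> C) (L : C) : Prop :=
  forall eps, 0 < eps ->
    exists l0, (forall z, In z l0 -> P z) /\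
      forall l, NoDup l -> (forall z, In z l -> P z) -> incl l0 l ->
        Cmod (list_sum f l - L) < eps.

(* Zeros are counted with multiplicity. *)
Definition has_sum_over_zeros (f : C -> C) (L : C) : Prop :=
  has_sum_over nontrivial_zero
    (fun rho => (RtoC (INR (multiplicity rho)) * f rho)%C) L.

(* Main.v *)
Require Import Defs.
From Stdlib Require Import Lra Lia Classical ClassicalEpsilon.
Import ListNotations.

(** Put [F(s) = X^s int B(v) e^(-2 pi i xi X v) v^(s-1) dv], the Mellin transform of
  [x -> e(-x xi) B(x/X)]. Integrating [F zeta'/zeta] over the boundary of
  [[-1/4, 3/2] x [t0, T]], with [T] a little above [X^3], gives [2 pi i] times the sum of
  [F(rho)]. The right edge is, by Mellin inversion, minus the prime sum up to
  [O(X^(1/2))]; on the left edge [F] is of size [X^(-1/4)] on a range of length [X] and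
  [zeta'/zeta] is logarithmic under RH, whence [O(X^(3/4+eps))]. Finally, by the method
  of stationary phase, [F(1/2 + i gamma)] is [xi^(-1/2 - i gamma) B(gamma/(2 pi xi X))]
  times [2 int cos(2 pi x) x^(-1/2 + i gamma) dx] up to [O(X^(-1/2))]; this oscillatory
  integral is the conjugate of the factor [chi] of the functional equation
  [zeta(s) = chi(s) zeta(1 - s)], and on the critical line
  [zeta(s) = chi(s) conj(zeta(s))] says that [chi(1/2 + it) = e(S(t))]. *)

(* On [Re s = sigma] the transform is bounded by [X^sigma] times the weight [X^2 / (X + |t|)^2],
   whose integral is of order [X]. This decay explains the height [X^3]: the tails above it cost at
   most [X^(1/2)], and the top edge only a power of a logarithm. The bottom edge stays at a fixed
   height near 300, clear of the pole; the zeros below it that matter are finitely many,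
   independently of [X], and zeros of negative ordinate drop out because [B] vanishes there. Two
   constructions keep the analysis elementary. The factor [chi] is defined by an absolutely
   convergent integral, and the functional equation comes from the Fourier series of a periodic
   quadratic; the integral met in stationary phase is then [chi] itself, without Gamma function or
   Stirling formula. And [zeta] is divided by its zeros in a band, leaving a zero-free cofactor;
   this replaces the residue theorem and yields the local bounds for [zeta'/zeta]. The exponent
   [9/10] leaves room above [3/4] for logarithms, each bounded by a multiple of [X^(1/20)]. *)
Tactic Notation "le_via" open_constr(t) := eapply Rle_trans; [apply t|].
Tactic Notation "le_mid" constr(t) := apply Rle_trans with t.
Tactic Notation "note" constr(t) := pose proof t.
Tactic Notation "note" constr(t) "as" simple_intropattern(p) := pose proof t as p.
Ltac mul_le := apply Rmult_le_compat; auto using Cmod_ge_0.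
Ltac mul_le_l := apply Rmult_le_compat_l.
Ltac mul_le_r := apply Rmult_le_compat_r.
Ltac div_cancel := unfold Rdiv; rewrite Rmult_assoc, Rinv_l, Rmult_1_r by lra.
Ltac min_le a b := pose proof (Rmin_l a b); pose proof (Rmin_r a b).
Ltac mulpos := repeat match goal with |- 0 < _ * _ => apply Rmult_lt_0_compat | |- 0 <= _ * _ => apply Rmult_le_pos end.
Ltac pos := solve
 [ mulpos; lra
 | apply Rdiv_lt_0_compat; lra | apply Rdiv_le_0_compat; lra | apply Rmult_lt_0_compat; lra | apply Rmult_le_pos; lra
 | apply Rinv_0_lt_compat; lra | left; apply Rinv_0_lt_compat; (lra || auto) | left; apply exp_pos ].
Local Notation C_RN := C_R_CompleteNormedModule.
Local Notation R_N := R_NormedModule.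
Ltac RtoC_nz := let X := fresh in intros X; apply (f_equal Re) in X; simpl in X; lra.

(** * Elementary facts about the complex modulus *)

Lemma ex_derive_cont (f : R -> R) x : ex_derive f x -> continuous f x.
Proof. apply (ex_derive_continuous (K := R_AbsRing) (V := R_NormedModule)). Qed.

Lemma Cmod_le_Re_Im (z : C) : Cmod z <= Rabs (Re z) + Rabs (Im z).
Proof. unfold Cmod. apply Rsqr_incr_0_var.
 - rewrite Rsqr_sqrt by nra. unfold Rsqr, Re, Im.
  note (Rabs_pos (fst z)). note (Rabs_pos (snd z)).
  note (pow2_abs (fst z)). note (pow2_abs (snd z)). nra.
 - note (Rabs_pos (Re z)). note (Rabs_pos (Im z)). lra.
Qed.

Lemma Im_le_Cmod (z : C) : Rabs (Im z) <= Cmod z.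
Proof. apply Rle_trans with (2 := Rmax_Cmod z). apply Rmax_r.
Qed.

Lemma Ceq_intro (z w : C) : Re z = Re w -> Im z = Im w -> z = w.
Proof. destruct z, w; simpl; intros -> ->; reflexivity. Qed.

Ltac Ceq := apply Ceq_intro; unfold Re, Im; simpl; try ring.

Lemma Cmod_minus_sym (z w : C) : Cmod (z - w) = Cmod (w - z).
Proof. rewrite <- Cmod_opp. f_equal. ring. Qed.

Lemma Cmod_triangle_minus (z w : C) : Cmod (z - w) <= Cmod z + Cmod w.
Proof. unfold Cminus. rewrite <- (Cmod_opp w). apply Cmod_triangle. Qed.

Lemma Cmod_triangle3 (a b c : C) : Cmod (a - c) <= Cmod (a - b) + Cmod (b - c).
Proof. replace (a - c)%C with ((a - b) + (b - c))%C by ring. apply Cmod_triangle. Qed.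

Lemma Cmod_triangle_rev (z w : C) : Cmod z - Cmod w <= Cmod (z - w).
Proof. note (Cmod_triangle (z - w) w). replace (z - w + w)%C with z in H by ring. lra.
Qed.

Lemma Cmod_lt_neq0 (z : C) : 0 < Cmod z -> z <> 0.
Proof. intros H. apply Cmod_gt_0; exact H. Qed.

Lemma Cmod_RtoC_pos (x : R) : 0 <= x -> Cmod (RtoC x) = x.
Proof. intros; rewrite Cmod_R; apply Rabs_pos_eq; auto. Qed.

Lemma Cminus_neq0 (a b : C) : a <> b -> (a - b)%C <> 0.
Proof. apply Cminus_eq_contra. Qed.

Lemma Cmod_inv' (z : C) : Cmod z <> 0 -> Cmod (/ z) = / Cmod z.
Proof. intros H. apply Cmod_inv. intros ->. apply H, Cmod_0. Qed.

Lemma Cmod_small_eq (a b : C) : (forall e, 0 < e -> Cmod (a - b) <= e) -> a = b.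
Proof. intros H. apply Ceq_minus. apply Cmod_eq_0.
 destruct (Req_dec (Cmod (a - b)) 0) as [E|E]; auto.
 note (Cmod_ge_0 (a-b)).
 specialize (H (Cmod (a - b) / 2) ltac:(lra)). lra.
Qed.

Lemma Re_le_Cmod' (z : C) : Re z <= Cmod z.
Proof. eapply Rle_trans; [apply Rle_abs|apply re_le_Cmod]. Qed.

(** * Differentiability along a subset of the plane *)

(** One notion covers complex differentiability ([S] the whole plane) and derivatives of curves ([S]
    the real axis, see [RD]), so the calculus rules are proved once. The form of the inequality
    avoids dividing by [w - z]. *)
Definition derw (S : C -> Prop) (f : C -> C) (z l : C) : Prop :=
 forall eps, 0 < eps -> exists d, 0 < d /\ forall w, S w -> Cmod (w - z) < d ->
  Cmod (f w - f z - l * (w - z)) <= eps * Cmod (w - z).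

Definition Cdiff (f : C -> C) (z l : C) : Prop := derw (fun _ => True) f z l.

Definition RD (f : R -> C) (x : R) (l : C) : Prop :=
 derw (fun w => Im w = 0) (fun w => f (Re w)) (RtoC x) l.

Section Rules.
Variable S : C -> Prop.

Lemma derw_const (c z : C) : derw S (fun _ => c) z 0.
Proof. intros eps He. exists 1. split. lra. intros w _ _.
 replace (c - c - 0 * (w - z))%C with (RtoC 0) by ring. rewrite Cmod_0.
 note (Cmod_ge_0 (w - z)). nra.
Qed.

Lemma derw_id (z : C) : derw S (fun w => w) z 1.
Proof. intros eps He. exists 1. split. lra. intros w _ _.
 replace (w - z - 1 * (w - z))%C with (RtoC 0) by ring. rewrite Cmod_0.
 note (Cmod_ge_0 (w - z)). nra.
Qed.

Lemma derw_plus f g z a b :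
 derw S f z a -> derw S g z b -> derw S (fun w => f w + g w)%C z (a + b).
Proof. intros Hf Hg eps He.
 destruct (Hf (eps/2)) as [d1 [D1 H1]]. lra.
 destruct (Hg (eps/2)) as [d2 [D2 H2]]. lra.
 exists (Rmin d1 d2). split. apply Rmin_pos; auto.
 intros w Sw Hw. min_le d1 d2.
 specialize (H1 w Sw ltac:(lra)). specialize (H2 w Sw ltac:(lra)).
 replace (f w + g w - (f z + g z) - (a + b) * (w - z))%C with
  ((f w - f z - a * (w - z)) + (g w - g z - b * (w - z)))%C by ring.
 le_via Cmod_triangle. lra.
Qed.

Lemma derw_lip f z l : derw S f z l -> exists d, 0 < d /\ forall w, S w -> Cmod (w - z) < d ->
 Cmod (f w - f z) <= (Cmod l + 1) * Cmod (w - z).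
Proof. intros Hf. destruct (Hf 1) as [d [D H]]. lra. exists d. split; auto.
 intros w Sw Hw. specialize (H w Sw Hw).
 replace (f w - f z)%C with ((f w - f z - l * (w - z)) + l * (w - z))%C by ring.
 le_via Cmod_triangle. rewrite Cmod_mult. lra.
Qed.

Lemma derw_comp f g z a b :
 Cdiff f (g z) a -> derw S g z b -> derw S (fun w => f (g w)) z (a * b).
Proof. intros Hf Hg eps He.
 destruct (derw_lip _ _ _ Hg) as [d1 [D1 H1]].
 note (Cmod_ge_0 b) as Pb. note (Cmod_ge_0 a) as Pa.
 destruct (Hf (eps / 2 / (Cmod b + 1))) as [d2 [D2 H2]].
 { pos. }
 destruct (Hg (eps / 2 / (Cmod a + 1))) as [d3 [D3 H3]].
 { pos. }
 exists (Rmin (Rmin d1 d3) (d2 / (Cmod b + 1))). split.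
 { repeat apply Rmin_pos; auto. pos. }
 intros w Sw Hw.
 assert (Cmod (w - z) < d1 /\ Cmod (w - z) < d3 /\ Cmod (w - z) < d2 / (Cmod b + 1)) as (W1 & W3 & W2).
 { note (Rmin_l (Rmin d1 d3) (d2 / (Cmod b + 1))).
  note (Rmin_r (Rmin d1 d3) (d2 / (Cmod b + 1))).
  min_le d1 d3. lra. }
 specialize (H1 w Sw W1). specialize (H3 w Sw W3).
 assert (Cmod (g w - g z) < d2).
 { apply Rle_lt_trans with (1 := H1). apply Rmult_lt_reg_r with (/ (Cmod b + 1)).
  apply Rinv_0_lt_compat; lra. replace ((Cmod b + 1) * Cmod (w - z) * / (Cmod b + 1)) with (Cmod (w-z)) by (field; lra). exact W2. }
 specialize (H2 (g w) I H).
 replace (f (g w) - f (g z) - a * b * (w - z))%C with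
  ((f (g w) - f (g z) - a * (g w - g z)) + a * (g w - g z - b * (w - z)))%C by ring.
 le_via Cmod_triangle. rewrite Cmod_mult.
 assert (eps / 2 / (Cmod b + 1) * Cmod (g w - g z) <= eps / 2 * Cmod (w - z)).
 { replace (eps / 2 * Cmod (w - z)) with (eps / 2 / (Cmod b + 1) * ((Cmod b + 1) * Cmod (w - z))) by (field; lra).
  mul_le_l; auto. left; apply Rdiv_lt_0_compat; lra. }
 assert (Cmod a * Cmod (g w - g z - b * (w - z)) <= eps / 2 * Cmod (w - z)).
 { le_mid ((Cmod a + 1) * (eps / 2 / (Cmod a + 1) * Cmod (w - z))).
  - note (Cmod_ge_0 (g w - g z - b * (w - z))). nra.
  - right; field; lra. }
 lra.
Qed.

Lemma derw_ext_loc f g z l :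
 (exists d, 0 < d /\ forall w, S w -> Cmod (w - z) < d -> f w = g w) -> f z = g z -> derw S f z l -> derw S g z l.
Proof. intros [d [D E]] Ez Hf eps He. destruct (Hf eps He) as [d' [D' H]].
 exists (Rmin d d'). split. apply Rmin_pos; auto.
 intros w Sw Hw. note (Rmin_l d d'). note (Rmin_r d d').
 rewrite <- E, <- Ez by (auto; lra). apply H; auto; lra.
Qed.

Lemma derw_ext f g z l : (forall w, f w = g w) -> derw S f z l -> derw S g z l.
Proof. intros E. apply derw_ext_loc; auto. exists 1; split; auto; lra. Qed.

(** Polarisation: [4 f g = (f + g)^2 - (f - g)^2], so the product rule follows from the chain rule
    with the quadratic [c v^2], whose remainder is exactly [c (w - u)^2]. *)
Lemma derw_mult f g z a b :
 derw S f z a -> derw S g z b -> derw S (fun w => f w * g w)%C z (a * g z + f z * b).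
Proof. intros Hf Hg.
 assert (Q : forall c u : C, Cdiff (fun v => c * (v * v))%C u (2 * c * u)).
 { intros c u eps He. note (Cmod_ge_0 c). exists (eps / (Cmod c + 1)). split. pos. intros w _ Hw. note (Cmod_ge_0 (w - u)).
  replace (c * (w * w) - c * (u * u) - 2 * c * u * (w - u))%C with (c * ((w - u) * (w - u)))%C by ring. rewrite !Cmod_mult, <- Rmult_assoc. mul_le_r; auto.
  le_mid ((Cmod c + 1) * (eps / (Cmod c + 1))). apply Rmult_le_compat; lra. right; field; lra. }
 assert (N : Cdiff (fun v => - v)%C (g z) (- (1))%C).
 { intros eps He. exists 1. split. lra. intros w _ _. replace (- w - - g z - - (1) * (w - g z))%C with (RtoC 0) by ring. rewrite Cmod_0. note (Cmod_ge_0 (w - g z)). nra. }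
 assert (N4 : (4 : C) <> 0) by (RtoC_nz).
 replace (a * g z + f z * b)%C with (2 * / 4 * (f z + g z) * (a + b) + 2 * - / 4 * (f z + - g z) * (a + - (1) * b))%C by (field; auto).
 eapply derw_ext. 2: apply derw_plus; [apply (derw_comp _ _ _ _ _ (Q _ _) (derw_plus _ _ _ _ _ Hf Hg))|apply (derw_comp _ _ _ _ _ (Q _ _) (derw_plus _ _ _ _ _ Hf (derw_comp _ _ _ _ _ N Hg)))].
 intros w. cbv beta. field; auto.
Qed.

End Rules.

Lemma Cdiff_const c z : Cdiff (fun _ => c) z 0. Proof. apply derw_const. Qed.
Lemma Cdiff_id z : Cdiff (fun w => w) z 1. Proof. apply derw_id. Qed.
Lemma Cdiff_plus f g z a b : Cdiff f z a -> Cdiff g z b -> Cdiff (fun w => f w + g w)%C z (a + b).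
Proof. apply derw_plus. Qed.
Lemma Cdiff_mult f g z a b : Cdiff f z a -> Cdiff g z b -> Cdiff (fun w => f w * g w)%C z (a * g z + f z * b).
Proof. apply derw_mult. Qed.
Lemma Cdiff_comp f g z a b : Cdiff f (g z) a -> Cdiff g z b -> Cdiff (fun w => f (g w)) z (a * b).
Proof. apply derw_comp. Qed.
Lemma Cdiff_ext f g z l : (forall w, f w = g w) -> Cdiff f z l -> Cdiff g z l.
Proof. apply derw_ext. Qed.
Lemma Cdiff_ext_loc f g z l :
 (exists d, 0 < d /\ forall w, Cmod (w - z) < d -> f w = g w) -> Cdiff f z l -> Cdiff g z l.
Proof. intros [d [D E]]. apply derw_ext_loc. exists d; split; auto. apply E.
 replace (z - z)%C with (RtoC 0) by ring. rewrite Cmod_0; auto.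
Qed.
Lemma Cdiff_scal c f z a : Cdiff f z a -> Cdiff (fun w => c * f w)%C z (c * a).
Proof. intros H. replace (c * a)%C with (0 * f z + c * a)%C by ring.
 apply (Cdiff_mult (fun _ => c)); auto using Cdiff_const.
Qed.
Lemma Cdiff_opp f z a : Cdiff f z a -> Cdiff (fun w => - f w)%C z (- a).
Proof. intros H. replace (- a)%C with (-(1) * a)%C by ring.
 apply Cdiff_ext with (fun w => (- (1)) * f w)%C. intros; ring. apply Cdiff_scal; auto.
Qed.
Lemma Cdiff_minus f g z a b : Cdiff f z a -> Cdiff g z b -> Cdiff (fun w => f w - g w)%C z (a - b).
Proof. intros. apply Cdiff_plus; auto using Cdiff_opp. Qed.

Lemma Cdiff_inv_id (z : C) : z <> 0 -> Cdiff (fun w => / w)%C z (- / (z * z))%C.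
Proof. intros Hz eps He. note (proj1 (Cmod_gt_0 z) Hz) as P.
 set (m := Cmod z) in *.
 exists (Rmin (m / 2) (eps * (m * m * m) / 2)). split.
 { apply Rmin_pos. lra. assert (0 < m * m * m) by (repeat apply Rmult_lt_0_compat; auto). nra. }
 intros w _ Hw. note (Rmin_l (m / 2) (eps * (m * m * m) / 2)). note (Rmin_r (m / 2) (eps * (m * m * m) / 2)).
 note (Cmod_triangle_rev z w). rewrite Cmod_minus_sym in H1. fold m in H1.
 assert (Pw : m / 2 < Cmod w) by lra.
 assert (w <> 0) by (apply Cmod_lt_neq0; lra).
 replace (/ w - / z - - / (z * z) * (w - z))%C with ((w - z) * (w - z) * / (w * (z * z)))%C by (field; auto).
 rewrite !Cmod_mult, Cmod_inv, !Cmod_mult by (repeat apply Cmult_neq_0; auto). fold m.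
 note (Cmod_ge_0 (w - z)). rewrite Rmult_comm, <- Rmult_assoc.
 mul_le_r; auto. rewrite Rmult_comm.
 apply Rmult_le_reg_r with (Cmod w * (m * m)). repeat apply Rmult_lt_0_compat; lra.
 rewrite Rmult_assoc, Rinv_l, Rmult_1_r by (repeat apply Rmult_integral_contrapositive_currified; lra).
 le_mid (eps * (m / 2 * (m * m))). nra.
 mul_le_l. lra. mul_le_r. nra. lra.
Qed.

Lemma Cdiff_inv f z a : f z <> RtoC 0 -> Cdiff f z a -> Cdiff (fun w => / f w)%C z (- a / (f z * f z))%C.
Proof. intros Hz H. replace (- a / (f z * f z))%C with (- / (f z * f z) * a)%C by (field; auto).
 apply (Cdiff_comp (fun w => / w)%C); auto using Cdiff_inv_id.
Qed.

Lemma Cdiff_div f g z a b : g z <> RtoC 0 -> Cdiff f z a -> Cdiff g z b ->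
 Cdiff (fun w => f w / g w)%C z ((a * g z - f z * b) / (g z * g z))%C.
Proof. intros Hz Hf Hg. replace ((a * g z - f z * b) / (g z * g z))%C with (a * / g z + f z * (- b / (g z * g z)))%C by (field; auto).
 apply (Cdiff_mult f (fun w => / g w)%C); auto using Cdiff_inv.
Qed.

Lemma Cdiff_unique f z a b : Cdiff f z a -> Cdiff f z b -> a = b.
Proof. intros Ha Hb. apply Cmod_small_eq. intros e He.
 destruct (Ha (e/2)) as [d1 [D1 H1]]. lra. destruct (Hb (e/2)) as [d2 [D2 H2]]. lra.
 set (h := Rmin d1 d2 / 2). assert (0 < Rmin d1 d2) by (apply Rmin_pos; auto).
 min_le d1 d2.
 assert (0 < h) by (unfold h; lra).
 set (w := (z + RtoC h)%C). assert (E : (w - z)%C = RtoC h) by (unfold w; ring).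
 assert (Eh : Cmod (w - z) = h) by (rewrite E; apply Cmod_RtoC_pos; lra).
 specialize (H1 w I ltac:(unfold h in *; lra)). specialize (H2 w I ltac:(unfold h in *; lra)).
 apply Rmult_le_reg_r with h; auto. rewrite <- Eh at 1. rewrite <- Cmod_mult.
 replace ((a - b) * (w - z))%C with ((f w - f z - b * (w - z)) - (f w - f z - a * (w - z)))%C by ring.
 le_via Cmod_triangle_minus. rewrite Eh in *. lra.
Qed.

Lemma RD_iff f x l : RD f x l <-> forall eps, 0 < eps -> exists d, 0 < d /\ forall y, Rabs (y - x) < d ->
  Cmod (f y - f x - l * RtoC (y - x)) <= eps * Rabs (y - x).
Proof. split; intros H eps He; destruct (H eps He) as [d [D K]]; exists d; split; auto.
 - intros y Hy. specialize (K (RtoC y) eq_refl). rewrite <- RtoC_minus, Cmod_R in K. apply K; auto.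
 - intros w Sw Hw. assert (w = RtoC (Re w)) as E by (apply Ceq_intro; simpl; auto).
  rewrite E in Hw |- *. simpl. rewrite <- RtoC_minus, Cmod_R in *. apply K; auto.
Qed.

Lemma RD_const c x : RD (fun _ => c) x 0. Proof. apply derw_const. Qed.
Lemma RD_plus f g x a b : RD f x a -> RD g x b -> RD (fun y => f y + g y)%C x (a + b).
Proof. apply derw_plus. Qed.
Lemma RD_mult f g x a b : RD f x a -> RD g x b -> RD (fun y => f y * g y)%C x (a * g x + f x * b).
Proof. apply derw_mult. Qed.
Lemma RD_comp f g x a b : Cdiff f (g x) a -> RD g x b -> RD (fun y => f (g y)) x (a * b).
Proof. intros. apply (derw_comp _ f (fun w => g (Re w))); auto. Qed.
Lemma RD_scal c f x a : RD f x a -> RD (fun w => c * f w)%C x (c * a).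
Proof. intros H. replace (c * a)%C with (0 * f x + c * a)%C by ring.
 apply (RD_mult (fun _ => c)); auto using RD_const.
Qed.
Lemma RD_ext f g x l : (forall w, f w = g w) -> RD f x l -> RD g x l.
Proof. intros E. apply derw_ext. auto. Qed.
Lemma RD_ext_loc f g x l :
 (exists d, 0 < d /\ forall y, Rabs (y - x) < d -> f y = g y) -> RD f x l -> RD g x l.
Proof. intros [d [D E]] H. apply RD_iff. intros eps He. apply RD_iff with (eps := eps) in H; auto.
 destruct H as [d' [D' H]]. exists (Rmin d d'). split. apply Rmin_pos; auto.
 intros y Hy. note (Rmin_l d d'). note (Rmin_r d d').
 rewrite <- !E. apply H; lra. rewrite Rminus_diag, Rabs_R0; auto. lra.
Qed.
Lemma RD_opp f x a : RD f x a -> RD (fun w => - f w)%C x (- a).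
Proof. intros H. replace (- a)%C with (-(1) * a)%C by ring.
 apply RD_ext with (fun w => (- (1)) * f w)%C. intros; ring. apply RD_scal; auto.
Qed.
Lemma RD_minus f g x a b : RD f x a -> RD g x b -> RD (fun y => f y - g y)%C x (a - b).
Proof. intros. apply RD_plus; auto using RD_opp. Qed.

Lemma RD_RtoC (f : R -> R) x l : is_derive f x l -> RD (fun y => RtoC (f y)) x (RtoC l).
Proof. intros H. apply RD_iff. intros eps He.
 destruct H as [_ H]. specialize (H x (fun P Q => Q)). specialize (H (mkposreal eps He)).
 destruct H as [d Hd]. exists d. split. apply cond_pos.
 intros y Hy. specialize (Hd y Hy). rewrite <- RtoC_minus, <- RtoC_mult, <- RtoC_minus, Cmod_R.
 unfold norm, minus, plus, opp, scal in Hd; simpl in Hd. unfold abs, mult in Hd; simpl in Hd.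
 replace (f y - f x - l * (y - x)) with (f y + - f x + - ((y + - x) * l)) by ring.
 exact Hd.
Qed.

Lemma RD_Re f x l : RD f x l -> is_derive (fun y => Re (f y)) x (Re l).
Proof. intros H. split. apply is_linear_scal_l. intros x0 Hx0. 
 apply (is_filter_lim_locally_unique (V := R_N)) in Hx0. subst x0. intros eps.
 destruct (proj1 (RD_iff f x l) H eps (cond_pos eps)) as [d [D K]].
 exists (mkposreal d D). intros y Hy. specialize (K y Hy).
 unfold norm, minus, plus, opp, scal; simpl. unfold abs, mult; simpl.
 refine (Rle_trans _ _ _ _ K).
 eapply Rle_trans; [|apply re_le_Cmod]. right. f_equal. unfold Re; simpl. ring.
Qed.

Lemma RD_mulR f x l c : RD f x l -> is_derive (fun y => Re (c * f y)%C) x (Re (c * l)%C).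
Proof. intros. apply RD_Re, RD_scal; auto. Qed.

Lemma RD_Im f x l : RD f x l -> is_derive (fun y => Im (f y)) x (Im l).
Proof. intros H. apply (RD_mulR f x l (- Ci)%C) in H.
 eapply is_derive_ext. 2: { evar_last. exact H. unfold Re, Im; simpl; ring. }
 intros t. unfold Re, Im; simpl; ring.
Qed.

Lemma RD_pair (u v : R -> R) x a b : is_derive u x a -> is_derive v x b -> RD (fun y => (u y, v y)) x (a, b).
Proof. intros Hu Hv. apply RD_RtoC in Hu. apply RD_RtoC in Hv.
 apply RD_ext with (fun y => RtoC (u y) + Ci * RtoC (v y))%C.
 intros; Ceq. replace (a, b) with (RtoC a + Ci * RtoC b)%C by Ceq.
 apply RD_plus; auto. apply RD_scal; auto.
Qed.

Lemma RD_id x : RD RtoC x 1.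
Proof. apply RD_iff. intros eps He. exists 1. split. lra. intros y _. rewrite RtoC_minus.
 replace (y - x - 1 * (y - x))%C with (RtoC 0) by ring. rewrite Cmod_0. note (Rabs_pos (y - x)). nra.
Qed.

(** * Continuity *)

Definition contC (f : C -> C) (z : C) : Prop :=
 forall eps, 0 < eps -> exists d, 0 < d /\ forall w, Cmod (w - z) < d -> Cmod (f w - f z) < eps.
Definition contR (f : R -> C) (x : R) : Prop :=
 forall eps, 0 < eps -> exists d, 0 < d /\ forall y, Rabs (y - x) < d -> Cmod (f y - f x) < eps.

Lemma contR_continuous f x : contR f x <-> continuous (U := C_RN) f x.
Proof. split.
 - intros H. apply filterlim_locally. intros eps. destruct (H eps (cond_pos eps)) as [d [D K]].
  exists (mkposreal d D). intros y Hy. apply C_NormedModule_mixin_compat1. apply K. exact Hy.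
 - intros H eps He. assert (He2 : 0 < eps / 2) by lra.
  note (proj1 (filterlim_locally (U := C_RN) f (f x)) H (mkposreal _ He2)) as [d K].
  exists d. split. apply cond_pos. intros y Hy. specialize (K y Hy).
  destruct K as [K1 K2]. simpl in K1, K2. unfold ball in K1, K2; simpl in K1, K2. unfold AbsRing_ball, abs, minus, plus, opp in K1, K2; simpl in K1, K2.
  eapply Rle_lt_trans. apply Cmod_le_Re_Im. simpl. unfold Rminus in *. lra.
Qed.

Lemma derw_cont S f z l : derw S f z l -> forall eps, 0 < eps -> exists d, 0 < d /\ forall w, S w -> Cmod (w - z) < d -> Cmod (f w - f z) < eps.
Proof. intros H eps He. destruct (derw_lip _ _ _ _ H) as [d [D K]]. note (Cmod_ge_0 l).
 exists (Rmin d (eps / (Cmod l + 1))). split. apply Rmin_pos; auto. pos. intros w Sw Hw.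
 note (Rmin_l d (eps / (Cmod l + 1))). note (Rmin_r d (eps / (Cmod l + 1))). eapply Rle_lt_trans. apply K; auto; lra.
 apply Rlt_le_trans with ((Cmod l + 1) * (eps / (Cmod l + 1))). apply Rmult_lt_compat_l; lra. right; field; lra.
Qed.

Lemma Cdiff_contC f z l : Cdiff f z l -> contC f z.
Proof. intros H eps He. destruct (derw_cont _ _ _ _ H eps He) as (d & D & K). exists d; split; auto. Qed.

Lemma RD_contR f x l : RD f x l -> contR f x.
Proof. intros H eps He. destruct (derw_cont _ _ _ _ H eps He) as (d & D & K). exists d; split; auto. intros y Hy. apply (K (RtoC y)); auto. rewrite <- RtoC_minus, Cmod_R; auto.
Qed.

Lemma contR_const c x : contR (fun _ => c) x.
Proof. eapply RD_contR, RD_const. Qed.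

Lemma contR_plus f g x : contR f x -> contR g x -> contR (fun y => f y + g y)%C x.
Proof. intros Hf Hg eps He. destruct (Hf (eps/2)) as [d1 [D1 H1]]. lra. destruct (Hg (eps/2)) as [d2 [D2 H2]]. lra.
 exists (Rmin d1 d2). split. apply Rmin_pos; auto. intros y Hy.
 min_le d1 d2.
 specialize (H1 y ltac:(lra)). specialize (H2 y ltac:(lra)).
 replace (f y + g y - (f x + g x))%C with ((f y - f x) + (g y - g x))%C by ring.
 eapply Rle_lt_trans. apply Cmod_triangle. lra.
Qed.

Lemma contR_comp f g x : contC f (g x) -> contR g x -> contR (fun y => f (g y)) x.
Proof. intros Hf Hg eps He. destruct (Hf eps He) as [d1 [D1 H1]]. destruct (Hg d1 D1) as [d2 [D2 H2]].
 exists d2. split; auto.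
Qed.

Lemma contR_mult f g x : contR f x -> contR g x -> contR (fun y => f y * g y)%C x.
Proof. intros Hf Hg.
 assert (K : forall h, contR h x -> contR (fun y => h y * h y)%C x).
 { intros h Hh. apply (contR_comp (fun z => z * z)%C h); auto.
  eapply Cdiff_contC. apply Cdiff_mult; apply Cdiff_id. }
 assert (Sc : forall c h, contR h x -> contR (fun y => c * h y)%C x).
 { intros c h Hh. apply (contR_comp (fun z => c * z)%C h); auto.
  eapply Cdiff_contC. apply Cdiff_scal; apply Cdiff_id. }
 note (K _ (contR_plus _ _ _ Hf Hg)) as A. note (K _ (contR_plus _ _ _ Hf (Sc (-(1))%C _ Hg))) as B.
 note (Sc (/ 4)%C _ (contR_plus _ _ _ A (Sc (-(1))%C _ B))) as E.
 intros eps He. destruct (E eps He) as [d [D Q]]. exists d; split; auto.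
 intros y Hy. specialize (Q y Hy).
 assert ((4:C) <> 0) by (RtoC_nz).
 match goal with |- Cmod ?a < _ => match type of Q with Cmod ?b < _ => replace a with b end end; auto.
 field; auto.
Qed.

Lemma contR_scal c f x : contR f x -> contR (fun y => c * f y)%C x.
Proof. intros. apply contR_mult; auto using contR_const. Qed.
Lemma contR_opp f x : contR f x -> contR (fun y => - f y)%C x.
Proof. intros H eps He. destruct (H eps He) as [d [D K]]. exists d; split; auto. intros y Hy.
 replace (- f y - - f x)%C with (- (f y - f x))%C by ring. rewrite Cmod_opp. auto. Qed.
Lemma contR_minus f g x : contR f x -> contR g x -> contR (fun y => f y - g y)%C x.
Proof. intros. apply contR_plus; auto using contR_opp. Qed.
Lemma contR_inv f x : f x <> RtoC 0 -> contR f x -> contR (fun y => / f y)%C x.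
Proof. intros Hz H. apply (contR_comp (fun z => / z)%C); auto. eapply Cdiff_contC, Cdiff_inv_id; auto. Qed.
Lemma contR_ext f g x : (forall y, f y = g y) -> contR f x -> contR g x.
Proof. intros E H eps He. destruct (H eps He) as [d [D K]]. exists d; split; auto. intros. rewrite <- !E. auto. Qed.
Lemma contR_ext_loc f g x : (exists d, 0 < d /\ forall y, Rabs (y - x) < d -> f y = g y) -> contR f x -> contR g x.
Proof. intros [d0 [D0 E]] H eps He. destruct (H eps He) as [d [D K]]. exists (Rmin d0 d); split. apply Rmin_pos; auto.
 intros y Hy. min_le d0 d. rewrite <- !E; try lra. apply K; lra.
 rewrite Rminus_diag, Rabs_R0; auto. Qed.

Lemma contC_const c z : contC (fun _ => c) z.
Proof. eapply Cdiff_contC, Cdiff_const. Qed.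
Lemma contC_ext_loc f g z : (exists d, 0 < d /\ forall w, Cmod (w - z) < d -> f w = g w) -> contC f z -> contC g z.
Proof. intros [d0 [D0 E]] H eps He. destruct (H eps He) as [d [D K]]. exists (Rmin d0 d); split. apply Rmin_pos; auto.
 intros y Hy. min_le d0 d. rewrite <- !E; try lra. apply K; lra.
 replace (z - z)%C with (RtoC 0) by ring. rewrite Cmod_0; auto. Qed.

Lemma contR_pair (u v : R -> R) x : continuous u x -> continuous v x -> contR (fun y => (u y, v y)) x.
Proof. intros Hu Hv eps He. assert (He2 : 0 < eps / 2) by lra.
 destruct (proj1 (filterlim_locally u (u x)) Hu (mkposreal _ He2)) as [d1 K1].
 destruct (proj1 (filterlim_locally v (v x)) Hv (mkposreal _ He2)) as [d2 K2].
 exists (Rmin d1 d2). split. apply Rmin_pos; apply cond_pos. intros y Hy.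
 min_le d1 d2.
 assert (A1 : Rabs (y - x) < d1) by lra. assert (A2 : Rabs (y - x) < d2) by lra.
 specialize (K1 y A1). specialize (K2 y A2).
 unfold ball in K1, K2; simpl in K1, K2. unfold AbsRing_ball, abs, minus, plus, opp in K1, K2; simpl in K1, K2.
 eapply Rle_lt_trans. apply Cmod_le_Re_Im. simpl. unfold Rminus in *. lra.
Qed.

Lemma contR_RtoC (u : R -> R) x : continuous u x -> contR (fun y => RtoC (u y)) x.
Proof. intros. apply (contR_pair u (fun _ => 0)); auto. apply continuous_const. Qed.

Lemma is_derive_continuity_pt (g : R -> R) (x l : R) : is_derive g x l -> continuity_pt g x.
Proof. intros H. apply continuity_pt_filterlim.
 apply ex_derive_cont. exists l; exact H.
Qed.

(** The real mean value theorem is applied to [Re (conj u f) - |u| G] with [u = f b - f a]. The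
    derivative of this real function is at most 0, because [Re (conj u f')] is at most [|u| |f'|].
    The case [u = 0] only needs [G] to increase. *)
Lemma Rdiff_le_of_deriv_le f f' (G G' : R -> R) a b : a <= b -> (forall x, a <= x <= b -> RD f x (f' x)) ->
 (forall x, a <= x <= b -> is_derive G x (G' x)) ->
 (forall x, a <= x <= b -> Cmod (f' x) <= G' x) -> Cmod (f b - f a) <= G b - G a.
Proof. intros Hab Hd HG HM. set (u := (f b - f a)%C).
 destruct (Req_dec (Cmod u) 0) as [E|E].
 - rewrite E. destruct (MVT_gen G a b G') as [c [Hc Hm]].
  + intros x Hx. rewrite Rmin_left, Rmax_right in Hx by auto. apply HG; lra.
  + intros x Hx. rewrite Rmin_left, Rmax_right in Hx by auto. eapply is_derive_continuity_pt. apply HG; auto.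
  + rewrite Rmin_left, Rmax_right in Hc by auto. rewrite Hm.
  note (Cmod_ge_0 (f' c)). specialize (HM c Hc). nra.
 - note (Cmod_ge_0 u).
  assert (DD : forall x, a <= x <= b ->
  is_derive (fun y => Re (Cconj u * f y)%C - Cmod u * G y) x (Re (Cconj u * f' x)%C - Cmod u * G' x)).
  { intros x Hx. apply (is_derive_minus (K := R_AbsRing) (V := R_N)). apply RD_mulR, Hd. lra.
  apply (is_derive_scal G). apply HG. lra. }
  destruct (MVT_gen (fun y => Re (Cconj u * f y)%C - Cmod u * G y) a b (fun y => Re (Cconj u * f' y)%C - Cmod u * G' y)) as [c [Hc Hm]].
  + intros x Hx. rewrite Rmin_left, Rmax_right in Hx by auto. apply DD; lra.
  + intros x Hx. rewrite Rmin_left, Rmax_right in Hx by auto. eapply is_derive_continuity_pt. apply DD; auto.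
  + rewrite Rmin_left, Rmax_right in Hc by auto.
  assert (E2 : Re (Cconj u * f b)%C - Re (Cconj u * f a)%C = Cmod u ^ 2).
  { rewrite Cmod2_alt. unfold u. simpl. ring. }
  assert (Re (Cconj u * f' c)%C <= Cmod u * G' c).
  { le_via Re_le_Cmod'. rewrite Cmod_mult, Cmod_conj. mul_le_l; auto. }
  apply Rmult_le_reg_l with (Cmod u). lra. nra.
Qed.

Lemma RD_mean_ineq f f' a b M : a <= b -> (forall x, a <= x <= b -> RD f x (f' x)) ->
 (forall x, a <= x <= b -> Cmod (f' x) <= M) -> Cmod (f b - f a) <= M * (b - a).
Proof. intros Hab Hd HM. rewrite Rmult_minus_distr_l. apply (Rdiff_le_of_deriv_le f f' (fun x => M * x) (fun _ => M)); auto. intros. auto_derive; auto; ring.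
Qed.

(** * The complex exponential *)

Lemma exp_le x y : x <= y -> exp x <= exp y.
Proof. intros [H| ->]; [left; apply exp_increasing; auto|right; auto]. Qed.


Lemma Cexp_0 : Cexp 0 = 1.
Proof. unfold Cexp. simpl. rewrite exp_0, cos_0, sin_0. Ceq. Qed.
Lemma Cexp_plus a b : Cexp (a + b) = (Cexp a * Cexp b)%C.
Proof. unfold Cexp. apply Ceq_intro; simpl; rewrite ?re_plus, ?im_plus; unfold Re, Im; simpl; rewrite exp_plus, ?cos_plus, ?sin_plus; ring. Qed.
Lemma Cmod_Cexp z : Cmod (Cexp z) = exp (Re z).
Proof. unfold Cmod, Cexp; simpl. replace (exp (Re z) * cos (Im z) * (exp (Re z) * cos (Im z) * 1) + exp (Re z) * sin (Im z) * (exp (Re z) * sin (Im z) * 1))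
  with (exp (Re z) * exp (Re z) * (Rsqr (sin (Im z)) + Rsqr (cos (Im z)))) by (unfold Rsqr; ring).
 rewrite sin2_cos2, Rmult_1_r. apply sqrt_square. pos.
Qed.
Lemma Cexp_neq0 z : Cexp z <> 0.
Proof. apply Cmod_lt_neq0. rewrite Cmod_Cexp. apply exp_pos. Qed.
Lemma Cexp_opp z : Cexp (- z) = (/ Cexp z)%C.
Proof. note (Cexp_plus z (- z)). replace (z + - z)%C with (RtoC 0) in H by ring. rewrite Cexp_0 in H.
 note (Cexp_neq0 z). replace (/ Cexp z)%C with (/ Cexp z * 1)%C by ring. rewrite H. field; auto.
Qed.
Lemma Cconj_Cexp z : Cconj (Cexp z) = Cexp (Cconj z).
Proof. unfold Cexp, Cconj; simpl. rewrite cos_neg, sin_neg. Ceq. Qed.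
Lemma RtoC_exp x : RtoC (exp x) = Cexp (RtoC x).
Proof. unfold Cexp; simpl. rewrite cos_0, sin_0. Ceq. Qed.

Lemma RD_Cexp_line h x : RD (fun t => Cexp (RtoC t * h)) x (h * Cexp (RtoC x * h)).
Proof. apply RD_ext with (fun t => (exp (t * Re h) * cos (t * Im h), exp (t * Re h) * sin (t * Im h))).
 { intros t. unfold Cexp. rewrite re_scal_l, im_scal_l. reflexivity. }
 replace (h * Cexp (x * h))%C with
  (Re h * exp (x * Re h) * cos (x * Im h) - exp (x * Re h) * (Im h * sin (x * Im h)),
  Re h * exp (x * Re h) * sin (x * Im h) + exp (x * Re h) * (Im h * cos (x * Im h))).
 - apply RD_pair; auto_derive; auto; ring.
 - unfold Cexp. rewrite re_scal_l, im_scal_l. destruct h as [p q]. Ceq.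
Qed.

Lemma Cexp_sub_1 h : Cmod (Cexp h - 1) <= Cmod h * exp (Cmod h).
Proof. note (RD_mean_ineq (fun t => Cexp (RtoC t * h)) (fun x => h * Cexp (RtoC x * h))%C 0 1 (Cmod h * exp (Cmod h))).
 cbv beta in H. replace (RtoC 1 * h)%C with h in H by ring. replace (RtoC 0 * h)%C with (RtoC 0) in H by ring. rewrite Cexp_0 in H.
 replace (Cmod h * exp (Cmod h) * (1 - 0)) with (Cmod h * exp (Cmod h)) in H by ring.
 apply H. lra. intros; apply RD_Cexp_line.
 intros x Hx. rewrite Cmod_mult, Cmod_Cexp. mul_le_l. apply Cmod_ge_0.
 apply exp_le. rewrite re_scal_l. note (Re_le_Cmod' h). note (Cmod_ge_0 h).
 destruct (Rle_dec 0 (Re h)); nra.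
Qed.

Lemma Cexp_sub_1_lin h : Cmod (Cexp h - 1 - h) <= Cmod h * Cmod h * exp (Cmod h).
Proof. note (RD_mean_ineq (fun t => Cexp (RtoC t * h) - h * RtoC t)%C (fun x => h * Cexp (RtoC x * h) - h * 1)%C 0 1 (Cmod h * Cmod h * exp (Cmod h))).
 cbv beta in H. replace (RtoC 1 * h)%C with h in H by ring. replace (RtoC 0 * h)%C with (RtoC 0) in H by ring. rewrite Cexp_0 in H.
 replace (Cmod h * Cmod h * exp (Cmod h) * (1 - 0)) with (Cmod h * Cmod h * exp (Cmod h)) in H by ring.
 replace (Cexp h - 1 - h)%C with (Cexp h - h * 1 - (1 - h * 0))%C by ring.
 apply H. lra.
 - intros. apply RD_minus. apply RD_Cexp_line. apply RD_scal, RD_id.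
 - intros x Hx. replace (h * Cexp (x * h) - h * 1)%C with (h * (Cexp (x * h) - 1))%C by ring.
  rewrite Cmod_mult, Rmult_assoc. mul_le_l. apply Cmod_ge_0.
  le_via Cexp_sub_1. rewrite Cmod_mult, Cmod_RtoC_pos by lra. note (Cmod_ge_0 h).
  apply Rmult_le_compat; try nra. pos. apply exp_le. nra.
Qed.

Lemma Cdiff_Cexp z : Cdiff Cexp z (Cexp z).
Proof. intros eps He. note (exp_pos (Re z)) as P. note (exp_pos 1) as P1.
 exists (Rmin 1 (eps / (exp (Re z) * exp 1))). split.
 { apply Rmin_pos. lra. apply Rdiv_lt_0_compat; auto. nra. }
 intros w _ Hw. note (Rmin_l 1 (eps / (exp (Re z) * exp 1))). note (Rmin_r 1 (eps / (exp (Re z) * exp 1))).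
 replace (Cexp w - Cexp z - Cexp z * (w - z))%C with (Cexp z * (Cexp (w - z) - 1 - (w - z)))%C.
 2:{ replace (Cexp w) with (Cexp (z + (w - z))) by (f_equal; ring). rewrite Cexp_plus. ring. }
 rewrite Cmod_mult, Cmod_Cexp. note (Cmod_ge_0 (w - z)).
 le_mid (exp (Re z) * (Cmod (w - z) * Cmod (w - z) * exp 1)).
 - mul_le_l. lra. le_via Cexp_sub_1_lin.
  mul_le_l. nra. apply exp_le. lra.
 - replace (exp (Re z) * (Cmod (w - z) * Cmod (w - z) * exp 1)) with ((Cmod (w - z) * (exp (Re z) * exp 1)) * Cmod (w - z)) by ring.
  mul_le_r; auto. apply Rmult_le_reg_r with (/ (exp (Re z) * exp 1)). apply Rinv_0_lt_compat; nra.
  rewrite Rmult_assoc, Rinv_r by nra. unfold Rdiv in H0. lra.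
Qed.

(** * Integrals of complex-valued functions *)

Definition CInt (f : R -> C) (a b : R) : C := RInt (V := C_RN) f a b.

Definition contI (f : R -> C) (a b : R) : Prop := forall x, a <= x <= b -> contR f x.

Lemma contI_sub f a b a' b' : contI f a b -> a <= a' -> b' <= b -> contI f a' b'.
Proof. intros H ? ? x Hx. apply H. lra. Qed.

Lemma CInt_ex f a b : a <= b -> contI f a b -> ex_RInt (V := C_RN) f a b.
Proof. intros Hab H. apply ex_RInt_continuous. intros x Hx. rewrite Rmin_left, Rmax_right in Hx by auto.
 apply contR_continuous. auto.
Qed.

Lemma CInt_is f a b l : is_RInt (V := C_RN) f a b l -> CInt f a b = l.
Proof. apply (is_RInt_unique (V := C_RN)). Qed.

Lemma CInt_correct f a b : a <= b -> contI f a b -> is_RInt (V := C_RN) f a b (CInt f a b).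
Proof. intros. apply (RInt_correct (V := C_RN)). apply CInt_ex; auto. Qed.

Lemma CInt_ftc f f' a b : a <= b -> (forall x, a <= x <= b -> RD f x (f' x)) -> contI f' a b ->
 CInt f' a b = (f b - f a)%C.
Proof. intros Hab Hd Hc. apply CInt_is.
 assert (K : is_RInt (V := prod_NormedModule R_AbsRing R_N R_N) f' a b
  (minus (Re (f b)) (Re (f a)), minus (Im (f b)) (Im (f a)))).
 { apply is_RInt_fct_extend_pair.
  - apply (is_RInt_derive (V := R_CompleteNormedModule) (fun x => Re (f x)) (fun x => Re (f' x)));
  intros x Hx; rewrite Rmin_left, Rmax_right in Hx by auto.
  apply RD_Re; auto.
  apply (continuous_comp (V := C_UniformSpace) f' (fst : C -> R)). apply contR_continuous; auto. apply continuous_fst.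
  - apply (is_RInt_derive (V := R_CompleteNormedModule) (fun x => Im (f x)) (fun x => Im (f' x)));
  intros x Hx; rewrite Rmin_left, Rmax_right in Hx by auto.
  apply RD_Im; auto.
  apply (continuous_comp (V := C_UniformSpace) f' (snd : C -> R)). apply contR_continuous; auto. apply continuous_snd. }
 exact K.
Qed.

Lemma CInt_ext f g a b : a <= b -> (forall x, a < x < b -> f x = g x) -> CInt f a b = CInt g a b.
Proof. intros Hab H. apply (RInt_ext (V := C_RN)). intros x Hx.
 rewrite Rmin_left, Rmax_right in Hx by auto. auto.
Qed.

Lemma CInt_plus f g a b : a <= b -> contI f a b -> contI g a b ->
 CInt (fun x => f x + g x)%C a b = (CInt f a b + CInt g a b)%C.
Proof. intros Hab Hf Hg. apply (RInt_plus (V := C_RN)); apply CInt_ex; auto.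
Qed.

Lemma CInt_opp f a b : a <= b -> contI f a b -> CInt (fun x => - f x)%C a b = (- CInt f a b)%C.
Proof. intros. apply (RInt_opp (V := C_RN)); apply CInt_ex; auto. Qed.

Lemma CInt_minus f g a b : a <= b -> contI f a b -> contI g a b ->
 CInt (fun x => f x - g x)%C a b = (CInt f a b - CInt g a b)%C.
Proof. intros Hab Hf Hg. apply (RInt_minus (V := C_RN)); apply CInt_ex; auto.
Qed.

Lemma is_RInt_components f a b l : is_RInt (V := C_RN) f a b l ->
 is_RInt (fun x => Re (f x)) a b (Re l) /\ is_RInt (fun x => Im (f x)) a b (Im l).
Proof. intros H. split.
 - apply (is_RInt_fct_extend_fst (U := R_N) (V := R_N) f a b l). exact H.
 - apply (is_RInt_fct_extend_snd (U := R_N) (V := R_N) f a b l). exact H.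
Qed.

Lemma CInt_scal c f a b : a <= b -> contI f a b -> CInt (fun x => c * f x)%C a b = (c * CInt f a b)%C.
Proof. intros Hab Hf. apply CInt_is. destruct (is_RInt_components _ _ _ _ (CInt_correct f a b Hab Hf)) as [H1 H2].
 set (l := CInt f a b) in *.
 apply (is_RInt_fct_extend_pair (U := R_N) (V := R_N)); simpl.
 - apply (is_RInt_minus (V := R_N) (fun x => fst c * Re (f x)) (fun x => snd c * Im (f x)) a b (fst c * Re l) (snd c * Im l));
  apply (is_RInt_scal (V := R_N)); auto.
 - apply (is_RInt_plus (V := R_N) (fun x => fst c * Im (f x)) (fun x => snd c * Re (f x)) a b (fst c * Im l) (snd c * Re l));
  apply (is_RInt_scal (V := R_N)); auto.
Qed.

Lemma CInt_Chasles f a b c : a <= b -> b <= c -> contI f a c -> CInt f a c = (CInt f a b + CInt f b c)%C.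
Proof. intros H1 H2 Hf. symmetry. apply (RInt_Chasles (V := C_RN)); apply CInt_ex; auto;
 eapply contI_sub; eauto; lra.
Qed.

Lemma CInt_point f a : CInt f a a = 0.
Proof. apply (RInt_point (V := C_RN)). Qed.

Lemma CInt_bound_fun f g a b : a <= b -> contI f a b -> (forall x, a <= x <= b -> continuous g x) ->
 (forall x, a <= x <= b -> Cmod (f x) <= g x) -> Cmod (CInt f a b) <= RInt g a b.
Proof. intros Hab Hf Hg H.
 assert (N : forall z : C, @norm R_AbsRing C_R_NormedModule z = Cmod z).
 { intros z. unfold norm; simpl. unfold prod_norm, Cmod. simpl. unfold norm; simpl. unfold abs; simpl.
  rewrite !Rmult_1_r. f_equal. rewrite <- !Rabs_mult. rewrite !Rabs_pos_eq by nra. reflexivity. }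
 rewrite <- N.
 apply (norm_RInt_le (V := C_R_NormedModule) f g a b); auto.
 - intros x Hx. rewrite N. auto.
 - apply CInt_correct; auto.
 - apply (RInt_correct (V := R_CompleteNormedModule)). apply (ex_RInt_continuous (V := R_CompleteNormedModule)).
  intros x Hx. rewrite Rmin_left, Rmax_right in Hx by auto. auto.
Qed.

Lemma CInt_bound f a b M : a <= b -> contI f a b -> (forall x, a <= x <= b -> Cmod (f x) <= M) ->
 Cmod (CInt f a b) <= M * (b - a).
Proof. intros Hab Hf H. eapply Rle_trans. apply (CInt_bound_fun f (fun _ => M)); auto.
 intros; apply continuous_const. rewrite RInt_const. right. unfold scal; simpl. unfold mult; simpl. ring.
Qed.

Lemma CInt_bound_prim f G G' a b : a <= b -> contI f a b -> (forall x, a <= x <= b -> is_derive G x (G' x)) ->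
 (forall x, a <= x <= b -> continuous G' x) ->
 (forall x, a <= x <= b -> Cmod (f x) <= G' x) -> Cmod (CInt f a b) <= G b - G a.
Proof. intros Hab Hf HG HG' H. eapply Rle_trans. apply (CInt_bound_fun f G'); auto.
 right. apply is_RInt_unique. apply (is_RInt_derive (V := R_CompleteNormedModule) G G'); intros x Hx;
 rewrite Rmin_left, Rmax_right in Hx by auto; auto.
Qed.

(** * Contour integrals over boundaries of rectangles *)

(** The boundary is run through counterclockwise; [Ci] is the factor [dz/dy] on the vertical
    edges. *)
Definition Rect (f : C -> C) (a b c d : R) : C :=
 (CInt (fun x => f (x, c)) a b + Ci * CInt (fun y => f (b, y)) c d
  - CInt (fun x => f (x, d)) a b - Ci * CInt (fun y => f (a, y)) c d)%C.

Definition inR (a b c d : R) (z : C) : Prop := a <= Re z <= b /\ c <= Im z <= d.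

Definition onB (a b c d : R) (z : C) : Prop :=
 inR a b c d z /\ (Re z = a \/ Re z = b \/ Im z = c \/ Im z = d).

Lemma RD_hor y x : RD (fun t => (t, y)) x 1.
Proof. apply RD_pair. apply (is_derive_id (K := R_AbsRing)). apply (is_derive_const (V := R_N)). Qed.
Lemma RD_ver y x : RD (fun t => (y, t)) x Ci.
Proof. apply RD_pair. apply (is_derive_const (V := R_N)). apply (is_derive_id (K := R_AbsRing)). Qed.
Lemma contR_hor f x y : contC f (x, y) -> contR (fun t => f (t, y)) x.
Proof. intros. apply (contR_comp f (fun t => (t, y))); auto. eapply RD_contR, RD_hor. Qed.
Lemma contR_ver f x y : contC f (x, y) -> contR (fun t => f (x, t)) y.
Proof. intros. apply (contR_comp f (fun t => (x, t))); auto. eapply RD_contR, RD_ver. Qed.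

Section RectRules.
Variables (a b c d : R).
Hypotheses (Hab : a <= b) (Hcd : c <= d).

Let bnd f := forall z, onB a b c d z -> contC f z.

Lemma edges f : bnd f -> contI (fun x => f (x, c)) a b /\ contI (fun y => f (b, y)) c d /\
 contI (fun x => f (x, d)) a b /\ contI (fun y => f (a, y)) c d.
Proof. intros H. repeat split; intros x Hx; (apply contR_hor || apply contR_ver); apply H;
 unfold onB, inR; simpl; lra.
Qed.

Lemma Rect_plus f g : bnd f -> bnd g -> Rect (fun z => f z + g z)%C a b c d = (Rect f a b c d + Rect g a b c d)%C.
Proof. intros Hf Hg. destruct (edges f Hf) as (F1 & F2 & F3 & F4). destruct (edges g Hg) as (G1 & G2 & G3 & G4).
 unfold Rect. rewrite !CInt_plus by auto. ring.
Qed.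

Lemma Rect_minus f g : bnd f -> bnd g -> Rect (fun z => f z - g z)%C a b c d = (Rect f a b c d - Rect g a b c d)%C.
Proof. intros Hf Hg. destruct (edges f Hf) as (F1 & F2 & F3 & F4). destruct (edges g Hg) as (G1 & G2 & G3 & G4).
 unfold Rect. rewrite !CInt_minus by auto. ring.
Qed.

Lemma Rect_scal k f : bnd f -> Rect (fun z => k * f z)%C a b c d = (k * Rect f a b c d)%C.
Proof. intros Hf. destruct (edges f Hf) as (F1 & F2 & F3 & F4).
 unfold Rect. rewrite !CInt_scal by auto. ring.
Qed.

Lemma Rect_ext f g : (forall z, onB a b c d z -> f z = g z) -> Rect f a b c d = Rect g a b c d.
Proof. intros H. unfold Rect.
 rewrite (CInt_ext (fun x => f (x, c)) (fun x => g (x, c))), (CInt_ext (fun x => f (x, d)) (fun x => g (x, d))),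
  (CInt_ext (fun x => f (a, x)) (fun x => g (a, x))), (CInt_ext (fun x => f (b, x)) (fun x => g (b, x))); auto;
 intros x Hx; apply H; unfold onB, inR; simpl; lra.
Qed.

Lemma Rect_bound f M : bnd f -> (forall z, onB a b c d z -> Cmod (f z) <= M) ->
 Cmod (Rect f a b c d) <= M * (2 * ((b - a) + (d - c))).
Proof. intros Hf H. destruct (edges f Hf) as (F1 & F2 & F3 & F4). unfold Rect.
 assert (B1 := CInt_bound (fun x => f (x, c)) a b M Hab F1).
 assert (B2 := CInt_bound (fun x => f (b, x)) c d M Hcd F2).
 assert (B3 := CInt_bound (fun x => f (x, d)) a b M Hab F3).
 assert (B4 := CInt_bound (fun x => f (a, x)) c d M Hcd F4).
 specialize (B1 ltac:(intros; apply H; unfold onB, inR; simpl; lra)).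
 specialize (B2 ltac:(intros; apply H; unfold onB, inR; simpl; lra)).
 specialize (B3 ltac:(intros; apply H; unfold onB, inR; simpl; lra)).
 specialize (B4 ltac:(intros; apply H; unfold onB, inR; simpl; lra)).
 le_via Cmod_triangle_minus. rewrite Cmod_mult, Cmod_Ci, Rmult_1_l.
 le_via Rplus_le_compat_r. apply Cmod_triangle_minus.
 le_via Rplus_le_compat_r. apply Rplus_le_compat_r. apply Cmod_triangle.
 rewrite Cmod_mult, Cmod_Ci, Rmult_1_l. lra.
Qed.

Lemma Rect_prim F f : (forall z, inR a b c d z -> Cdiff F z (f z)) -> bnd f -> Rect f a b c d = 0.
Proof. intros HF Hf. destruct (edges f Hf) as (F1 & F2 & F3 & F4). unfold Rect.
 rewrite <- !CInt_scal by auto.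
 rewrite (CInt_ftc (fun x => F (x, c))), (CInt_ftc (fun y => F (b, y))), (CInt_ftc (fun x => F (x, d))), (CInt_ftc (fun y => F (a, y))); auto.
 ring.
 all: try (intros x Hx; apply contR_scal; auto; fail).
 all: intros x Hx.
 - replace (Ci * f (a, x))%C with (f (a, x) * Ci)%C by ring. apply (RD_comp F (fun y => (a, y))). apply HF; unfold inR; simpl; lra. apply RD_ver.
 - replace (f (x, d))%C with (f (x, d) * 1)%C by ring. apply (RD_comp F (fun y => (y, d))). apply HF; unfold inR; simpl; lra. apply RD_hor.
 - replace (Ci * f (b, x))%C with (f (b, x) * Ci)%C by ring. apply (RD_comp F (fun y => (b, y))). apply HF; unfold inR; simpl; lra. apply RD_ver.
 - replace (f (x, c))%C with (f (x, c) * 1)%C by ring. apply (RD_comp F (fun y => (y, c))). apply HF; unfold inR; simpl; lra. apply RD_hor.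
Qed.

Lemma Rect_split_v f m : a <= m <= b -> (forall x, a <= x <= b -> contC f (x, c) /\ contC f (x, d)) ->
 Rect f a b c d = (Rect f a m c d + Rect f m b c d)%C.
Proof. intros Hm H. unfold Rect. rewrite (CInt_Chasles (fun x => f (x, c)) a m b), (CInt_Chasles (fun x => f (x, d)) a m b); try lra.
 ring. all: intros x Hx; apply contR_hor; apply H; lra.
Qed.

Lemma Rect_split_h f m : c <= m <= d -> (forall y, c <= y <= d -> contC f (a, y) /\ contC f (b, y)) ->
 Rect f a b c d = (Rect f a b c m + Rect f a b m d)%C.
Proof. intros Hm H. unfold Rect. rewrite (CInt_Chasles (fun x => f (a, x)) c m d), (CInt_Chasles (fun x => f (b, x)) c m d); try lra.
 ring. all: intros x Hx; apply contR_ver; apply H; lra.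
Qed.

End RectRules.

(** * Goursat's lemma *)

Lemma INR_lt_pow2 n : INR n < 2 ^ n.
Proof. induction n. simpl; lra. rewrite S_INR. simpl. note (pow_R1_Rle 2 n ltac:(lra)). lra. Qed.

Lemma half_pow_small w e : 0 < e -> exists n, w / 2 ^ n < e.
Proof. intros He. destruct (INR_archimed 1 (Rabs w / e)) as [n Hn]. lra. exists n.
 note (INR_lt_pow2 n). note (pow_lt 2 n ltac:(lra)). note (Rle_abs w).
 apply Rmult_lt_reg_r with (2 ^ n); auto. unfold Rdiv at 1. rewrite Rmult_assoc, Rinv_l by lra. rewrite Rmult_1_r in *.
 apply Rmult_lt_compat_r with (r := e) in Hn; auto. unfold Rdiv in Hn. rewrite Rmult_assoc, Rinv_l in Hn by lra. nra.
Qed.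

Lemma nested_limit (u w : nat -> R) M : (forall n, u n <= u (S n)) -> (forall n, u (S n) + w (S n) <= u n + w n) ->
 (forall n, 0 <= w n) -> (forall n, u n + w n <= M) -> exists x, forall n, u n <= x <= u n + w n.
Proof. intros H1 H2 H3 H4.
 assert (A : forall n k, u n <= u (n + k)%nat /\ u (n + k)%nat + w (n + k)%nat <= u n + w n).
 { intros n k. induction k. rewrite Nat.add_0_r; lra. rewrite Nat.add_succ_r. specialize (H1 (n + k)%nat). specialize (H2 (n + k)%nat). lra. }
 destruct (completeness (fun x => exists n, x = u n)) as [x [Hx1 Hx2]].
 - exists M. intros y [n ->]. specialize (H3 n). specialize (H4 n). lra.
 - exists (u 0%nat); eauto.
 - exists x. intros n. split. apply Hx1; eauto. apply Hx2. intros y [m ->].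
  destruct (Nat.le_ge_cases n m).
  + replace m with (n + (m - n))%nat by lia. destruct (A n (m - n)%nat). specialize (H3 (n + (m - n))%nat). lra.
  + note (A m (n - m)%nat). replace (m + (n - m))%nat with n in * by lia. specialize (H3 n). lra.
Qed.

(** If the claim failed, one of the four quarters would fail at each stage, and the failing
    rectangles would shrink to a point, contradicting the local hypothesis there. *)
Lemma rect_bisection (P : R -> R -> R -> R -> Prop) a b c d : a <= b -> c <= d ->
 (forall a' b' c' d', a <= a' <= b' -> b' <= b -> c <= c' <= d' -> d' <= d ->
  let m := (a' + b') / 2 in let n := (c' + d') / 2 in
  P a' m c' n -> P m b' c' n -> P a' m n d' -> P m b' n d' -> P a' b' c' d') ->
 (forall x y, a <= x <= b -> c <= y <= d -> exists e, 0 < e /\ forall a' b' c' d',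
  a <= a' <= x -> x <= b' <= b -> c <= c' <= y -> y <= d' <= d -> b' - a' < e -> d' - c' < e -> P a' b' c' d') ->
 P a b c d.
Proof. intros Hab Hcd Hs Hl. apply NNPP. intros Hn.
 set (wx := fun n : nat => (b - a) / 2 ^ n). set (wy := fun n : nat => (d - c) / 2 ^ n).
 assert (P2 : forall n, 0 < 2 ^ n) by (intros; apply pow_lt; lra).
 assert (W : forall n, wx n = 2 * wx (S n) /\ wy n = 2 * wy (S n) /\ 0 <= wx n /\ 0 <= wy n).
 { intros n. unfold wx, wy. simpl. specialize (P2 n). repeat split; try (field; lra); apply Rdiv_le_0_compat; lra. }
 set (bad := fun n (p : R * R) => a <= fst p /\ fst p + wx n <= b /\ c <= snd p /\ snd p + wy n <= d /\
  ~ P (fst p) (fst p + wx n) (snd p) (snd p + wy n)).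
 assert (step : forall n p, bad n p -> exists q, bad (S n) q /\ fst p <= fst q /\ fst q + wx (S n) <= fst p + wx n /\
  snd p <= snd q /\ snd q + wy (S n) <= snd p + wy n).
 { intros n [x y] (B1 & B2 & B3 & B4 & B5). simpl in *. destruct (W n) as (E1 & E2 & E3 & E4). destruct (W (S n)) as (_ & _ & E5 & E6).
  apply NNPP. intros Hq. apply B5.
  assert (Q : forall p q, (p = x \/ p = x + wx (S n)) -> (q = y \/ q = y + wy (S n)) -> P p (p + wx (S n)) q (q + wy (S n))).
  { intros p q Hp Hq'. apply NNPP. intros Hno. apply Hq. exists (p, q). unfold bad; simpl.
  repeat split; auto; lra. }
  apply Hs; try lra; replace ((x + (x + wx n)) / 2) with (x + wx (S n)) by lra; replace ((y + (y + wy n)) / 2) with (y + wy (S n)) by lra.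
  - apply Q; auto.
  - replace (x + wx n) with (x + wx (S n) + wx (S n)) by lra. apply Q; auto.
  - replace (y + wy n) with (y + wy (S n) + wy (S n)) by lra. apply Q; auto.
  - replace (x + wx n) with (x + wx (S n) + wx (S n)) by lra. replace (y + wy n) with (y + wy (S n) + wy (S n)) by lra. apply Q; auto. }
 set (nxt := fun n p => epsilon (inhabits (a, c)) (fun q => bad (S n) q /\ fst p <= fst q /\ fst q + wx (S n) <= fst p + wx n /\
  snd p <= snd q /\ snd q + wy (S n) <= snd p + wy n)).
 set (s := fix s n := match n with O => (a, c) | S m => nxt m (s m) end).
 assert (B : forall n, bad n (s n)).
 { induction n. unfold bad, wx, wy; simpl. replace (a + (b - a) / 1) with b by field. replace (c + (d - c) / 1) with d by field.
  repeat split; auto; lra.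
  simpl. apply (epsilon_spec (inhabits (a, c)) _ (step n (s n) IHn)). }
 assert (N : forall n, fst (s n) <= fst (s (S n)) /\ fst (s (S n)) + wx (S n) <= fst (s n) + wx n /\
  snd (s n) <= snd (s (S n)) /\ snd (s (S n)) + wy (S n) <= snd (s n) + wy n).
 { intros n. apply (epsilon_spec (inhabits (a, c)) _ (step n (s n) (B n))). }
 destruct (nested_limit (fun n => fst (s n)) wx b) as [x Hx]; try (intros; apply N).
 { intros; apply W. } { intros n; apply B. }
 destruct (nested_limit (fun n => snd (s n)) wy d) as [y Hy]; try (intros; apply N).
 { intros; apply W. } { intros n; apply B. }
 cbv beta in *.
 destruct (Hl x y) as [e [He K]].
 { destruct (B 0%nat) as (? & ? & _). specialize (Hx 0%nat). lra. }
 { destruct (B 0%nat) as (_ & _ & ? & ? & _). specialize (Hy 0%nat). lra. }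
 destruct (half_pow_small (b - a + (d - c)) e He) as [n Hn'].
 destruct (B n) as (B1 & B2 & B3 & B4 & B5). destruct (W n) as (_ & _ & E3 & E4). specialize (Hx n). specialize (Hy n).
 assert (wx n + wy n < e). { unfold wx, wy. replace ((b - a) / 2 ^ n + (d - c) / 2 ^ n) with ((b - a + (d - c)) / 2 ^ n). auto. specialize (P2 n). field. lra. }
 apply B5, K; lra.
Qed.

Lemma inR_Cmod_le a b c d z w : inR a b c d z -> inR a b c d w -> Cmod (z - w) <= (b - a) + (d - c).
Proof. intros [H1 H2] [H3 H4]. le_via Cmod_le_Re_Im. unfold Cminus. rewrite re_plus, im_plus, re_opp, im_opp.
 apply Rplus_le_compat; apply Rabs_le; lra.
Qed.

Lemma Goursat f a b c d : a <= b -> c <= d -> (forall z, inR a b c d z -> exists l, Cdiff f z l) -> Rect f a b c d = 0.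
Proof. intros Hab Hcd Hf. apply Cmod_small_eq. intros eps He. replace (Rect f a b c d - 0)%C with (Rect f a b c d) by ring.
 set (A := ((b - a) + (d - c)) ^ 2). assert (HA : 0 <= A) by (unfold A; apply pow2_ge_0).
 set (e := eps / (A + 1)). assert (e > 0) by pos.
 assert (HC : forall z, inR a b c d z -> contC f z) by (intros z Hz; destruct (Hf z Hz); eapply Cdiff_contC; eauto).
 le_mid (e * ((b - a) + (d - c)) ^ 2).
 2:{ fold A. le_mid (e * (A + 1)). nra. right; unfold e; field; lra. }
 (* A bound by [e] times the square of the half-perimeter is stable under bisection, since each
    quarter has a quarter of that square. Locally it comes from subtracting the linear part of [f],
    which has a primitive. *)
 apply (rect_bisection (fun a b c d => Cmod (Rect f a b c d) <= e * ((b - a) + (d - c)) ^ 2) a b c d); auto.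
 - intros a' b' c' d' Ha Hb Hc Hd m n Q1 Q2 Q3 Q4.
  assert (a' <= m <= b') by (unfold m; lra). assert (c' <= n <= d') by (unfold n; lra).
  rewrite (Rect_split_v a' b' c' d') with (m := m); try lra.
  2:{ intros; split; apply HC; unfold inR; simpl; lra. }
  rewrite (Rect_split_h a' m c' d') with (m := n); try lra.
  2:{ intros; split; apply HC; unfold inR; simpl; lra. }
  rewrite (Rect_split_h m b' c' d') with (m := n); try lra.
  2:{ intros; split; apply HC; unfold inR; simpl; lra. }
  le_via Cmod_triangle. eapply Rle_trans. apply Rplus_le_compat; apply Cmod_triangle.
  assert (m - a' = (b' - a') / 2) as R1 by (unfold m; field). assert (b' - m = (b' - a') / 2) as R2 by (unfold m; field).
  assert (n - c' = (d' - c') / 2) as R3 by (unfold n; field). assert (d' - n = (d' - c') / 2) as R4 by (unfold n; field).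
  rewrite R1, R2, R3, R4 in *. simpl in *. nra.
 - intros x y Hx Hy. destruct (Hf (x, y)) as [l Hl]. { unfold inR; simpl; lra. }
  destruct (Hl (e / 2)) as [dl [D K]]. lra. exists (dl / 2). split. lra.
  intros a' b' c' d' Ha Hb Hc Hd W1 W2.
  set (lin := fun z : C => (f (x, y) + l * (z - (x, y)))%C).
  assert (L1 : forall z, Cdiff lin z (0 + l * (1 - 0))%C).
  { intros z. unfold lin. apply (Cdiff_plus (fun _ => f (x, y))). apply Cdiff_const. apply Cdiff_scal.
  apply (Cdiff_minus (fun z => z) (fun _ => (x, y))). apply Cdiff_id. apply Cdiff_const. }
  assert (L2 : Rect lin a' b' c' d' = 0).
  { apply (Rect_prim a' b' c' d') with (F := fun z => (f (x, y) * z + / 2 * l * ((z - (x, y)) * (z - (x, y))))%C); try lra.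
  - intros z _. assert ((2:C) <> 0) by (RtoC_nz).
  replace (lin z) with (f (x, y) * 1 + / 2 * l * ((1 - 0) * (z - (x, y)) + (z - (x, y)) * (1 - 0)))%C by (unfold lin; field; auto).
  apply Cdiff_plus. apply Cdiff_scal, Cdiff_id. apply Cdiff_scal. 
  apply (Cdiff_mult (fun z => z - (x, y))%C (fun z => z - (x, y))%C); (apply (Cdiff_minus (fun z => z) (fun _ => (x, y))); [apply Cdiff_id|apply Cdiff_const]).
  - intros z _. eapply Cdiff_contC. apply L1. }
  replace (Rect f a' b' c' d') with (Rect (fun z => f z - lin z)%C a' b' c' d').
  2:{ rewrite (Rect_minus a' b' c' d'); try lra. rewrite L2. ring.
  intros z [Hz _]. apply HC. unfold inR in *; lra. intros z _. eapply Cdiff_contC. apply L1. }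
  eapply Rle_trans. apply (Rect_bound a' b' c' d') with (M := e / 2 * ((b' - a') + (d' - c'))); try lra.
  + intros z [Hz _]. destruct (Hf z) as [l' Hl']. unfold inR in *; lra. eapply Cdiff_contC. apply Cdiff_minus; eauto.
  + intros z [Hz _]. unfold lin. replace (f z - (f (x, y) + l * (z - (x, y))))%C with (f z - f (x, y) - l * (z - (x, y)))%C by ring.
  assert (Cmod (z - (x, y)) <= (b' - a') + (d' - c')) by (apply inR_Cmod_le; auto; unfold inR; simpl; lra).
  eapply Rle_trans. apply K; auto. lra. mul_le_l; lra.
  + right. field.
Qed.

Lemma Cmod_RI (z w : C) : Rabs (Re z - Re w) <= Cmod (z - w) /\ Rabs (Im z - Im w) <= Cmod (z - w).
Proof. split. replace (Re z - Re w) with (Re (z - w)%C). apply re_le_Cmod. unfold Cminus; rewrite re_plus, re_opp; ring.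
 replace (Im z - Im w) with (Im (z - w)%C). apply Im_le_Cmod. unfold Cminus; rewrite im_plus, im_opp; ring.
Qed.

Local Notation onSq p e := (onB (Re p - e) (Re p + e) (Im p - e) (Im p + e)).

Lemma onB_square_dist z p e : 0 < e -> onSq p e z -> e <= Cmod (z - p) <= 2 * e.
Proof. intros He [[H1 H2] H]. split.
 - destruct (Cmod_RI z p). destruct H as [H|[H|[H|H]]]; rewrite H in *;
  [eapply Rle_trans; [|exact H0]|eapply Rle_trans; [|exact H0]|eapply Rle_trans; [|exact H3]|eapply Rle_trans; [|exact H3]];
  unfold Rabs; destruct Rcase_abs; lra.
 - le_via Cmod_le_Re_Im. unfold Cminus. rewrite re_plus, im_plus, re_opp, im_opp.
  assert (Rabs (Re z + - Re p) <= e) by (apply Rabs_le; lra). assert (Rabs (Im z + - Im p) <= e) by (apply Rabs_le; lra). lra.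
Qed.

Lemma neq_of_Re (z p : C) : Re z <> Re p -> z <> p. Proof. intros H ->; auto. Qed.
Lemma neq_of_Im (z p : C) : Im z <> Im p -> z <> p. Proof. intros H ->; auto. Qed.

Lemma Rect_shrink f a b c d p e : 0 < e -> a <= Re p - e -> Re p + e <= b -> c <= Im p - e -> Im p + e <= d ->
 (forall z, inR a b c d z -> z <> p -> exists l, Cdiff f z l) ->
 Rect f a b c d = Rect f (Re p - e) (Re p + e) (Im p - e) (Im p + e).
Proof. intros He H1 H2 H3 H4 Hf.
 assert (HC : forall z, inR a b c d z -> z <> p -> contC f z) by (intros z Hz Hp; destruct (Hf z Hz Hp); eapply Cdiff_contC; eauto).
 rewrite (Rect_split_v a b c d) with (m := Re p - e); try lra.
 2:{ intros; split; apply HC; unfold inR; simpl; try lra; apply neq_of_Im; simpl; lra. }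
 rewrite (Rect_split_v (Re p - e) b c d) with (m := Re p + e); try lra.
 2:{ intros; split; apply HC; unfold inR; simpl; try lra; apply neq_of_Im; simpl; lra. }
 rewrite (Rect_split_h (Re p - e) (Re p + e) c d) with (m := Im p - e); try lra.
 2:{ intros; split; apply HC; unfold inR; simpl; try lra; apply neq_of_Re; simpl; lra. }
 rewrite (Rect_split_h (Re p - e) (Re p + e) (Im p - e) d) with (m := Im p + e); try lra.
 2:{ intros; split; apply HC; unfold inR; simpl; try lra; apply neq_of_Re; simpl; lra. }
 rewrite (Goursat f a (Re p - e)); try lra.
 2:{ intros z [Z1 Z2]; apply Hf; unfold inR; try lra; apply neq_of_Re; lra. }
 rewrite (Goursat f (Re p + e) b); try lra.
 2:{ intros z [Z1 Z2]; apply Hf; unfold inR; try lra; apply neq_of_Re; lra. }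
 rewrite (Goursat f (Re p - e) (Re p + e) c); try lra.
 2:{ intros z [Z1 Z2]; apply Hf; unfold inR; try lra; apply neq_of_Im; lra. }
 rewrite (Goursat f (Re p - e) (Re p + e) (Im p + e)); try lra.
 2:{ intros z [Z1 Z2]; apply Hf; unfold inR; try lra; apply neq_of_Im; lra. }
 ring.
Qed.

Definition inI (a b c d : R) (z : C) : Prop := a < Re z < b /\ c < Im z < d.

Lemma inI_room a b c d p : inI a b c d p -> exists e0, 0 < e0 /\ forall e, e <= e0 ->
 a <= Re p - e /\ Re p + e <= b /\ c <= Im p - e /\ Im p + e <= d.
Proof. intros [H1 H2]. exists (Rmin (Rmin (Re p - a) (b - Re p)) (Rmin (Im p - c) (d - Im p))). split.
 repeat apply Rmin_pos; lra. intros e He.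
 note (Rmin_l (Rmin (Re p - a) (b - Re p)) (Rmin (Im p - c) (d - Im p))).
 note (Rmin_r (Rmin (Re p - a) (b - Re p)) (Rmin (Im p - c) (d - Im p))).
 min_le (Re p - a) (b - Re p).
 min_le (Im p - c) (d - Im p). lra.
Qed.

(** By [Rect_shrink] only a square of half-side [e] around [p] remains; its perimeter is [8 e], so a
    bounded integrand contributes arbitrarily little. *)
Lemma Cauchy_punctured f a b c d p : inI a b c d p ->
 (forall z, inR a b c d z -> z <> p -> exists l, Cdiff f z l) ->
 (exists dl M, 0 < dl /\ forall z, z <> p -> Cmod (z - p) < dl -> Cmod (f z) <= M) -> Rect f a b c d = 0.
Proof. intros Hp Hf (dl & M & D & HM). destruct (inI_room _ _ _ _ _ Hp) as (e0 & E0 & Hr).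
 apply Cmod_small_eq. intros eps He. replace (Rect f a b c d - 0)%C with (Rect f a b c d) by ring.
 set (e := Rmin (Rmin e0 (dl / 3)) (eps / (8 * (Rabs M + 1)))).
 note (Rabs_pos M) as PM. note (Rle_abs M) as AM.
 assert (Q : 0 < e /\ e <= e0 /\ e <= dl / 3 /\ e <= eps / (8 * (Rabs M + 1))).
 { unfold e. split. repeat apply Rmin_pos; try lra. pos.
  unfold Rmin; repeat destruct Rle_dec; lra. }
 destruct Q as (Q1 & Q2 & Q3 & Q4). destruct (Hr e Q2) as (R1 & R2 & R3 & R4).
 rewrite (Rect_shrink f a b c d p e); auto.
 assert (NP : forall z, onSq p e z -> z <> p).
 { intros z Hz ->. apply onB_square_dist in Hz; auto. replace (p - p)%C with (RtoC 0) in Hz by ring. rewrite Cmod_0 in Hz. lra. }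
 eapply Rle_trans. apply (Rect_bound (Re p - e) (Re p + e) (Im p - e) (Im p + e)) with (M := Rabs M + 1); try lra.
 - intros z Hz. destruct (Hf z) as [l Hl]; auto. destruct Hz as [[Z1 Z2] _]; unfold inR; lra. eapply Cdiff_contC; eauto.
 - intros z Hz. note (onB_square_dist _ _ _ Q1 Hz). specialize (HM z (NP z Hz) ltac:(lra)). lra.
 - apply Rmult_le_compat_r with (r := 8 * (Rabs M + 1)) in Q4; [|lra].
  unfold Rdiv in Q4. rewrite Rmult_assoc, Rinv_l in Q4 by lra. lra.
Qed.

Lemma Rect_inv_square p e : 0 < e ->
 Rect (fun z => / (z - p))%C (Re p - e) (Re p + e) (Im p - e) (Im p + e) = (2 * PI * Ci)%C.
Proof. intros He.
 assert (At : atan 1 = PI / 4) by apply atan_1.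
 (* Along an edge at distance [e] from [p], the components of [1 / (z - p)] have a logarithm and an
    arctangent as primitives. The logarithm takes equal values at both ends, and each arctangent
    gives [PI / 2]. The sign [s] tells opposite edges apart. *)
 assert (KK : forall q s, s = 1 \/ s = -1 ->
  CInt (fun x => ((x - q) / ((x - q) ^ 2 + e ^ 2), s * (e / ((x - q) ^ 2 + e ^ 2)))) (q - e) (q + e) = (0, s * (PI / 2))).
 { intros q s Hs. rewrite (CInt_ftc (fun x => (/ 2 * ln ((x - q) ^ 2 + e ^ 2), s * atan ((x - q) / e)))); try lra.
  - replace (q + e - q) with e by ring. replace (q - e - q) with (- e) by ring.
  replace (e / e) with 1 by (field; lra). replace (- e / e) with (- (1)) by (field; lra). rewrite atan_opp, At.
  replace ((- e) ^ 2) with (e ^ 2) by ring. apply Ceq_intro; simpl; field.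
  - intros x Hx. assert (0 < (x - q) ^ 2 + e ^ 2) by (note (pow2_ge_0 (x - q)); nra).
  apply RD_pair; auto_derive; try lra; try (simpl in *; lra).
  + simpl in *. field. lra.
  + simpl in *. field. repeat split; try lra; nra.
  - intros x Hx. assert (0 < (x - q) ^ 2 + e ^ 2) by (note (pow2_ge_0 (x - q)); nra).
  apply contR_pair; apply ex_derive_cont; auto_derive; simpl in *; lra. }
 assert (CC : forall q s, contI (fun x => ((x - q) / ((x - q) ^ 2 + e ^ 2), s * (e / ((x - q) ^ 2 + e ^ 2)))) (q - e) (q + e)).
 { intros q s x Hx. assert (0 < (x - q) ^ 2 + e ^ 2) by (note (pow2_ge_0 (x - q)); nra).
  apply contR_pair; apply ex_derive_cont; auto_derive; simpl in *; lra. }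
 unfold Rect. destruct p as [p1 p2]; simpl Re; simpl Im.
 rewrite (CInt_ext (fun x => / ((x, (p2 - e)%R) - (p1, p2)))%C (fun x => ((x - p1) / ((x - p1) ^ 2 + e ^ 2), 1 * (e / ((x - p1) ^ 2 + e ^ 2))))).
 2: lra. 2:{ intros x Hx. assert (0 < (x - p1) ^ 2 + e ^ 2) by (note (pow2_ge_0 (x - p1)); nra).
  unfold Cinv; simpl in *. f_equal; field; repeat split; nra. }
 rewrite (CInt_ext (fun x => / ((x, (p2 + e)%R) - (p1, p2)))%C (fun x => ((x - p1) / ((x - p1) ^ 2 + e ^ 2), -1 * (e / ((x - p1) ^ 2 + e ^ 2))))).
 2: lra. 2:{ intros x Hx. assert (0 < (x - p1) ^ 2 + e ^ 2) by (note (pow2_ge_0 (x - p1)); nra).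
  unfold Cinv; simpl in *. f_equal; field; repeat split; nra. }
 rewrite (CInt_ext (fun x => / (((p1 + e)%R, x) - (p1, p2)))%C (fun x => - Ci * (((x - p2) / ((x - p2) ^ 2 + e ^ 2))%R, (1 * (e / ((x - p2) ^ 2 + e ^ 2)))%R))%C).
 2: lra. 2:{ intros x Hx. assert (0 < (x - p2) ^ 2 + e ^ 2) by (note (pow2_ge_0 (x - p2)); nra).
  unfold Cinv; simpl in *. apply Ceq_intro; simpl; field; repeat split; nra. }
 rewrite (CInt_ext (fun x => / (((p1 - e)%R, x) - (p1, p2)))%C (fun x => - Ci * (((x - p2) / ((x - p2) ^ 2 + e ^ 2))%R, (-1 * (e / ((x - p2) ^ 2 + e ^ 2)))%R))%C).
 2: lra. 2:{ intros x Hx. assert (0 < (x - p2) ^ 2 + e ^ 2) by (note (pow2_ge_0 (x - p2)); nra).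
  unfold Cinv; simpl in *. apply Ceq_intro; simpl; field; repeat split; nra. }
 rewrite !CInt_scal by (try lra; auto). rewrite !KK by auto. apply Ceq_intro; simpl; field.
Qed.

(** * Cauchy's formula and its consequences *)

Definition holR (a b c d : R) (f : C -> C) : Prop := forall z, inR a b c d z -> exists l, Cdiff f z l.
Definition hol (U : C -> Prop) (f : C -> C) : Prop := forall z, U z -> exists l, Cdiff f z l.
Definition opn (U : C -> Prop) : Prop := forall z, U z -> exists d, 0 < d /\ forall w, Cmod (w - z) < d -> U w.

(** A total operator; its value is meaningful only where [f] is complex differentiable, by
    [Cder_spec]. *)
Definition Cder (f : C -> C) (z : C) : C := epsilon (inhabits (RtoC 0)) (Cdiff f z).

Lemma Cder_eq f z l : Cdiff f z l -> Cder f z = l.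
Proof. intros H. apply Cdiff_unique with f z; auto. apply (epsilon_spec (inhabits (RtoC 0)) (Cdiff f z)). exists l; auto.
Qed.

Lemma Cder_spec f z : (exists l, Cdiff f z l) -> Cdiff f z (Cder f z).
Proof. intros [l H]. rewrite (Cder_eq _ _ _ H). auto. Qed.

Lemma hol_contC U f z : hol U f -> U z -> contC f z.
Proof. intros H Hz. destruct (H z Hz). eapply Cdiff_contC; eauto. Qed.

Lemma twopii_neq0 : (2 * PI * Ci)%C <> 0.
Proof. intros H. apply (f_equal Im) in H. simpl in H. note PI_RGT_0. lra. Qed.

Lemma Cmod_twopii : Cmod (2 * PI * Ci) = 2 * PI.
Proof. rewrite !Cmod_mult, Cmod_Ci, !Cmod_R. rewrite !Rabs_pos_eq; try lra. note PI_RGT_0; lra. Qed.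

Lemma onB_inR a b c d z : onB a b c d z -> inR a b c d z. Proof. intros [H _]; auto. Qed.

Lemma inI_onB_dist a b c d p : inI a b c d p -> exists e, 0 < e /\ (forall z, onB a b c d z -> e <= Cmod (z - p)) /\
 (forall w, Cmod (w - p) < e -> inI a b c d w).
Proof. intros Hp. destruct (inI_room _ _ _ _ _ Hp) as (e & He & H). exists e. specialize (H e (Rle_refl e)).
 split; auto. split.
 - intros z [[H1 H2] HB]. destruct (Cmod_RI z p) as [K1 K2]. 
  assert (forall u, u <= Rabs u) by (intros; apply Rle_abs).
  assert (forall u, -u <= Rabs u) by (intros; rewrite <- Rabs_Ropp; apply Rle_abs).
  note (H0 (Re z - Re p)). note (H0 (Im z - Im p)). note (H3 (Re z - Re p)). note (H3 (Im z - Im p)).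
  destruct HB as [E|[E|[E|E]]]; rewrite E in *; lra.
 - intros w Hw. destruct (Cmod_RI w p) as [K1 K2]. apply Rle_lt_trans with (r3 := e) in K1; auto. apply Rle_lt_trans with (r3 := e) in K2; auto.
  apply Rabs_def2 in K1. apply Rabs_def2 in K2. destruct Hp. unfold inI. lra.
Qed.

Lemma onB_neq a b c d p z : inI a b c d p -> onB a b c d z -> (z - p)%C <> 0.
Proof. intros Hp Hz. destruct (inI_onB_dist _ _ _ _ _ Hp) as (e & He & H & _). apply Cmod_lt_neq0. specialize (H z Hz). lra.
Qed.

Lemma inI_inR a b c d z : inI a b c d z -> inR a b c d z.
Proof. unfold inI, inR. intros; lra. Qed.

Lemma contI_bounded g a b : contI g a b -> exists M, 0 <= M /\ forall x, a <= x <= b -> Cmod (g x) <= M.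
Proof. intros H. destruct (Rle_dec a b) as [Hab|Hab].
 2:{ exists 0. split. lra. intros; lra. }
 destruct (continuity_ab_maj (fun x => Cmod (g x)) a b Hab) as [m [Hm _]].
 - intros x Hx eps He. destruct (H x Hx eps He) as [dl [D K]]. exists dl. split; auto.
  intros y [_ Hy]. unfold dist in *; simpl in *. unfold Rdist in *. specialize (K y Hy).
  eapply Rle_lt_trans; [|exact K]. apply Rabs_le. note (Cmod_triangle_rev (g y) (g x)).
  note (Cmod_triangle_rev (g x) (g y)). rewrite (Cmod_minus_sym (g x)) in H1. lra.
 - exists (Cmod (g m)). split. apply Cmod_ge_0. auto.
Qed.

Lemma onB_bounded f a b c d : a <= b -> c <= d -> (forall z, onB a b c d z -> contC f z) ->
 exists M, 0 <= M /\ forall z, onB a b c d z -> Cmod (f z) <= M.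
Proof. intros Hab Hcd H. destruct (edges a b c d Hab Hcd f H) as (F1 & F2 & F3 & F4).
 apply contI_bounded in F1, F2, F3, F4.
 destruct F1 as (M1 & P1 & F1). destruct F2 as (M2 & P2 & F2). destruct F3 as (M3 & P3 & F3). destruct F4 as (M4 & P4 & F4).
 exists (M1 + M2 + M3 + M4). split. lra.
 intros [x y] [[H1 H2] HB]; simpl in *. destruct HB as [HB|[HB|[HB|HB]]]; subst.
 specialize (F4 y H2); lra. specialize (F2 y H2); lra. specialize (F1 x H1); lra. specialize (F3 x H1); lra.
Qed.

Lemma Rect_inv a b c d p : inI a b c d p -> Rect (fun z => / (z - p))%C a b c d = (2 * PI * Ci)%C.
Proof. intros Hp. destruct (inI_room _ _ _ _ _ Hp) as (e & He & H). specialize (H e (Rle_refl e)).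
 rewrite (Rect_shrink _ a b c d p e); try lra. apply Rect_inv_square; auto.
 intros z _ Hz. eexists. apply (Cdiff_inv (fun z => z - p)%C). apply Cminus_neq0; auto.
 apply (Cdiff_minus (fun z => z) (fun _ => p)). apply Cdiff_id. apply Cdiff_const.
Qed.

Lemma Cdiff_sub_const p z : Cdiff (fun w => w - p)%C z 1.
Proof. replace (RtoC 1) with (1 - 0)%C by ring. apply (Cdiff_minus (fun z => z) (fun _ => p)). apply Cdiff_id. apply Cdiff_const. Qed.

Lemma contC_div f g z : g z <> RtoC 0 -> contC f z -> contC g z -> contC (fun w => f w / g w)%C z.
Proof. intros Hz Hf Hg.
 assert (Hi : contC (fun w => / g w)%C z).
 { intros eps He. destruct (Cdiff_contC _ _ _ (Cdiff_inv_id _ Hz) eps He) as (d1 & D1 & H1). destruct (Hg d1 D1) as (d2 & D2 & H2).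
  exists d2; auto. }
 intros eps He. destruct (Hf 1) as (d0 & D0 & H0). lra.
 set (M := Cmod (f z) + Cmod (/ g z) + 1). note (Cmod_ge_0 (f z)). note (Cmod_ge_0 (/ g z)).
 assert (HM : 0 < M) by (unfold M; lra).
 assert (He2 : 0 < eps / (2 * M)) by pos.
 destruct (Hf _ He2) as (d1 & D1 & H3). destruct (Hi _ He2) as (d2 & D2 & H4).
 exists (Rmin d0 (Rmin d1 d2)). split. repeat apply Rmin_pos; auto.
 intros w Hw. assert (Cmod (w - z) < d0 /\ Cmod (w - z) < d1 /\ Cmod (w - z) < d2) as (W0 & W1 & W2).
 { repeat split; (eapply Rlt_le_trans; [exact Hw|]); unfold Rmin; repeat destruct Rle_dec; lra. }
 specialize (H0 w W0). specialize (H3 w W1). specialize (H4 w W2).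
 replace (f w / g w - f z / g z)%C with (f w * (/ g w - / g z) + (f w - f z) * / g z)%C by (unfold Cdiv; ring).
 eapply Rle_lt_trans. apply Cmod_triangle. rewrite !Cmod_mult.
 assert (Cmod (f w) <= M). { note (Cmod_triangle_rev (f w) (f z)). unfold M. lra. }
 assert (EE : eps = eps / (2 * M) * M + M * (eps / (2 * M))) by (field; lra). rewrite EE.
 note (Cmod_ge_0 (/ g w - / g z)). note (Cmod_ge_0 (f w - f z)).
 note (Cmod_ge_0 (f w)).
 assert (Cmod (f w) * Cmod (/ g w - / g z) <= M * Cmod (/ g w - / g z)) by nra.
 assert (Cmod (f w - f z) * Cmod (/ g z) <= Cmod (f w - f z) * M). { mul_le_l; auto. unfold M; lra. }
 nra.
Qed.

Lemma contC_sub_const p z : contC (fun w => w - p)%C z.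
Proof. eapply Cdiff_contC, Cdiff_sub_const. Qed.

Lemma Cauchy_formula f a b c d p : inI a b c d p -> holR a b c d f ->
 Rect (fun z => f z / (z - p))%C a b c d = (2 * PI * Ci * f p)%C.
Proof. intros Hp Hf.
 assert (Hab : a <= b /\ c <= d) by (unfold inI in Hp; lra). destruct Hab as [Hab Hcd].
 assert (H0 : Rect (fun z => (f z - f p) / (z - p))%C a b c d = 0).
 { apply Cauchy_punctured with p; auto.
  - intros z Hz Hn. destruct (Hf z Hz) as [l Hl]. eexists. apply (Cdiff_div (fun z => f z - f p)%C (fun z => z - p)%C).
  apply Cminus_neq0; auto. apply (Cdiff_minus f (fun _ => f p)); [exact Hl|apply Cdiff_const]. apply Cdiff_sub_const.
  - destruct (Hf p (inI_inR _ _ _ _ _ Hp)) as [l Hl]. destruct (derw_lip _ _ _ _ Hl) as (dl & D & H).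
  exists dl, (Cmod l + 1). split; auto. intros z Hz Hd. specialize (H z I Hd).
  rewrite Cmod_div by (apply Cminus_neq0; auto).
  assert (0 < Cmod (z - p)) by (apply Cmod_gt_0, Cminus_neq0; auto).
  apply Rmult_le_reg_r with (Cmod (z - p)); auto. unfold Rdiv. rewrite Rmult_assoc, Rinv_l by lra. lra. }
 rewrite <- (Rect_inv a b c d p Hp).
 rewrite Cmult_comm, <- (Rect_scal a b c d Hab Hcd).
 2:{ intros z Hz. eapply Cdiff_contC. apply Cdiff_inv. eapply onB_neq; eauto. apply Cdiff_sub_const. }
 rewrite <- (Cplus_0_l (Rect (fun z => f p * / (z - p))%C a b c d)). rewrite <- H0.
 rewrite <- (Rect_plus a b c d Hab Hcd).
 - apply Rect_ext; auto. intros z Hz. note (onB_neq _ _ _ _ _ _ Hp Hz). field; auto.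
 - intros z Hz. apply contC_div. eapply onB_neq; eauto. destruct (Hf z (onB_inR _ _ _ _ _ Hz)) as [l Hl].
  eapply Cdiff_contC. apply (Cdiff_minus f (fun _ => f p)); [exact Hl|apply Cdiff_const]. apply contC_sub_const.
 - intros z Hz. eapply Cdiff_contC. apply Cdiff_scal. apply Cdiff_inv. eapply onB_neq; eauto. apply Cdiff_sub_const.
Qed.

(** Differentiation under the contour integral, from a remainder that is quadratic in [w - p]
    uniformly on the boundary. It serves the kernels [phi z / (z - w)] and [phi z / (z - w)^2]. *)
Lemma Rect_param a b c d (K : C -> C -> C) (K' : C -> C) p A dl : a <= b -> c <= d -> 0 < dl -> 0 <= A ->
 (forall w, Cmod (w - p) < dl -> forall z, onB a b c d z -> contC (fun z => K z w) z) ->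
 (forall z, onB a b c d z -> contC K' z) ->
 (forall w, Cmod (w - p) < dl -> forall z, onB a b c d z -> Cmod (K z w - K z p - K' z * (w - p)) <= A * (Cmod (w - p) * Cmod (w - p))) ->
 Cdiff (fun w => Rect (fun z => K z w) a b c d) p (Rect K' a b c d).
Proof. intros Hab Hcd D HA HK HK' HE eps He.
 set (L := A * (2 * ((b - a) + (d - c)))). assert (HL : 0 <= L) by (unfold L; apply Rmult_le_pos; lra).
 exists (Rmin dl (eps / (L + 1))). split. apply Rmin_pos; auto. pos.
 intros w _ Hw. note (Rmin_l dl (eps / (L + 1))). note (Rmin_r dl (eps / (L + 1))).
 assert (W : Cmod (w - p) < dl) by lra.
 assert (W0 : Cmod (p - p) < dl). { replace (p - p)%C with (RtoC 0) by ring. rewrite Cmod_0; auto. }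
 assert (B1 := HK w W). assert (B0 := HK p W0).
 assert (B2 : forall z, onB a b c d z -> contC (fun z => (w - p) * K' z)%C z).
 { intros z Hz e1 He1. destruct (HK' z Hz (e1 / (Cmod (w - p) + 1))) as (d1 & D1 & H1).
  apply Rdiv_lt_0_compat; auto. note (Cmod_ge_0 (w - p)); lra. exists d1. split; auto. intros v Hv. specialize (H1 v Hv).
  replace ((w - p) * K' v - (w - p) * K' z)%C with ((w - p) * (K' v - K' z))%C by ring. rewrite Cmod_mult.
  note (Cmod_ge_0 (w - p)). note (Cmod_ge_0 (K' v - K' z)).
  apply Rmult_lt_compat_l with (r := Cmod (w - p) + 1) in H1; [|lra].
  replace ((Cmod (w - p) + 1) * (e1 / (Cmod (w - p) + 1))) with e1 in H1 by (field; lra). nra. }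
 assert (B3 : forall z, onB a b c d z -> contC (fun z => K z w - K z p)%C z).
 { intros z Hz e1 He1. destruct (B1 z Hz (e1 / 2)) as (d1 & D1 & H1). lra. destruct (B0 z Hz (e1 / 2)) as (d2 & D2 & H2). lra.
  exists (Rmin d1 d2). split. apply Rmin_pos; auto. intros v Hv. min_le d1 d2.
  specialize (H1 v ltac:(lra)). specialize (H2 v ltac:(lra)).
  replace (K v w - K v p - (K z w - K z p))%C with ((K v w - K z w) - (K v p - K z p))%C by ring.
  eapply Rle_lt_trans. apply Cmod_triangle_minus. lra. }
 assert (B4 : forall z, onB a b c d z -> contC (fun z => K z w - K z p - (w - p) * K' z)%C z).
 { intros z Hz e1 He1. destruct (B3 z Hz (e1 / 2)) as (d1 & D1 & H1). lra. destruct (B2 z Hz (e1 / 2)) as (d2 & D2 & H2). lra.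
  exists (Rmin d1 d2). split. apply Rmin_pos; auto. intros v Hv. min_le d1 d2.
  specialize (H1 v ltac:(lra)). specialize (H2 v ltac:(lra)).
  match goal with |- Cmod ?x < _ => replace x with ((K v w - K v p - (K z w - K z p)) - ((w - p) * K' v - (w - p) * K' z))%C by ring end.
  eapply Rle_lt_trans. apply Cmod_triangle_minus. lra. }
 rewrite (Cmult_comm (Rect K' a b c d)). rewrite <- (Rect_scal a b c d) by auto.
 rewrite <- (Rect_minus a b c d) by auto. rewrite <- (Rect_minus a b c d) by auto.
 eapply Rle_trans. apply (Rect_bound a b c d) with (M := A * (Cmod (w - p) * Cmod (w - p))); auto.
 - intros z Hz. rewrite (Cmult_comm (w - p)). auto.
 - replace (A * (Cmod (w - p) * Cmod (w - p)) * (2 * (b - a + (d - c)))) with ((L * Cmod (w - p)) * Cmod (w - p)) by (unfold L; ring).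
  mul_le_r. apply Cmod_ge_0. note (Cmod_ge_0 (w - p)).
  le_mid ((L + 1) * (eps / (L + 1))). apply Rmult_le_compat; lra. right; field; lra.
Qed.

Lemma CauchyT1 phi a b c d p : inI a b c d p -> (forall z, onB a b c d z -> contC phi z) ->
 Cdiff (fun w => Rect (fun z => phi z / (z - w))%C a b c d) p (Rect (fun z => phi z / ((z - p) * (z - p)))%C a b c d).
Proof. intros Hp Hc. destruct (inI_onB_dist _ _ _ _ _ Hp) as (e & He & HB & HI).
 assert (Hab : a <= b /\ c <= d) by (unfold inI in Hp; lra). destruct Hab as [Hab Hcd].
 destruct (onB_bounded phi a b c d Hab Hcd Hc) as (M & PM & HM).
 assert (Hfar : forall w, Cmod (w - p) < e / 2 -> forall z, onB a b c d z -> e / 2 <= Cmod (z - w)).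
 { intros w Hw z Hz. specialize (HB z Hz). note (Cmod_triangle3 z w p). lra. }
 apply (Rect_param a b c d (fun z w => phi z / (z - w))%C (fun z => phi z / ((z - p) * (z - p)))%C p (M * (2 / (e * e * e))) (e / 2)); auto; try lra.
 - apply Rmult_le_pos; auto. apply Rdiv_le_0_compat. lra. repeat apply Rmult_lt_0_compat; auto.
 - intros w Hw z Hz. specialize (Hfar w Hw z Hz). apply contC_div; auto. apply Cmod_lt_neq0; lra. apply contC_sub_const.
 - intros z Hz. apply contC_div; auto. apply Cmult_neq_0; eapply onB_neq; eauto. eapply Cdiff_contC. apply Cdiff_mult; apply Cdiff_sub_const.
 - intros w Hw z Hz. specialize (Hfar w Hw z Hz). specialize (HB z Hz).
  assert (N1 : (z - w)%C <> 0) by (apply Cmod_lt_neq0; lra). assert (N2 : (z - p)%C <> 0) by (apply Cmod_lt_neq0; lra).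
  replace (phi z / (z - w) - phi z / (z - p) - phi z / ((z - p) * (z - p)) * (w - p))%C with
  ((w - p) * (w - p) * (phi z * / ((z - p) * (z - p) * (z - w))))%C by (field; auto).
  rewrite !Cmod_mult, Cmod_inv by (repeat apply Cmult_neq_0; auto). rewrite !Cmod_mult.
  rewrite (Rmult_comm (M * _)). mul_le_l. note (Cmod_ge_0 (w - p)); nra.
  mul_le.
  + left; apply Rinv_0_lt_compat. repeat apply Rmult_lt_0_compat; lra.
  + replace (2 / (e * e * e)) with (/ (e * e * (e / 2))) by (field; lra).
  apply Rinv_le_contravar. repeat apply Rmult_lt_0_compat; lra.
  apply Rmult_le_compat; try lra. nra. nra.
Qed.

(** With [phi = f] this differentiates the integral formula for [f'] once more, so that the
    derivative of a holomorphic function is holomorphic. *)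
Lemma CauchyT2 phi a b c d p : inI a b c d p -> (forall z, onB a b c d z -> contC phi z) ->
 exists l, Cdiff (fun w => Rect (fun z => phi z / ((z - w) * (z - w)))%C a b c d) p l.
Proof. intros Hp Hc. destruct (inI_onB_dist _ _ _ _ _ Hp) as (e & He & HB & HI).
 assert (Hab : a <= b /\ c <= d) by (unfold inI in Hp; lra). destruct Hab as [Hab Hcd].
 destruct (onB_bounded phi a b c d Hab Hcd Hc) as (M & PM & HM).
 assert (Hfar : forall w, Cmod (w - p) < e / 2 -> forall z, onB a b c d z -> e / 2 <= Cmod (z - w)).
 { intros w Hw z Hz. specialize (HB z Hz). note (Cmod_triangle3 z w p). lra. }
 exists (Rect (fun z => (2 * phi z) / ((z - p) * (z - p) * (z - p)))%C a b c d).
 set (D := (b - a) + (d - c)). assert (HD : 0 <= D) by (unfold D; lra).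
 apply (Rect_param a b c d (fun z w => phi z / ((z - w) * (z - w)))%C (fun z => (2 * phi z) / ((z - p) * (z - p) * (z - p)))%C p
  (M * ((3 * D + 2 * e) * / (e * e * e * (e / 2 * (e / 2))))) (e / 2)); auto; try lra.
 - apply Rmult_le_pos; auto. apply Rmult_le_pos. lra. left; apply Rinv_0_lt_compat. repeat apply Rmult_lt_0_compat; lra.
 - intros w Hw z Hz. specialize (Hfar w Hw z Hz). apply contC_div; auto. apply Cmult_neq_0; apply Cmod_lt_neq0; lra. eapply Cdiff_contC. apply Cdiff_mult; apply Cdiff_sub_const.
 - intros z Hz. apply contC_div; auto. repeat apply Cmult_neq_0; eapply onB_neq; eauto.
  { intros e1 He1. destruct (Hc z Hz (e1 / 2)) as (d1 & D1 & H1). lra. exists d1; split; auto. intros w Hw. specialize (H1 w Hw).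
  replace (2 * phi w - 2 * phi z)%C with (2 * (phi w - phi z))%C by ring. rewrite Cmod_mult, Cmod_R, Rabs_pos_eq; lra. }
  eapply Cdiff_contC. repeat apply Cdiff_mult; apply Cdiff_sub_const.
 - intros w Hw z Hz. specialize (Hfar w Hw z Hz). specialize (HB z Hz).
  assert (N1 : (z - w)%C <> 0) by (apply Cmod_lt_neq0; lra). assert (N2 : (z - p)%C <> 0) by (apply Cmod_lt_neq0; lra).
  match goal with |- Cmod ?x <= _ => replace x with
  ((w - p) * (w - p) * (phi z * ((3 * (z - p) - 2 * (w - p)) * / ((z - p) * (z - p) * (z - p) * ((z - w) * (z - w))))))%C by (field; auto) end.
  rewrite !Cmod_mult, Cmod_inv by (repeat apply Cmult_neq_0; auto). rewrite !Cmod_mult.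
  rewrite (Rmult_comm (M * _)). mul_le_l. note (Cmod_ge_0 (w - p)); nra.
  assert (0 < / (Cmod (z - p) * Cmod (z - p) * Cmod (z - p) * (Cmod (z - w) * Cmod (z - w)))).
  { apply Rinv_0_lt_compat. repeat apply Rmult_lt_0_compat; lra. }
  mul_le.
  + apply Rmult_le_pos. apply Cmod_ge_0. lra.
  + mul_le. lra.
  * le_via Cmod_triangle_minus. rewrite !Cmod_mult, !Cmod_R, !Rabs_pos_eq by lra.
  assert (Cmod (z - p) <= D). { apply inR_Cmod_le. apply onB_inR; auto. apply inI_inR; auto. } lra.
  * apply Rinv_le_contravar. repeat apply Rmult_lt_0_compat; lra.
  assert (0 < Cmod (z - p)) by lra. assert (0 < Cmod (z - w)) by lra.
  repeat (apply Rmult_le_compat; try lra); repeat apply Rmult_le_pos; lra.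
Qed.

Lemma Cdiff_rect f a b c d p : inI a b c d p -> holR a b c d f ->
 Cdiff f p (/ (2 * PI * Ci) * Rect (fun z => f z / ((z - p) * (z - p)))%C a b c d)%C.
Proof. intros Hp Hf. destruct (inI_onB_dist _ _ _ _ _ Hp) as (e & He & HB & HI).
 apply Cdiff_ext_loc with (fun w => / (2 * PI * Ci) * Rect (fun z => f z / (z - w))%C a b c d)%C.
 - exists e. split; auto. intros w Hw. rewrite Cauchy_formula by auto. note twopii_neq0.
  rewrite Cmult_assoc, Cinv_l by auto. ring.
 - apply Cdiff_scal. apply CauchyT1; auto. intros z Hz. destruct (Hf z (onB_inR _ _ _ _ _ Hz)). eapply Cdiff_contC; eauto.
Qed.

Lemma Cder_diff_rect f a b c d p : inI a b c d p -> holR a b c d f -> exists l, Cdiff (Cder f) p l.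
Proof. intros Hp Hf. destruct (inI_onB_dist _ _ _ _ _ Hp) as (e & He & HB & HI).
 destruct (CauchyT2 f a b c d p Hp) as [l Hl].
 { intros z Hz. destruct (Hf z (onB_inR _ _ _ _ _ Hz)). eapply Cdiff_contC; eauto. }
 eexists. eapply Cdiff_ext_loc; [|apply Cdiff_scal; exact Hl].
 exists e. split; auto. intros w Hw. symmetry. apply Cder_eq. apply Cdiff_rect; auto.
Qed.

(** * Squares about a point, and holomorphic functions on a set *)

Definition sqR (p : C) (e : R) : C -> Prop := inR (Re p - e) (Re p + e) (Im p - e) (Im p + e).
Definition sqI (p : C) (e : R) : C -> Prop := inI (Re p - e) (Re p + e) (Im p - e) (Im p + e).

Lemma sqR_Cmod p e z : sqR p e z -> Cmod (z - p) <= 2 * e.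
Proof. intros [H1 H2]. le_via Cmod_le_Re_Im. unfold Cminus. rewrite re_plus, im_plus, re_opp, im_opp.
 assert (Rabs (Re z + - Re p) <= e) by (apply Rabs_le; lra). assert (Rabs (Im z + - Im p) <= e) by (apply Rabs_le; lra). lra.
Qed.

Lemma Cmod_sqI p e z : Cmod (z - p) < e -> sqI p e z.
Proof. intros H. destruct (Cmod_RI z p) as [K1 K2]. assert (A := Rle_lt_trans _ _ _ K1 H). assert (B := Rle_lt_trans _ _ _ K2 H).
 apply Rabs_def2 in A. apply Rabs_def2 in B. unfold sqI, inI. lra.
Qed.

Lemma sqI_center p e : 0 < e -> sqI p e p.
Proof. unfold sqI, inI; lra. Qed.

Lemma opn_square U p : opn U -> U p -> exists e, 0 < e /\ forall z, sqR p e z -> U z.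
Proof. intros HU Hp. destruct (HU p Hp) as (d & D & H). exists (d / 3). split. lra. intros z Hz. apply H. apply sqR_Cmod in Hz. lra.
Qed.

Lemma hol_Cder U f : opn U -> hol U f -> hol U (Cder f).
Proof. intros HU Hf p Hp. destruct (opn_square U p HU Hp) as (e & He & H).
 eapply Cder_diff_rect. apply (sqI_center p e He). intros z Hz. apply Hf, H, Hz.
Qed.

Lemma hol_Cdiff U f z : hol U f -> U z -> Cdiff f z (Cder f z).
Proof. intros. apply Cder_spec; auto. Qed.

Lemma hol_mult U f g : hol U f -> hol U g -> hol U (fun z => f z * g z)%C.
Proof. intros Hf Hg z Hz. destruct (Hf z Hz), (Hg z Hz). eexists. apply Cdiff_mult; eauto. Qed.
Lemma hol_plus U f g : hol U f -> hol U g -> hol U (fun z => f z + g z)%C.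
Proof. intros Hf Hg z Hz. destruct (Hf z Hz), (Hg z Hz). eexists. apply Cdiff_plus; eauto. Qed.
Lemma hol_minus U f g : hol U f -> hol U g -> hol U (fun z => f z - g z)%C.
Proof. intros Hf Hg z Hz. destruct (Hf z Hz), (Hg z Hz). eexists. apply Cdiff_minus; eauto. Qed.
Lemma hol_const U c : hol U (fun _ => c).
Proof. intros z _. exists 0. apply Cdiff_const. Qed.
Lemma hol_id U : hol U (fun z => z).
Proof. intros z _. exists 1. apply Cdiff_id. Qed.
Lemma hol_div U f g : hol U f -> hol U g -> (forall z, U z -> g z <> RtoC 0) -> hol U (fun z => f z / g z)%C.
Proof. intros Hf Hg Hn z Hz. destruct (Hf z Hz), (Hg z Hz). eexists. apply Cdiff_div; eauto. Qed.
Lemma hol_sub (U V : C -> Prop) f : (forall z, V z -> U z) -> hol U f -> hol V f.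
Proof. intros H Hf z Hz. auto. Qed.
Lemma hol_comp U V f g : hol V f -> hol U g -> (forall z, U z -> V (g z)) -> hol U (fun z => f (g z)).
Proof. intros Hf Hg H z Hz. destruct (Hg z Hz). destruct (Hf (g z) (H z Hz)). eexists. apply Cdiff_comp; eauto. Qed.
Lemma hol_pow U f n : hol U f -> hol U (fun z => (f z) ^ n)%C.
Proof. intros Hf. induction n. apply (hol_const U 1). apply (hol_mult U f); auto. Qed.

(** Near [p] the quotient is the Cauchy integral of [f z / (z - p)] over a small square, which is
    differentiable by [CauchyT1]; its value at [p] is [Cder f p]. This is the removable singularity
    on which the division by zeros of [zeta] rests. *)
Lemma divide_zero U f p : opn U -> hol U f -> U p -> f p = 0 ->
 exists g, hol U g /\ forall z, U z -> f z = ((z - p) * g z)%C.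
Proof. intros HU Hf Hp Hz.
 set (g := fun z => if Ceq_dec z p then Cder f p else (f z / (z - p))%C).
 exists g. split.
 - intros z Uz. destruct (Ceq_dec z p) as [->|N].
  + destruct (opn_square U p HU Hp) as (e & He & H).
  assert (HR : holR (Re p - e) (Re p + e) (Im p - e) (Im p + e) f) by (intros z Hz'; apply Hf, H, Hz').
  assert (Hpi := sqI_center p e He).
  set (phi := fun z => (f z / (z - p))%C).
  assert (Hphi : forall z, onSq p e z -> contC phi z).
  { intros z Hz'. apply contC_div. eapply onB_neq; eauto. destruct (HR z (onB_inR _ _ _ _ _ Hz')). eapply Cdiff_contC; eauto. apply contC_sub_const. }
  eexists. eapply Cdiff_ext_loc; [|apply Cdiff_scal; apply (CauchyT1 phi _ _ _ _ p Hpi Hphi)].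
  destruct (inI_onB_dist _ _ _ _ _ Hpi) as (e' & He' & HB & HI). exists e'. split; auto.
  intros w Hw. specialize (HI w Hw).
  instantiate (1 := (/ (2 * PI * Ci))%C). unfold g. destruct (Ceq_dec w p) as [->|Nw].
  * rewrite (Cder_eq _ _ _ (Cdiff_rect f _ _ _ _ p Hpi HR)). f_equal. apply Rect_ext; try lra.
  intros z Hz'. unfold phi. note (onB_neq _ _ _ _ _ _ Hpi Hz'). field; auto.
  * assert (Nwp : (w - p)%C <> 0) by (apply Cminus_neq0; auto).
  note (Cauchy_formula f _ _ _ _ w HI HR) as F1. note (Cauchy_formula f _ _ _ _ p Hpi HR) as F2.
  rewrite Hz in F2.
  assert (Cc : forall q, inI (Re p - e) (Re p + e) (Im p - e) (Im p + e) q -> forall z, onSq p e z -> contC (fun z => f z / (z - q))%C z).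
  { intros q Hq z Hz'. apply contC_div. eapply onB_neq; eauto. destruct (HR z (onB_inR _ _ _ _ _ Hz')). eapply Cdiff_contC; eauto. apply contC_sub_const. }
  (* Partial fractions: the integrand [f z / ((z - p) (z - w))] splits into two Cauchy integrals,
     and the one at [p] vanishes together with [f p]. *)
  rewrite (Rect_ext (Re p - e) (Re p + e) (Im p - e) (Im p + e) ltac:(lra) ltac:(lra) _ (fun z => / (w - p) * (f z / (z - w) - f z / (z - p)))%C).
  2:{ intros z Hz'. unfold phi. note (onB_neq _ _ _ _ _ _ Hpi Hz'). note (onB_neq _ _ _ _ _ _ HI Hz'). field; auto. }
  rewrite Rect_scal, Rect_minus; try lra; auto.
  2:{ intros z Hz'. destruct (HR z (onB_inR _ _ _ _ _ Hz')) as [l Hl]. eapply Cdiff_contC. apply Cdiff_minus; apply Cdiff_div; eauto using Cdiff_sub_const; eapply onB_neq; eauto. }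
  rewrite F1, F2. note twopii_neq0. note Ci_nz.
  assert ((2:C) <> 0) by (RtoC_nz).
  assert (RtoC PI <> 0) by (intros X; apply (f_equal Re) in X; simpl in X; note PI_RGT_0; lra).
  field; auto.
  + destruct (Hf z Uz) as [l Hl]. eexists.
  apply Cdiff_ext_loc with (fun z => f z / (z - p))%C.
  * exists (Cmod (z - p)). split. apply Cmod_gt_0, Cminus_neq0; auto.
  intros w Hw. unfold g. destruct (Ceq_dec w p) as [->|]; auto. rewrite Cmod_minus_sym in Hw. lra.
  * apply Cdiff_div; eauto using Cdiff_sub_const. apply Cminus_neq0; auto.
 - intros z Uz. unfold g. destruct (Ceq_dec z p) as [->|N]. rewrite Hz. ring.
  assert ((z - p)%C <> 0) by (apply Cminus_neq0; auto). field; auto.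
Qed.

Lemma pow_le_const_mult x M K : 0 <= x -> 0 <= M -> (forall n, x ^ n <= K * M ^ n) -> x <= M.
Proof. intros Hx HM H. destruct (Rle_dec x M) as [|N]; auto. exfalso.
 destruct (Req_dec M 0) as [->|NM]. { specialize (H 1%nat). simpl in H. lra. }
 set (t := x / M - 1). assert (Ht : 0 < t). { unfold t. apply Rmult_lt_reg_r with M. lra. unfold Rdiv. replace ((x * / M - 1) * M) with (x - M) by (field; lra). lra. }
 destruct (INR_archimed t K Ht) as [n Hn].
 specialize (H n). note (poly n t Ht). replace (1 + t) with (x / M) in H0 by (unfold t; ring).
 unfold Rdiv in H0. rewrite Rpow_mult_distr, pow_inv in H0. note (pow_lt M n ltac:(lra)).
 assert (x ^ n * / M ^ n <= K). { apply Rmult_le_reg_r with (M ^ n); auto. rewrite Rmult_assoc, Rinv_l by lra. lra. }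
 lra.
Qed.

(** Cauchy's formula for [f^n] loses a factor independent of [n]; letting [n] grow removes it, by
    [pow_le_const_mult]. *)
Lemma max_modulus f a b c d M p : holR a b c d f -> 0 <= M -> (forall z, onB a b c d z -> Cmod (f z) <= M) ->
 inI a b c d p -> Cmod (f p) <= M.
Proof. intros Hf HM HB Hp. destruct (inI_onB_dist _ _ _ _ _ Hp) as (e & He & Hd & _).
 assert (Hab : a <= b /\ c <= d) by (unfold inI in Hp; lra). destruct Hab as [Hab Hcd].
 apply pow_le_const_mult with (/ e * (2 * ((b - a) + (d - c)))); auto using Cmod_ge_0.
 intros n.
 assert (Hn : holR a b c d (fun z => (f z) ^ n)%C) by (apply hol_pow; exact Hf).
 note (Cauchy_formula _ _ _ _ _ p Hp Hn) as F. apply (f_equal Cmod) in F.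
 rewrite Cmod_mult, Cmod_twopii, Cmod_pow in F.
 assert (G : Cmod (Rect (fun z => (f z) ^ n / (z - p))%C a b c d) <= (M ^ n * / e) * (2 * ((b - a) + (d - c)))).
 { apply Rect_bound; auto.
  - intros z Hz. apply contC_div. eapply onB_neq; eauto. destruct (Hn z (onB_inR _ _ _ _ _ Hz)). eapply Cdiff_contC; eauto. apply contC_sub_const.
  - intros z Hz. rewrite Cmod_div by (eapply onB_neq; eauto). rewrite Cmod_pow. specialize (Hd z Hz). apply Rmult_le_compat.
  apply pow_le, Cmod_ge_0. pos. apply pow_incr. split; auto using Cmod_ge_0. apply Rinv_le_contravar; auto. }
 rewrite F in G. assert (0 <= Cmod (f p) ^ n) by (apply pow_le, Cmod_ge_0). note PI2_1. unfold PI2 in *. nra.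
Qed.

(** The contour has length [8 e] and the kernel is at most [1 / e^2], so the integral formula gives
    [4 M / (PI e)]. *)
Lemma Cauchy_estimate f p e M : 0 < e -> (forall z, sqR p e z -> exists l, Cdiff f z l) -> (forall z, sqR p e z -> Cmod (f z) <= M) ->
 Cmod (Cder f p) <= 2 * M / e.
Proof. intros He Hf HM. note (sqI_center p e He) as Hp.
 rewrite (Cder_eq _ _ _ (Cdiff_rect f _ _ _ _ p Hp Hf)). rewrite Cmod_mult, Cmod_inv, Cmod_twopii by apply twopii_neq0.
 assert (PM : 0 <= M). { le_via (Cmod_ge_0 (f p)). apply HM. apply (inI_inR _ _ _ _ _ Hp). }
 assert (G : Cmod (Rect (fun z => f z / ((z - p) * (z - p)))%C (Re p - e) (Re p + e) (Im p - e) (Im p + e)) <= (M * / (e * e)) * (2 * ((Re p + e - (Re p - e)) + (Im p + e - (Im p - e))))).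
 { apply Rect_bound; try lra.
  - intros z Hz. apply contC_div. apply Cmult_neq_0; eapply onB_neq; eauto. destruct (Hf z (onB_inR _ _ _ _ _ Hz)). eapply Cdiff_contC; eauto. eapply Cdiff_contC, Cdiff_mult; apply Cdiff_sub_const.
  - intros z Hz. rewrite Cmod_div by (apply Cmult_neq_0; eapply onB_neq; eauto). rewrite Cmod_mult. apply onB_square_dist in Hz as Hd; auto. apply Rmult_le_compat.
  apply Cmod_ge_0. left; apply Rinv_0_lt_compat; nra. apply HM, (onB_inR _ _ _ _ _ Hz). apply Rinv_le_contravar; nra. }
 apply Rmult_le_compat_l with (r := / (2 * PI)) in G. 2:{ left; apply Rinv_0_lt_compat. note PI_RGT_0; lra. }
 eapply Rle_trans. exact G. note PI2_1. unfold PI2 in *.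
 replace (/ (2 * PI) * (M * / (e * e) * (2 * (Re p + e - (Re p - e) + (Im p + e - (Im p - e)))))) with ((2 * M / e) * (2 / PI)) by (field; split; lra).
 assert (2 / PI <= 1). { apply Rmult_le_reg_r with PI. lra. unfold Rdiv. rewrite Rmult_assoc, Rinv_l; lra. }
 assert (0 <= 2 * M / e) by pos. nra.
Qed.

(** * Locally uniform limits and the identity principle *)

Definition locunif (U : C -> Prop) (fn : nat -> C -> C) (f : C -> C) : Prop :=
 forall p, U p -> exists r, 0 < r /\ forall eps, 0 < eps -> exists N, forall n, (N <= n)%nat ->
  forall z, Cmod (z - p) < r -> Cmod (fn n z - f z) <= eps.

(** The limit is continuous and inherits Cauchy's formula on a small square, and a Cauchy integral
    of a continuous function is differentiable. *)
Lemma locunif_hol U fn f : opn U -> (forall n, hol U (fn n)) -> locunif U fn f -> hol U f.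
Proof. intros HU Hn Hl p Hp. destruct (Hl p Hp) as (r & Hr & Hu). destruct (opn_square U p HU Hp) as (e0 & He0 & H0).
 set (e := Rmin e0 (r / 3)).
 assert (E : 0 < e /\ e <= e0 /\ e <= r / 3). { unfold e. split. apply Rmin_pos; lra. split; [apply Rmin_l|apply Rmin_r]. }
 destruct E as (E & E1 & E2).
 assert (HsU : forall z, sqR p e z -> U z). { intros z Hz. apply H0. unfold sqR, inR in *. lra. }
 assert (Hsr : forall z, sqR p e z -> Cmod (z - p) < r). { intros z Hz. apply sqR_Cmod in Hz. lra. }
 assert (Hc : forall z, sqR p e z -> contC f z).
 { intros z Hz eps Heps. destruct (Hu (eps / 4)) as (N & HN). lra. specialize (HN N (Nat.le_refl N)).
  destruct (hol_contC U (fn N) z (Hn N) (HsU z Hz) (eps / 4)) as (d & D & K). lra.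
  exists (Rmin d (r - Cmod (z - p))). split. apply Rmin_pos; auto. specialize (Hsr z Hz). lra.
  intros w Hw. note (Rmin_l d (r - Cmod (z - p))). note (Rmin_r d (r - Cmod (z - p))).
  specialize (K w ltac:(lra)). note (HN z (Hsr z Hz)) as A. note (Cmod_triangle3 w z p).
  note (HN w ltac:(lra)) as B. rewrite Cmod_minus_sym in B.
  replace (f w - f z)%C with ((f w - fn N w) + (fn N w - fn N z) + (fn N z - f z))%C by ring.
  eapply Rle_lt_trans. apply Cmod_triangle. eapply Rle_lt_trans. apply Rplus_le_compat_r. apply Cmod_triangle. lra. }
 note (sqI_center p e E) as Hpi. destruct (inI_onB_dist _ _ _ _ _ Hpi) as (e' & He' & HB & HI).
 eexists. eapply Cdiff_ext_loc; [|apply Cdiff_scal; apply (CauchyT1 f _ _ _ _ p Hpi)].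
 2:{ intros z Hz. apply Hc. apply (onB_inR _ _ _ _ _ Hz). }
 exists e'. split; auto. intros w Hw. instantiate (1 := (/ (2 * PI * Ci))%C).
 specialize (HI w Hw). destruct (inI_onB_dist _ _ _ _ _ HI) as (e'' & He'' & HB' & _).
 note twopii_neq0 as NT.
 assert (CB : forall n, (forall z, onSq p e z -> contC (fun z => fn n z / (z - w))%C z)).
 { intros n z Hz. apply contC_div. eapply onB_neq; eauto. eapply hol_contC; eauto. apply HsU. apply (onB_inR _ _ _ _ _ Hz). apply contC_sub_const. }
 assert (CB' : (forall z, onSq p e z -> contC (fun z => f z / (z - w))%C z)).
 { intros z Hz. apply contC_div. eapply onB_neq; eauto. apply Hc. apply (onB_inR _ _ _ _ _ Hz). apply contC_sub_const. }
 assert (ER : Rect (fun z => f z / (z - w))%C (Re p - e) (Re p + e) (Im p - e) (Im p + e) = (2 * PI * Ci * f w)%C).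
 2:{ rewrite ER. rewrite Cmult_assoc, Cinv_l by auto. ring. }
 apply Cmod_small_eq. intros eps Heps.
 set (L := / e'' * (2 * ((Re p + e - (Re p - e)) + (Im p + e - (Im p - e)))) + 2 * PI).
 assert (HL : 0 < L). { unfold L. note PI_RGT_0. note (Rinv_0_lt_compat e'' He''). nra. }
 destruct (Hu (eps / L)) as (N & HN). apply Rdiv_lt_0_compat; auto. specialize (HN N (Nat.le_refl N)).
 assert (FN : Rect (fun z => fn N z / (z - w))%C (Re p - e) (Re p + e) (Im p - e) (Im p + e) = (2 * PI * Ci * fn N w)%C).
 { apply Cauchy_formula; auto. intros z Hz. apply Hn, HsU, Hz. }
 match goal with |- Cmod ?x <= _ => replace x with (- (2 * PI * Ci * fn N w - Rect (fun z => f z / (z - w))%C (Re p - e) (Re p + e) (Im p - e) (Im p + e)) + 2 * PI * Ci * (fn N w - f w))%C by ring end.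
 rewrite <- FN at 1. rewrite <- Rect_minus by (auto; lra).
 le_via Cmod_triangle. rewrite Cmod_opp, Cmod_mult, Cmod_twopii.
 assert (A1 : Cmod (fn N w - f w) <= eps / L). { apply HN. apply Hsr. apply inI_inR; auto. }
 match goal with |- ?x + _ <= _ => assert (A2 : x <= (eps / L * / e'') * (2 * ((Re p + e - (Re p - e)) + (Im p + e - (Im p - e))))) end.
 { apply Rect_bound; try lra.
  - intros z Hz. specialize (CB N z Hz). specialize (CB' z Hz).
  intros q Hq. destruct (CB (q / 2)) as (d1 & D1 & H1). lra. destruct (CB' (q / 2)) as (d2 & D2 & H2). lra.
  exists (Rmin d1 d2). split. apply Rmin_pos; auto. intros v Hv. min_le d1 d2.
  specialize (H1 v ltac:(lra)). specialize (H2 v ltac:(lra)).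
  match goal with |- Cmod ?x < _ => replace x with ((fn N v / (v - w) - fn N z / (z - w)) - (f v / (v - w) - f z / (z - w)))%C by ring end.
  eapply Rle_lt_trans. apply Cmod_triangle_minus. lra.
  - intros z Hz. note (onB_neq _ _ _ _ _ _ HI Hz) as Nz.
  replace (fn N z / (z - w) - f z / (z - w))%C with ((fn N z - f z) / (z - w))%C by (field; auto). rewrite Cmod_div by auto.
  apply Rmult_le_compat. apply Cmod_ge_0. left; apply Rinv_0_lt_compat, Cmod_gt_0; auto. apply HN, Hsr, (onB_inR _ _ _ _ _ Hz).
  apply Rinv_le_contravar; auto. }
 note PI_RGT_0.
 le_mid (eps / L * L). 2:{ right; field; lra. } unfold L at 2. nra.
Qed.

Lemma locunif_Cder U fn f p : opn U -> (forall n, hol U (fn n)) -> locunif U fn f -> U p ->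
 forall eps, 0 < eps -> exists N, forall n, (N <= n)%nat -> Cmod (Cder (fn n) p - Cder f p) <= eps.
Proof. intros HU Hn Hl Hp eps Heps. note (locunif_hol U fn f HU Hn Hl) as Hf.
 destruct (Hl p Hp) as (r & Hr & Hu). destruct (opn_square U p HU Hp) as (e0 & He0 & H0).
 set (e := Rmin e0 (r / 3)).
 assert (E : 0 < e /\ e <= e0 /\ e <= r / 3). { unfold e. split. apply Rmin_pos; lra. split; [apply Rmin_l|apply Rmin_r]. }
 destruct E as (E & E1 & E2).
 destruct (Hu (eps * e / 2)) as (N & HN). nra. exists N. intros n Hle.
 assert (EQ : Cder (fun z => fn n z - f z)%C p = (Cder (fn n) p - Cder f p)%C).
 { apply Cder_eq. apply Cdiff_minus; eapply hol_Cdiff; eauto. }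
 rewrite <- EQ. replace eps with (2 * (eps * e / 2) / e) by (field; lra).
 apply Cauchy_estimate; auto.
 - intros z Hz. apply (hol_minus U); auto. apply H0. unfold sqR, inR in *. lra.
 - intros z Hz. apply HN; auto. apply sqR_Cmod in Hz. lra.
Qed.

(** [f z / (z - p)^n], set to 0 at [p], is holomorphic for every [n] because [f] vanishes near [p].
    The maximum principle gives [|f w| <= M (|w - p| / r)^n], and the right side tends to 0. A
    single square thus replaces power series and connectedness. *)
Lemma identity_square f p r : 0 < r -> (forall z, sqR p r z -> exists l, Cdiff f z l) ->
 (exists d, 0 < d /\ forall z, Cmod (z - p) < d -> f z = 0) -> forall w, Cmod (w - p) < r -> f w = 0.
Proof. intros Hr Hf (d & D & Hz) w Hw. destruct (Ceq_dec w p) as [->|N].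
 { apply Hz. replace (p - p)%C with (RtoC 0) by ring. rewrite Cmod_0; auto. }
 destruct (onB_bounded f (Re p - r) (Re p + r) (Im p - r) (Im p + r)) as (M & PM & HM); try lra.
 { intros z Hz'. destruct (Hf z (onB_inR _ _ _ _ _ Hz')). eapply Cdiff_contC; eauto. }
 assert (Nw : (w - p)%C <> 0) by (apply Cminus_neq0; auto). note (proj1 (Cmod_gt_0 _) Nw) as Pw.
 apply Cmod_eq_0. destruct (Rle_lt_or_eq_dec 0 (Cmod (f w)) (Cmod_ge_0 _)) as [P|]; auto. exfalso.
 assert (B : forall n, Cmod (f w) * r ^ n <= M * Cmod (w - p) ^ n).
 { intros n. set (g := fun z => if Ceq_dec z p then RtoC 0 else (f z / (z - p) ^ n)%C).
  assert (Cmod (g w) <= M / r ^ n).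
  { apply (max_modulus g (Re p - r) (Re p + r) (Im p - r) (Im p + r)).
  - intros z Hz'. destruct (Ceq_dec z p) as [->|Nz].
  + exists 0. apply Cdiff_ext_loc with (fun _ => RtoC 0). 2: apply Cdiff_const.
  exists d. split; auto. intros v Hv. unfold g. destruct (Ceq_dec v p); auto. rewrite (Hz v Hv). unfold Cdiv. ring.
  + destruct (Hf z Hz') as [l Hl].
  destruct (hol_pow (fun _ => True) (fun v => v - p)%C n (fun v _ => ex_intro _ _ (Cdiff_sub_const p v)) z I) as [l' Hl'].
  eexists. apply Cdiff_ext_loc with (fun z => f z / (z - p) ^ n)%C.
  * exists (Cmod (z - p)). split. apply Cmod_gt_0, Cminus_neq0; auto.
  intros v Hv. unfold g. destruct (Ceq_dec v p) as [->|]; auto. rewrite Cmod_minus_sym in Hv. lra.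
  * apply Cdiff_div; eauto. apply Cpow_nz, Cminus_neq0; auto.
  - apply Rdiv_le_0_compat; auto. apply pow_lt; auto.
  - intros z Hz'. unfold g. destruct (Ceq_dec z p). rewrite Cmod_0. apply Rdiv_le_0_compat; auto. apply pow_lt; auto.
  rewrite Cmod_div by (apply Cpow_nz, Cminus_neq0; auto). rewrite Cmod_pow. apply onB_square_dist in Hz' as Hd; auto.
  apply Rmult_le_compat. apply Cmod_ge_0. left; apply Rinv_0_lt_compat, pow_lt; lra. auto.
  apply Rinv_le_contravar. apply pow_lt; auto. apply pow_incr; lra.
  - apply Cmod_sqI; auto. }
  unfold g in H. destruct (Ceq_dec w p) as [|_]; [contradiction|]. rewrite Cmod_div, Cmod_pow in H by (apply Cpow_nz; auto).
  note (pow_lt r n Hr). note (pow_lt _ n Pw).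
  apply Rmult_le_compat_r with (r := r ^ n * Cmod (w - p) ^ n) in H; [|nra].
  replace (Cmod (f w) / Cmod (w - p) ^ n * (r ^ n * Cmod (w - p) ^ n)) with (Cmod (f w) * r ^ n) in H by (field; lra).
  replace (M / r ^ n * (r ^ n * Cmod (w - p) ^ n)) with (M * Cmod (w - p) ^ n) in H by (field; lra). auto. }
 assert (r <= Cmod (w - p)); [|lra].
 apply pow_le_const_mult with (M / Cmod (f w)); try lra. intros n. specialize (B n).
 apply Rmult_le_reg_l with (Cmod (f w)); auto. replace (Cmod (f w) * (M / Cmod (f w) * Cmod (w - p) ^ n)) with (M * Cmod (w - p) ^ n) by (field; lra). auto.
Qed.

(** * Primitives and logarithms on rectangles *)

Lemma RD_eq f x l l' : RD f x l -> l = l' -> RD f x l'.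
Proof. intros H <-; auto. Qed.
Lemma Cdiff_eq f x l l' : Cdiff f x l -> l = l' -> Cdiff f x l'.
Proof. intros H <-; auto. Qed.
Lemma exp_le_inv x y : exp x <= exp y -> x <= y.
Proof. intros H. apply Rnot_lt_le. intros K. apply exp_increasing in K. lra. Qed.


Lemma RD_mean_ineq_sym f f' a b M : (forall x, Rmin a b <= x <= Rmax a b -> RD f x (f' x)) ->
 (forall x, Rmin a b <= x <= Rmax a b -> Cmod (f' x) <= M) -> Cmod (f b - f a) <= M * Rabs (b - a).
Proof. intros H1 H2. destruct (Rle_dec a b) as [Hab|Hab].
 - rewrite Rmin_left, Rmax_right in * by lra. rewrite Rabs_pos_eq by lra. apply RD_mean_ineq with f'; auto.
 - rewrite Rmin_right, Rmax_left in * by lra. rewrite Rabs_left by lra. rewrite Cmod_minus_sym.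
  replace (M * - (b - a)) with (M * (a - b)) by ring. apply RD_mean_ineq with f'; auto; lra.
Qed.

Lemma RD_CInt_upper g a b x : a < x < b -> contI g a b -> RD (fun t => CInt g a t) x (g x).
Proof. intros Hx Hg. apply RD_iff. intros eps He. destruct (Hg x ltac:(lra) eps He) as (d & D & K).
 exists (Rmin d (Rmin (x - a) (b - x))). split. repeat apply Rmin_pos; lra.
 intros y Hy.
 assert (Rabs (y - x) < d /\ Rabs (y - x) < x - a /\ Rabs (y - x) < b - x) as (Y1 & Y2 & Y3).
 { repeat split; (eapply Rlt_le_trans; [exact Hy|]); unfold Rmin; repeat destruct Rle_dec; lra. }
 apply Rabs_def2 in Y2. apply Rabs_def2 in Y3. note (Rabs_def2 _ _ Y1).
 assert (Kc : forall p q, p <= q -> a <= p -> q <= b -> CInt (fun _ => g x) p q = (g x * RtoC (q - p))%C).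
 { intros p q Hpq _ _. rewrite (CInt_ftc (fun t => g x * RtoC t)%C); auto. rewrite RtoC_minus; ring.
  intros t _. eapply RD_eq. apply RD_scal, RD_id. ring. intros t _. apply contR_const. }
 destruct (Rle_dec x y) as [Hxy|Hxy].
 - rewrite (CInt_Chasles g a x y) by (try lra; eapply contI_sub; eauto; lra).
  replace (CInt g a x + CInt g x y - CInt g a x - g x * RtoC (y - x))%C with (CInt g x y - g x * RtoC (y - x))%C by ring.
  rewrite <- Kc by lra. assert (contI g x y) by (eapply contI_sub; eauto; lra).
  rewrite <- CInt_minus; auto; try (intros t _; apply contR_const). rewrite Rabs_pos_eq by lra.
  apply CInt_bound; auto. intros t Ht. apply contR_minus; auto. apply contR_const.
  intros t Ht. left. apply K. rewrite Rabs_pos_eq; lra.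
 - rewrite (CInt_Chasles g a y x) by (try lra; eapply contI_sub; eauto; lra).
  replace (CInt g a y - (CInt g a y + CInt g y x) - g x * RtoC (y - x))%C with (- (CInt g y x - g x * RtoC (x - y)))%C by (rewrite !RtoC_minus; ring).
  rewrite Cmod_opp. rewrite <- Kc by lra. assert (contI g y x) by (eapply contI_sub; eauto; lra).
  rewrite <- CInt_minus; auto; try lra; try (intros t _; apply contR_const). rewrite Rabs_left by lra.
  replace (eps * - (y - x)) with (eps * (x - y)) by ring.
  apply CInt_bound; auto. lra. intros t Ht. apply contR_minus; auto. apply contR_const.
  intros t Ht. left. apply K. rewrite Rabs_left1; lra.
Qed.

Lemma Rmin_max_abs a b x : Rmin a b <= x <= Rmax a b -> Rabs (x - a) <= Rabs (b - a).
Proof. unfold Rmin, Rmax. destruct Rle_dec; intros H; unfold Rabs; repeat destruct Rcase_abs; lra. Qed.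

(** The hypothesis on the partial derivatives encodes the Cauchy-Riemann equations. From [p] to [w]
    one moves along a horizontal and a vertical segment, and on each the mean value inequality and
    the continuity of [f] at [p] control the increment. *)
Lemma Cdiff_of_partials F f a b c d p : inI a b c d p ->
 (forall x y, a < x < b -> c < y < d -> RD (fun t => F (t, y)) x (f (x, y)) /\ RD (fun t => F (x, t)) y (Ci * f (x, y))%C) ->
 contC f p -> Cdiff F p (f p).
Proof. intros Hp HF Hc eps He. destruct (inI_onB_dist _ _ _ _ _ Hp) as (e0 & He0 & _ & HI).
 destruct (Hc (eps / 2)) as (d0 & D0 & K). lra.
 exists (Rmin (d0 / 2) (e0 / 2)). split. apply Rmin_pos; lra.
 intros w _ Hw. min_le (d0 / 2) (e0 / 2).
 destruct (Cmod_RI w p) as [K1 K2].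
 destruct w as [x' y']. destruct p as [x y]. simpl Re in *; simpl Im in *.
 assert (NB : forall u v, Rabs (u - x) <= Cmod ((x', y') - (x, y)) -> Rabs (v - y) <= Cmod ((x', y') - (x, y)) ->
  Cmod ((u, v) - (x, y)) < d0 /\ Cmod ((u, v) - (x, y)) < e0).
 { intros u v Hu Hv. assert (Cmod ((u, v) - (x, y)) <= Rabs (u - x) + Rabs (v - y)).
  { le_via Cmod_le_Re_Im. simpl. unfold Rminus. lra. } lra. }
 assert (S1 : Cmod ((F (x', y') - f (x, y) * Ci * RtoC y') - (F (x', y) - f (x, y) * Ci * RtoC y)) <= eps / 2 * Rabs (y' - y)).
 { apply (RD_mean_ineq_sym (fun t => F (x', t) - f (x, y) * Ci * RtoC t)%C (fun t => Ci * f (x', t) - f (x, y) * Ci * 1)%C).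
  - intros t Ht. apply Rmin_max_abs in Ht. destruct (NB x' t K1 ltac:(lra)) as [_ N]. apply HI in N. destruct N; simpl in *.
  apply RD_minus. apply HF; auto. apply RD_scal, RD_id.
  - intros t Ht. apply Rmin_max_abs in Ht. destruct (NB x' t K1 ltac:(lra)) as [N _].
  replace (Ci * f (x', t) - f (x, y) * Ci * 1)%C with (Ci * (f (x', t) - f (x, y)))%C by ring. rewrite Cmod_mult, Cmod_Ci, Rmult_1_l. left; auto. }
 assert (S2 : Cmod ((F (x', y) - f (x, y) * RtoC x') - (F (x, y) - f (x, y) * RtoC x)) <= eps / 2 * Rabs (x' - x)).
 { apply (RD_mean_ineq_sym (fun t => F (t, y) - f (x, y) * RtoC t)%C (fun t => f (t, y) - f (x, y) * 1)%C).
  - intros t Ht. apply Rmin_max_abs in Ht. destruct (NB t y ltac:(lra)) as [_ N]. rewrite Rminus_diag, Rabs_R0; apply Cmod_ge_0. apply HI in N. destruct N; simpl in *.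
  apply RD_minus. apply HF; auto. apply RD_scal, RD_id.
  - intros t Ht. apply Rmin_max_abs in Ht. destruct (NB t y ltac:(lra)) as [N _]. rewrite Rminus_diag, Rabs_R0; apply Cmod_ge_0.
  replace (f (t, y) - f (x, y) * 1)%C with (f (t, y) - f (x, y))%C by ring. left; auto. }
 replace (F (x', y') - F (x, y) - f (x, y) * ((x', y') - (x, y)))%C with
  (((F (x', y') - f (x, y) * Ci * RtoC y') - (F (x', y) - f (x, y) * Ci * RtoC y)) + ((F (x', y) - f (x, y) * RtoC x') - (F (x, y) - f (x, y) * RtoC x)))%C.
 2:{ replace ((x', y') - (x, y))%C with (RtoC x' - RtoC x + Ci * (RtoC y' - RtoC y))%C by Ceq. ring. }
 le_via Cmod_triangle. nra.
Qed.

(** [F] integrates along the bottom edge and then upwards. Its vertical derivative is immediate; for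
    the horizontal one, Goursat's lemma allows the path around the other corner. *)
Lemma primitive_rect f a b c d : a < b -> c < d -> holR a b c d f -> exists F, forall z, inI a b c d z -> Cdiff F z (f z).
Proof. intros Hab Hcd Hf.
 assert (HC : forall z, inR a b c d z -> contC f z) by (intros z Hz; destruct (Hf z Hz); eapply Cdiff_contC; eauto).
 assert (Ih : forall y, c <= y <= d -> contI (fun t => f (t, y)) a b).
 { intros y Hy x Hx. apply contR_hor, HC. unfold inR; simpl; lra. }
 assert (Iv : forall x, a <= x <= b -> contI (fun t => f (x, t)) c d).
 { intros x Hx y Hy. apply contR_ver, HC. unfold inR; simpl; lra. }
 set (F := fun z : C => (CInt (fun t => f (t, c)) a (Re z) + Ci * CInt (fun t => f (Re z, t)) c (Im z))%C).
 exists F. intros z Hz. apply Cdiff_of_partials with a b c d; auto. 2: apply HC, inI_inR; auto.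
 intros x y Hx Hy. split.
 - apply RD_ext_loc with (fun t => Ci * CInt (fun s => f (a, s)) c y + CInt (fun s => f (s, y)) a t)%C.
  + exists (Rmin (x - a) (b - x)). split. apply Rmin_pos; lra. intros t Ht.
  min_le (x - a) (b - x). apply Rabs_def2 in Ht.
  unfold F; simpl Re; simpl Im.
  assert (G : Rect f a t c y = 0). { apply Goursat; try lra. intros v [V1 V2]. apply Hf. unfold inR; lra. }
  unfold Rect in G.
  match goal with |- ?l = ?r => assert (E : (r - l)%C = 0) by (rewrite <- G; ring) end.
  symmetry. apply Ceq_minus. exact E.
  + replace (f (x, y)) with (0 + f (x, y))%C by ring. apply RD_plus. apply RD_const.
  apply (RD_CInt_upper (fun s => f (s, y)) a b); auto. apply Ih; lra.
 - unfold F; simpl Re; simpl Im. replace (Ci * f (x, y))%C with (0 + Ci * f (x, y))%C by ring. apply RD_plus. apply RD_const. apply RD_scal.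
  apply (RD_CInt_upper (fun s => f (x, s)) c d); auto. apply Iv; lra.
Qed.

Lemma RD_segment z w x : RD (fun t => z + RtoC t * (w - z))%C x (w - z).
Proof. eapply RD_eq. apply (RD_plus (fun _ => z)). apply RD_const. apply (RD_mult RtoC (fun _ => w - z)%C). apply RD_id. apply RD_const. ring.
Qed.

Lemma inI_segment a b c d z w t : inI a b c d z -> inI a b c d w -> 0 <= t <= 1 -> inI a b c d (z + RtoC t * (w - z))%C.
Proof. intros [H1 H2] [H3 H4] Ht. unfold inI. rewrite re_plus, im_plus, re_scal_l, im_scal_l.
 unfold Cminus. rewrite re_plus, im_plus, re_opp, im_opp.
 assert (K : forall p q x y, p < x < q -> p < y < q -> p < x + t * (y + - x) < q).
 { intros p q x y Hx Hy. destruct (Req_dec t 1) as [->|N]. lra.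
  assert (0 < (1 - t) * (x - p)) by pos. assert (0 < (1 - t) * (q - x)) by pos.
  assert (0 <= t * (y - p)) by pos. assert (0 <= t * (q - y)) by pos. lra. }
 split; apply K; auto.
Qed.

Lemma const_of_Cdiff0 h a b c d : (forall z, inI a b c d z -> Cdiff h z 0) -> forall z w, inI a b c d z -> inI a b c d w -> h z = h w.
Proof. intros H z w Hz Hw. symmetry. apply Ceq_minus. apply Cmod_eq_0. apply Rle_antisym; [|apply Cmod_ge_0].
 note (RD_mean_ineq (fun t => h (z + RtoC t * (w - z))%C) (fun _ => 0 * (w - z))%C 0 1 0) as K. cbv beta in K.
 replace (z + 1 * (w - z))%C with w in K by ring. replace (z + 0 * (w - z))%C with z in K by ring.
 rewrite Rmult_0_l in K. apply K. lra.
 - intros x Hx. apply (RD_comp h (fun t => z + RtoC t * (w - z))%C). apply H. apply inI_segment; auto. apply RD_segment.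
 - intros. replace (0 * (w - z))%C with (RtoC 0) by ring. rewrite Cmod_0; lra.
Qed.

(** When [F] is a primitive of [g'/g], the product [g Cexp (- F)] has derivative 0. The
    normalisation [h p = 0] makes [Im h] the variation of the argument from [p]. *)
Lemma log_exists U g a b c d p : opn U -> hol U g -> a < b -> c < d -> (forall z, inR a b c d z -> U z) ->
 (forall z, inR a b c d z -> g z <> RtoC 0) -> inI a b c d p ->
 exists h, (forall z, inI a b c d z -> Cdiff h z (Cder g z / g z)%C) /\ h p = 0 /\
  forall z, inI a b c d z -> g z = (g p * Cexp (h z))%C.
Proof. intros HU Hg Hab Hcd HRU Hn Hp.
 destruct (primitive_rect (fun z => Cder g z / g z)%C a b c d Hab Hcd) as [F HF].
 { intros z Hz. apply (hol_div (inR a b c d)); auto. apply (hol_sub U); auto. apply hol_Cder; auto. apply (hol_sub U); auto. }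
 exists (fun z => F z - F p)%C. split; [|split].
 - intros z Hz. replace (Cder g z / g z)%C with (Cder g z / g z - 0)%C by ring. apply (Cdiff_minus F (fun _ => F p)); auto. apply Cdiff_const.
 - ring.
 - intros z Hz.
  assert (E : (g z * Cexp (- (F z)))%C = (g p * Cexp (- (F p)))%C).
  { apply (const_of_Cdiff0 (fun z => g z * Cexp (- (F z)))%C a b c d); auto. intros w Hw.
  assert (HwR := inI_inR _ _ _ _ _ Hw).
  replace (RtoC 0) with (Cder g w * Cexp (- F w) + g w * (Cexp (- F w) * - (Cder g w / g w)))%C by (field; auto).
  apply (Cdiff_mult g (fun z => Cexp (- F z))). apply (hol_Cdiff U); auto. apply (Cdiff_comp Cexp (fun z => - F z)%C). apply Cdiff_Cexp. apply Cdiff_opp; auto. }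
  replace (Cexp (F z - F p)) with (Cexp (- F p) * Cexp (F z))%C by (rewrite <- Cexp_plus; f_equal; ring).
  rewrite Cmult_assoc, <- E, <- Cmult_assoc, <- Cexp_plus. replace (- F z + F z)%C with (RtoC 0) by ring. rewrite Cexp_0. ring.
Qed.

Lemma opn_inI a b c d : opn (inI a b c d).
Proof. intros z Hz. destruct (inI_onB_dist _ _ _ _ _ Hz) as (e & He & _ & H). exists e; auto. Qed.

(** * The Borel-Caratheodory inequality *)

(** [w = h / (2 L - h)] maps into the unit disc and vanishes at [p]. The maximum principle for
    [w / (z - p)] on the square of half-side [3 r / 4] gives [|w| <= 1/3] within [r / 4] of [p], and
    solving for [h] gives [|h| <= L]. *)
Lemma Borel_Caratheodory h p r L : 0 < r -> 0 < L -> hol (sqI p r) h -> h p = 0 ->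
 (forall z, sqI p r z -> Re (h z) <= L) -> forall z, Cmod (z - p) <= r / 4 -> Cmod (h z) <= L.
Proof. intros Hr HL Hh Hp HRe.
 assert (N : forall z, sqI p r z -> (2 * L - h z)%C <> 0).
 { intros z Hz E. specialize (HRe z Hz). apply (f_equal Re) in E. unfold Cminus in E. rewrite re_plus, re_opp in E. simpl in E. lra. }
 set (w := fun z => (h z / (2 * L - h z))%C).
 assert (Hw : hol (sqI p r) w). { apply hol_div; auto. apply (hol_minus _ (fun _ => 2 * L)%C); auto. apply hol_const. }
 assert (W1 : forall z, sqI p r z -> Cmod (w z) <= 1).
 { intros z Hz. unfold w. rewrite Cmod_div by auto. specialize (HRe z Hz).
  assert (0 < Cmod (2 * L - h z)) by (apply Cmod_gt_0; auto).
  apply Rmult_le_reg_r with (Cmod (2 * L - h z)); auto. unfold Rdiv. rewrite Rmult_assoc, Rinv_l, Rmult_1_l, Rmult_1_r by lra.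
  apply Rsqr_incr_0_var; [|lra]. unfold Rsqr. note (Cmod2_alt (h z)). note (Cmod2_alt (2 * L - h z)).
  unfold Cminus in H1. rewrite re_plus, im_plus, re_opp, im_opp in H1. fold (Cminus (2 * L) (h z)) in H1. simpl in *. nra. }
 assert (Wp : w p = 0). { unfold w. rewrite Hp. unfold Cdiv. ring. }
 destruct (divide_zero (sqI p r) w p (opn_inI _ _ _ _) Hw (sqI_center p r Hr) Wp) as (k & Hk & Ek).
 assert (Sub : forall z, sqR p (3 * r / 4) z -> sqI p r z). { intros z. unfold sqR, inR, sqI, inI. lra. }
 intros z Hz.
 assert (B : Cmod (k z) <= / (3 * r / 4)).
 { apply (max_modulus k (Re p - 3 * r / 4) (Re p + 3 * r / 4) (Im p - 3 * r / 4) (Im p + 3 * r / 4)).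
  - intros v Hv. apply Hk. apply Sub. exact Hv.
  - left; apply Rinv_0_lt_compat; lra.
  - intros v Hv. apply onB_square_dist in Hv as Hd; [|lra]. apply onB_inR in Hv. apply Sub in Hv.
  specialize (W1 v Hv). rewrite (Ek v Hv), Cmod_mult in W1. note (Cmod_ge_0 (k v)).
  apply Rmult_le_reg_l with (3 * r / 4). lra. rewrite Rinv_r by lra. nra.
  - apply Cmod_sqI. lra. }
 assert (Hz' : sqI p r z). { apply Cmod_sqI. lra. }
 assert (B2 : Cmod (w z) <= 1 / 3).
 { rewrite (Ek z Hz'), Cmod_mult. le_mid (r / 4 * / (3 * r / 4)). mul_le. right; field; lra. }
 assert (E : h z = (w z * (2 * L - h z))%C). { unfold w. field. auto. }
 apply (f_equal Cmod) in E. rewrite Cmod_mult in E.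
 assert (Cmod (2 * L - h z) <= 2 * L + Cmod (h z)).
 { le_via Cmod_triangle_minus. rewrite Cmod_mult, !Cmod_R, !Rabs_pos_eq; lra. }
 note (Cmod_ge_0 (w z)). note (Cmod_ge_0 (h z)). note (Cmod_ge_0 (2 * L - h z)). nra.
Qed.

(** * Zeros in squares *)

Definition prodl (l : list C) (z : C) : C := fold_right (fun r acc => ((z - r) * acc)%C) (RtoC 1) l.
(** The logarithmic derivative of [prodl l]. *)
Definition suml (l : list C) (z : C) : C := fold_right (fun r acc => (/ (z - r) + acc)%C) (RtoC 0) l.

(** [g] may still vanish, so that zeros can be split off one at a time. Repetitions in [l] stand for
    multiplicities. *)
Definition facl (U : C -> Prop) (f : C -> C) (l : list C) (g : C -> C) : Prop :=
 hol U g /\ forall z, U z -> f z = (prodl l z * g z)%C.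

Lemma hol_prodl U l : hol U (prodl l).
Proof. induction l. apply hol_const. simpl. apply (hol_mult U (fun z => z - a)%C); auto. intros z _. eexists. apply Cdiff_sub_const.
Qed.

Lemma prodl_ge l z m : 0 <= m -> (forall r, In r l -> m <= Cmod (z - r)) -> m ^ length l <= Cmod (prodl l z).
Proof. intros Hm. induction l; intros H; simpl. rewrite Cmod_1; lra. rewrite Cmod_mult. apply Rmult_le_compat; auto.
 apply pow_le; auto. apply H; left; auto. apply IHl. intros; apply H; right; auto.
Qed.

Lemma prodl_le l z m : (forall r, In r l -> Cmod (z - r) <= m) -> Cmod (prodl l z) <= m ^ length l.
Proof. induction l; intros H; simpl. rewrite Cmod_1; lra. rewrite Cmod_mult. mul_le.
 apply H; left; auto. apply IHl. intros; apply H; right; auto.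
Qed.

Lemma prodl_neq0 l z : (forall r, In r l -> z <> r) -> prodl l z <> 0.
Proof. induction l; intros H; simpl. apply C1_nz. apply Cmult_neq_0. apply Cminus_neq0. apply H; left; auto. apply IHl. intros; apply H; right; auto.
Qed.

Lemma Cdiff_prodl l z : (forall r, In r l -> z <> r) -> Cdiff (prodl l) z (prodl l z * suml l z)%C.
Proof. induction l; intros H; simpl. replace (1 * 0)%C with (RtoC 0) by ring. apply Cdiff_const.
 assert (N : (z - a)%C <> 0) by (apply Cminus_neq0; apply H; left; auto).
 replace ((z - a) * prodl l z * (/ (z - a) + suml l z))%C with (1 * prodl l z + (z - a) * (prodl l z * suml l z))%C by (field; auto).
 apply (Cdiff_mult (fun z => z - a)%C). apply Cdiff_sub_const. apply IHl. intros; apply H; right; auto.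
Qed.

Lemma logder_facl U f l g z : opn U -> facl U f l g -> U z -> f z <> RtoC 0 ->
 (Cder f z / f z)%C = (suml l z + Cder g z / g z)%C.
Proof. intros HU [Hg Hf] Uz Hz.
 assert (Ng : g z <> RtoC 0). { intros E. apply Hz. rewrite (Hf z Uz), E. ring. }
 assert (Np : prodl l z <> RtoC 0). { intros E. apply Hz. rewrite (Hf z Uz), E. ring. }
 assert (Nr : forall r, In r l -> z <> r).
 { intros r Hr ->. apply Np. clear - Hr. induction l; simpl in *. contradiction. destruct Hr as [->|Hr].
  replace (r - r)%C with (RtoC 0) by ring. ring. rewrite IHl by auto. ring. }
 destruct (HU z Uz) as (d & D & H).
 rewrite (Cder_eq f z (prodl l z * suml l z * g z + prodl l z * Cder g z)%C).
 - rewrite (Hf z Uz). field. auto.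
 - apply Cdiff_ext_loc with (fun z => prodl l z * g z)%C. exists d; split; auto. intros w Hw. symmetry; auto.
  apply Cdiff_mult. apply Cdiff_prodl; auto. apply (hol_Cdiff U); auto.
Qed.

Lemma onB_sq_far p r R0 z w : 0 < r -> r <= R0 -> onB (Re p - R0) (Re p + R0) (Im p - R0) (Im p + R0) z -> sqR p r w -> R0 - r <= Cmod (z - w).
Proof. intros Hr HR [[H1 H2] HB] [H3 H4]. destruct (Cmod_RI z w) as [K1 K2].
 note (Rle_abs (Re z - Re w)). note (Rle_abs (- (Re z - Re w))). rewrite Rabs_Ropp in H0.
 note (Rle_abs (Im z - Im w)). note (Rle_abs (- (Im z - Im w))). rewrite Rabs_Ropp in H6.
 destruct HB as [E|[E|[E|E]]]; rewrite E in *; lra.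
Qed.

Section Landau.
Variables (U : C -> Prop) (f g : C -> C) (l : list C) (p : C) (r M : R).
Hypotheses (HU : opn U) (Hfac : facl U f l g) (Hr : 0 < r) (Hsq : forall z, sqR p (5 * r) z -> U z)
 (HM : forall z, sqR p (5 * r) z -> Cmod (f z) <= M) (Hl : forall q, In q l -> sqR p r q) (Hp : f p <> RtoC 0).

(** On the boundary of the square of half-side [5 r] every listed zero is at distance at least
    [4 r], while all of them are within [2 r] of [p]. The ratio 2 of these distances is the source
    of [2 ^ length l] in [Landau_count]. *)
Lemma Landau_g_bound z : sqI p (5 * r) z -> Cmod (g z) <= M / (4 * r) ^ length l.
Proof. intros Hz. destruct Hfac as [Hg Hf].
 assert (PM : 0 <= M). { eapply Rle_trans; [apply (Cmod_ge_0 (f z))|]. apply HM, inI_inR, Hz. }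
 assert (P4 : 0 < (4 * r) ^ length l) by (apply pow_lt; lra).
 apply (max_modulus g (Re p - 5 * r) (Re p + 5 * r) (Im p - 5 * r) (Im p + 5 * r)); auto.
 - intros v Hv. apply Hg, Hsq, Hv.
 - apply Rdiv_le_0_compat; auto.
 - intros v Hv. note (HM v (onB_inR _ _ _ _ _ Hv)) as B. rewrite (Hf v (Hsq v (onB_inR _ _ _ _ _ Hv))), Cmod_mult in B.
  assert (K : (4 * r) ^ length l <= Cmod (prodl l v)).
  { apply prodl_ge. lra. intros q Hq. replace (4 * r) with (5 * r - r) by ring. apply onB_sq_far with p; auto. lra. }
  apply Rmult_le_reg_r with ((4 * r) ^ length l); auto. unfold Rdiv. rewrite (Rmult_assoc M), Rinv_l by lra.
  note (Cmod_ge_0 (g v)). nra.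
Qed.

Lemma Landau_p : Cmod (prodl l p) <= (2 * r) ^ length l.
Proof. apply prodl_le. intros q Hq. rewrite Cmod_minus_sym. apply sqR_Cmod; auto. Qed.

Lemma Landau_count : 2 ^ length l * Cmod (f p) <= M.
Proof. assert (Sp : sqI p (5 * r) p) by (apply sqI_center; lra).
 note (Landau_g_bound p Sp) as B. destruct Hfac as [Hg Hf].
 rewrite (Hf p (Hsq p (inI_inR _ _ _ _ _ Sp))), Cmod_mult. note Landau_p as Q.
 assert (P4 : 0 < (4 * r) ^ length l) by (apply pow_lt; lra).
 le_mid (2 ^ length l * ((2 * r) ^ length l * (M / (4 * r) ^ length l))).
 - mul_le_l. apply pow_le; lra. mul_le.
 - right. replace ((4 * r) ^ length l) with (2 ^ length l * (2 * r) ^ length l) by (rewrite <- Rpow_mult_distr; f_equal; ring).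
  field. split; apply pow_nonzero; lra.
Qed.

(** By [Landau_g_bound] the logarithm [h] of [g / g p] has real part at most [L]. Borel-Caratheodory
    bounds [|h|] within [r / 4] of [p], and Cauchy's estimate on squares of half-side [r / 16]
    bounds its derivative. *)
Lemma Landau_logder L : 0 < L -> M <= Cmod (f p) * exp L -> (forall z, sqR p r z -> g z <> RtoC 0) ->
 forall z, sqR p (r / 16) z -> Cmod (Cder g z / g z) <= 32 * L / r.
Proof. intros HL HML Hn z Hz.
 assert (Sp : sqI p (5 * r) p) by (apply sqI_center; lra).
 assert (P4 : 0 < (4 * r) ^ length l) by (apply pow_lt; lra).
 assert (P2 : 0 < (2 * r) ^ length l) by (apply pow_lt; lra).
 assert (SU : forall z, sqR p r z -> U z). { intros v Hv. apply Hsq. unfold sqR, inR in *; lra. }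
 destruct (log_exists U g (Re p - r) (Re p + r) (Im p - r) (Im p + r) p HU (proj1 Hfac)) as (h & H1 & H2 & H3); auto; try lra.
 { apply sqI_center; auto. }
 assert (HRe : forall v, sqI p r v -> Re (h v) <= L).
 { intros v Hv. assert (Sv : sqI p (5 * r) v) by (unfold sqI, inI in *; lra).
  note (Landau_g_bound v Sv) as B. rewrite (H3 v Hv), Cmod_mult, Cmod_Cexp in B.
  assert (Pg : 0 < Cmod (g p)). { apply Cmod_gt_0. apply Hn. apply inI_inR, (sqI_center p r Hr). }
  assert (Ef : Cmod (f p) <= (2 * r) ^ length l * Cmod (g p)).
  { rewrite (proj2 Hfac p (Hsq p (inI_inR _ _ _ _ _ Sp))), Cmod_mult. mul_le_r. lra. apply Landau_p. }
  apply exp_le_inv.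
  apply Rmult_le_reg_l with (Cmod (g p)); auto. eapply Rle_trans. exact B.
  apply Rmult_le_reg_r with ((4 * r) ^ length l); auto. unfold Rdiv. rewrite (Rmult_assoc M), Rinv_l, Rmult_1_r by lra.
  note (exp_pos L).
  le_mid ((2 * r) ^ length l * Cmod (g p) * exp L). nra.
  replace ((4 * r) ^ length l) with (2 ^ length l * (2 * r) ^ length l) by (rewrite <- Rpow_mult_distr; f_equal; ring).
  note (pow_R1_Rle 2 (length l) ltac:(lra)).
  assert (0 < (2 * r) ^ length l * Cmod (g p) * exp L) by (repeat apply Rmult_lt_0_compat; auto). nra. }
 assert (Hh : hol (sqI p r) h). { intros v Hv. eexists. apply H1. exact Hv. }
 assert (EQ : (Cder g z / g z)%C = Cder h z). { symmetry. apply Cder_eq. apply H1. unfold sqR, inR, inI in *; lra. }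
 rewrite EQ. replace (32 * L / r) with (2 * L / (r / 16)) by (field; lra).
 apply Cauchy_estimate. lra.
 - intros v Hv. apply Hh. unfold sqR, inR, sqI, inI in *. lra.
 - intros v Hv. apply (Borel_Caratheodory h p r L); auto.
  apply sqR_Cmod in Hv. apply sqR_Cmod in Hz. note (Cmod_triangle3 v z p). lra.
Qed.

End Landau.

(** * Counting zeros in a set *)

Definition decb (P : Prop) : bool := if excluded_middle_informative P then true else false.
Lemma decb_true P : decb P = true <-> P.
Proof. unfold decb. destruct excluded_middle_informative; split; auto; discriminate. Qed.
Lemma decb_false P : decb P = false <-> ~ P.
Proof. unfold decb. destruct excluded_middle_informative; split; auto; try discriminate. contradiction. Qed.

Ltac undec E := first [apply (proj1 (decb_true _)) in E | apply (proj1 (decb_false _)) in E].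

Definition sel (S : C -> Prop) (l : list C) : list C := filter (fun z => decb (S z)) l.

Lemma sel_In S l z : In z (sel S l) <-> In z l /\ S z.
Proof. unfold sel. rewrite filter_In, decb_true. tauto. Qed.

Lemma prodl_sel S l z : prodl l z = (prodl (sel S l) z * prodl (sel (fun w => ~ S w) l) z)%C.
Proof. induction l; simpl. ring. unfold sel in *. simpl. rewrite IHl.
 destruct (decb (S a)) eqn:E; destruct (decb (~ S a)) eqn:E'; simpl; try ring.
 - exfalso. undec E'; undec E; auto.
 - exfalso. undec E'; undec E; auto.
Qed.

Lemma facl_sel U f l g S : facl U f l g -> facl U f (sel S l) (fun z => prodl (sel (fun w => ~ S w) l) z * g z)%C.
Proof. intros [Hg Hf]. split. apply hol_mult; auto. apply hol_prodl. intros z Uz. rewrite (Hf z Uz), (prodl_sel S l z). ring.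
Qed.

(** An upper bound for the number of zeros in [S], required of every partial factorisation; stated
    in this way it presupposes no finiteness. *)
Definition cntb (U : C -> Prop) (f : C -> C) (S : C -> Prop) (N : nat) : Prop :=
 forall l g, facl U f l g -> (length (sel S l) <= N)%nat.

Lemma cntb_union U f S T V N M : cntb U f S N -> cntb U f T M -> (forall z, V z -> S z \/ T z) -> cntb U f V (N + M).
Proof. intros HS HT H l g Hf. specialize (HS l g Hf). specialize (HT l g Hf).
 assert (A : (length (sel V l) <= length (sel S l) + length (sel T l))%nat).
 { clear - H. unfold sel. induction l; simpl; auto.
  destruct (decb (V a)) eqn:E1; destruct (decb (S a)) eqn:E2; destruct (decb (T a)) eqn:E3; simpl; try lia.
  undec E1. undec E2. undec E3. exfalso. destruct (H a E1); auto. }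
 lia.
Qed.

Lemma sel_all S l : (forall z, In z l -> S z) -> sel S l = l.
Proof. induction l; simpl; intros H; auto. unfold sel in *. simpl.
 rewrite (proj2 (decb_true (S a)) (H a (or_introl eq_refl))). f_equal. apply IHl; auto.
Qed.

(** Zeros in [S] are divided out one at a time by [divide_zero]. The process must stop, since
    [N + 1] divisions would contradict [cntb]. *)
Lemma complete_list U f S N : opn U -> hol U f -> (forall z, S z -> U z) -> cntb U f S N ->
 exists l g, facl U f l g /\ (forall z, In z l -> S z) /\ forall z, S z -> g z <> 0.
Proof. intros HU Hf HS HN. apply NNPP. intros Hno.
 assert (A : forall n, exists l g, length l = n /\ facl U f l g /\ forall z, In z l -> S z).
 { induction n.
  - exists [], f. split; auto. split. split; auto. intros; simpl; ring. intros z [].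
  - destruct IHn as (l & g & E & [Hg Hfac] & Hin).
  assert (exists z, S z /\ g z = 0) as (z & Sz & Gz).
  { apply NNPP. intros H. apply Hno. exists l, g. split. split; auto. split; auto. intros z Sz Ez. apply H. exists z; auto. }
  destruct (divide_zero U g z HU Hg (HS z Sz) Gz) as (k & Hk & Ek).
  exists (z :: l), k. split. simpl; auto. split. split; auto.
  + intros w Uw. rewrite (Hfac w Uw), (Ek w Uw). simpl. ring.
  + intros w [<-|Hw]; auto. }
 destruct (A (N + 1)%nat) as (l & g & E & Hfac & Hin). specialize (HN l g Hfac). rewrite sel_all in HN by auto. lia.
Qed.

Lemma cntb_square U f p r M N : opn U -> 0 < r -> (forall z, sqR p (5 * r) z -> U z) ->
 (forall z, sqR p (5 * r) z -> Cmod (f z) <= M) -> f p <> RtoC 0 -> M < 2 ^ (S N) * Cmod (f p) -> cntb U f (sqR p r) N.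
Proof. intros HU Hr Hsq HM Hp HN l g Hf. apply (facl_sel _ _ _ _ (sqR p r)) in Hf.
 assert (K : 2 ^ length (sel (sqR p r) l) * Cmod (f p) <= M).
 { eapply Landau_count; eauto. intros q Hq. apply sel_In in Hq. tauto. }
 apply Nat.nlt_ge. intros Hlt.
 assert (2 ^ S N <= 2 ^ length (sel (sqR p r) l)) by (apply Rle_pow; [lra|lia]).
 note (Cmod_ge_0 (f p)). nra.
Qed.

(** * Complex powers and series *)

Lemma Cmod_rcpow a s : Cmod (rcpow a s) = Rpower a (Re s).
Proof. unfold rcpow. rewrite Cmod_Cexp, re_scal_r. reflexivity. Qed.
Lemma rcpow_plus a s t : rcpow a (s + t) = (rcpow a s * rcpow a t)%C.
Proof. unfold rcpow. rewrite <- Cexp_plus. f_equal. ring. Qed.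
Lemma rcpow_neq0 a s : rcpow a s <> 0.
Proof. apply Cexp_neq0. Qed.
Lemma rcpow_opp a s : rcpow a (- s) = (/ rcpow a s)%C.
Proof. unfold rcpow. replace (- s * ln a)%C with (- (s * ln a))%C by ring. apply Cexp_opp. Qed.
Lemma rcpow_base1 s : rcpow 1 s = 1.
Proof. unfold rcpow. rewrite ln_1. replace (s * 0)%C with (RtoC 0) by ring. apply Cexp_0. Qed.
Lemma rcpow_1 a : 0 < a -> rcpow a 1 = RtoC a.
Proof. intros Ha. unfold rcpow. replace (1 * ln a)%C with (RtoC (ln a)) by ring. rewrite <- RtoC_exp, exp_ln; auto. Qed.
Lemma rcpow_mult_base a b s : 0 < a -> 0 < b -> rcpow (a * b) s = (rcpow a s * rcpow b s)%C.
Proof. intros Ha Hb. unfold rcpow. rewrite ln_mult, RtoC_plus by auto. rewrite <- Cexp_plus. f_equal. ring. Qed.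
Lemma Cconj_rcpow a s : Cconj (rcpow a s) = rcpow a (Cconj s).
Proof. unfold rcpow. rewrite Cconj_Cexp, Cmult_conj. f_equal. f_equal. Ceq. Qed.

Lemma Cdiff_rcpow a s : Cdiff (fun s => rcpow a s) s (ln a * rcpow a s)%C.
Proof. eapply Cdiff_eq. apply (Cdiff_comp Cexp (fun s => s * ln a)%C). apply Cdiff_Cexp.
 apply (Cdiff_mult (fun s => s) (fun _ => RtoC (ln a))). apply Cdiff_id. apply Cdiff_const. unfold rcpow. ring.
Qed.

Lemma RD_rcpow s x : 0 < x -> RD (fun t => rcpow t s) x (s * rcpow x (s - 1))%C.
Proof. intros Hx. eapply RD_eq. apply (RD_comp Cexp (fun t => s * RtoC (ln t))%C). apply Cdiff_Cexp.
 apply RD_scal. apply RD_RtoC. apply is_derive_Reals. apply derivable_pt_lim_ln; auto.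
 unfold Cminus. rewrite rcpow_plus, rcpow_opp, rcpow_1 by auto. rewrite RtoC_inv by lra. unfold rcpow. ring.
Qed.

(** * Series dominated by a power of the index *)

Fixpoint Csum (f : nat -> C) (n : nat) : C := match n with O => RtoC 0 | S m => (Csum f m + f m)%C end.

Definition Cser (f : nat -> C) (L : C) : Prop :=
 forall eps, 0 < eps -> exists N, forall n, (N <= n)%nat -> Cmod (Csum f n - L) <= eps.

Lemma Csum_ext f g n : (forall k, (k < n)%nat -> f k = g k) -> Csum f n = Csum g n.
Proof. induction n; simpl; intros H; auto. rewrite IHn, H; auto. Qed.
Lemma Csum_plus f g n : Csum (fun k => f k + g k)%C n = (Csum f n + Csum g n)%C.
Proof. induction n; simpl. ring. rewrite IHn. ring. Qed.
Lemma Csum_scal c f n : Csum (fun k => c * f k)%C n = (c * Csum f n)%C.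
Proof. induction n; simpl. ring. rewrite IHn. ring. Qed.
Lemma Csum_S_l f n : Csum f (S n) = (f 0%nat + Csum (fun k => f (S k)) n)%C.
Proof. induction n. simpl; ring. simpl in *. rewrite IHn. ring. Qed.
Lemma Csum_swap (f : nat -> nat -> C) n m : Csum (fun i => Csum (f i) m) n = Csum (fun j => Csum (fun i => f i j) n) m.
Proof. induction n; simpl. induction m; simpl; auto. rewrite <- IHm; ring. rewrite IHn, <- Csum_plus. reflexivity. Qed.
Lemma Csum_telescope (v : nat -> C) n : Csum (fun k => v (S k) - v k)%C n = (v n - v 0%nat)%C.
Proof. induction n; simpl. ring. rewrite IHn. ring. Qed.

Lemma Cser_ext f g L : (forall n, f n = g n) -> Cser f L -> Cser g L.
Proof. intros E H eps He. destruct (H eps He) as [N HN]. exists N. intros n Hn. rewrite <- (Csum_ext f g) by auto. auto. Qed.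
Lemma Cser_unique f L L' : Cser f L -> Cser f L' -> L = L'.
Proof. intros H H'. apply Cmod_small_eq. intros e He. destruct (H (e / 2)) as [N HN]. lra. destruct (H' (e / 2)) as [N' HN']. lra.
 specialize (HN (N + N')%nat ltac:(lia)). specialize (HN' (N + N')%nat ltac:(lia)). rewrite Cmod_minus_sym in HN.
 note (Cmod_triangle3 L (Csum f (N + N')) L'). lra.
Qed.
Lemma Cser_plus f g L L' : Cser f L -> Cser g L' -> Cser (fun n => f n + g n)%C (L + L')%C.
Proof. intros H H' e He. destruct (H (e / 2)) as [N HN]. lra. destruct (H' (e / 2)) as [N' HN']. lra. exists (N + N')%nat. intros n Hn.
 specialize (HN n ltac:(lia)). specialize (HN' n ltac:(lia)). rewrite Csum_plus.
 replace (Csum f n + Csum g n - (L + L'))%C with ((Csum f n - L) + (Csum g n - L'))%C by ring. le_via Cmod_triangle. lra.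
Qed.
Lemma Cser_scal c f L : Cser f L -> Cser (fun n => c * f n)%C (c * L)%C.
Proof. intros H e He. note (Cmod_ge_0 c). destruct (H (e / (Cmod c + 1))) as [N HN]. pos. exists N. intros n Hn.
 specialize (HN n Hn). rewrite Csum_scal. replace (c * Csum f n - c * L)%C with (c * (Csum f n - L))%C by ring. rewrite Cmod_mult.
 apply Rmult_le_compat_l with (r := Cmod c + 1) in HN; [|lra]. replace ((Cmod c + 1) * (e / (Cmod c + 1))) with e in HN by (field; lra).
 note (Cmod_ge_0 (Csum f n - L)). nra.
Qed.
Lemma Cser_Csum (f : nat -> nat -> C) (L : nat -> C) m : (forall j, (j < m)%nat -> Cser (f j) (L j)) -> Cser (fun n => Csum (fun j => f j n) m) (Csum L m).
Proof. induction m; intros H; simpl.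
 - intros e He. exists 0%nat. intros n _. replace (Csum (fun _ => RtoC 0) n) with (RtoC 0). replace (0 - 0)%C with (RtoC 0) by ring. rewrite Cmod_0; lra.
  induction n; simpl; auto. rewrite <- IHn; ring.
 - apply Cser_plus; auto.
Qed.

(** A bound for the sum of [n^(-sg)]: by the mean value theorem each term is at most [Ksig sg] times
    a decrement of [m^(1 - sg)]. The power of 2 comes from [m + 1 <= 2 m]. *)
Definition Ksig (sg : R) : R := Rpower 2 sg / (sg - 1).

Lemma Rpower_pos x y : 0 < Rpower x y. Proof. apply exp_pos. Qed.

Lemma Ksig_pos sg : 1 < sg -> 0 < Ksig sg.
Proof. intros. apply Rdiv_lt_0_compat. apply Rpower_pos. lra. Qed.

Lemma Rpower_antimono x y a : 0 < x <= y -> a <= 0 -> Rpower y a <= Rpower x a.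
Proof. intros Hx Ha. unfold Rpower. apply exp_le. assert (ln x <= ln y). { destruct (Req_dec x y) as [->|]. lra. left; apply ln_increasing; lra. } nra.
Qed.

Lemma is_derive_Rpower x a : 0 < x -> is_derive (fun t => Rpower t a) x (a * Rpower x (a - 1)).
Proof. intros Hx. apply is_derive_Reals. apply derivable_pt_lim_power; auto. Qed.

Lemma Rpower_telescope sg m : 1 < sg -> 1 <= m -> Rpower m (- sg) <= Ksig sg * (Rpower m (1 - sg) - Rpower (m + 1) (1 - sg)).
Proof. intros Hs Hm.
 destruct (MVT_gen (fun t => Rpower t (1 - sg)) m (m + 1) (fun t => (1 - sg) * Rpower t (1 - sg - 1))) as [c [Hc E]].
 - intros x Hx. rewrite Rmin_left, Rmax_right in Hx by lra. apply is_derive_Rpower. lra.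
 - intros x Hx. rewrite Rmin_left, Rmax_right in Hx by lra. eapply is_derive_continuity_pt. apply is_derive_Rpower. lra.
 - rewrite Rmin_left, Rmax_right in Hc by lra. replace (1 - sg - 1) with (- sg) in E by ring.
  replace (Rpower m (1 - sg) - Rpower (m + 1) (1 - sg)) with ((sg - 1) * Rpower c (- sg)) by lra.
  unfold Ksig. replace (Rpower 2 sg / (sg - 1) * ((sg - 1) * Rpower c (- sg))) with (Rpower 2 sg * Rpower c (- sg)) by (field; lra).
  le_mid (Rpower 2 sg * Rpower (2 * m) (- sg)).
  + rewrite <- Rpower_mult_distr by lra. rewrite <- Rmult_assoc, <- Rpower_plus. replace (sg + - sg) with 0 by ring. rewrite Rpower_O by lra. lra.
  + mul_le_l. pos. apply Rpower_antimono; lra.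
Qed.

Local Notation dominated f A sg := (forall n, Cmod (f n) <= A * Rpower (INR (S n)) (- sg)).

Lemma Csum_tail f A sg : 1 < sg -> 0 <= A -> dominated f A sg ->
 forall N k, Cmod (Csum f (N + k) - Csum f N) <= A * Ksig sg * (Rpower (INR (S N)) (1 - sg) - Rpower (INR (S (N + k))) (1 - sg)).
Proof. intros Hs HA H N k. induction k.
 - rewrite Nat.add_0_r. replace (Csum f N - Csum f N)%C with (RtoC 0) by ring. rewrite Cmod_0. right; ring.
 - rewrite Nat.add_succ_r. simpl Csum. replace (Csum f (N + k) + f (N + k)%nat - Csum f N)%C with ((Csum f (N + k) - Csum f N) + f (N + k)%nat)%C by ring.
  le_via Cmod_triangle. specialize (H (N + k)%nat).
  assert (1 <= INR (S (N + k))). { rewrite S_INR. note (pos_INR (N + k)). lra. }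
  note (Rpower_telescope sg (INR (S (N + k))) Hs H0). rewrite <- S_INR in H1.
  apply Rmult_le_compat_l with (r := A) in H1; auto. lra.
Qed.

Lemma Rpower_small sg eps : 1 < sg -> 0 < eps -> exists N, forall n, (N <= n)%nat -> Rpower (INR (S n)) (1 - sg) <= eps.
Proof. intros Hs He. destruct (INR_archimed 1 (Rpower eps (/ (1 - sg)))) as [N HN]. lra. rewrite Rmult_1_r in HN. exists N. intros n Hn.
 apply le_INR in Hn. assert (INR N < INR (S n)) by (rewrite S_INR; lra). note (Rpower_pos eps (/ (1 - sg))).
 le_mid (Rpower (Rpower eps (/ (1 - sg))) (1 - sg)). apply Rpower_antimono; lra.
 rewrite Rpower_mult. replace (/ (1 - sg) * (1 - sg)) with 1 by (field; lra). rewrite Rpower_1; lra.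
Qed.

Lemma C_complete_seq (u : nat -> C) : (forall eps, 0 < eps -> exists N, forall n m, (N <= n)%nat -> (N <= m)%nat -> Cmod (u n - u m) <= eps) ->
 exists L, forall eps, 0 < eps -> exists N, forall n, (N <= n)%nat -> Cmod (u n - L) <= eps.
Proof. intros H.
 destruct (Rcomplete.R_complete (fun n => Re (u n))) as [x Hx].
 { intros eps He. destruct (H (eps / 2)) as [N HN]. lra. exists N. intros n m Hn Hm. unfold Rdist.
  destruct (Cmod_RI (u n) (u m)) as [K _]. specialize (HN n m Hn Hm). lra. }
 destruct (Rcomplete.R_complete (fun n => Im (u n))) as [y Hy].
 { intros eps He. destruct (H (eps / 2)) as [N HN]. lra. exists N. intros n m Hn Hm. unfold Rdist.
  destruct (Cmod_RI (u n) (u m)) as [_ K]. specialize (HN n m Hn Hm). lra. }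
 exists (x, y). intros eps He. destruct (Hx (eps / 2)) as [N1 H1]. lra. destruct (Hy (eps / 2)) as [N2 H2]. lra.
 exists (N1 + N2)%nat. intros n Hn. specialize (H1 n ltac:(lia)). specialize (H2 n ltac:(lia)). unfold Rdist in *.
 le_via Cmod_le_Re_Im. unfold Cminus. rewrite re_plus, im_plus, re_opp, im_opp. simpl. unfold Rminus in *. lra.
Qed.

Lemma Cser_exists f A sg : 1 < sg -> 0 <= A -> dominated f A sg -> exists L, Cser f L.
Proof. intros Hs HA H. apply C_complete_seq. intros eps He.
 assert (PK := Ksig_pos sg Hs). assert (P : 0 <= A * Ksig sg) by pos.
 destruct (Rpower_small sg (eps / (A * Ksig sg + 1)) Hs) as [N HN]. pos.
 exists N.
 assert (B : forall n k, (N <= n)%nat -> Cmod (Csum f (n + k) - Csum f n) <= eps).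
 { intros n k Hn. eapply Rle_trans. apply (Csum_tail f A sg); auto. specialize (HN n Hn). note (Rpower_pos (INR (S (n + k))) (1 - sg)).
  note (Rpower_pos (INR (S n)) (1 - sg)).
  le_mid ((A * Ksig sg + 1) * (eps / (A * Ksig sg + 1))). le_mid (A * Ksig sg * Rpower (INR (S n)) (1 - sg)). mul_le_l; lra. apply Rmult_le_compat; lra. right; field; lra. }
 intros n m Hn Hm. destruct (Nat.le_ge_cases n m).
 - replace m with (n + (m - n))%nat by lia. rewrite Cmod_minus_sym. auto.
 - replace n with (m + (n - m))%nat by lia. auto.
Qed.

Lemma Cser_tail f A sg L : 1 < sg -> 0 <= A -> dominated f A sg -> Cser f L ->
 forall N, Cmod (Csum f N - L) <= A * Ksig sg * Rpower (INR (S N)) (1 - sg).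
Proof. intros Hs HA H HL N. apply Rle_plus_epsilon. intros eps He. destruct (HL eps He) as [n Hn]. specialize (Hn (N + n)%nat ltac:(lia)).
 note (Csum_tail f A sg Hs HA H N n) as T. rewrite Cmod_minus_sym in T. note (Cmod_triangle3 (Csum f N) (Csum f (N + n)) L).
 assert (PK := Ksig_pos sg Hs). assert (P : 0 <= A * Ksig sg) by pos.
 note (Rpower_pos (INR (S (N + n))) (1 - sg)). nra.
Qed.

Lemma Cser_bound f A sg L : 1 < sg -> 0 <= A -> dominated f A sg -> Cser f L -> Cmod L <= A * Ksig sg.
Proof. intros Hs HA H HL. note (Cser_tail f A sg L Hs HA H HL 0). simpl in H0. replace (0 - L)%C with (- L)%C in H0 by ring. rewrite Cmod_opp in H0.
 unfold Rpower in H0. rewrite ln_1, Rmult_0_r, exp_0 in H0. lra.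
Qed.

Definition Clim_ser (f : nat -> C) : C := epsilon (inhabits (RtoC 0)) (Cser f).
Lemma Clim_ser_spec f L : Cser f L -> Cser f (Clim_ser f).
Proof. intros H. apply (epsilon_spec (inhabits (RtoC 0)) (Cser f)). exists L; auto. Qed.
Lemma Weierstrass_ser U (f : nat -> C -> C) : (forall p, U p -> exists r A sg, 0 < r /\ 0 <= A /\ 1 < sg /\
  forall z, Cmod (z - p) < r -> forall n, Cmod (f n z) <= A * Rpower (INR (S n)) (- sg)) ->
 locunif U (fun N z => Csum (fun n => f n z) N) (fun z => Clim_ser (fun n => f n z)).
Proof. intros H p Hp. destruct (H p Hp) as (r & A & sg & Hr & HA & Hs & B). exists r. split; auto. intros eps He.
 assert (PK := Ksig_pos sg Hs). assert (P : 0 <= A * Ksig sg) by pos.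
 destruct (Rpower_small sg (eps / (A * Ksig sg + 1)) Hs) as [N HN]. pos.
 exists N. intros n Hn z Hz. destruct (Cser_exists (fun n => f n z) A sg Hs HA (B z Hz)) as [L HL]. apply Clim_ser_spec in HL.
 le_via (Cser_tail _ A sg _ Hs HA (B z Hz) HL). specialize (HN n Hn). note (Rpower_pos (INR (S n)) (1 - sg)).
 le_mid ((A * Ksig sg + 1) * (eps / (A * Ksig sg + 1))). apply Rmult_le_compat; lra. right; field; lra.
Qed.

Lemma hol_Csum U (f : nat -> C -> C) N : (forall n, hol U (f n)) -> hol U (fun z => Csum (fun n => f n z) N).
Proof. intros H. induction N; simpl. apply hol_const. apply hol_plus; auto. Qed.

(** * Taylor's inequality *)

(** The Taylor polynomial evaluated at [b] is differentiated in its base point; the derivatives of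
    consecutive terms cancel, and only the last one survives. *)
Lemma RD_taylor (u : nat -> R -> C) b K x : (forall i, RD (u i) x (u (S i) x)) ->
 RD (fun t => Csum (fun i => u i t * RtoC ((b - t) ^ i / INR (fact i)))%C (S K)) x (u (S K) x * RtoC ((b - x) ^ K / INR (fact K)))%C.
Proof. intros H. induction K.
 - simpl. eapply RD_eq. apply (RD_plus (fun _ => RtoC 0)). apply RD_const. apply (RD_mult (u 0%nat) (fun _ => RtoC (1 / 1))). apply H. apply RD_const. ring.
 - note (INR_fact_neq_0 K) as NK. note (INR_fact_neq_0 (S K)) as NSK.
  change (RD (fun t => Csum (fun i => u i t * RtoC ((b - t) ^ i / INR (fact i))) (S K) + u (S K) t * RtoC ((b - t) ^ (S K) / INR (fact (S K))))%C x
  (u (S (S K)) x * RtoC ((b - x) ^ S K / INR (fact (S K))))%C).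
  eapply RD_eq. apply RD_plus. apply IHK. apply (RD_mult (u (S K)) (fun t => RtoC ((b - t) ^ (S K) / INR (fact (S K))))). apply H.
  apply RD_RtoC with (l := - ((b - x) ^ K / INR (fact K))).
  + assert (E : INR (fact (S K)) = (INR K + 1) * INR (fact K)) by (rewrite fact_simpl, mult_INR, S_INR; auto).
  note (pos_INR K). apply (is_derive_ext (fun t => / INR (fact (S K)) * (b - t) ^ S K)). intros t. unfold Rdiv. apply Rmult_comm.
  evar_last. apply (is_derive_scal (fun t => (b - t) ^ S K)). apply (is_derive_pow (fun t => b - t)) with (l := -1). auto_derive; auto; ring.
  rewrite E. rewrite S_INR. simpl pred. field. split; auto. lra.
  + rewrite RtoC_opp. ring.
Qed.

Lemma Taylor_ineq (u : nat -> R -> C) a K M : (forall i x, a <= x <= a + 1 -> RD (u i) x (u (S i) x)) ->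
 (forall x, a <= x <= a + 1 -> Cmod (u (S K) x) <= M) ->
 Cmod (u 0%nat (a + 1)%R - Csum (fun i => u i a * RtoC (/ INR (fact i)))%C (S K)) <= M.
Proof. intros H HM.
 note (RD_mean_ineq _ _ a (a + 1) M ltac:(lra) (fun x Hx => RD_taylor u (a + 1) K x (fun i => H i x Hx))) as T.
 assert (E1 : Csum (fun i => u i (a + 1)%R * RtoC ((a + 1 - (a + 1)) ^ i / INR (fact i)))%C (S K) = u 0%nat (a + 1)).
 { rewrite Csum_S_l. rewrite (Csum_ext _ (fun _ => RtoC 0)). replace (Csum (fun _ => RtoC 0) K) with (RtoC 0).
  simpl. replace (1 / 1) with 1 by field. ring. clear. induction K; simpl; auto. rewrite <- IHK; ring.
  intros k _. rewrite Rminus_diag. rewrite pow_ne_zero by lia. unfold Rdiv. rewrite Rmult_0_l. ring. }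
 assert (E2 : Csum (fun i => u i a * RtoC ((a + 1 - a) ^ i / INR (fact i)))%C (S K) = Csum (fun i => u i a * RtoC (/ INR (fact i)))%C (S K)).
 { apply Csum_ext. intros k _. replace (a + 1 - a) with 1 by ring. rewrite pow1. unfold Rdiv. rewrite Rmult_1_l. auto. }
 cbv beta in T. rewrite E1, E2 in T. replace (M * (a + 1 - a)) with M in T by ring. apply T.
 intros x Hx. rewrite Cmod_mult, Cmod_R. note (INR_fact_lt_0 K).
 assert (0 <= (a + 1 - x) ^ K / INR (fact K) <= 1).
 { assert (0 <= (a + 1 - x) ^ K <= 1). { split. apply pow_le; lra. le_mid (1 ^ K); [apply pow_incr; lra|rewrite pow1; lra]. }
  assert (1 <= INR (fact K)). { apply (le_INR 1). apply lt_O_fact. }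
  split. pos. apply Rmult_le_reg_r with (INR (fact K)); auto. unfold Rdiv. rewrite Rmult_assoc, Rinv_l; lra. }
 rewrite Rabs_pos_eq by lra. specialize (HM x Hx). note (Cmod_ge_0 (u (S K) x)). nra.
Qed.

(** * Identity theorem on half-planes *)

Definition Hp (c : R) (s : C) : Prop := c < Re s.
Definition UH (s : C) : Prop := 0 < Im s.

Lemma opn_Hp c : opn (Hp c).
Proof. intros z Hz. exists (Re z - c). unfold Hp in *. split. lra. intros w Hw. destruct (Cmod_RI w z) as [K _].
 assert (A := Rle_lt_trans _ _ _ K Hw). apply Rabs_def2 in A. lra.
Qed.
Lemma opn_UH : opn UH.
Proof. intros z Hz. exists (Im z). unfold UH in *. split. lra. intros w Hw. destruct (Cmod_RI w z) as [_ K].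
 assert (A := Rle_lt_trans _ _ _ K Hw). apply Rabs_def2 in A. lra.
Qed.

Lemma Cmod_lt_iff z r : 0 <= r -> (Re z) ^ 2 + (Im z) ^ 2 < r ^ 2 -> Cmod z < r.
Proof. intros Hr H. rewrite <- Cmod2_alt in H. apply Rsqr_incrst_0; auto using Cmod_ge_0. unfold Rsqr. simpl in H. lra. Qed.

(** One disc suffices: a centre [P] far to the right lies where [f] vanishes, and the disc of radius
    [P - c - eta] about it reaches the given [w] while its square stays in the half-plane. *)
Lemma identity_Hp f c c' : hol (Hp c) f -> (forall s, c' < Re s -> f s = 0) -> forall s, c < Re s -> f s = 0.
Proof. intros Hf H0 w Hw. set (eta := (Re w - c) / 2). assert (He : 0 < eta) by (unfold eta; lra).
 set (P := Rabs (Re w) + Rabs c' + Rabs c + 1 + eta + (Im w) ^ 2 / eta).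
 assert (PP : 0 <= (Im w) ^ 2 / eta). { apply Rdiv_le_0_compat; auto. apply pow2_ge_0. }
 assert (Q : forall u, u <= Rabs u) by (intros; apply Rle_abs).
 note (Q (Re w)). note (Q c'). note (Q c). note (Rabs_pos (Re w)). note (Rabs_pos c'). note (Rabs_pos c).
 assert (P1 : Re w + eta + (Im w) ^ 2 / eta < P) by (unfold P; lra).
 assert (P2 : c' + 1 <= P) by (unfold P; lra). assert (P3 : c + eta < P) by (unfold P; lra).
 apply (identity_square f (RtoC P) (P - c - eta)). lra.
 - intros z Hz. apply Hf. unfold sqR, inR, Hp in *. simpl in Hz. lra.
 - exists 1. split. lra. intros z Hz. apply H0. destruct (Cmod_RI z (RtoC P)) as [K _]. simpl in K. assert (A := Rle_lt_trans _ _ _ K Hz). apply Rabs_def2 in A. lra.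
 - apply Cmod_lt_iff. lra. unfold Cminus. rewrite re_plus, im_plus, re_opp, im_opp. simpl Re; simpl Im.
  replace (P - c - eta) with (P - Re w + eta) by (unfold eta; field).
  assert ((Im w) ^ 2 < eta * (P - Re w)). { replace ((Im w) ^ 2) with (eta * ((Im w) ^ 2 / eta)) by (field; lra). apply Rmult_lt_compat_l; lra. }
  nra.
Qed.

Lemma identity_UH f c' : hol UH f -> (forall s, UH s -> c' < Re s -> f s = 0) -> forall s, UH s -> f s = 0.
Proof. intros Hf H0 w Hw. unfold UH in Hw. set (eta := Im w / 2). assert (He : 0 < eta) by (unfold eta; lra).
 (* With this [Y] the disc of radius [Y - eta] about [(c' + 1, Y)] contains [w]: the condition is
    [(c' + 1 - Re w)^2 + 3 eta^2 < 2 eta Y]. *)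
 set (Y := ((c' + 1 - Re w) ^ 2 + 4 * eta ^ 2) / (2 * eta)).
 assert (EY : 2 * eta * Y = (c' + 1 - Re w) ^ 2 + 4 * eta ^ 2) by (unfold Y; field; lra).
 assert (HY : 2 * eta <= Y). { note (pow2_ge_0 (c' + 1 - Re w)). apply Rmult_le_reg_l with (2 * eta); nra. }
 apply (identity_square f (c' + 1, Y) (Y - eta)). lra.
 - intros z Hz. apply Hf. unfold sqR, inR, UH in *. simpl in Hz. lra.
 - exists (Rmin 1 eta). split. apply Rmin_pos; lra. intros z Hz. min_le 1 eta.
  destruct (Cmod_RI z (c' + 1, Y)) as [K1 K2]. simpl in K1, K2.
  assert (A := Rle_lt_trans _ _ _ K1 Hz). assert (B := Rle_lt_trans _ _ _ K2 Hz). apply Rabs_def2 in A. apply Rabs_def2 in B. apply H0; unfold UH; lra.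
 - apply Cmod_lt_iff. lra. unfold Cminus. rewrite re_plus, im_plus, re_opp, im_opp. simpl Re; simpl Im.
  replace (Im w) with (2 * eta) by (unfold eta; field). nra.
Qed.

(** * Analytic continuation of the zeta function *)

Definition zD (s : C) : C := Clim_ser (fun n => rcpow (INR (S n)) (- s)).

Lemma INR_S_ge1 n : 1 <= INR (S n).
Proof. rewrite S_INR. note (pos_INR n). lra. Qed.

Lemma Rpower_mono_exp x a b : 1 <= x -> a <= b -> Rpower x a <= Rpower x b.
Proof. intros Hx Hab. unfold Rpower. apply exp_le. assert (0 <= ln x). { rewrite <- ln_1. destruct (Req_dec 1 x) as [<-|]. lra. left; apply ln_increasing; lra. } nra. Qed.

Lemma zD_term_bound s sg n : sg <= Re s -> Cmod (rcpow (INR (S n)) (- s)) <= 1 * Rpower (INR (S n)) (- sg).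
Proof. intros H. rewrite Cmod_rcpow, re_opp, Rmult_1_l. apply Rpower_mono_exp. apply INR_S_ge1. lra. Qed.

Lemma zD_Cser s : 1 < Re s -> Cser (fun n => rcpow (INR (S n)) (- s)) (zD s).
Proof. intros H. destruct (Cser_exists (fun n => rcpow (INR (S n)) (- s)) 1 (Re s) H ltac:(lra)) as [L HL].
 intros n. apply zD_term_bound; lra. eapply Clim_ser_spec; eauto.
Qed.

Lemma hol_rcpow U a (g : C -> C) : hol U g -> hol U (fun s => rcpow a (g s)).
Proof. intros Hg. apply (hol_comp U (fun _ => True) (fun s => rcpow a s)); auto. intros s _. eexists. apply Cdiff_rcpow. Qed.

Lemma hol_opp U f : hol U f -> hol U (fun z => - f z)%C.
Proof. intros Hf z Hz. destruct (Hf z Hz). eexists. apply Cdiff_opp; eauto. Qed.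

Lemma zD_locunif : locunif (Hp 1) (fun N s => Csum (fun n => rcpow (INR (S n)) (- s)) N) zD.
Proof. apply (Weierstrass_ser (Hp 1) (fun n s => rcpow (INR (S n)) (- s))). intros p Hp1. unfold Hp in Hp1.
 exists ((Re p - 1) / 2), 1, ((Re p + 1) / 2). repeat split; try lra. intros z Hz n. apply zD_term_bound.
 destruct (Cmod_RI z p) as [K _]. assert (A := Rle_lt_trans _ _ _ K Hz). apply Rabs_def2 in A. lra.
Qed.

Lemma hol_zD : hol (Hp 1) zD.
Proof. apply (locunif_hol (Hp 1) _ _ (opn_Hp 1)) with (2 := zD_locunif). intros N. apply (hol_Csum _ (fun n s => rcpow (INR (S n)) (- s))).
 intros n. apply hol_rcpow. apply hol_opp, hol_id.
Qed.

(** [pf s i] is the coefficient of the [i]-th derivative of [x^(1 - s)], and [tu s i] below is that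
    derivative; [trem] is its Taylor remainder from [n + 1] to [n + 2]. *)
Fixpoint pf (s : C) (i : nat) : C := match i with O => RtoC 1 | S j => (pf s j * (1 - s - RtoC (INR j)))%C end.

Lemma hol_pf U i : hol U (fun s => pf s i).
Proof. induction i; simpl. apply hol_const. apply hol_mult; auto. apply (hol_minus U (fun s => 1 - s)%C). apply (hol_minus U (fun _ => RtoC 1)). apply hol_const. apply hol_id. apply hol_const. Qed.

Lemma pf_bound s i : Cmod (pf s i) <= (INR (S i) * (1 + Cmod s)) ^ i.
Proof. induction i. simpl. rewrite Cmod_1; lra. simpl pf. rewrite Cmod_mult. note (Cmod_ge_0 s). note (pos_INR i).
 le_mid ((INR (S i) * (1 + Cmod s)) ^ i * (INR (S (S i)) * (1 + Cmod s))).
 - mul_le. unfold Cminus at 1. le_via Cmod_triangle. rewrite Cmod_opp, Cmod_R, (Rabs_pos_eq (INR i)) by lra.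
  note (Cmod_triangle_minus 1 s). rewrite Cmod_1 in H1. rewrite !S_INR. nra.
 - rewrite <- tech_pow_Rmult, Rmult_comm. mul_le_l. rewrite !S_INR. nra.
  apply pow_incr. rewrite !S_INR. split; nra.
Qed.

Definition tu (s : C) (i : nat) (x : R) : C := (pf s i * rcpow x (1 - s - RtoC (INR i)))%C.

Lemma RD_tu s i x : 0 < x -> RD (tu s i) x (tu s (S i) x).
Proof. intros Hx. unfold tu. eapply RD_eq. apply RD_scal. apply RD_rcpow; auto. rewrite S_INR, RtoC_plus. simpl pf.
 replace (1 - s - (INR i + 1))%C with (1 - s - INR i - 1)%C by ring. ring.
Qed.

Definition trem (K n : nat) (s : C) : C := (tu s 0 (INR (S n) + 1) - Csum (fun i => tu s i (INR (S n)) * RtoC (/ INR (fact i)))%C (S K))%C.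

Lemma trem_bound K n s : 3 / 2 <= Re s + INR K -> Cmod (trem K n s) <= Cmod (pf s (S K)) * Rpower (INR (S n)) (- (3 / 2)).
Proof. intros H. note (INR_S_ge1 n). unfold trem. apply Taylor_ineq.
 - intros i x Hx. apply RD_tu. lra.
 - intros x Hx. unfold tu. rewrite Cmod_mult. mul_le_l. apply Cmod_ge_0. rewrite Cmod_rcpow.
  unfold Cminus. rewrite !re_plus, !re_opp, !re_RtoC, S_INR.
  le_mid (Rpower x (- (3 / 2))). apply Rpower_mono_exp; lra. apply Rpower_antimono; lra.
Qed.

Definition trsum (K : nat) (s : C) : C := Clim_ser (fun n => trem K n s).

Lemma trsum_Cser K s : 3 / 2 <= Re s + INR K -> Cser (fun n => trem K n s) (trsum K s).
Proof. intros H. destruct (Cser_exists (fun n => trem K n s) (Cmod (pf s (S K))) (3 / 2)) as [L HL]. lra. apply Cmod_ge_0.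
 intros n. apply trem_bound; auto. eapply Clim_ser_spec; eauto.
Qed.

Lemma hol_trsum K : hol (Hp (3 / 2 - INR K)) (trsum K).
Proof. eapply (locunif_hol (Hp (3 / 2 - INR K)) (fun N s => Csum (fun n => trem K n s) N)). apply opn_Hp.
 - intros N. apply (hol_Csum _ (fun n s => trem K n s)). intros n. unfold trem.
  apply (hol_minus _ (fun s => tu s 0 (INR (S n) + 1))).
  + unfold tu. apply hol_mult. apply hol_pf. apply hol_rcpow. apply (hol_minus _ (fun s => 1 - s)%C). apply (hol_minus _ (fun _ => RtoC 1)). apply hol_const. apply hol_id. apply hol_const.
  + apply (hol_Csum _ (fun i s => tu s i (INR (S n)) * RtoC (/ INR (fact i)))%C). intros i. apply (hol_mult _ (fun s => tu s i (INR (S n)))); [|apply hol_const].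
  unfold tu. apply hol_mult. apply hol_pf. apply hol_rcpow. apply (hol_minus _ (fun s => 1 - s)%C). apply (hol_minus _ (fun _ => RtoC 1)). apply hol_const. apply hol_id. apply hol_const.
 - apply (Weierstrass_ser _ (fun n s => trem K n s)). intros p Hp0. unfold Hp in Hp0.
  exists (Rmin 1 (Re p - (3 / 2 - INR K))), ((INR (S (S K)) * (2 + Cmod p)) ^ (S K)), (3 / 2). note (Cmod_ge_0 p) as Pp. note (pos_INR (S (S K))) as PK.
  split. apply Rmin_pos; lra. split. apply pow_le. nra. split. lra.
  intros z Hz n. note (Rmin_l 1 (Re p - (3 / 2 - INR K))). note (Rmin_r 1 (Re p - (3 / 2 - INR K))).
  destruct (Cmod_RI z p) as [Kz _]. assert (A : Rabs (Re z - Re p) < Re p - (3 / 2 - INR K)) by lra. apply Rabs_def2 in A.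
  le_via trem_bound. lra. mul_le_r. pos. le_via pf_bound.
  apply pow_incr. note (Cmod_ge_0 z). split. nra. mul_le_l. lra. note (Cmod_triangle_rev z p). lra.
Qed.

Lemma trsum_bound K s : 3 / 2 <= Re s + INR K -> Cmod (trsum K s) <= (INR (S (S K)) * (1 + Cmod s)) ^ (S K) * Ksig (3 / 2).
Proof. intros H. le_via (Cser_bound (fun n => trem K n s) (Cmod (pf s (S K))) (3 / 2)). lra. apply Cmod_ge_0. intros n; apply trem_bound; auto. apply trsum_Cser; auto.
 mul_le_r. left; apply Ksig_pos; lra. apply pf_bound.
Qed.

Definition polyb (U : C -> Prop) (f : C -> C) : Prop := exists A m, 0 <= A /\ forall s, U s -> Cmod (f s) <= A * (1 + Cmod s) ^ m.

Lemma polyb_mult U f g : polyb U f -> polyb U g -> polyb U (fun s => f s * g s)%C.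
Proof. intros (A & m & PA & H) (B & n & PB & H'). exists (A * B), (m + n)%nat. split. nra. intros s Hs. rewrite Cmod_mult, pow_add.
 replace (A * B * ((1 + Cmod s) ^ m * (1 + Cmod s) ^ n)) with (A * (1 + Cmod s) ^ m * (B * (1 + Cmod s) ^ n)) by ring. mul_le.
Qed.
Lemma polyb_plus U f g : polyb U f -> polyb U g -> polyb U (fun s => f s + g s)%C.
Proof. intros (A & m & PA & H) (B & n & PB & H'). exists (A + B), (m + n)%nat. split. lra. intros s Hs. le_via Cmod_triangle.
 specialize (H s Hs). specialize (H' s Hs). note (Cmod_ge_0 s).
 assert ((1 + Cmod s) ^ m <= (1 + Cmod s) ^ (m + n)) by (apply Rle_pow; [lra|lia]). assert ((1 + Cmod s) ^ n <= (1 + Cmod s) ^ (m + n)) by (apply Rle_pow; [lra|lia]). nra.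
Qed.
Lemma polyb_const U c : polyb U (fun _ => c).
Proof. exists (Cmod c), 0%nat. split. apply Cmod_ge_0. intros; simpl; lra. Qed.
Lemma polyb_id U : polyb U (fun s => s).
Proof. exists 1, 1%nat. split. lra. intros s _. simpl. lra. Qed.
Lemma polyb_opp U f : polyb U f -> polyb U (fun s => - f s)%C.
Proof. intros (A & m & PA & H). exists A, m. split; auto. intros; rewrite Cmod_opp; auto. Qed.
Lemma polyb_pf U i : polyb U (fun s => pf s i).
Proof. exists (INR (S i) ^ i), i. split. apply pow_le, pos_INR. intros s _. rewrite <- Rpow_mult_distr. apply pf_bound.
Qed.
Lemma polyb_Csum U (f : nat -> C -> C) N : (forall n, (n < N)%nat -> polyb U (f n)) -> polyb U (fun z => Csum (fun n => f n z) N).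
Proof. intros H. induction N; simpl. apply polyb_const. apply polyb_plus; auto. Qed.
Lemma polyb_shift U V f (a : R) : polyb V f -> 0 <= a -> (forall s, U s -> V (s + RtoC a)%C) -> polyb U (fun s => f (s + RtoC a)%C).
Proof. intros (A & m & PA & H) Ha HV. exists (A * (1 + a) ^ m), m. split. apply Rmult_le_pos; auto. apply pow_le; lra.
 intros s Hs. eapply Rle_trans. apply H; auto. rewrite Rmult_assoc, <- Rpow_mult_distr. mul_le_l; auto. apply pow_incr.
 note (Cmod_ge_0 (s + RtoC a)). note (Cmod_triangle s (RtoC a)). rewrite Cmod_RtoC_pos in H1 by auto. note (Cmod_ge_0 s). split; nra.
Qed.

(** [W] continues [(s - 1) zeta(s)], which has no pole; the polynomial growth carried along is what
    the Landau bounds are later fed with. *)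
Definition goodW (k : nat) (W : C -> C) : Prop :=
 hol (Hp (3 / 2 - INR k)) W /\ polyb (Hp (3 / 2 - INR k)) W /\ forall s, 3 / 2 < Re s -> W s = ((s - 1) * zD s)%C.

Lemma goodW0 : goodW 0 (fun s => (s - 1) * zD s)%C.
Proof. simpl. split; [|split].
 - apply hol_mult. intros z _. eexists. apply Cdiff_sub_const. apply (hol_sub (Hp 1)). unfold Hp; simpl; intros; lra. apply hol_zD.
 - apply polyb_mult. apply polyb_plus. apply polyb_id. apply polyb_const. exists (1 * Ksig (3 / 2)), 0%nat. split. note (Ksig_pos (3 / 2)); lra.
  intros s Hs. unfold Hp in Hs. simpl in Hs. simpl. rewrite Rmult_1_r. apply (Cser_bound (fun n => rcpow (INR (S n)) (- s))). lra. lra. intros n. apply zD_term_bound; lra. apply zD_Cser; lra.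
 - auto.
Qed.

(** Expand [(n + 2)^(1 - s) - (n + 1)^(1 - s)] by Taylor and sum over [n]. The left side telescopes
    to [-1]; the first term on the right is [(1 - s) zeta(s)], and the others are multiples of
    [zeta(s + j)] with [j >= 1], already continued. Their coefficients contain the factor that
    cancels the pole, so they are expressed through [W (s + j)]. *)
Lemma goodW_step k W : goodW k W -> exists W', goodW (S k) W'.
Proof. intros (H1 & H2 & H3).
 exists (fun s => 1 - Csum (fun j => pf s (S j) * RtoC (/ INR (fact (S (S j)))) * W (s + RtoC (INR (S j))))%C (S k) + trsum (S (S k)) s)%C.
 assert (Sh : forall j s, Hp (3 / 2 - INR (S k)) s -> Hp (3 / 2 - INR k) (s + RtoC (INR (S j)))%C).
 { intros j s. unfold Hp. rewrite re_plus, re_RtoC, !S_INR. note (pos_INR j). lra. }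
 split; [|split].
 - apply hol_plus. apply (hol_minus _ (fun _ => RtoC 1)). apply hol_const.
  + apply (hol_Csum _ (fun j s => pf s (S j) * RtoC (/ INR (fact (S (S j)))) * W (s + RtoC (INR (S j))))%C). intros j.
  apply (hol_mult _ (fun s => pf s (S j) * RtoC (/ INR (fact (S (S j)))))%C). apply hol_mult. apply hol_pf. apply hol_const.
  apply (hol_comp _ (Hp (3 / 2 - INR k)) W (fun s => s + RtoC (INR (S j)))%C); auto. apply hol_plus. apply hol_id. apply hol_const.
  + apply (hol_sub (Hp (3 / 2 - INR (S (S k))))); [|apply hol_trsum]. intros z. unfold Hp. rewrite !S_INR. lra.
 - apply polyb_plus. apply (polyb_plus _ (fun _ => RtoC 1)). apply polyb_const. apply polyb_opp.
  + apply (polyb_Csum _ (fun j s => pf s (S j) * RtoC (/ INR (fact (S (S j)))) * W (s + RtoC (INR (S j))))%C). intros j _.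
  apply (polyb_mult _ (fun s => pf s (S j) * RtoC (/ INR (fact (S (S j)))))%C). apply polyb_mult. apply polyb_pf. apply polyb_const.
  apply (polyb_shift _ (Hp (3 / 2 - INR k))); auto. apply pos_INR.
  + exists (INR (S (S (S (S k)))) ^ (S (S (S k))) * Ksig (3 / 2)), (S (S (S k))). split. apply Rmult_le_pos. apply pow_le, pos_INR. left; apply Ksig_pos; lra.
  intros s Hs. unfold Hp in Hs. le_via trsum_bound. rewrite !S_INR in *. lra.
  rewrite Rpow_mult_distr. right; ring.
 - intros s Hs. set (K := S (S k)).
  assert (HK : 3 / 2 <= Re s + INR K) by (note (pos_INR K); lra).
  note (trsum_Cser K s HK) as T.
  assert (A : forall j, Cser (fun n => pf s (S j) * RtoC (/ INR (fact (S j))) * rcpow (INR (S n)) (- (s + RtoC (INR j))))%C (pf s (S j) * RtoC (/ INR (fact (S j))) * zD (s + RtoC (INR j)))%C).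
  { intros j. apply Cser_scal. apply zD_Cser. rewrite re_plus, re_RtoC. note (pos_INR j). lra. }
  note (Cser_plus _ _ _ _ (Cser_Csum _ _ K (fun j _ => A j)) T) as S1.
  assert (S2 : Cser (fun n => (rcpow (INR (S (S n))) (1 - s) - rcpow (INR (S n)) (1 - s))%C) (-(1))%C).
  { intros eps He. destruct (Rpower_small (Re s) eps) as [N HN]; try lra. exists N. intros n Hn.
  rewrite (Csum_telescope (fun n => rcpow (INR (S n)) (1 - s))). simpl (INR 1). rewrite rcpow_base1.
  replace (rcpow (INR (S n)) (1 - s) - 1 - - (1))%C with (rcpow (INR (S n)) (1 - s)) by ring. rewrite Cmod_rcpow. unfold Cminus. rewrite re_plus, re_opp, re_RtoC. apply HN; auto. }
  assert (E : (Csum (fun j => pf s (S j) * RtoC (/ INR (fact (S j))) * zD (s + RtoC (INR j)))%C K + trsum K s)%C = (-(1))%C).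
  { eapply Cser_unique. exact S1. eapply Cser_ext; [|exact S2]. intros n. cbv beta. unfold trem.
  rewrite (Csum_S_l (fun i => tu s i (INR (S n)) * RtoC (/ INR (fact i)))%C).
  rewrite (Csum_ext (fun k0 => tu s (S k0) (INR (S n)) * RtoC (/ INR (fact (S k0))))%C (fun j => pf s (S j) * RtoC (/ INR (fact (S j))) * rcpow (INR (S n)) (- (s + RtoC (INR j))))%C).
  - unfold tu at 1 2. simpl pf. rewrite <- S_INR. simpl (INR 0). replace (1 - s - 0)%C with (1 - s)%C by ring. change (fact 0) with 1%nat. simpl (INR 1). rewrite Rinv_1. ring.
  - intros j _. unfold tu. replace (1 - s - RtoC (INR (S j)))%C with (- (s + RtoC (INR j)))%C by (rewrite S_INR, RtoC_plus; ring). ring. }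
  unfold K in E at 1. rewrite (Csum_S_l (fun j => pf s (S j) * RtoC (/ INR (fact (S j))) * zD (s + RtoC (INR j)))%C) in E.
  assert (E2 : Csum (fun k0 => pf s (S (S k0)) * RtoC (/ INR (fact (S (S k0)))) * zD (s + RtoC (INR (S k0))))%C (S k) =
  (- Csum (fun j => pf s (S j) * RtoC (/ INR (fact (S (S j)))) * W (s + RtoC (INR (S j))))%C (S k))%C).
  { replace (- Csum (fun j => pf s (S j) * RtoC (/ INR (fact (S (S j)))) * W (s + RtoC (INR (S j))))%C (S k))%C with (-(1) * Csum (fun j => pf s (S j) * RtoC (/ INR (fact (S (S j)))) * W (s + RtoC (INR (S j))))%C (S k))%C by ring.
  rewrite <- Csum_scal. apply Csum_ext. intros j _. rewrite H3. 2:{ rewrite re_plus, re_RtoC. note (pos_INR (S j)). lra. }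
  change (pf s (S (S j))) with (pf s (S j) * (1 - s - RtoC (INR (S j))))%C. ring. }
  rewrite E2 in E. change (fact 1) with 1%nat in E. simpl (INR 1) in E. rewrite Rinv_1 in E. simpl (INR 0) in E. simpl (pf s 1) in E.
  replace (s + 0)%C with s in E by ring. fold K.
  replace ((s - 1) * zD s)%C with (- (1 * (1 - s - 0) * 1 * zD s))%C by ring.
  apply Ceq_minus. match type of E with ?l = _ => match goal with |- ?g = _ => replace g with (l + 1)%C by ring end end. rewrite E. ring.
Qed.

Lemma goodW_exists k : exists W, goodW k W.
Proof. induction k. exists (fun s => (s - 1) * zD s)%C. apply goodW0. destruct IHk as [W H]. eapply goodW_step; eauto. Qed.

(** * Comparison with the notions of the definitions, and the function [zeta] *)

Lemma Cdiff_is_derive f z l : Cdiff f z l <-> is_derive (K := C_AbsRing) (V := C_NormedModule) f z l.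
Proof. split.
 - intros H. split. apply is_linear_scal_l. intros x Hx.
  apply (is_filter_lim_locally_unique (V := AbsRing_NormedModule C_AbsRing)) in Hx. subst x. intros eps.
  destruct (H eps (cond_pos eps)) as (d & D & K). exists (mkposreal d D). intros w Hw. specialize (K w I Hw).
  change (Cmod ((f w + - f z) + - ((w + - z) * l)) <= eps * Cmod (w + - z)).
  replace ((f w + - f z) + - ((w + - z) * l))%C with (f w - f z - l * (w - z))%C by ring. exact K.
 - intros [_ H] eps He. specialize (H z (fun P Q => Q) (mkposreal eps He)). destruct H as [d Hd]. exists d. split. apply cond_pos.
  intros w _ Hw. specialize (Hd w Hw). change (Cmod ((f w + - f z) + - ((w + - z) * l)) <= eps * Cmod (w + - z)) in Hd.
  replace (f w - f z - l * (w - z))%C with ((f w + - f z) + - ((w + - z) * l))%C by ring. exact Hd.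
Qed.

Lemma locally_C_Cmod (z : C) (P : C -> Prop) : locally (T := C_UniformSpace) z P <-> exists d, 0 < d /\ forall w, Cmod (w - z) < d -> P w.
Proof. split.
 - intros [d H]. exists d. split. apply cond_pos. intros w Hw. apply H. apply C_NormedModule_mixin_compat1. exact Hw.
 - intros (d & D & H). assert (D2 : 0 < d / 2) by lra. exists (mkposreal _ D2). intros w [K1 K2]. apply H.
  simpl in K1, K2. unfold ball in K1, K2; simpl in K1, K2. unfold AbsRing_ball, abs, minus, plus, opp in K1, K2; simpl in K1, K2.
  eapply Rle_lt_trans. apply Cmod_le_Re_Im. simpl. unfold Re, Im in *. lra.
Qed.

Lemma holomorphic_at_Cdiff f z : holomorphic_at f z <-> exists d, 0 < d /\ forall w, Cmod (w - z) < d -> exists l, Cdiff f w l.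
Proof. unfold holomorphic_at. rewrite locally_C_Cmod. split; intros (d & D & H); exists d; split; auto; intros w Hw;
 destruct (H w Hw) as [l Hl]; exists l; apply Cdiff_is_derive; auto.
Qed.

Lemma sum_n_Csum (a : nat -> C) n : sum_n (G := C_AbelianMonoid) a n = Csum a (S n).
Proof. induction n. rewrite sum_O. simpl. ring. rewrite sum_Sn, IHn. reflexivity.
Qed.

Lemma Cser_is_series a l : Cser a l <-> is_series (K := C_AbsRing) (V := C_NormedModule) a l.
Proof. split.
 - intros H P HP. apply locally_C_Cmod in HP. destruct HP as (d & D & K). destruct (H (d / 2)) as [N HN]. lra.
  exists N. intros n Hn. apply K. change (Cmod (sum_n (G := C_AbelianMonoid) a n - l) < d). rewrite (sum_n_Csum a n). specialize (HN (S n) ltac:(lia)). lra.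
 - intros H eps He. specialize (H (fun w => Cmod (w - l) < eps)).
  destruct H as [N HN]. { apply locally_C_Cmod. exists eps; auto. }
  exists (S N). intros n Hn. destruct n as [|n]. lia. specialize (HN n ltac:(lia)). change (Cmod (sum_n (G := C_AbelianMonoid) a n - l) < eps) in HN. rewrite (sum_n_Csum a n) in HN. lra.
Qed.

Definition Wk (k : nat) : C -> C := epsilon (inhabits (fun _ => RtoC 0)) (goodW k).

Lemma Wk_good k : goodW k (Wk k).
Proof. apply (epsilon_spec (inhabits (fun _ => RtoC 0)) (goodW k)). apply goodW_exists. Qed.

Lemma Wk_consistent k k' s : 3 / 2 - INR k < Re s -> 3 / 2 - INR k' < Re s -> Wk k s = Wk k' s.
Proof. intros H H'. destruct (Wk_good k) as (A1 & _ & A3). destruct (Wk_good k') as (B1 & _ & B3). apply Ceq_minus.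
 set (c := Rmax (3 / 2 - INR k) (3 / 2 - INR k')).
 apply (identity_Hp (fun s => Wk k s - Wk k' s)%C c (3 / 2)).
 - apply hol_minus; [apply (hol_sub (Hp (3 / 2 - INR k))); auto|apply (hol_sub (Hp (3 / 2 - INR k'))); auto]; intros z; unfold Hp, c; intros Hz;
  note (Rmax_l (3 / 2 - INR k) (3 / 2 - INR k')); note (Rmax_r (3 / 2 - INR k) (3 / 2 - INR k')); lra.
 - intros z Hz. rewrite A3, B3 by auto. ring.
 - apply Rmax_lub_lt; auto.
Qed.

(** Any index reaching beyond [s] gives the same value, by [Wk_consistent]; this one is explicit. *)
Definition kz (s : C) : nat := Z.to_nat (up (2 - Re s)).

Lemma kz_spec s : 3 / 2 - INR (kz s) < Re s.
Proof. unfold kz. destruct (archimed (2 - Re s)) as [H _].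
 destruct (Z_le_gt_dec 0 (up (2 - Re s))) as [P|P].
 - rewrite INR_IZR_INZ, Z2Nat.id by auto. lra.
 - replace (Z.to_nat (up (2 - Re s))) with 0%nat by (destruct (up (2 - Re s)); simpl in *; lia || reflexivity).
  simpl. apply Z.gt_lt, IZR_lt in P. lra.
Qed.

Definition ZZ (s : C) : C := (Wk (kz s) s / (s - 1))%C.

Lemma ZZ_eq k s : 3 / 2 - INR k < Re s -> ZZ s = (Wk k s / (s - 1))%C.
Proof. intros H. unfold ZZ. rewrite (Wk_consistent (kz s) k s); auto. apply kz_spec. Qed.

Lemma opn_neq1 : opn (fun s => s <> RtoC 1).
Proof. intros z Hz. exists (Cmod (z - 1)). split. apply Cmod_gt_0, Cminus_neq0; auto. intros w Hw ->. rewrite Cmod_minus_sym in Hw. lra.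
Qed.

Lemma ZZ_hol : hol (fun s => s <> RtoC 1) ZZ.
Proof. intros s Hs. destruct (Wk_good (kz s)) as (A & _). destruct (A s (kz_spec s)) as [l Hl].
 eexists. apply Cdiff_ext_loc with (fun s' => Wk (kz s) s' / (s' - 1))%C.
 - destruct (opn_Hp (3 / 2 - INR (kz s)) s (kz_spec s)) as (d & D & K). exists d. split; auto. intros w Hw. symmetry. apply ZZ_eq. apply K; auto.
 - apply Cdiff_div. apply Cminus_neq0; auto. exact Hl. apply Cdiff_sub_const.
Qed.

Lemma ZZ_zD s : 1 < Re s -> ZZ s = zD s.
Proof. intros H. rewrite (ZZ_eq 1) by (simpl; lra). destruct (Wk_good 1) as (A & _ & A3).
 assert (E : (Wk 1 s - (s - 1) * zD s)%C = 0).
 { apply (identity_Hp (fun s => Wk 1 s - (s - 1) * zD s)%C 1 (3 / 2)); auto.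
  - apply hol_minus. apply (hol_sub (Hp (3 / 2 - INR 1))); auto. unfold Hp; simpl; intros; lra.
  apply hol_mult. intros z _. eexists. apply Cdiff_sub_const. apply hol_zD.
  - intros z Hz. rewrite A3 by auto. ring. }
 apply Ceq_minus in E. rewrite E. field. apply Cminus_neq0. intros ->. simpl in H. lra.
Qed.

Lemma zeta_spec : continues_Dirichlet_series zeta.
Proof. apply (epsilon_spec (inhabits (fun _ => RtoC 0)) continues_Dirichlet_series). exists ZZ. split.
 - intros s Hs. apply Cser_is_series. rewrite ZZ_zD by auto. apply zD_Cser; auto.
 - intros s Hs. apply holomorphic_at_Cdiff. destruct (opn_neq1 s Hs) as (d & D & K). exists d; split; auto. intros w Hw. apply ZZ_hol; auto.
Qed.

Lemma zeta_hol : hol (fun s => s <> RtoC 1) zeta.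
Proof. intros s Hs. apply (proj2 zeta_spec) in Hs. apply holomorphic_at_Cdiff in Hs. destruct Hs as (d & D & K). apply K.
 replace (s - s)%C with (RtoC 0) by ring. rewrite Cmod_0; auto.
Qed.

Lemma UH_neq1 s : UH s -> s <> RtoC 1.
Proof. intros H ->. unfold UH in H. simpl in H. lra. Qed.

Lemma zeta_hol_UH : hol UH zeta.
Proof. apply (hol_sub _ _ _ UH_neq1 zeta_hol). Qed.

Lemma zeta_zD s : 1 < Re s -> zeta s = zD s.
Proof. intros H. apply Cser_unique with (fun n => rcpow (INR (S n)) (- s)). apply Cser_is_series. apply (proj1 zeta_spec); auto. apply zD_Cser; auto.
Qed.

(** [zeta] is known only through its defining properties. [identity_UH] carries the agreement with
    [ZZ] from [Re s > 1] to the upper half-plane, where the growth bound and the functional equation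
    are used. *)
Lemma zeta_ZZ s : UH s -> zeta s = ZZ s.
Proof. intros H. apply Ceq_minus. apply (identity_UH (fun s => zeta s - ZZ s)%C 1); auto.
 - apply hol_minus. apply zeta_hol_UH. apply (hol_sub _ _ _ UH_neq1 ZZ_hol).
 - intros z _ Hz. rewrite zeta_zD, ZZ_zD by auto. ring.
Qed.

Lemma zeta_poly k : exists A m, 0 <= A /\ forall s, 1 <= Im s -> 3 / 2 - INR k < Re s -> Cmod (zeta s) <= A * (1 + Cmod s) ^ m.
Proof. destruct (Wk_good k) as (_ & (A & m & PA & B) & _). exists A, m. split; auto. intros s H1 H2.
 rewrite zeta_ZZ by (unfold UH; lra). rewrite (ZZ_eq k) by auto.
 assert (N : s <> RtoC 1) by (apply UH_neq1; unfold UH; lra). rewrite Cmod_div by (apply Cminus_neq0; auto).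
 assert (1 <= Cmod (s - 1)). { destruct (Cmod_RI s 1) as [_ K]. simpl in K. rewrite Rminus_0_r in K. note (Rle_abs (Im s)). lra. }
 specialize (B s H2). apply Rmult_le_reg_r with (Cmod (s - 1)). lra. div_cancel.
 note (Cmod_ge_0 (Wk k s)). nra.
Qed.

Lemma Rpower_m2 x : 0 < x -> Rpower x (- (2)) = / (x * x).
Proof. intros Hx. rewrite Rpower_Ropp. f_equal. replace 2 with (1 + 1) by ring. rewrite Rpower_plus, Rpower_1; auto. Qed.

(** The term of 2 gives [1/4] and the later ones at most [1/2], because
    [1 / m^2 <= 1 / (m - 1) - 1 / m]. *)
Lemma zD_near_1 s : Re s = 2 -> Cmod (zD s - 1) <= 3 / 4.
Proof. intros Hs. note (zD_Cser s ltac:(lra)) as H. set (f := fun n => rcpow (INR (S n)) (- s)) in *.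
 assert (F : forall n, Cmod (f n) = / (INR (S n) * INR (S n))).
 { intros n. unfold f. rewrite Cmod_rcpow, re_opp, Hs. apply Rpower_m2. apply lt_0_INR; lia. }
 assert (B : forall n, Cmod (Csum f (S (S n)) - 1) <= 3 / 4 - / INR (S (S n))).
 { induction n.
  - simpl Csum. assert (E0 : f 0%nat = 1) by (unfold f; simpl INR; apply rcpow_base1). rewrite E0.
  replace (0 + 1 + f 1%nat - 1)%C with (f 1%nat) by ring. rewrite F. simpl. lra.
  - change (Csum f (S (S (S n)))) with (Csum f (S (S n)) + f (S (S n)))%C.
  replace (Csum f (S (S n)) + f (S (S n)) - 1)%C with ((Csum f (S (S n)) - 1) + f (S (S n)))%C by ring.
  le_via Cmod_triangle. rewrite F. rewrite !S_INR in *. note (pos_INR n). set (x := INR n) in *.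
  assert (/ ((x + 1 + 1 + 1) * (x + 1 + 1 + 1)) <= / (x + 1 + 1) - / (x + 1 + 1 + 1)).
  { replace (/ (x + 1 + 1) - / (x + 1 + 1 + 1)) with (/ ((x + 1 + 1) * (x + 1 + 1 + 1))) by (field; lra). apply Rinv_le_contravar; nra. }
  lra. }
 apply Rle_plus_epsilon. intros eps He. destruct (H eps He) as [N HN]. specialize (HN (S (S N)) ltac:(lia)). specialize (B N).
 rewrite Cmod_minus_sym in HN. note (Cmod_triangle3 (zD s) (Csum f (S (S N))) 1).
 assert (0 < / INR (S (S N))). { apply Rinv_0_lt_compat. apply lt_0_INR; lia. } lra.
Qed.

Lemma zeta_2_lower s : Re s = 2 -> 1 / 4 <= Cmod (zeta s).
Proof. intros H. rewrite zeta_zD by lra. note (zD_near_1 s H). note (Cmod_triangle_rev 1 (zD s)). rewrite Cmod_1, Cmod_minus_sym in H1. lra.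
Qed.

Lemma zeta_zero_nontrivial s : UH s -> zeta s = 0 -> nontrivial_zero s.
Proof. intros H E. split. apply UH_neq1; auto. split; auto. intros k ->. unfold UH in H. simpl in H. lra.
Qed.

(** * The Fourier series of the periodic quadratic *)

Section SquareSeries.

Local Arguments INR n : simpl never.

Fixpoint Rsum (f : nat -> R) (n : nat) : R := match n with O => 0 | S m => Rsum f m + f m end.

(** The limit is [PI^2 (x - x^2)] on [[0, 1]]. With [1 - cos] in place of [cos] the partial sums
    increase with [N] and vanish at the integers, which fixes the constant term of the Fourier
    series. *)
Definition SQ (N : nat) (x : R) : R := Rsum (fun k => (1 - cos (2 * PI * INR (S k) * x)) / (INR (S k)) ^ 2) N.

Lemma is_derive_Rsum (f f' : nat -> R -> R) N x : (forall k, is_derive (f k) x (f' k x)) -> is_derive (fun t => Rsum (fun k => f k t) N) x (Rsum (fun k => f' k x) N).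
Proof. intros H. induction N; simpl. apply (is_derive_const (V := R_N)). apply (is_derive_plus (V := R_N)); auto.
Qed.

Lemma Rsum_ext f g n : (forall k, (k < n)%nat -> f k = g k) -> Rsum f n = Rsum g n.
Proof. induction n; simpl; intros H; auto. rewrite IHn, H; auto. Qed.
Lemma Rsum_scal c f n : Rsum (fun k => c * f k) n = c * Rsum f n.
Proof. induction n; simpl. ring. rewrite IHn. ring. Qed.

Lemma INR_S_pos k : 0 < INR (S k). Proof. apply lt_0_INR; lia. Qed.

Lemma cos_int_period x n : cos (x + 2 * PI * INR n) = cos x.
Proof. replace (x + 2 * PI * INR n) with (x + 2 * INR n * PI) by ring. apply cos_period. Qed.

Lemma SQ_period N x n : SQ N (x + INR n) = SQ N x.
Proof. apply Rsum_ext. intros k _. f_equal. f_equal. replace (2 * PI * INR (S k) * (x + INR n)) with (2 * PI * INR (S k) * x + 2 * PI * INR (S k * n)) by (rewrite mult_INR; ring).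
 apply cos_int_period.
Qed.

Lemma SQ_sym N x : SQ N (1 - x) = SQ N x.
Proof. apply Rsum_ext. intros k _. f_equal. f_equal. replace (2 * PI * INR (S k) * (1 - x)) with (- (2 * PI * INR (S k) * x) + 2 * PI * INR (S k)) by ring.
 rewrite cos_int_period. apply cos_neg.
Qed.

Definition SQ1 (N : nat) (x : R) : R := Rsum (fun k => 2 * PI * sin (2 * PI * INR (S k) * x) / INR (S k)) N.

Lemma is_derive_SQ N x : is_derive (SQ N) x (SQ1 N x).
Proof. apply (is_derive_Rsum (fun k t => (1 - cos (2 * PI * INR (S k) * t)) / (INR (S k)) ^ 2) (fun k t => 2 * PI * sin (2 * PI * INR (S k) * t) / INR (S k))). intros k. note (INR_S_pos k).
 set (m := INR (S k)) in *. auto_derive. nra. field. lra.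
Qed.

Lemma is_derive_SQ1 N x : is_derive (SQ1 N) x (Rsum (fun k => 4 * PI ^ 2 * cos (2 * PI * INR (S k) * x)) N).
Proof. apply (is_derive_Rsum (fun k t => 2 * PI * sin (2 * PI * INR (S k) * t) / INR (S k)) (fun k t => 4 * PI ^ 2 * cos (2 * PI * INR (S k) * t))). intros k. note (INR_S_pos k).
 set (m := INR (S k)) in *. auto_derive. lra. field. lra.
Qed.

Lemma Dirichlet_kernel N x : (1 + 2 * Rsum (fun k => cos (2 * PI * INR (S k) * x)) N) * sin (PI * x) = sin ((2 * INR N + 1) * PI * x).
Proof. induction N. simpl. rewrite INR_0. replace ((2 * 0 + 1) * PI * x) with (PI * x) by ring. ring.
 cbn [Rsum]. rewrite S_INR in *.
 replace ((1 + 2 * (Rsum (fun k => cos (2 * PI * INR (S k) * x)) N + cos (2 * PI * (INR N + 1) * x))) * sin (PI * x))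
  with (sin ((2 * INR N + 1) * PI * x) + 2 * cos (2 * PI * (INR N + 1) * x) * sin (PI * x)) by (rewrite <- IHN; ring).
 replace ((2 * INR N + 1) * PI * x) with (2 * PI * (INR N + 1) * x - PI * x) by ring.
 replace ((2 * (INR N + 1) + 1) * PI * x) with (2 * PI * (INR N + 1) * x + PI * x) by ring. rewrite sin_plus, sin_minus. ring.
Qed.

(** The derivative of the error [TQ] below; its own derivative is [2 PI^2] times the Dirichlet
    kernel. *)
Definition TQ1 (N : nat) (x : R) : R := SQ1 N x - PI ^ 2 + 2 * PI ^ 2 * x.

Lemma SQ1_half N : SQ1 N (1 / 2) = 0.
Proof. unfold SQ1. rewrite (Rsum_ext _ (fun _ => 0)). induction N; simpl; lra. intros k _.
 replace (2 * PI * INR (S k) * (1 / 2)) with (INR (S k) * PI) by field.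
 replace (sin (INR (S k) * PI)) with 0. unfold Rdiv; ring. symmetry. rewrite INR_IZR_INZ. apply sin_eq_0_1. exists (Z.of_nat (S k)). auto.
Qed.

Lemma cos_odd_half N : cos ((2 * INR N + 1) * PI * (1 / 2)) = 0.
Proof. replace ((2 * INR N + 1) * PI * (1 / 2)) with (INR N * PI + PI / 2) by field. rewrite cos_plus, cos_PI2.
 replace (sin (INR N * PI)) with 0. ring. symmetry. rewrite INR_IZR_INZ. apply sin_eq_0_1. exists (Z.of_nat N). auto.
Qed.

Lemma sin_pi_pos x : 0 < x < 1 -> 0 < sin (PI * x).
Proof. intros H. note PI_RGT_0. apply sin_gt_0; nra. Qed.

Lemma sin_pi_mono x y : 0 <= x <= y -> y <= 1 / 2 -> sin (PI * x) <= sin (PI * y).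
Proof. intros H H'. note PI_RGT_0. apply sin_incr_1; nra. Qed.

Lemma TQ1_bound N x : 0 < x <= 1 / 2 -> Rabs (TQ1 N x) <= 4 * PI / ((2 * INR N + 1) * sin (PI * x)).
Proof. intros Hx. note PI_RGT_0 as PP. note (pos_INR N) as PN. set (L := 2 * INR N + 1). assert (HL : 0 < L) by (unfold L; lra).
 set (Y := fun u => TQ1 N u + 2 * PI * cos (L * PI * u) / (L * sin (PI * u))).
 set (Z := fun u => - (2 * PI / (L * sin (PI * u)))).
 assert (DY : forall u, x <= u <= 1 / 2 -> is_derive Y u (- (2 * PI ^ 2 * (cos (L * PI * u) * cos (PI * u)) / (L * (sin (PI * u)) ^ 2)))).
 { intros u Hu. note (sin_pi_pos u ltac:(lra)) as Su.
  assert (D1 : is_derive (TQ1 N) u (Rsum (fun k => 4 * PI ^ 2 * cos (2 * PI * INR (S k) * u)) N + 2 * PI ^ 2)).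
  { unfold TQ1. evar_last. apply (is_derive_plus (V := R_N) (fun u => SQ1 N u - PI ^ 2) (fun u => 2 * PI ^ 2 * u)).
  apply (is_derive_minus (V := R_N) (SQ1 N) (fun _ => PI ^ 2)). apply is_derive_SQ1. apply (is_derive_const (V := R_N)).
  auto_derive. auto. reflexivity. unfold plus, minus, opp, zero; simpl. unfold plus; simpl. ring. }
  assert (D2 : is_derive (fun u => 2 * PI * cos (L * PI * u) / (L * sin (PI * u))) u
  (2 * PI * (- (L * PI) * sin (L * PI * u) * (L * sin (PI * u)) - cos (L * PI * u) * (L * PI * cos (PI * u))) / (L * sin (PI * u)) ^ 2)).
  { auto_derive. nra. field. split; lra. }
  unfold Y. evar_last. apply (is_derive_plus (V := R_N)); [exact D1|exact D2].
  match goal with |- plus ?a ?b = _ => change (plus a b) with (a + b) end. rewrite Rsum_scal. note (Dirichlet_kernel N u) as DK. fold L in DK.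
  replace (4 * PI ^ 2 * Rsum (fun k => cos (2 * PI * INR (S k) * u)) N + 2 * PI ^ 2) with (2 * PI ^ 2 * (1 + 2 * Rsum (fun k => cos (2 * PI * INR (S k) * u)) N)) by ring.
  replace (1 + 2 * Rsum (fun k => cos (2 * PI * INR (S k) * u)) N) with (sin (L * PI * u) / sin (PI * u)). field; lra.
  rewrite <- DK. field. lra. }
 assert (DZ : forall u, x <= u <= 1 / 2 -> is_derive Z u (2 * PI ^ 2 * cos (PI * u) / (L * (sin (PI * u)) ^ 2))).
 { intros u Hu. note (sin_pi_pos u ltac:(lra)) as Su. unfold Z. auto_derive. nra. field. split; lra. }
 assert (K : Cmod (RtoC (Y (1 / 2)) - RtoC (Y x)) <= Z (1 / 2) - Z x).
 { apply (Rdiff_le_of_deriv_le (fun u => RtoC (Y u)) (fun u => RtoC (- (2 * PI ^ 2 * (cos (L * PI * u) * cos (PI * u)) / (L * (sin (PI * u)) ^ 2)))) Z (fun u => 2 * PI ^ 2 * cos (PI * u) / (L * (sin (PI * u)) ^ 2))). lra.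
  intros; apply RD_RtoC; auto. auto.
  intros u Hu. note (sin_pi_pos u ltac:(lra)) as Su. rewrite Cmod_R, Rabs_Ropp.
  assert (PS : 0 < L * sin (PI * u) ^ 2) by (apply Rmult_lt_0_compat; [auto|apply pow_lt; auto]).
  assert (0 <= cos (PI * u)). { apply cos_ge_0; nra. }
  unfold Rdiv. rewrite !Rabs_mult. rewrite (Rabs_pos_eq (/ _)). mul_le_r. pos.
  rewrite (Rabs_pos_eq (cos (PI * u))) by auto. rewrite (Rabs_pos_eq 2) by lra. rewrite (Rabs_pos_eq (PI ^ 2)) by (simpl; nra).
  note (COS_bound (L * PI * u)). assert (Rabs (cos (L * PI * u)) <= 1) by (apply Rabs_le; lra).
  assert (0 <= 2 * PI ^ 2 * cos (PI * u)) by (note (pow_lt PI 2 PP); apply Rmult_le_pos; lra).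
  replace (2 * PI ^ 2 * (Rabs (cos (L * PI * u)) * cos (PI * u))) with (2 * PI ^ 2 * cos (PI * u) * Rabs (cos (L * PI * u))) by ring. nra.
  left; apply Rinv_0_lt_compat; auto. }
 assert (Y0 : Y (1 / 2) = 0). { unfold Y, TQ1. rewrite SQ1_half. unfold L. rewrite cos_odd_half. assert (Q : forall q, 2 * PI * 0 / q = 0) by (intros; unfold Rdiv; ring). rewrite Q. field. }
 assert (Z0 : Z (1 / 2) <= 0). { unfold Z. assert (0 < 2 * PI / (L * sin (PI * (1 / 2)))). apply Rdiv_lt_0_compat. lra. note (sin_pi_pos (1/2) ltac:(lra)). nra. lra. }
 rewrite Y0 in K. rewrite <- RtoC_minus, Cmod_R in K. rewrite Rabs_minus_sym, Rminus_0_r in K.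
 note (sin_pi_pos x ltac:(lra)) as Sx.
 assert (Zx : - Z x = 2 * PI / (L * sin (PI * x))) by (unfold Z; ring).
 assert (B : Rabs (2 * PI * cos (L * PI * x) / (L * sin (PI * x))) <= 2 * PI / (L * sin (PI * x))).
 { unfold Rdiv. rewrite Rabs_mult, (Rabs_pos_eq (/ _)) by (left; apply Rinv_0_lt_compat; nra). mul_le_r. left; apply Rinv_0_lt_compat; nra.
  rewrite Rabs_mult, (Rabs_pos_eq (2 * PI)) by lra. note (COS_bound (L * PI * x)). assert (Rabs (cos (L * PI * x)) <= 1) by (apply Rabs_le; lra). nra. }
 replace (TQ1 N x) with (Y x - 2 * PI * cos (L * PI * x) / (L * sin (PI * x))) by (unfold Y; ring).
 le_via Rabs_triang. rewrite Rabs_Ropp.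
 replace (4 * PI / (L * sin (PI * x))) with (2 * PI / (L * sin (PI * x)) + 2 * PI / (L * sin (PI * x))) by (field; split; lra). lra.
Qed.

Definition TQ (N : nat) (x : R) : R := SQ N x - PI ^ 2 * (x - x ^ 2).

Lemma is_derive_TQ N x : is_derive (TQ N) x (TQ1 N x).
Proof. unfold TQ, TQ1. evar_last. apply (is_derive_minus (V := R_N) (SQ N) (fun x => PI ^ 2 * (x - x ^ 2))). apply is_derive_SQ.
 auto_derive. auto. reflexivity. unfold minus, plus, opp; simpl. change (INR 2) with (1 + 1). ring.
Qed.

Lemma SQ_diff N k x : (1 <= N)%nat -> 0 <= SQ (N + k) x - SQ N x <= 2 * (/ INR N - / INR (N + k)).
Proof. intros HN. assert (0 < INR N) by (apply lt_0_INR; lia). induction k.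
 - rewrite Nat.add_0_r. lra.
 - rewrite Nat.add_succ_r. unfold SQ in *. cbn [Rsum].
  set (m := INR (N + k)) in *. assert (Pm : 0 < m). { apply lt_0_INR; lia. } rewrite ?S_INR. fold m.
  set (c := cos (2 * PI * (m + 1) * x)). assert (-1 <= c <= 1) by apply COS_bound.
  assert (0 <= (1 - c) / (m + 1) ^ 2 <= 2 * (/ m - / (m + 1))).
  { split. apply Rdiv_le_0_compat. lra. simpl; nra.
  replace (/ m - / (m + 1)) with (/ (m * (m + 1))) by (field; lra). unfold Rdiv. apply Rmult_le_compat. lra. left; apply Rinv_0_lt_compat; simpl; nra. lra.
  apply Rinv_le_contravar; simpl; nra. }
  fold m. fold c. lra.
Qed.

Lemma one_minus_cos_bound t : 0 <= 1 - cos t <= t ^ 2 / 2.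
Proof.   note (COS_bound t). split. lra.
  replace t with (2 * (t / 2)) at 1 by field. rewrite cos_2a_sin. 
  assert (Rabs (sin (t / 2)) <= Rabs (t / 2)).
  { destruct (Rle_dec 0 (t / 2)). 
  - destruct (Req_dec (t / 2) 0) as [E|E]. rewrite E, sin_0, Rabs_R0; lra.
  apply Rabs_le. rewrite (Rabs_pos_eq (t / 2)) by lra. note (sin_lt_x (t / 2) ltac:(lra)). note (SIN_bound (t / 2)).
  destruct (Rle_dec 1 (t / 2)). lra. split; [|lra]. assert (0 <= sin (t / 2)). { apply sin_ge_0; [lra|]. note PI2_1. unfold PI2 in *. lra. } lra.
  - rewrite <- (Rabs_Ropp (sin _)), <- sin_neg, <- (Rabs_Ropp (t / 2)). set (u := - (t / 2)). assert (0 < u) by (unfold u; lra).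
  apply Rabs_le. rewrite (Rabs_pos_eq u) by lra. note (sin_lt_x u ltac:(lra)). note (SIN_bound u).
  destruct (Rle_dec 1 u). lra. split; [|lra]. assert (0 <= sin u). { apply sin_ge_0; [lra|]. note PI2_1. unfold PI2 in *. lra. } lra. }
  apply Rsqr_le_abs_1 in H0. unfold Rsqr in H0. nra.
Qed.

Lemma SQ_small N x : 0 <= SQ N x <= INR N * (2 * PI ^ 2 * x ^ 2).
Proof. induction N. unfold SQ; simpl; rewrite INR_0; lra. unfold SQ in *. cbn [Rsum]. rewrite (S_INR N).
 note (INR_S_pos N) as P. rewrite S_INR in P. set (m := INR N + 1) in *. set (t := 2 * PI * m * x).
 note (one_minus_cos_bound t) as B.
 assert (0 <= (1 - cos t) / m ^ 2 <= 2 * PI ^ 2 * x ^ 2).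
 { split. apply Rdiv_le_0_compat. lra. simpl; nra. le_mid (t ^ 2 / 2 / m ^ 2). unfold Rdiv at 1 3. mul_le_r. left; apply Rinv_0_lt_compat; simpl; nra. lra.
  right. unfold t. field. lra. }
 unfold m in *. lra.
Qed.

(** Up to a point [ep] fixed before [N] the error is small by direct estimates; between [ep] and [x]
    it changes little, because its derivative [TQ1] tends to 0 uniformly there. *)
Lemma TQ_limit x : 0 <= x <= 1 / 2 -> forall eta, 0 < eta -> exists N0, forall N, (N0 <= N)%nat -> Rabs (TQ N x) <= eta.
Proof. intros Hx eta He. note PI_RGT_0 as PP.
 destruct (Req_dec x 0) as [->|Nx].
 { exists 0%nat. intros N _. unfold TQ. destruct (SQ_small N 0). replace (SQ N 0) with 0 by (simpl in *; nra). replace (0 - PI ^ 2 * (0 - 0 ^ 2)) with 0 by ring. rewrite Rabs_R0; lra. }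
 destruct (INR_archimed 1 (8 / eta + 1)) as [m Hm]. lra. rewrite Rmult_1_r in Hm.
 assert (P8 : 0 < 8 / eta) by pos. assert (Pm : 0 < INR m) by lra.
 set (A := INR m * (2 * PI ^ 2) + PI ^ 2). assert (PA : 0 < A) by (unfold A; simpl; nra).
 set (ep := Rmin x (Rmin 1 (eta / (4 * A)))).
 assert (E : 0 < ep /\ ep <= x /\ ep <= 1 /\ ep <= eta / (4 * A)).
 { unfold ep. split. repeat apply Rmin_pos; try lra. pos. unfold Rmin; repeat destruct Rle_dec; lra. }
 destruct E as (E1 & E2 & E3 & E4). note (sin_pi_pos ep ltac:(lra)) as Se.
 destruct (INR_archimed 1 (4 * PI / (sin (PI * ep) * (eta / 4)))) as [n1 Hn1]. lra. rewrite Rmult_1_r in Hn1.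
 exists (m + n1 + 1)%nat. intros N HN.
 assert (B1 : Rabs (TQ N ep) <= eta / 2).
 { unfold TQ. destruct (SQ_small m ep) as [S1 S2]. assert (1 <= m)%nat. { destruct m; [rewrite INR_0 in Pm; lra|lia]. }
  note (SQ_diff m (N - m) ep H) as D. replace (m + (N - m))%nat with N in D by lia.
  assert (0 < / INR N) by (apply Rinv_0_lt_compat, lt_0_INR; lia).
  assert (/ INR m <= eta / 8). { replace (eta / 8) with (/ (8 / eta)) by (field; lra). apply Rinv_le_contravar; lra. }
  assert (A * ep <= eta / 4). { le_mid (A * (eta / (4 * A))). mul_le_l; lra. right; field; lra. }
  assert (INR m * (2 * PI ^ 2 * ep ^ 2) <= INR m * (2 * PI ^ 2) * ep). { replace (INR m * (2 * PI ^ 2 * ep ^ 2)) with (INR m * (2 * PI ^ 2) * ep * ep) by ring. assert (0 <= INR m * (2 * PI ^ 2) * ep) by (note (pow_lt PI 2 PP); apply Rmult_le_pos; [apply Rmult_le_pos; lra|lra]). nra. }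
  assert (0 <= PI ^ 2 * (ep - ep ^ 2) <= PI ^ 2 * ep). { assert (0 < PI ^ 2) by (simpl; nra). simpl; split; nra. }
  unfold A in *. apply Rabs_le. lra. }
 assert (B2 : Rabs (TQ N x - TQ N ep) <= eta / 2).
 { note (RD_mean_ineq (fun t => RtoC (TQ N t)) (fun t => RtoC (TQ1 N t)) ep x (eta / 4) E2) as K. cbv beta in K. rewrite <- RtoC_minus, Cmod_R in K.
  le_via K. intros; apply RD_RtoC, is_derive_TQ.
  - intros u Hu. rewrite Cmod_R. eapply Rle_trans. apply TQ1_bound; lra. note (sin_pi_pos u ltac:(lra)) as Su. note (sin_pi_mono ep u ltac:(lra) ltac:(lra)).
  assert (HNR : INR n1 < 2 * INR N + 1). { apply Rle_lt_trans with (INR N). apply le_INR; lia. note (pos_INR N); lra. }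
  apply Rmult_le_reg_r with ((2 * INR N + 1) * sin (PI * u)). note (pos_INR N); nra. unfold Rdiv at 1. rewrite Rmult_assoc, Rinv_l by (note (pos_INR N); nra).
  apply Rmult_lt_compat_r with (r := sin (PI * ep) * (eta / 4)) in Hn1; [|nra].
  replace (4 * PI / (sin (PI * ep) * (eta / 4)) * (sin (PI * ep) * (eta / 4))) with (4 * PI) in Hn1 by (field; lra).
  note (pos_INR n1). 
  le_mid (INR n1 * (sin (PI * ep) * (eta / 4))). lra.
  replace (eta / 4 * ((2 * INR N + 1) * sin (PI * u))) with ((2 * INR N + 1) * (sin (PI * u) * (eta / 4))) by ring. apply Rmult_le_compat; nra.
  - nra. }
 replace (TQ N x) with ((TQ N x - TQ N ep) + TQ N ep) by ring. le_via Rabs_triang. lra.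
Qed.

(** The tail of the series is at most [2 / N] by [SQ_diff], and the limit is known from [TQ_limit];
    the symmetry about [1/2] covers the other half. *)
Lemma SQ_series N x : (1 <= N)%nat -> 0 <= x <= 1 -> Rabs (SQ N x - PI ^ 2 * (x - x ^ 2)) <= 2 / INR N.
Proof. intros HN Hx.
 assert (H : forall x, 0 <= x <= 1 / 2 -> Rabs (SQ N x - PI ^ 2 * (x - x ^ 2)) <= 2 / INR N).
 { clear x Hx. intros x Hx. apply Rle_plus_epsilon. intros eps He. destruct (TQ_limit x Hx eps He) as [N0 H0]. specialize (H0 (N + N0)%nat ltac:(lia)).
  note (SQ_diff N N0 x HN) as D. unfold TQ in H0. assert (0 < / INR (N + N0)) by (apply Rinv_0_lt_compat, lt_0_INR; lia).
  apply Rabs_le_between in H0. unfold Rdiv. apply Rabs_le. lra. }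
 destruct (Rle_dec x (1 / 2)). apply H; lra. rewrite <- SQ_sym. replace (x - x ^ 2) with ((1 - x) - (1 - x) ^ 2) by ring. apply H. lra.
Qed.

End SquareSeries.

(** * Mellin-type integrals depending on a parameter *)

Lemma Rpower_le_1 x a : 1 <= x -> a <= 0 -> Rpower x a <= 1.
Proof. intros Hx Ha. le_mid (Rpower x 0). apply Rpower_mono_exp; auto. rewrite Rpower_O; lra. Qed.

Lemma contR_rcpow s x : 0 < x -> contR (fun t => rcpow t s) x.
Proof. intros. eapply RD_contR, RD_rcpow; auto. Qed.

Lemma contR_ln x : 0 < x -> contR (fun t => RtoC (ln t)) x.
Proof. intros. eapply RD_contR. apply RD_RtoC. apply is_derive_Reals. apply derivable_pt_lim_ln; auto. Qed.

Lemma is_derive_continuous (g : R -> R) x l : is_derive g x l -> continuous g x.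
Proof. intros H. apply ex_derive_cont. exists l; auto. Qed.

Lemma continuous_Rpower x a : 0 < x -> continuous (fun t => Rpower t a) x.
Proof. intros. eapply is_derive_continuous, is_derive_Rpower; auto. Qed.

Lemma Cdiff_CInt_rcpow phi a b s : 0 < a <= b -> contI phi a b ->
 Cdiff (fun s => CInt (fun x => phi x * rcpow x s)%C a b) s (CInt (fun x => phi x * (RtoC (ln x) * rcpow x s))%C a b).
Proof. intros Hab Hphi. destruct (contI_bounded phi a b Hphi) as (M & PM & HM).
 set (Lm := Rabs (ln a) + Rabs (ln b)).
 assert (HL : forall x, a <= x <= b -> Rabs (ln x) <= Lm).
 { intros x Hx. assert (ln a <= ln x <= ln b). { split; [destruct (Req_dec a x) as [->|]|destruct (Req_dec x b) as [->|]]; try lra; left; apply ln_increasing; lra. }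
  unfold Lm. note (Rle_abs (ln b)). note (Rle_abs (- ln a)). rewrite Rabs_Ropp in H1. note (Rabs_pos (ln a)). note (Rabs_pos (ln b)). apply Rabs_le. lra. }
 assert (PL : 0 <= Lm) by (unfold Lm; note (Rabs_pos (ln a)); note (Rabs_pos (ln b)); lra).
 set (E := exp (Cmod s * Lm)). assert (PE : 0 < E) by apply exp_pos.
 assert (C1 : forall s, contI (fun x => phi x * rcpow x s)%C a b).
 { intros s' x Hx. apply contR_mult; auto. apply contR_rcpow. lra. }
 assert (C2 : contI (fun x => phi x * (RtoC (ln x) * rcpow x s))%C a b).
 { intros x Hx. apply contR_mult; auto. apply contR_mult. apply contR_ln; lra. apply contR_rcpow. lra. }
 set (A := M * (E * (Lm * Lm * exp Lm)) * (b - a)).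
 assert (PA : 0 <= A). { unfold A. note (exp_pos Lm). repeat apply Rmult_le_pos; lra. }
 intros eps He. exists (Rmin 1 (eps / (A + 1))). split. apply Rmin_pos. lra. pos.
 intros w _ Hw. note (Rmin_l 1 (eps / (A + 1))). note (Rmin_r 1 (eps / (A + 1))). set (h := (w - s)%C) in *.
 rewrite <- CInt_minus by (auto; lra). rewrite (Cmult_comm _ h), <- CInt_scal by (auto; lra).
 rewrite <- CInt_minus; try lra.
 2:{ intros x Hx. apply contR_minus; apply C1; auto. } 2:{ intros x Hx. apply contR_scal. apply C2; auto. }
 assert (B : Cmod (CInt (fun x => phi x * rcpow x w - phi x * rcpow x s - h * (phi x * (RtoC (ln x) * rcpow x s)))%C a b) <= M * (E * (Lm * Lm * exp Lm)) * (Cmod h * Cmod h) * (b - a)).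
 { apply CInt_bound; try lra.
  - intros x Hx. apply contR_minus. apply contR_minus; apply C1; auto. apply contR_scal, C2; auto.
  - intros x Hx. replace (rcpow x w) with (rcpow x s * Cexp (h * RtoC (ln x)))%C.
  2:{ unfold rcpow. rewrite <- Cexp_plus. f_equal. unfold h. ring. }
  replace (phi x * (rcpow x s * Cexp (h * RtoC (ln x))) - phi x * rcpow x s - h * (phi x * (RtoC (ln x) * rcpow x s)))%C with
  (phi x * (rcpow x s * (Cexp (h * RtoC (ln x)) - 1 - h * RtoC (ln x))))%C by ring.
  rewrite !Cmod_mult. rewrite (Rmult_assoc M). specialize (HL x Hx). note (Cmod_ge_0 h). note (Rabs_pos (ln x)).
  assert (Q1 : Cmod (rcpow x s) <= E).
  { rewrite Cmod_rcpow. unfold Rpower, E. apply exp_le. le_via Rle_abs. rewrite Rabs_mult. apply Rmult_le_compat; auto using Rabs_pos. apply re_le_Cmod. }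
  assert (Q2 : Cmod (Cexp (h * RtoC (ln x)) - 1 - h * RtoC (ln x)) <= Lm * Lm * exp Lm * (Cmod h * Cmod h)).
  { le_via Cexp_sub_1_lin. rewrite Cmod_mult, Cmod_R.
  le_mid (Cmod h * Lm * (Cmod h * Lm) * exp Lm).
  - apply Rmult_le_compat. apply Rmult_le_pos; nra. pos. apply Rmult_le_compat; try nra. apply exp_le. nra.
  - right; ring. }
  replace (M * (E * (Lm * Lm * exp Lm) * (Cmod h * Cmod h))) with (M * (E * (Lm * Lm * exp Lm * (Cmod h * Cmod h)))) by ring.
  mul_le. apply Rmult_le_pos; apply Cmod_ge_0. mul_le. }
 eapply Rle_trans. exact B. replace (M * (E * (Lm * Lm * exp Lm)) * (Cmod h * Cmod h) * (b - a)) with (A * Cmod h * Cmod h) by (unfold A; ring).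
 note (Cmod_ge_0 h). mul_le_r; auto.
 le_mid ((A + 1) * (eps / (A + 1))). apply Rmult_le_compat; lra. right; field; lra.
Qed.

(** Two integrations by parts turn [2 cos(2 PI x) x^(-w)] into a multiple of this integrand, which
    is absolutely integrable on the half-line for [-1 < Re w < 1]. The cosine integral thus acquires
    a meaning throughout the strip. *)
Definition Iw (dl M : R) (w : C) : C := CInt (fun x => RtoC (1 - cos (2 * PI * x)) * rcpow x (- w - 2))%C dl M.

Lemma contR_cosk (c : R) x : contR (fun t => RtoC (1 - cos (c * t))) x.
Proof. apply contR_RtoC. apply ex_derive_cont. auto_derive; auto. Qed.

Lemma Iw_contI dl M w : 0 < dl -> contI (fun x => RtoC (1 - cos (2 * PI * x)) * rcpow x (- w - 2))%C dl M.
Proof. intros H x Hx. apply contR_mult. apply (contR_cosk (2 * PI)). apply contR_rcpow. lra. Qed.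

Lemma Re_mw2 w : Re (- w - 2)%C = - Re w - 2.
Proof. unfold Cminus. rewrite re_plus, !re_opp, re_RtoC. ring. Qed.

Lemma Iw_small w s2 dl dl' : Re w <= s2 -> s2 < 1 -> 0 < dl' <= dl -> dl <= 1 -> Cmod (Iw dl' dl w) <= 2 * PI ^ 2 / (1 - s2) * Rpower dl (1 - s2).
Proof. intros Hw Hs Hd Hd1. note PI_RGT_0.
 le_mid (2 * PI ^ 2 / (1 - s2) * Rpower dl (1 - s2) - 2 * PI ^ 2 / (1 - s2) * Rpower dl' (1 - s2)).
 - apply (CInt_bound_prim _ (fun x => 2 * PI ^ 2 / (1 - s2) * Rpower x (1 - s2)) (fun x => 2 * PI ^ 2 * Rpower x (- s2))); try lra.
  + apply Iw_contI; lra.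
  + intros x Hx. evar_last. apply is_derive_scal. apply is_derive_Rpower; lra. replace (1 - s2 - 1) with (- s2) by ring. field. lra.
  + intros x Hx. apply (continuous_scal_r (K := R_AbsRing) (V := R_N) (2 * PI ^ 2) (fun x => Rpower x (- s2))). apply continuous_Rpower; lra.
  + intros x Hx. rewrite Cmod_mult, Cmod_R, Cmod_rcpow, Re_mw2. destruct (one_minus_cos_bound (2 * PI * x)) as [B1 B2]. rewrite Rabs_pos_eq by lra.
  le_mid (2 * PI ^ 2 * x ^ 2 * Rpower x (- s2 - 2)).
  * apply Rmult_le_compat; auto. pos. eapply Rle_trans; [exact B2|right; field].
  unfold Rpower. apply exp_le. assert (ln x <= 0). { rewrite <- ln_1. destruct (Req_dec x 1) as [->|]. lra. left; apply ln_increasing; lra. } nra.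
  * right. rewrite Rmult_assoc. f_equal. replace (x ^ 2) with (Rpower x 2). rewrite <- Rpower_plus. f_equal; ring. replace 2 with (INR 2) by (simpl; ring). rewrite Rpower_pow by lra. reflexivity.
 - assert (0 <= 2 * PI ^ 2 / (1 - s2) * Rpower dl' (1 - s2)); [|lra]. apply Rmult_le_pos. apply Rdiv_le_0_compat. note (pow2_ge_0 PI); lra. lra. pos.
Qed.

Lemma Rpower_Rinv_base x a : 0 < x -> Rpower (/ x) a = Rpower x (- a).
Proof. intros H. unfold Rpower. rewrite ln_Rinv by auto. f_equal. ring. Qed.

Lemma Iw_large w s1 M M' : s1 <= Re w -> -1 < s1 -> 1 <= M <= M' -> Cmod (Iw M M' w) <= 2 / (1 + s1) * Rpower (/ M) (1 + s1).
Proof. intros Hw Hs HM. rewrite Rpower_Rinv_base by lra.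
 le_mid (- (2 / (1 + s1)) * Rpower M' (- (1 + s1)) - - (2 / (1 + s1)) * Rpower M (- (1 + s1))).
 - apply (CInt_bound_prim _ (fun x => - (2 / (1 + s1)) * Rpower x (- (1 + s1))) (fun x => 2 * Rpower x (- s1 - 2))); try lra.
  + apply Iw_contI; lra.
  + intros x Hx. evar_last. apply is_derive_scal. apply is_derive_Rpower; lra. replace (- (1 + s1) - 1) with (- s1 - 2) by ring. field. lra.
  + intros x Hx. apply (continuous_scal_r (K := R_AbsRing) (V := R_N) 2 (fun x => Rpower x (- s1 - 2))). apply continuous_Rpower; lra.
  + intros x Hx. rewrite Cmod_mult, Cmod_R, Cmod_rcpow, Re_mw2. note (COS_bound (2 * PI * x)). rewrite Rabs_pos_eq by lra.
  apply Rmult_le_compat; try lra. pos. apply Rpower_mono_exp; lra.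
 - assert (0 <= 2 / (1 + s1) * Rpower M' (- (1 + s1))); [|lra]. apply Rmult_le_pos. pos. pos.
Qed.

(** The error of cutting the integral at [dl] and [M], uniform for [s1 <= Re w <= s2]. *)
Definition rate (s1 s2 dl M : R) : R := 2 * PI ^ 2 / (1 - s2) * Rpower dl (1 - s2) + 2 / (1 + s1) * Rpower (/ M) (1 + s1).

Lemma Iw_split a b c w : 0 < a <= b -> b <= c -> Iw a c w = (Iw a b w + Iw b c w)%C.
Proof. intros H1 H2. apply CInt_Chasles; try lra. apply Iw_contI; lra. Qed.

Lemma Iw_cauchy w s1 s2 dl dl' M M' : s1 <= Re w <= s2 -> -1 < s1 -> s2 < 1 -> 0 < dl' <= dl -> dl <= 1 -> 1 <= M <= M' ->
 Cmod (Iw dl' M' w - Iw dl M w) <= rate s1 s2 dl M.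
Proof. intros Hw H1 H2 Hd Hd1 HM. rewrite (Iw_split dl' dl M') by lra. rewrite (Iw_split dl M M') by lra.
 replace (Iw dl' dl w + (Iw dl M w + Iw M M' w) - Iw dl M w)%C with (Iw dl' dl w + Iw M M' w)%C by ring.
 le_via Cmod_triangle. apply Rplus_le_compat. apply Iw_small; lra. apply Iw_large; lra.
Qed.

(** Uniform in both cut-offs: this dominates the series over the frequencies in the functional
    equation. *)
Lemma Iw_bounded w s1 s2 a b : s1 <= Re w <= s2 -> -1 < s1 -> s2 < 1 -> 0 < a <= b -> Cmod (Iw a b w) <= rate s1 s2 1 1.
Proof. intros Hw H1 H2 Hab. unfold rate. note (pow2_ge_0 PI).
 assert (R1 : forall e, Rpower 1 e = 1) by (intros; unfold Rpower; rewrite ln_1, Rmult_0_r; apply exp_0).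
 rewrite Rinv_1, !R1, !Rmult_1_r.
 assert (P1 : 0 <= 2 * PI ^ 2 / (1 - s2)) by pos. assert (P2 : 0 <= 2 / (1 + s1)) by pos.
 assert (S : forall x, 0 < x <= 1 -> Rpower x (1 - s2) <= 1).
 { intros x Hx. le_mid (Rpower 1 (1 - s2)); [|rewrite R1; lra]. apply Rle_Rpower_l; lra. }
 assert (L : forall x, 1 <= x -> Rpower (/ x) (1 + s1) <= 1).
 { intros x Hx. rewrite Rpower_Rinv_base by lra. apply Rpower_le_1; lra. }
 destruct (Rle_dec b 1).
 - eapply Rle_trans. apply (Iw_small w s2 b a); lra. specialize (S b ltac:(lra)). nra.
 - destruct (Rle_dec 1 a).
  + eapply Rle_trans. apply (Iw_large w s1 a b); lra. specialize (L a ltac:(lra)). nra.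
  + rewrite (Iw_split a 1 b) by lra. le_via Cmod_triangle. apply Rplus_le_compat.
  eapply Rle_trans. apply (Iw_small w s2 1 a); lra. rewrite R1; lra. eapply Rle_trans. apply (Iw_large w s1 1 b); lra. rewrite Rinv_1, R1; lra.
Qed.

Lemma Rpower_small0 a eta : 0 < a -> 0 < eta -> exists x0, 0 < x0 /\ forall x, 0 < x <= x0 -> Rpower x a <= eta.
Proof. intros Ha He. exists (Rpower eta (/ a)). split. apply Rpower_pos. intros x Hx.
 le_mid (Rpower (Rpower eta (/ a)) a). apply Rle_Rpower_l; lra. rewrite Rpower_mult, Rinv_l, Rpower_1; lra.
Qed.

Lemma rate_small s1 s2 eta : -1 < s1 -> s2 < 1 -> 0 < eta -> exists x0, 0 < x0 <= 1 /\ forall dl M, 0 < dl <= x0 -> 0 < / M <= x0 -> rate s1 s2 dl M <= eta.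
Proof. intros H1 H2 He. note (pow2_ge_0 PI).
 assert (P1 : 0 <= 2 * PI ^ 2 / (1 - s2)) by pos. assert (P2 : 0 <= 2 / (1 + s1)) by pos.
 set (c1 := 2 * PI ^ 2 / (1 - s2)) in *. set (c2 := 2 / (1 + s1)) in *.
 destruct (Rpower_small0 (1 - s2) (eta / 2 / (c1 + 1))) as (x1 & X1 & K1). lra. pos.
 destruct (Rpower_small0 (1 + s1) (eta / 2 / (c2 + 1))) as (x2 & X2 & K2). lra. pos.
 exists (Rmin 1 (Rmin x1 x2)). split. split. repeat apply Rmin_pos; lra. apply Rmin_l.
 intros dl M Hd HM. assert (dl <= x1 /\ / M <= x2) as [D1 D2]. { note (Rmin_r 1 (Rmin x1 x2)). min_le x1 x2. lra. }
 specialize (K1 dl ltac:(lra)). specialize (K2 (/ M) ltac:(lra)). unfold rate. fold c1 c2.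
 note (Rpower_pos dl (1 - s2)). note (Rpower_pos (/ M) (1 + s1)).
 assert (c1 * Rpower dl (1 - s2) <= eta / 2). { le_mid ((c1 + 1) * (eta / 2 / (c1 + 1))). apply Rmult_le_compat; lra. right; field; lra. }
 assert (c2 * Rpower (/ M) (1 + s1) <= eta / 2). { le_mid ((c2 + 1) * (eta / 2 / (c2 + 1))). apply Rmult_le_compat; lra. right; field; lra. }
 lra.
Qed.

Definition Iseq (n : nat) (w : C) : C := Iw (/ INR (S n)) (INR (S n)) w.
Definition Cw (w : C) : C := epsilon (inhabits (RtoC 0)) (fun L => forall eps, 0 < eps -> exists N, forall n, (N <= n)%nat -> Cmod (Iseq n w - L) <= eps).

Lemma inv_INR_S n : 0 < / INR (S n) <= 1.
Proof. note (INR_S_ge1 n). split. pos. rewrite <- Rinv_1. apply Rinv_le_contravar; lra. Qed.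

Lemma inv_INR_le n m : (n <= m)%nat -> / INR (S m) <= / INR (S n).
Proof. intros H. apply Rinv_le_contravar. apply INR_S_pos. apply le_INR; lia. Qed.

Lemma inv_INR_small x0 : 0 < x0 -> exists N, forall n, (N <= n)%nat -> / INR (S n) <= x0.
Proof. intros H. destruct (INR_archimed 1 (/ x0)) as [N HN]. lra. rewrite Rmult_1_r in HN. exists N. intros n Hn. note (Rinv_0_lt_compat x0 H).
 rewrite <- (Rinv_inv x0). apply Rinv_le_contravar; auto. apply le_INR in Hn. rewrite S_INR. lra.
Qed.

Lemma Cw_spec w : -1 < Re w < 1 -> forall eps, 0 < eps -> exists N, forall n, (N <= n)%nat -> Cmod (Iseq n w - Cw w) <= eps.
Proof. intros Hw. apply (epsilon_spec (inhabits (RtoC 0)) (fun L => forall eps, 0 < eps -> exists N, forall n, (N <= n)%nat -> Cmod (Iseq n w - L) <= eps)).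
 apply C_complete_seq. intros eps He. destruct (rate_small (Re w) (Re w) eps) as (x0 & X0 & K); try lra.
 destruct (inv_INR_small x0) as [N HN]. lra. exists N.
 assert (B : forall n m, (N <= n)%nat -> (n <= m)%nat -> Cmod (Iseq m w - Iseq n w) <= eps).
 { intros n m Hn Hm. note (inv_INR_S n). note (inv_INR_S m). note (inv_INR_le n m Hm). note (INR_S_ge1 n). specialize (HN n Hn).
  eapply Rle_trans. apply (Iw_cauchy w (Re w) (Re w)); try lra. split; [lra|]. apply le_INR; lia. apply K; lra. }
 intros n m Hn Hm. destruct (Nat.le_ge_cases n m). rewrite Cmod_minus_sym; auto. auto.
Qed.

Lemma Cw_rate w s1 s2 dl M : s1 <= Re w <= s2 -> -1 < s1 -> s2 < 1 -> 0 < dl <= 1 -> 1 <= M -> Cmod (Iw dl M w - Cw w) <= rate s1 s2 dl M.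
Proof. intros Hw H1 H2 Hd HM. apply Rle_plus_epsilon. intros eps He. destruct (Cw_spec w ltac:(lra) eps He) as [N HN].
 destruct (inv_INR_small dl ltac:(lra)) as [N1 HN1]. destruct (INR_archimed 1 M) as [N2 HN2]. lra. rewrite Rmult_1_r in HN2.
 set (n := (N + N1 + N2)%nat). specialize (HN n ltac:(unfold n; lia)). specialize (HN1 n ltac:(unfold n; lia)).
 assert (M <= INR (S n)). { le_mid (INR N2). lra. apply le_INR. unfold n; lia. } note (inv_INR_S n).
 note (Iw_cauchy w s1 s2 dl (/ INR (S n)) M (INR (S n)) Hw H1 H2 ltac:(lra) ltac:(lra) ltac:(lra)) as B.
 rewrite Cmod_minus_sym in B. note (Cmod_triangle3 (Iw dl M w) (Iseq n w) (Cw w)). unfold Iseq at 1 in H3. lra.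
Qed.

Definition strip (w : C) : Prop := -1 < Re w < 1.

Lemma opn_strip : opn strip.
Proof. intros z Hz. exists (Rmin (Re z + 1) (1 - Re z)). unfold strip in *. split. apply Rmin_pos; lra. intros w Hw. destruct (Cmod_RI w z) as [K _].
 min_le (Re z + 1) (1 - Re z).
 assert (A := Rle_lt_trans _ _ _ K Hw). apply Rabs_def2 in A. lra.
Qed.

Lemma hol_Cw : hol strip Cw.
Proof. apply (locunif_hol strip Iseq Cw opn_strip).
 - intros n w _. unfold Iseq, Iw. note (inv_INR_S n). note (INR_S_ge1 n). eexists.
  apply (Cdiff_comp (fun s => CInt (fun x => RtoC (1 - cos (2 * PI * x)) * rcpow x s)%C (/ INR (S n)) (INR (S n))) (fun w => - w - 2)%C).
  apply Cdiff_CInt_rcpow. lra. intros x _. apply (contR_cosk (2 * PI)). apply (Cdiff_minus (fun w => - w)%C (fun _ => RtoC 2)). apply Cdiff_opp, Cdiff_id. apply Cdiff_const.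
 - intros p Hp. unfold strip in Hp. set (r := Rmin (Re p + 1) (1 - Re p) / 2).
  assert (0 < r /\ r <= (Re p + 1) / 2 /\ r <= (1 - Re p) / 2) as (R0 & R1 & R2).
  { unfold r. min_le (Re p + 1) (1 - Re p). assert (0 < Rmin (Re p + 1) (1 - Re p)) by (apply Rmin_pos; lra). lra. }
  exists r. split; auto. intros eps He. destruct (rate_small (Re p - r) (Re p + r) eps) as (x0 & X0 & K); try lra.
  destruct (inv_INR_small x0) as [N HN]. lra. exists N. intros n Hn z Hz. note (inv_INR_S n). note (INR_S_ge1 n). specialize (HN n Hn).
  destruct (Cmod_RI z p) as [Kz _]. assert (A := Rle_lt_trans _ _ _ Kz Hz). apply Rabs_def2 in A.
  eapply Rle_trans. apply (Cw_rate z (Re p - r) (Re p + r)); lra. apply K; lra.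
Qed.

(** * The trapezoidal formula for zeta *)

(** On [[m, m + 1]] the limit of [SQ] is [-2 PI^2 qm m x]. [Psi] below results from integrating
    [(w - 1) w (w + 1) qm m x x^(-w - 2)] by parts until the polynomial factor is exhausted. *)
Definition qm (m x : R) : R := ((x - m) ^ 2 - (x - m)) / 2.
Definition Psi (w : C) (m x : R) : C :=
 ((w - 1) * RtoC (x - m - 1 / 2) * rcpow x (- w) + rcpow x (1 - w) + (w - 1) * w * RtoC (qm m x) * rcpow x (- w - 1))%C.

Lemma RD_Psi w m x : 0 < x -> RD (Psi w m) x (- ((w - 1) * w * (w + 1) * (RtoC (qm m x) * rcpow x (- w - 2))))%C.
Proof. intros Hx. unfold Psi.
 assert (D1 : RD (fun x => (w - 1) * RtoC (x - m - 1 / 2))%C x ((w - 1) * 1)%C).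
 { apply RD_scal. apply (RD_RtoC (fun x => x - m - 1 / 2)). auto_derive; auto. }
 assert (D2 : RD (fun x => (w - 1) * w * RtoC (qm m x))%C x ((w - 1) * w * RtoC (x - m - 1 / 2))%C).
 { apply RD_scal. apply RD_RtoC. unfold qm. auto_derive; auto. simpl. field. }
 eapply RD_eq. apply RD_plus. apply RD_plus.
 apply (RD_mult (fun x => (w - 1) * RtoC (x - m - 1 / 2))%C (fun x => rcpow x (- w))). exact D1. apply RD_rcpow; auto.
 apply RD_rcpow; auto.
 apply (RD_mult (fun x => (w - 1) * w * RtoC (qm m x))%C (fun x => rcpow x (- w - 1))). exact D2. apply RD_rcpow; auto.
 replace (1 - w - 1)%C with (- w)%C by ring. replace (- w - 1 - 1)%C with (- w - 2)%C by ring. ring.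
Qed.

Local Notation qint m w := (fun x => RtoC (qm m x) * rcpow x (- w - 2))%C.

Lemma CInt_qm w m a b : 0 < a <= b ->
 ((w - 1) * w * (w + 1) * CInt (qint m w) a b)%C = (Psi w m a - Psi w m b)%C.
Proof. intros Hab. assert (Cc : contI (qint m w) a b).
 { intros x Hx. apply contR_mult. apply contR_RtoC. apply ex_derive_cont. unfold qm. auto_derive; auto. apply contR_rcpow; lra. }
 rewrite <- CInt_scal by (auto; lra).
 note (CInt_ftc (Psi w m) (fun x => - ((w - 1) * w * (w + 1) * (RtoC (qm m x) * rcpow x (- w - 2))))%C a b ltac:(lra)) as F.
 rewrite CInt_opp in F; try lra. 2:{ intros x Hx; apply contR_scal; auto. }
 replace (Psi w m a - Psi w m b)%C with (- (Psi w m b - Psi w m a))%C by ring. rewrite <- F. ring.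
 intros x Hx. apply RD_Psi; lra. intros x Hx. apply contR_opp, contR_scal; auto.
Qed.

(** [w - 1] times the error of the trapezoidal rule for [x^(-w)] on [[n + 1, n + 2]]; as a
    second-order error it gains two powers of [n]. *)
Definition Jn (n : nat) (w : C) : C :=
 ((w - 1) / 2 * (rcpow (INR (S n)) (- w) + rcpow (INR (S (S n))) (- w)) + (rcpow (INR (S (S n))) (1 - w) - rcpow (INR (S n)) (1 - w)))%C.

Lemma C2_neq0 : RtoC 2 <> 0.
Proof. intros X. apply (f_equal Re) in X. simpl in X. lra. Qed.

Lemma Jn_Psi n w : Jn n w = (Psi w (INR (S n)) (INR (S n) + 1) - Psi w (INR (S n)) (INR (S n)))%C.
Proof. unfold Jn, Psi, qm. rewrite (S_INR (S n)). set (x := INR (S n)).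
 replace (x + 1 - x - 1 / 2) with (1 / 2) by field. replace (((x + 1 - x) ^ 2 - (x + 1 - x)) / 2) with 0 by field.
 replace (x - x - 1 / 2) with (- (1 / 2)) by field. replace (((x - x) ^ 2 - (x - x)) / 2) with 0 by field.
 rewrite RtoC_opp, RtoC_div by lra. field.
Qed.

Lemma qm_bound m x : m <= x <= m + 1 -> Rabs (qm m x) <= 1.
Proof. intros H. unfold qm. apply Rabs_le. split; nra. Qed.

Lemma Jn_bound n w : -2 < Re w -> Cmod (Jn n w) <= Cmod ((w - 1) * w * (w + 1)) * Rpower (INR (S n)) (- Re w - 2).
Proof. intros Hw. rewrite Jn_Psi. note (INR_S_ge1 n). set (m := INR (S n)) in *.
 eapply Rle_trans. apply (RD_mean_ineq (Psi w m) (fun x => - ((w - 1) * w * (w + 1) * (RtoC (qm m x) * rcpow x (- w - 2))))%C m (m + 1)) with (M := Cmod ((w - 1) * w * (w + 1)) * Rpower m (- Re w - 2)). lra.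
 intros x Hx. apply RD_Psi; lra.
 - intros x Hx. rewrite Cmod_opp, Cmod_mult. mul_le_l. apply Cmod_ge_0. rewrite Cmod_mult, Cmod_R, Cmod_rcpow, Re_mw2.
  note (qm_bound m x Hx). note (Rabs_pos (qm m x)). note (Rpower_pos x (- Re w - 2)).
  assert (Rpower x (- Re w - 2) <= Rpower m (- Re w - 2)) by (apply Rpower_antimono; lra). nra.
 - right. ring.
Qed.

Lemma Cser_shift f L : Cser f L -> Cser (fun n => f (S n)) (L - f 0%nat)%C.
Proof. intros H eps He. destruct (H eps He) as [N HN]. exists N. intros n Hn. specialize (HN (S n) ltac:(lia)). rewrite Csum_S_l in HN.
 replace (Csum (fun n => f (S n)) n - (L - f 0%nat))%C with (f 0%nat + Csum (fun k => f (S k)) n - L)%C by ring. auto.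
Qed.

(** For [Re w > 3/2] the sum is computed from the Dirichlet series, and both sides are holomorphic
    for [Re w > -1]. The index 3 makes [Wk] available there, as [3/2 - 3 < -1]. *)
Lemma Jsum_Cser w : -1 < Re w -> Cser (fun n => Jn n w) (Wk 3 w - (w + 1) / 2)%C.
Proof. assert (Ex : forall w, -1 < Re w -> Cser (fun n => Jn n w) (Clim_ser (fun n => Jn n w))).
 { intros v Hv. destruct (Cser_exists (fun n => Jn n v) (Cmod ((v - 1) * v * (v + 1))) (Re v + 2)) as [L HL]. lra. apply Cmod_ge_0.
  intros n. replace (- (Re v + 2)) with (- Re v - 2) by ring. apply Jn_bound; lra. eapply Clim_ser_spec; eauto. }
 intros Hw. replace (Wk 3 w - (w + 1) / 2)%C with (Clim_ser (fun n => Jn n w)). auto.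
 apply Ceq_minus. replace (Clim_ser (fun n => Jn n w) - (Wk 3 w - (w + 1) / 2))%C with (Clim_ser (fun n => Jn n w) + (w + 1) / 2 - Wk 3 w)%C by ring.
 destruct (Wk_good 3) as (A1 & _ & A3).
 apply (identity_Hp (fun w => Clim_ser (fun n => Jn n w) + (w + 1) / 2 - Wk 3 w)%C (-1) (3 / 2)); auto.
 - apply hol_minus. apply hol_plus.
  + apply (locunif_hol (Hp (-1)) (fun N w => Csum (fun n => Jn n w) N)). apply opn_Hp.
  * intros N. apply (hol_Csum _ Jn). intros n. unfold Jn.
  assert (Hl : forall x, hol (Hp (-1)) (fun w => rcpow x (- w))) by (intros; apply hol_rcpow, hol_opp, hol_id).
  assert (Hr : forall x, hol (Hp (-1)) (fun w => rcpow x (1 - w))) by (intros; apply hol_rcpow, (hol_minus _ (fun _ => RtoC 1)); [apply hol_const|apply hol_id]).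
  apply hol_plus. apply hol_mult. apply (hol_mult _ (fun w => w - 1)%C (fun _ => / 2)%C). intros z _; eexists; apply Cdiff_sub_const. apply hol_const. apply hol_plus; auto. apply hol_minus; auto.
  * apply (Weierstrass_ser _ Jn). intros p Hp. assert (Hp' : -1 < Re p) by exact Hp. set (r := (Re p + 1) / 2).
  exists r, ((Cmod p + r + 1) * (Cmod p + r + 1) * (Cmod p + r + 1)), (Re p - r + 2). note (Cmod_ge_0 p). assert (0 < r) by (unfold r; lra).
  split; auto. split. repeat apply Rmult_le_pos; lra. split. unfold r; lra.
  intros z Hz n. destruct (Cmod_RI z p) as [Kz _]. assert (A := Rle_lt_trans _ _ _ Kz Hz). apply Rabs_def2 in A.
  assert (r < Re p + 1) by (unfold r; lra).
  le_via Jn_bound. lra. apply Rmult_le_compat. apply Cmod_ge_0. pos.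
  -- note (Cmod_triangle_rev z p). rewrite !Cmod_mult. note (Cmod_triangle_minus z 1). note (Cmod_triangle z 1). rewrite Cmod_1 in *.
  note (Cmod_ge_0 z). note (Cmod_ge_0 (z - 1)). note (Cmod_ge_0 (z + 1)). repeat apply Rmult_le_compat; try lra. pos.
  -- apply Rpower_mono_exp. apply INR_S_ge1. lra.
  + apply (hol_mult _ (fun w => w + 1)%C (fun _ => / 2)%C). apply hol_plus. apply hol_id. apply hol_const. apply hol_const.
  + apply (hol_sub (Hp (3 / 2 - INR 3))); auto. intros z. unfold Hp. replace (INR 3) with 3 by (simpl; ring). lra.
 - intros s Hs. rewrite A3 by auto. note (Ex s ltac:(lra)) as E1. note (zD_Cser s ltac:(lra)) as Z1. note (Cser_shift _ _ Z1) as Z2.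
  cbv beta in Z2. change (INR 1) with 1 in Z2. rewrite rcpow_base1 in Z2.
  assert (S2 : Cser (fun n => (rcpow (INR (S (S n))) (1 - s) - rcpow (INR (S n)) (1 - s))%C) (-(1))%C).
  { intros eps He. destruct (Rpower_small (Re s) eps) as [N HN]; try lra. exists N. intros n Hn.
  rewrite (Csum_telescope (fun n => rcpow (INR (S n)) (1 - s))). change (INR 1) with 1. rewrite rcpow_base1.
  replace (rcpow (INR (S n)) (1 - s) - 1 - - (1))%C with (rcpow (INR (S n)) (1 - s)) by ring. rewrite Cmod_rcpow. unfold Cminus. rewrite re_plus, re_opp, re_RtoC. apply HN; auto. }
  note (Cser_plus _ _ _ _ (Cser_scal ((s - 1) / 2) _ _ (Cser_plus _ _ _ _ Z1 Z2)) S2) as S3.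
  rewrite (Cser_unique _ _ _ E1 S3). field.
Qed.

(** * The functional equation *)

Lemma CInt_subst_lin f k a b : 0 < k -> a <= b -> contI f (k * a) (k * b) -> CInt f (k * a) (k * b) = CInt (fun y => RtoC k * f (k * y)%R)%C a b.
Proof. intros Hk Hab Hf. note (RInt_comp_lin (V := C_RN) f k 0 a b) as E.
 rewrite !Rplus_0_r in E. unfold CInt. rewrite <- E. 2:{ apply CInt_ex; auto. mul_le_l; lra. }
 apply (CInt_ext (fun y => @scal R_Ring C_RN k (f (k * y + 0))) (fun y => RtoC k * f (k * y)%R)%C a b Hab).
 intros x _. rewrite Rplus_0_r. apply scal_R_Cmult.
Qed.

Lemma rcpow_real_opp2 k : 0 < k -> rcpow k (- (2)) = RtoC (/ k ^ 2).
Proof. intros Hk. replace (2 : C) with (1 + 1)%C by Ceq. rewrite rcpow_opp, rcpow_plus, rcpow_1 by auto. rewrite <- RtoC_mult, <- RtoC_inv by nra. f_equal. f_equal. ring.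
Qed.

Lemma contR_SQ K x : contR (fun t => RtoC (SQ K t)) x.
Proof. apply contR_RtoC. eapply is_derive_continuous, is_derive_SQ. Qed.

Local Notation SQint K w := (fun x => RtoC (SQ K x) * rcpow x (- w - 2))%C.

(** Substituting [k x] for [x] in the [k]-th term produces the factor [k^(w - 1)], a term of the
    Dirichlet series of [zeta(1 - w)]. *)
Lemma SQ_int_terms w a b K : 0 < a <= b ->
 CInt (SQint K w) a b = Csum (fun k => rcpow (INR (S k)) (w - 1) * Iw (INR (S k) * a) (INR (S k) * b) w)%C K.
Proof. intros Hab. induction K.
 - cbn [Csum]. rewrite (CInt_ext _ (fun _ => 0 * 0)%C); try lra. 2:{ intros x _. unfold SQ; simpl. ring. }
  rewrite CInt_scal; try lra. ring. intros x _. apply contR_const.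
 - cbn [Csum]. rewrite <- IHK.
  set (k := INR (S K)) in *. assert (Hk : 0 < k) by apply INR_S_pos.
  rewrite (CInt_ext (fun x => RtoC (SQ (S K) x) * rcpow x (- w - 2))%C (fun x => RtoC (SQ K x) * rcpow x (- w - 2) + RtoC ((1 - cos (2 * PI * k * x)) / k ^ 2) * rcpow x (- w - 2))%C); try lra.
  2:{ intros x _. change (SQ (S K) x) with (SQ K x + (1 - cos (2 * PI * k * x)) / k ^ 2). rewrite RtoC_plus. ring. }
  assert (C1 : contI (fun x => RtoC ((1 - cos (2 * PI * k * x)) / k ^ 2) * rcpow x (- w - 2))%C a b).
  { intros x Hx. apply contR_mult. apply contR_RtoC. apply ex_derive_cont. auto_derive. nra. apply contR_rcpow; lra. }
  rewrite CInt_plus; auto; try lra. 2:{ intros x Hx. apply contR_mult. apply contR_SQ. apply contR_rcpow; lra. }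
  f_equal. unfold Iw. assert (0 < k * a) by pos.
  rewrite CInt_subst_lin; try lra. 2:{ apply Iw_contI; auto. }
  rewrite <- CInt_scal; try lra.
  + apply CInt_ext; try lra. intros x Hx. rewrite rcpow_mult_base by lra.
  replace (2 * PI * (k * x)) with (2 * PI * k * x) by ring. unfold Rdiv. rewrite RtoC_mult.
  replace (rcpow k (w - 1) * (k * (RtoC (1 - cos (2 * PI * k * x)) * (rcpow k (- w - 2) * rcpow x (- w - 2)))))%C with
  (rcpow k (w - 1) * RtoC k * rcpow k (- w - 2) * RtoC (1 - cos (2 * PI * k * x)) * rcpow x (- w - 2))%C by ring.
  assert (EK : (rcpow k (w - 1) * RtoC k * rcpow k (- w - 2))%C = RtoC (/ k ^ 2)).
  { rewrite <- rcpow_real_opp2 by auto. replace (- (2))%C with (w - 1 + 1 + (- w - 2))%C by ring. rewrite !rcpow_plus, rcpow_1 by auto. ring. }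
  rewrite EK. ring.
  + intros x Hx. apply contR_scal. apply contR_mult. apply contR_ext with (fun y => RtoC (1 - cos (2 * PI * k * y))). intros y. do 2 f_equal. f_equal. ring. apply (contR_cosk (2 * PI * k)).
  apply contR_ext_loc with (fun y => rcpow k (- w - 2) * rcpow y (- w - 2))%C; [|apply contR_scal; apply contR_rcpow; lra].
  exists x. split. lra. intros y Hy. apply Rabs_def2 in Hy. rewrite rcpow_mult_base by lra. reflexivity.
Qed.

Lemma CInt_unit_pieces f N : contI f 1 (INR (S N)) -> CInt f 1 (INR (S N)) = Csum (fun n => CInt f (INR (S n)) (INR (S (S n)))) N.
Proof. induction N; intros H. change (INR 1) with 1. cbn [Csum]. apply CInt_point. cbn [Csum].
 note (INR_S_ge1 N). assert (INR (S N) <= INR (S (S N))) by (apply le_INR; lia). rewrite <- IHN. apply CInt_Chasles; auto.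
 eapply contI_sub; eauto; lra.
Qed.

(** The limit, as [K] grows, of the integral of [SQ K] against [x^(-w - 2)] over
    [[1/(N + 1), N + 1]], cut at the integers, where the periodic quadratic changes its formula. *)
Definition Bpc (N : nat) (w : C) : C :=
 (- (2 * PI * PI) * (CInt (qint 0 w) (/ INR (S N)) 1 +
  Csum (fun n => CInt (qint (INR (S n)) w) (INR (S n)) (INR (S (S n)))) N))%C.

Lemma contR_qm m x : contR (fun t => RtoC (qm m t)) x.
Proof. apply contR_RtoC. apply ex_derive_cont. unfold qm. auto_derive; auto. Qed.

Lemma piece_bound K w m a b E : (1 <= K)%nat -> 0 < a <= b -> INR m <= a -> b <= INR m + 1 -> 0 <= E -> (forall x, a <= x <= b -> Cmod (rcpow x (- w - 2)) <= E) ->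
 Cmod (CInt (SQint K w) a b - (- (2 * PI * PI)) * CInt (qint (INR m) w) a b) <= 2 / INR K * E.
Proof. intros HK Hab Hm1 Hm2 PE HE.
 assert (C1 : contI (SQint K w) a b) by (intros x Hx; apply contR_mult; [apply contR_SQ|apply contR_rcpow; lra]).
 assert (C2 : contI (qint (INR m) w) a b) by (intros x Hx; apply contR_mult; [apply contR_qm|apply contR_rcpow; lra]).
 rewrite <- CInt_scal by (auto; lra). rewrite <- CInt_minus; auto; try lra. 2:{ intros x Hx; apply contR_scal; auto. }
 assert (PK : 0 <= 2 / INR K). { apply Rdiv_le_0_compat. lra. apply lt_0_INR; lia. }
 eapply Rle_trans. apply CInt_bound with (M := 2 / INR K * E); try lra.
 - intros x Hx. apply contR_minus; auto. apply contR_scal; auto.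
 - intros x Hx. replace (RtoC (SQ K x) * rcpow x (- w - 2) - - (2 * PI * PI) * (RtoC (qm (INR m) x) * rcpow x (- w - 2)))%C with
  (RtoC (SQ K x - PI ^ 2 * ((x - INR m) - (x - INR m) ^ 2)) * rcpow x (- w - 2))%C.
  2:{ replace (SQ K x - PI ^ 2 * ((x - INR m) - (x - INR m) ^ 2)) with (SQ K x + 2 * PI * PI * qm (INR m) x) by (unfold qm; field). rewrite RtoC_plus, !RtoC_mult. ring. }
  rewrite Cmod_mult, Cmod_R. apply Rmult_le_compat; auto using Rabs_pos, Cmod_ge_0.
  replace (SQ K x) with (SQ K (x - INR m)). apply SQ_series; auto; lra. rewrite <- (SQ_period K (x - INR m) m). f_equal; ring.
 - assert (b - a <= 1) by lra. assert (0 <= 2 / INR K * E) by (apply Rmult_le_pos; auto). nra.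
Qed.

(** [E] depends on the cut-off [N], so [K] has to be sent to infinity with [N] fixed. *)
Lemma SQ_int_pieces N w : exists E, 0 <= E /\ forall K, (1 <= K)%nat ->
 Cmod (CInt (SQint K w) (/ INR (S N)) (INR (S N)) - Bpc N w) <= E / INR K.
Proof. note (inv_INR_S N) as HN. note (INR_S_ge1 N) as HN1.
 destruct (contI_bounded (fun x => rcpow x (- w - 2)) (/ INR (S N)) (INR (S N))) as (E & PE & HE).
 { intros x Hx. apply contR_rcpow. lra. }
 exists (2 * E * INR (S N)). split. pos. intros K HK. assert (PK : 0 < INR K) by (apply lt_0_INR; lia).
 assert (C1 : contI (SQint K w) (/ INR (S N)) (INR (S N))) by (intros x Hx; apply contR_mult; [apply contR_SQ|apply contR_rcpow; lra]).
 rewrite (CInt_Chasles _ (/ INR (S N)) 1 (INR (S N))) by (auto; lra). rewrite CInt_unit_pieces by (eapply contI_sub; eauto; lra).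
 unfold Bpc. rewrite Cmult_plus_distr_l, <- Csum_scal.
 match goal with |- Cmod (?a + Csum ?f N - (?b + Csum ?g N)) <= _ => replace (a + Csum f N - (b + Csum g N))%C with ((a - b) + Csum (fun n => f n - g n) N)%C end.
 2:{ rewrite (Csum_ext (fun n => CInt (SQint K w) (INR (S n)) (INR (S (S n))) - - (2 * PI * PI) * CInt (qint (INR (S n)) w) (INR (S n)) (INR (S (S n))))%C
  (fun n => CInt (SQint K w) (INR (S n)) (INR (S (S n))) + -(1) * (- (2 * PI * PI) * CInt (qint (INR (S n)) w) (INR (S n)) (INR (S (S n)))))%C) by (intros; ring).
  rewrite Csum_plus, Csum_scal. ring. }
 le_via Cmod_triangle.
 assert (B0 : Cmod (CInt (SQint K w) (/ INR (S N)) 1 - - (2 * PI * PI) * CInt (qint 0 w) (/ INR (S N)) 1) <= 2 / INR K * E).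
 { apply (piece_bound K w 0 (/ INR (S N)) 1 E); auto; try (change (INR 0) with 0; lra). intros; apply HE; lra. }
 assert (BS : forall n, (n <= N)%nat -> Cmod (Csum (fun n => CInt (SQint K w) (INR (S n)) (INR (S (S n))) - - (2 * PI * PI) * CInt (qint (INR (S n)) w) (INR (S n)) (INR (S (S n))))%C n) <= INR n * (2 / INR K * E)).
 { induction n; intros Hn. cbn [Csum]. rewrite Cmod_0. change (INR 0) with 0. lra. cbn [Csum]. le_via Cmod_triangle. replace (INR (S n) * (2 / INR K * E)) with (INR n * (2 / INR K * E) + 2 / INR K * E) by (rewrite S_INR; ring). apply Rplus_le_compat. apply IHn; lia.
  note (INR_S_ge1 n). assert (INR (S (S n)) <= INR (S N)) by (apply le_INR; lia). note (S_INR (S n)). apply (piece_bound K w (S n)); auto; try lra. intros; apply HE; lra. }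
 specialize (BS N (Nat.le_refl N)).
 le_mid (2 / INR K * E + INR N * (2 / INR K * E)). lra. right. rewrite S_INR. field. lra.
Qed.

Lemma Bpc_eq N w : ((w - 1) * w * (w + 1) * Bpc N w)%C = (2 * PI * PI * ((w + 1) / 2 - Psi w 0 (/ INR (S N)) + Csum (fun n => Jn n w) N))%C.
Proof. unfold Bpc. note (inv_INR_S N).
 transitivity (- (2 * PI * PI) * ((w - 1) * w * (w + 1) * CInt (qint 0 w) (/ INR (S N)) 1 +
  Csum (fun n => (w - 1) * w * (w + 1) * CInt (qint (INR (S n)) w) (INR (S n)) (INR (S (S n)))) N))%C.
 { rewrite Csum_scal. ring. }
 rewrite CInt_qm by lra. rewrite (Csum_ext _ (fun n => -(1) * Jn n w)%C).
 2:{ intros n _. note (INR_S_ge1 n). rewrite CInt_qm. rewrite Jn_Psi, <- S_INR. ring. split. lra. apply le_INR; lia. }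
 rewrite Csum_scal. replace (Psi w 0 1) with ((w + 1) / 2)%C. ring.
 unfold Psi, qm. rewrite !rcpow_base1. replace (1 - 0 - 1 / 2) with (1 / 2) by field. replace (((1 - 0) ^ 2 - (1 - 0)) / 2) with 0 by field. rewrite RtoC_div by lra. field.
Qed.

(** For [Re w < 0] this boundary term disappears as the lower cut-off tends to 0. *)
Lemma Psi0_bound w dl : 0 < dl <= 1 -> Cmod (Psi w 0 dl) <= (Cmod (w - 1) + 1 + Cmod (w - 1) * Cmod w) * Rpower dl (- Re w).
Proof. intros Hd. unfold Psi. le_via Cmod_triangle. le_via Rplus_le_compat_r. apply Cmod_triangle.
 rewrite !Cmod_mult, !Cmod_R, !Cmod_rcpow. 
 assert (X1 : Re (1 - w)%C = 1 + - Re w) by (unfold Cminus; rewrite re_plus, re_opp, re_RtoC; ring).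
 assert (X2 : Re (- w - 1)%C = - Re w + - (1)) by (unfold Cminus; rewrite re_plus, !re_opp, re_RtoC; ring).
 rewrite X1, X2, re_opp.
 note (Cmod_ge_0 (w - 1)). note (Cmod_ge_0 w). set (P := Rpower dl (- Re w)). assert (0 < P) by apply Rpower_pos.
 assert (E1 : Rpower dl (1 + - Re w) = dl * P) by (rewrite Rpower_plus, Rpower_1; auto; lra).
 assert (E2 : dl * Rpower dl (- Re w + - (1)) = P).
 { rewrite Rpower_plus. replace (Rpower dl (- (1))) with (/ dl). unfold P. field. lra. rewrite Rpower_Ropp, Rpower_1; auto; lra. }
 assert (E3 : Rabs (dl - 0 - 1 / 2) <= 1) by (apply Rabs_le; lra).
 assert (E4 : Rabs (qm 0 dl) <= dl) by (unfold qm; apply Rabs_le; split; nra).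
 assert (F3 : Cmod (w - 1) * Rabs (dl - 0 - 1 / 2) * P <= Cmod (w - 1) * P). { mul_le_r. lra. note (Rabs_pos (dl - 0 - 1 / 2)). nra. }
 assert (F4 : Cmod (w - 1) * Cmod w * Rabs (qm 0 dl) * Rpower dl (- Re w + - (1)) <= Cmod (w - 1) * Cmod w * P).
 { rewrite <- E2. rewrite (Rmult_assoc (Cmod (w - 1) * Cmod w)). mul_le_l. apply Rmult_le_pos; auto. mul_le_r. pos. auto. }
 rewrite E1. fold P. nra.
Qed.

(** The integral of the periodic quadratic against [x^(-w - 2)] is evaluated in two ways: by its
    Fourier series it is [Cw w zeta(1 - w)], and on unit intervals, by the trapezoidal formula, a
    multiple of [(w - 1) zeta(w)]. For [Re w < 0] the Dirichlet series of [zeta(1 - w)] converges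
    absolutely and the boundary term at 0 vanishes. *)
Lemma func_eq_left w : -1 < Re w < 0 -> Wk 3 w = ((w - 1) * w * (w + 1) / (2 * PI * PI) * Cw w * zD (1 - w))%C.
Proof. intros Hw. set (P := ((w - 1) * w * (w + 1) / (2 * PI * PI))%C).
 note PI_RGT_0 as PP. assert (NPI : RtoC PI <> 0) by (RtoC_nz). note C2_neq0 as N2.
 set (sg := Re w) in *. set (Bd := rate sg sg 1 1).
 assert (HBd : forall a b, 0 < a <= b -> Cmod (Iw a b w) <= Bd) by (intros; apply (Iw_bounded w sg sg); unfold sg in *; lra).
 assert (HCw : Cmod (Cw w) <= Bd).
 { note (Cw_rate w sg sg 1 1) as K. unfold Iw in K. rewrite CInt_point in K. replace (0 - Cw w)%C with (- Cw w)%C in K by ring. rewrite Cmod_opp in K. apply K; unfold sg in *; lra. }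
 note (Cmod_ge_0 (Cw w)) as PC. assert (PB : 0 <= Bd) by lra.
 assert (Ha : forall k, Cmod (rcpow (INR (S k)) (w - 1)) = Rpower (INR (S k)) (- (1 - sg))).
 { intros k. rewrite Cmod_rcpow. unfold Cminus. rewrite re_plus, re_opp, re_RtoC. f_equal. unfold sg. ring. }
 assert (Hz : Cser (fun k => rcpow (INR (S k)) (w - 1)) (zD (1 - w))).
 { eapply Cser_ext; [|apply zD_Cser]. intros n. cbv beta. f_equal. ring. unfold Cminus. rewrite re_plus, re_opp, re_RtoC. unfold sg in *; lra. }
 assert (PZ := Cmod_ge_0 (zD (1 - w))). assert (PP' := Cmod_ge_0 P).
 (* [Tot] adds up the final errors: one [eps] from the cut-offs, three from comparing sum and
    integral, and [Cmod (Cw w)] from the Dirichlet series, the last two multiplied by [Cmod P]. *)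
 set (Tot := 1 + Cmod P * (3 + Cmod (Cw w))). assert (HTot : 0 < Tot) by (unfold Tot; nra).
 apply Cmod_small_eq. intros eps0 He0. set (eps := eps0 / Tot). assert (He : 0 < eps) by (apply Rdiv_lt_0_compat; auto).
 replace eps0 with (Tot * eps) by (unfold eps; field; lra).
 (* K0 controls the tail of the Dirichlet series, then N the cut-offs, then K the Fourier partial sum *)
 assert (Hsg : 1 < 1 - sg) by lra.
 destruct (Rpower_small (1 - sg) (eps / (2 * Bd * Ksig (1 - sg) + 1)) Hsg) as [K0 HK0].
 { apply Rdiv_lt_0_compat; auto. note (Ksig_pos _ Hsg). assert (0 <= 2 * Bd * Ksig (1 - sg)) by (apply Rmult_le_pos; [apply Rmult_le_pos|]; lra). lra. }
 destruct (rate_small sg sg (eps / (INR K0 + 1))) as (x0 & X0 & Hr); try lra. { apply Rdiv_lt_0_compat; auto. note (pos_INR K0); lra. }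
 destruct (inv_INR_small (x0 / INR (S K0))) as [N1 HN1]. { apply Rdiv_lt_0_compat. lra. apply INR_S_pos. }
 destruct (Jsum_Cser w ltac:(unfold sg in *; lra) (eps / 2)) as [N2' HN2]. lra.
 destruct (Rpower_small0 (- sg) (eps / 2 / (Cmod (w - 1) + 1 + Cmod (w - 1) * Cmod w))) as (y0 & Y0 & Hy); try lra.
 { note (Cmod_ge_0 (w - 1)). note (Cmod_ge_0 w). apply Rdiv_lt_0_compat; nra. }
 destruct (inv_INR_small y0 Y0) as [N3 HN3].
 set (N := (N1 + N2' + N3)%nat). specialize (HN1 N ltac:(unfold N; lia)). specialize (HN2 N ltac:(unfold N; lia)). specialize (HN3 N ltac:(unfold N; lia)).
 note (inv_INR_S N) as IN. note (INR_S_ge1 N) as IN1.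
 assert (A1 : Cmod (Wk 3 w - P * Bpc N w) <= eps).
 { assert (E : (P * Bpc N w)%C = ((w + 1) / 2 - Psi w 0 (/ INR (S N)) + Csum (fun n => Jn n w) N)%C).
  { unfold P. replace ((w - 1) * w * (w + 1) / (2 * PI * PI) * Bpc N w)%C with (((w - 1) * w * (w + 1) * Bpc N w) / (2 * PI * PI))%C by (field; auto). rewrite Bpc_eq. field. auto. }
  rewrite E. match goal with |- Cmod ?x <= _ => replace x with (Psi w 0 (/ INR (S N)) - (Csum (fun n => Jn n w) N - (Wk 3 w - (w + 1) / 2)))%C by ring end.
  le_via Cmod_triangle_minus. note (Psi0_bound w (/ INR (S N)) IN) as B. fold sg in B. specialize (Hy (/ INR (S N)) ltac:(lra)).
  note (Cmod_ge_0 (w - 1)). note (Cmod_ge_0 w). set (D := Cmod (w - 1) + 1 + Cmod (w - 1) * Cmod w) in *. assert (0 < D) by (unfold D; nra).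
  assert (D * Rpower (/ INR (S N)) (- sg) <= eps / 2). { le_mid (D * (eps / 2 / D)). mul_le_l; lra. right; field; lra. } lra. }
 destruct (SQ_int_pieces N w) as (E & PE & HE).
 destruct (INR_archimed 1 (E / eps)) as [K1 HK1]. lra. rewrite Rmult_1_r in HK1.
 destruct (Hz eps He) as [K2 HK2]. set (K := (K0 + (K1 + K2 + 1))%nat). specialize (HK2 K ltac:(unfold K; lia)).
 assert (PK : 0 < INR K) by (apply lt_0_INR; unfold K; lia).
 assert (A2 : Cmod (CInt (SQint K w) (/ INR (S N)) (INR (S N)) - Bpc N w) <= eps).
 { le_via HE. unfold K; lia. apply Rmult_le_reg_r with (INR K); auto. unfold Rdiv at 1. rewrite Rmult_assoc, Rinv_l by lra.
  assert (INR K1 <= INR K) by (apply le_INR; unfold K; lia). apply Rmult_lt_compat_r with (r := eps) in HK1; auto. unfold Rdiv in HK1. rewrite Rmult_assoc, Rinv_l in HK1 by lra. nra. }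
 rewrite SQ_int_terms in A2 by lra.
 set (ff := fun k => (rcpow (INR (S k)) (w - 1) * (Iw (INR (S k) * / INR (S N)) (INR (S k) * INR (S N)) w - Cw w))%C).
 assert (Ipos : forall k, 0 < INR (S k) * / INR (S N) <= INR (S k) * INR (S N)).
 { intros k. note (INR_S_pos k). split. pos. mul_le_l; lra. }
 assert (Hff : forall k, Cmod (ff k) <= 2 * Bd * Rpower (INR (S k)) (- (1 - sg))).
 { intros k. unfold ff. rewrite Cmod_mult, Ha, Rmult_comm. mul_le_r. pos. le_via Cmod_triangle_minus. specialize (HBd _ _ (Ipos k)). lra. }
 (* The first [K0] terms are small because [N] was chosen after [K0]; the remaining ones are
    controlled by the tail of the Dirichlet series, uniformly in [K]. *)
 assert (A3 : Cmod (Csum ff K) <= 2 * eps).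
 { assert (T1 : Cmod (Csum ff K - Csum ff K0) <= eps).
  { unfold K. eapply Rle_trans. apply (Csum_tail ff (2 * Bd) (1 - sg)); auto. lra. specialize (HK0 K0 (Nat.le_refl _)). note (Ksig_pos _ Hsg).
  match goal with |- _ * (_ - ?z) <= _ => assert (0 < z) by apply Rpower_pos end. note (Rpower_pos (INR (S K0)) (1 - (1 - sg))).
  assert (Q : 0 <= 2 * Bd * Ksig (1 - sg)) by (apply Rmult_le_pos; [apply Rmult_le_pos|]; lra). set (q := 2 * Bd * Ksig (1 - sg)) in *.
  le_mid (q * Rpower (INR (S K0)) (1 - (1 - sg))). mul_le_l; lra.
  le_mid ((q + 1) * (eps / (q + 1))). apply Rmult_le_compat; lra. right; field; lra. }
  assert (T2 : forall k, (k <= K0)%nat -> Cmod (Csum ff k) <= INR k * (eps / (INR K0 + 1))).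
  { induction k; intros Hk. cbn [Csum]. rewrite Cmod_0. change (INR 0) with 0. lra. cbn [Csum]. le_via Cmod_triangle. replace (INR (S k) * (eps / (INR K0 + 1))) with (INR k * (eps / (INR K0 + 1)) + eps / (INR K0 + 1)) by (rewrite S_INR; ring). apply Rplus_le_compat. apply IHk; lia.
  unfold ff. rewrite Cmod_mult, Ha. note (INR_S_ge1 k).
  assert (Rpower (INR (S k)) (- (1 - sg)) <= 1). { apply Rpower_le_1; lra. }
  assert (KK : INR (S k) * / INR (S N) <= x0).
  { assert (INR (S k) <= INR (S K0)) by (apply le_INR; lia). le_mid (INR (S K0) * (x0 / INR (S K0))). apply Rmult_le_compat; lra. right; field. note (INR_S_pos K0); lra. }
  assert (K3 : 0 < / (INR (S k) * INR (S N)) <= x0).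
  { assert (0 < INR (S k) * INR (S N)) by pos. split. apply Rinv_0_lt_compat; auto. rewrite Rinv_mult. assert (/ INR (S k) <= 1) by apply inv_INR_S. assert (0 < / INR (S k)) by apply inv_INR_S. nra. }
  assert (Cmod (Iw (INR (S k) * / INR (S N)) (INR (S k) * INR (S N)) w - Cw w) <= eps / (INR K0 + 1)).
  { eapply Rle_trans. apply (Cw_rate w sg sg); unfold sg in *; try lra. specialize (Ipos k); lra. nra. apply Hr. specialize (Ipos k); lra. auto. }
  note (Cmod_ge_0 (Iw (INR (S k) * / INR (S N)) (INR (S k) * INR (S N)) w - Cw w)). note (Rpower_pos (INR (S k)) (- (1 - sg))). nra. }
  specialize (T2 K0 (Nat.le_refl _)). assert (INR K0 * (eps / (INR K0 + 1)) <= eps).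
  { note (pos_INR K0). assert (0 < eps / (INR K0 + 1)) by pos. le_mid ((INR K0 + 1) * (eps / (INR K0 + 1))). nra. right; field; lra. }
  replace (Csum ff K) with ((Csum ff K - Csum ff K0) + Csum ff K0)%C by ring. le_via Cmod_triangle. lra. }
 assert (E3 : Csum (fun k => rcpow (INR (S k)) (w - 1) * Iw (INR (S k) * / INR (S N)) (INR (S k) * INR (S N)) w)%C K = (Csum ff K + Cw w * Csum (fun k => rcpow (INR (S k)) (w - 1)) K)%C).
 { rewrite <- Csum_scal, <- Csum_plus. apply Csum_ext. intros k _. unfold ff. ring. }
 rewrite E3 in A2.
 set (X1 := Csum (fun k => rcpow (INR (S k)) (w - 1)) K) in *.
 replace (Wk 3 w - P * Cw w * zD (1 - w))%C with ((Wk 3 w - P * Bpc N w) - P * ((Csum ff K + Cw w * X1 - Bpc N w) - Csum ff K) + P * Cw w * (X1 - zD (1 - w)))%C by ring.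
 le_via Cmod_triangle. le_via Rplus_le_compat_r. apply Cmod_triangle_minus. rewrite !Cmod_mult.
 assert (Cmod (Csum ff K + Cw w * X1 - Bpc N w - Csum ff K) <= 3 * eps) by (eapply Rle_trans; [apply Cmod_triangle_minus|lra]).
 assert (Cmod P * Cmod (Csum ff K + Cw w * X1 - Bpc N w - Csum ff K) <= Cmod P * (3 * eps)) by (mul_le_l; auto).
 assert (Cmod P * Cmod (Cw w) * Cmod (X1 - zD (1 - w)) <= Cmod P * Cmod (Cw w) * eps) by (mul_le_l; auto; apply Rmult_le_pos; auto).
 unfold Tot. nra.
Qed.

Lemma Cdiff_conj f z l : Cdiff f (Cconj z) l -> Cdiff (fun w => Cconj (f (Cconj w))) z (Cconj l).
Proof. intros H eps He. destruct (H eps He) as (d & D & K). exists d; split; auto. intros w _ Hw.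
 assert (E : Cmod (Cconj w - Cconj z) = Cmod (w - z)) by (rewrite <- Cminus_conj, Cmod_conj; auto).
 rewrite <- E in Hw |- *. specialize (K (Cconj w) I Hw). rewrite <- Cmod_conj in K.
 rewrite !Cminus_conj, Cmult_conj, !Cminus_conj, !Cconj_conj in K. exact K.
Qed.

(** The factor usually written with the Gamma function, here through an absolutely convergent
    integral. *)
Definition chi (w : C) : C := (w * (w + 1) / (2 * PI * PI) * Cw w)%C.
(** By reflection this is [zeta(1 - w)], but evaluated at a point that lies in the upper half-plane
    together with [w]. On the critical line that point is [w] itself. *)
Definition zrefl (w : C) : C := Cconj (zeta (Cconj (1 - w))).

Lemma hol_zrefl : hol UH zrefl.
Proof. intros w Hw. assert (U1 : UH (Cconj (1 - w)%C)). { unfold UH in *. rewrite im_conj. unfold Cminus. rewrite im_plus, im_opp, im_RtoC. lra. }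
 destruct (zeta_hol_UH _ U1) as [l Hl]. eexists. apply (Cdiff_comp (fun z => Cconj (zeta (Cconj z))) (fun w => 1 - w)%C).
 apply Cdiff_conj. exact Hl. apply (Cdiff_minus (fun _ => RtoC 1)). apply Cdiff_const. apply Cdiff_id.
Qed.

Lemma hol_chi : hol strip chi.
Proof. unfold chi. apply (hol_mult _ (fun w => w * (w + 1) / (2 * PI * PI))%C); [|apply hol_Cw].
 apply (hol_mult _ (fun w => w * (w + 1))%C (fun _ => / (2 * PI * PI))%C); [|apply hol_const]. apply hol_mult. apply hol_id. apply hol_plus. apply hol_id. apply hol_const.
Qed.

Lemma zD_conj s : 1 < Re s -> Cconj (zD s) = zD (Cconj s).
Proof. intros H. apply Cser_unique with (fun n => rcpow (INR (S n)) (- Cconj s)).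
 - note (zD_Cser s H) as Z. intros eps He. destruct (Z eps He) as [N HN]. exists N. intros n Hn. specialize (HN n Hn).
  rewrite <- Cmod_conj in HN. rewrite Cminus_conj in HN. replace (Csum (fun n => rcpow (INR (S n)) (- Cconj s)) n) with (Cconj (Csum (fun n => rcpow (INR (S n)) (- s)) n)). auto.
  clear. induction n. simpl. Ceq. cbn [Csum]. rewrite Cplus_conj, IHn, Cconj_rcpow, Copp_conj. auto.
 - apply zD_Cser. rewrite re_conj. auto.
Qed.

Lemma func_eq_strip w : UH w -> -1 < Re w < 0 -> zeta w = (chi w * zrefl w)%C.
Proof. intros Uw Hw. note (UH_neq1 w Uw) as N1. note PI_RGT_0. assert (NPI : RtoC PI <> 0) by (RtoC_nz). note C2_neq0.
 assert (Nw : (w - 1)%C <> 0) by (apply Cminus_neq0; auto).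
 rewrite zeta_ZZ, (ZZ_eq 3), func_eq_left by (auto; try (replace (INR 3) with 3 by (simpl; ring); lra)).
 unfold zrefl. assert (R1 : 1 < Re (Cconj (1 - w)%C)). { rewrite re_conj. unfold Cminus. rewrite re_plus, re_opp, re_RtoC. lra. }
 rewrite zeta_zD, zD_conj, Cconj_conj by auto. unfold chi. field. auto.
Qed.

Definition hl (t : R) : C := (1 / 2, t).

Lemma func_eq_line t : 1 <= t -> zeta (hl t) = (chi (hl t) * Cconj (zeta (hl t)))%C.
Proof. intros Ht. apply Ceq_minus.
 assert (E : (zeta (hl t) - chi (hl t) * zrefl (hl t))%C = 0).
 (* The disc of radius [3/4] about [-1/8 + i t] contains [1/2 + i t]; near its centre
    [-1 < Re w < 0], and its square stays inside [strip] and the upper half-plane. *)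
 { apply (identity_square (fun w => zeta w - chi w * zrefl w)%C (- (1 / 8), t) (3 / 4)). lra.
  - intros z [Z1 Z2]; simpl in *. apply (hol_minus (fun w => UH w /\ strip w)).
  apply (hol_sub UH). tauto. apply zeta_hol_UH. apply hol_mult. apply (hol_sub strip). tauto. apply hol_chi. apply (hol_sub UH). tauto. apply hol_zrefl.
  unfold UH, strip. lra.
  - exists (1 / 16). split. lra. intros z Hz. destruct (Cmod_RI z (- (1 / 8), t)) as [K1 K2]. simpl in K1, K2.
  assert (A := Rle_lt_trans _ _ _ K1 Hz). assert (B := Rle_lt_trans _ _ _ K2 Hz). apply Rabs_def2 in A. apply Rabs_def2 in B.
  rewrite (func_eq_strip z) by (unfold UH; lra). ring.
  - apply Cmod_lt_iff. lra. unfold hl. simpl. nra. }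
 rewrite <- E. unfold zrefl. replace (Cconj (1 - hl t))%C with (hl t). reflexivity. unfold hl. Ceq; field.
Qed.

(** * Zeros in horizontal bands *)

Lemma holR_bounded f a b c d : a <= b -> c <= d -> holR a b c d f -> exists M, 0 <= M /\ forall z, inR a b c d z -> Cmod (f z) <= M.
Proof. intros Hab Hcd Hf. destruct (onB_bounded f a b c d Hab Hcd) as (M & PM & HM).
 { intros z Hz. destruct (Hf z (onB_inR _ _ _ _ _ Hz)). eapply Cdiff_contC; eauto. }
 exists M. split; auto. intros z Hz. destruct (classic (inI a b c d z)) as [Hi|Hi].
 - apply (max_modulus f a b c d); auto.
 - apply HM. split; auto. unfold inI, inR in *. 
  destruct (Req_dec (Re z) a); auto. destruct (Req_dec (Re z) b); auto. destruct (Req_dec (Im z) c); auto. destruct (Req_dec (Im z) d); auto. exfalso. apply Hi. lra.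
Qed.

Lemma pow2_exceeds M e : 0 < e -> exists N, M < 2 ^ (S N) * e.
Proof. intros He. destruct (half_pow_small (Rabs M + 1) e He) as [n Hn]. exists n. note (pow_lt 2 n ltac:(lra)). simpl.
 apply Rmult_lt_compat_r with (r := 2 ^ n) in Hn; auto. unfold Rdiv in Hn. rewrite Rmult_assoc, Rinv_l in Hn by lra. note (Rle_abs M). note (Rabs_pos M). nra.
Qed.

Section WithRH.
Hypothesis RH : Riemann_hypothesis.

Lemma RH_line s : UH s -> zeta s = 0 -> Re s = 1 / 2.
Proof. intros H E. apply RH. apply zeta_zero_nontrivial; auto. Qed.

Lemma facl_zero l g z : facl UH zeta l g -> In z l -> UH z -> zeta z = 0.
Proof. intros [_ H] Hin Uz. rewrite (H z Uz). replace (prodl l z) with (RtoC 0). ring. symmetry. clear - Hin. induction l; simpl in *. contradiction.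
 destruct Hin as [->|Hin]. replace (z - z)%C with (RtoC 0) by ring. ring. rewrite IHl by auto. ring.
Qed.

Lemma cntb_sub U f (S T : C -> Prop) N : (forall z, S z -> T z) -> cntb U f T N -> cntb U f S N.
Proof. intros H HT. intros l g Hf. specialize (HT l g Hf). eapply Nat.le_trans; [|exact HT]. clear - H. unfold sel. induction l; simpl; auto.
 destruct (decb (S a)) eqn:E1; destruct (decb (T a)) eqn:E2; simpl; try lia.
 undec E1. undec E2. exfalso; auto.
Qed.

(** The centre lies off the critical line, so under RH [zeta] does not vanish there. The square
    touches the line from the right, and five times its size still fits above the real axis. *)
Lemma cntb_local a y : 0 < a <= y -> exists N, cntb UH zeta (sqR (1 / 2 + a / 6, y) (a / 6)) N.
Proof. intros Ha. set (p := (1 / 2 + a / 6, y) : C). assert (Up : UH p) by (unfold UH; simpl; lra).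
 assert (Np : zeta p <> RtoC 0). { intros E. apply RH_line in E; auto. simpl in E. lra. }
 assert (Sub : forall z, sqR p (5 * (a / 6)) z -> UH z). { intros z [_ Hz]. simpl in Hz. unfold UH. lra. }
 destruct (holR_bounded zeta (Re p - 5 * (a / 6)) (Re p + 5 * (a / 6)) (Im p - 5 * (a / 6)) (Im p + 5 * (a / 6))) as (M & _ & HM); try lra.
 { intros z Hz. apply zeta_hol_UH. apply Sub. exact Hz. }
 destruct (pow2_exceeds M (Cmod (zeta p))) as [N HN]. apply Cmod_gt_0; auto.
 exists N. apply cntb_square with M; auto. apply opn_UH. lra.
Qed.

Lemma cntb_segment a n : 0 < a -> exists N, cntb UH zeta (fun z => Re z = 1 / 2 /\ a <= Im z <= a + INR n * (a / 6)) N.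
Proof. intros Ha. induction n.
 - destruct (cntb_local a a ltac:(lra)) as [N HN]. exists N. eapply cntb_sub; [|exact HN]. intros z [E H]. simpl in H. unfold sqR, inR; simpl. lra.
 - destruct IHn as [N HN]. note (pos_INR n). destruct (cntb_local a (a + INR n * (a / 6)) ltac:(nra)) as [N' HN'].
  exists (N + N')%nat. eapply cntb_union; [exact HN|exact HN'|]. intros z [E H']. rewrite S_INR in H'. destruct (Rle_dec (Im z) (a + INR n * (a / 6))).
  left. lra. right. unfold sqR, inR; simpl. lra.
Qed.

Definition band (a b : R) (z : C) : Prop := a <= Im z <= b.

Lemma sel_ext (S T : C -> Prop) l : (forall z, In z l -> (S z <-> T z)) -> sel S l = sel T l.
Proof. induction l; simpl; intros H; auto. unfold sel in *. simpl. rewrite IHl by auto.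
 destruct (decb (S a)) eqn:E1; destruct (decb (T a)) eqn:E2; auto.
 - undec E1. undec E2. exfalso. apply E2, H; auto.
 - undec E2. undec E1. exfalso. apply E1, H; auto.
Qed.

(** Under RH the zeros of the infinite band lie on a segment, which finitely many squares of
    [cntb_local] cover. *)
Lemma cntb_band a b : 0 < a -> exists N, cntb UH zeta (band a b) N.
Proof. intros Ha. destruct (INR_archimed (a / 6) b ltac:(lra)) as [n Hn]. destruct (cntb_segment a n Ha) as [N HN]. exists N. intros l g Hf.
 specialize (HN l g Hf).
 rewrite (sel_ext (band a b) (fun z => Re z = 1 / 2 /\ a <= Im z <= b)).
 2:{ intros z Hz. unfold band. split; [|tauto]. intros H. split; auto. assert (UH z) by (unfold UH; lra). apply RH_line; auto. eapply facl_zero; eauto. }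
 eapply Nat.le_trans; [|exact HN]. clear - Hn Ha. unfold sel. induction l; simpl; auto.
 destruct (decb (Re a0 = 1 / 2 /\ a <= Im a0 <= b)) eqn:E1; destruct (decb (Re a0 = 1 / 2 /\ a <= Im a0 <= a + INR n * (a / 6))) eqn:E2; simpl; try lia.
 undec E1. undec E2. exfalso. apply E2. lra.
Qed.

Lemma band_list a b : 0 < a -> exists l g, facl UH zeta l g /\ (forall z, In z l -> band a b z) /\ forall z, band a b z -> g z <> 0.
Proof. intros Ha. destruct (cntb_band a b Ha) as [N HN]. apply (complete_list UH zeta (band a b) N); auto. apply opn_UH. apply zeta_hol_UH.
 intros z Hz. unfold band, UH in *. lra.
Qed.

Lemma band_list_zero a b l g z : 0 < a -> facl UH zeta l g -> (forall z, band a b z -> g z <> 0) -> band a b z -> zeta z = 0 -> In z l.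
Proof. intros Ha [Hg Hf] Hn Hz E. assert (Uz : UH z) by (unfold band, UH in *; lra). rewrite (Hf z Uz) in E.
 apply NNPP. intros Hni. assert (prodl l z <> 0). { apply prodl_neq0. intros r Hr ->. auto. } apply (Cmult_neq_0 _ _ H (Hn z Hz)); auto.
Qed.

Lemma finite_isolated (l : list C) x : exists eta, 0 < eta /\ forall z, In z l -> Im z <> x -> eta <= Rabs (Im z - x).
Proof. induction l. exists 1. split. lra. intros z []. destruct IHl as (eta & He & H).
 destruct (Req_dec (Im a) x) as [E|N].
 - exists eta. split; auto. intros z [<-|Hz] Nz; auto. contradiction.
 - exists (Rmin eta (Rabs (Im a - x))). split. apply Rmin_pos; auto. apply Rabs_pos_lt. lra.
  intros z [<-|Hz] Nz. apply Rmin_r. le_via Rmin_l. auto.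
Qed.

Lemma nonordinate_room T : 1 <= T -> exists eta, 0 < eta <= 1 / 2 /\ forall z, Rabs (Im z - T) < eta -> zeta z = 0 -> Im z = T.
Proof. intros HT. destruct (band_list (T - 1 / 2) (T + 1 / 2)) as (l & g & Hf & Hin & Hn). lra. destruct (finite_isolated l T) as (eta & He & H).
 exists (Rmin eta (1 / 2)). split. split. apply Rmin_pos; lra. apply Rmin_r. intros z Hz E. min_le eta (1 / 2).
 assert (B : band (T - 1 / 2) (T + 1 / 2) z). { assert (K : Rabs (Im z - T) < 1 / 2) by lra. apply Rabs_def2 in K. unfold band. lra. }
 note (band_list_zero (T - 1 / 2) (T + 1 / 2) l g z ltac:(lra) Hf Hn B E) as Hz'. destruct (Req_dec (Im z) T); auto. specialize (H z Hz' H2). lra.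
Qed.

(** * The argument of zeta on the critical line *)

Lemma zeta_RH_neq0 s : Re s <> 1 / 2 -> 0 < Re s -> s <> RtoC 1 -> zeta s <> RtoC 0.
Proof. intros H H0 N E. apply H, RH. split; auto. split; auto. intros k ->. simpl in H0. note (pos_INR k). destruct k; simpl in *; nra.
Qed.

Lemma zeta_real_2 : exists x, 0 < x /\ zeta (RtoC 2) = RtoC x.
Proof. exists (Re (zeta (RtoC 2))). rewrite zeta_zD by (simpl; lra). note (zD_conj (RtoC 2) ltac:(simpl; lra)) as E.
 replace (Cconj (RtoC 2)) with (RtoC 2) in E by Ceq. split.
 - note (zD_near_1 (RtoC 2) eq_refl). destruct (Cmod_RI (zD (RtoC 2)) 1) as [K _]. simpl in K. assert (A := Rle_trans _ _ _ K H). apply Rabs_le_between in A. simpl in *. lra.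
 - apply (f_equal Im) in E. rewrite im_conj in E. apply Ceq_intro; simpl in *; lra.
Qed.

Lemma continuous_contR_Im f x : contR f x -> continuous (fun t => Im (f t)) x.
Proof. intros H. apply contR_continuous in H. apply (continuous_comp (V := C_UniformSpace) f (snd : C -> R)); auto. apply continuous_snd. Qed.

Lemma continuous_Rmin1 c x : continuous (fun u => Rmin u c) x.
Proof. apply (filterlim_ext (fun u => (u + c - Rabs (u - c)) / 2)).
 intros u. unfold Rmin, Rabs. destruct Rle_dec; destruct Rcase_abs; lra.
 replace (Rmin x c) with ((x + c - Rabs (x - c)) / 2) by (unfold Rmin, Rabs; destruct Rle_dec; destruct Rcase_abs; lra).
 assert (continuous (fun u => Rabs (u - c)) x).
 { apply (continuous_comp (fun u => u - c) Rabs). apply ex_derive_cont. auto_derive; auto. apply continuous_Rabs. }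
 apply (continuous_mult (K := R_AbsRing) (fun u => u + c - Rabs (u - c)) (fun _ => / 2)); [|apply continuous_const].
 apply (continuous_minus (V := R_N) (fun u => u + c) (fun u => Rabs (u - c))); auto.
 apply ex_derive_cont. auto_derive; auto.
Qed.

(** Two rectangles without zeros of [zeta] carry logarithms along the vertical and the horizontal
    segment of the path; the height of the second is limited by the distance from [T] to the nearest
    ordinate. *)
Lemma is_arg_exists T : 1 <= T -> ~ zero_ordinate T -> exists a, is_arg_zeta T a.
Proof. intros HT HnT. destruct (nonordinate_room T HT) as (eta & Heta & Hroom).
 assert (NZ : forall z, Rabs (Im z - T) < eta -> zeta z <> RtoC 0).
 { intros z Hz E. apply HnT. exists z. split. apply zeta_zero_nontrivial; auto. assert (K : Rabs (Im z - T) < 1 / 2) by lra. apply Rabs_def2 in K. unfold UH; lra. apply Hroom; auto. }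
 destruct (log_exists (fun s => s <> RtoC 1) zeta (3 / 2) (5 / 2) (-1) (T + 1) (2, 0)) as (h1 & A1 & A2 & A3); try lra.
 { apply opn_neq1. } { apply zeta_hol. } { intros z [Hz _] ->. simpl in Hz. lra. }
 { intros z [Hz _]. apply zeta_RH_neq0; try lra. intros ->. simpl in Hz. lra. } { unfold inI; simpl; lra. }
 destruct (log_exists (fun s => s <> RtoC 1) zeta (1 / 4) (9 / 4) (T - eta / 2) (T + eta / 2) (2, T)) as (h2 & B1 & B2 & B3); try lra.
 { apply opn_neq1. } { apply zeta_hol. } { intros z [_ Hz] ->. simpl in Hz. lra. }
 { intros z [_ Hz]. apply NZ. apply Rabs_def1; lra. } { unfold inI; simpl; lra. }
 destruct zeta_real_2 as (x2 & Hx2 & E2). change ((2, 0) : C) with (RtoC 2) in *.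
 (* [- Rmin (- u) (-1)] is the maximum of [u] and 1. The first summand is frozen after [u = 1] and
    the second is 0 before it, so the sum is continuous without a case distinction. *)
 set (th := fun u => Im (h1 (2, Rmin u 1 * T)) + Im (h2 (2 - 3 / 2 * (- Rmin (- u) (-1) - 1), T))).
 assert (mx : forall u, u <= 1 -> Rmin u 1 = u /\ - Rmin (- u) (-1) = 1) by (intros; unfold Rmin; repeat destruct Rle_dec; lra).
 assert (mx2 : forall u, 1 <= u -> Rmin u 1 = 1 /\ - Rmin (- u) (-1) = u) by (intros; unfold Rmin; repeat destruct Rle_dec; lra).
 assert (P2 : zeta (2, T) = (x2 * Cexp (h1 (2, T)))%C). { rewrite A3, E2. reflexivity. unfold inI; simpl; lra. }
 assert (form : forall x w, 0 < x -> (x * Cexp w)%C = (RtoC (Cmod (x * Cexp w)) * Cexp (0%R, Im w))%C).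
 { intros x w Hx. rewrite Cmod_mult, Cmod_Cexp, Cmod_RtoC_pos by lra. rewrite RtoC_mult. unfold Cexp. Ceq. all: rewrite exp_0; ring. }
 exists (th 2). exists th. split; [|split; [|split]]; auto.
 - intros u Hu. enough (Hc : continuous th u) by (intros P HP; destruct (Hc P HP) as [d Hd]; exists d; intros y Hy _; apply Hd; auto).
  assert (c1 : continuous (fun u => Rmin u 1 * T) u).
  { apply (continuous_mult (K := R_AbsRing) (fun u => Rmin u 1) (fun _ => T)). apply continuous_Rmin1. apply continuous_const. }
  assert (c2 : continuous (fun u => 2 - 3 / 2 * (- Rmin (- u) (-1) - 1)) u).
  { assert (c3 : continuous (fun u => Rmin (- u) (-1)) u). { apply (continuous_comp (fun u => - u) (fun v => Rmin v (-1))). apply (continuous_opp (V := R_N)), continuous_id. apply continuous_Rmin1. }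
  apply (continuous_ext (fun u => 7 / 2 + 3 / 2 * Rmin (- u) (-1))). intros t; change (@eq R (7 / 2 + 3 / 2 * Rmin (- t) (-1)) (2 - 3 / 2 * (- Rmin (- t) (-1) - 1))); field.
  apply (continuous_plus (V := R_N) (fun _ => 7 / 2)). apply continuous_const. apply (continuous_scal_r (V := R_N) (3 / 2)). auto. }
  apply (continuous_plus (V := R_N) (fun u => Im (h1 (2, Rmin u 1 * T))) (fun u => Im (h2 (2 - 3 / 2 * (- Rmin (- u) (-1) - 1), T)))).
  + apply (continuous_contR_Im (fun u => h1 (2, Rmin u 1 * T))). apply (contR_comp h1 (fun u => (2, Rmin u 1 * T))).
  eapply Cdiff_contC, A1. unfold inI; simpl. assert (0 <= Rmin u 1 <= 1) by (unfold Rmin; destruct Rle_dec; lra). split. lra. nra. apply contR_pair. apply continuous_const. auto.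
  + apply (continuous_contR_Im (fun u => h2 (2 - 3 / 2 * (- Rmin (- u) (-1) - 1), T))). apply (contR_comp h2 (fun u => (2 - 3 / 2 * (- Rmin (- u) (-1) - 1), T))).
  eapply Cdiff_contC, B1. unfold inI; simpl. assert (1 <= - Rmin (- u) (-1) <= 2) by (unfold Rmin; destruct Rle_dec; lra). lra. apply contR_pair. auto. apply continuous_const.
 - unfold th. destruct (mx 0 ltac:(lra)) as [-> ->]. replace (0 * T) with 0 by ring. replace (2 - 3 / 2 * (1 - 1)) with 2 by ring. change ((2, 0) : C) with (RtoC 2). rewrite A2, B2. simpl. ring.
 - intros u Hu. unfold arg_path. destruct (Rle_dec u 1) as [L|L].
  + unfold th. destruct (mx u L) as [-> ->]. replace (2 - 3 / 2 * (1 - 1)) with 2 by ring. rewrite B2. simpl Im. rewrite Rplus_0_r.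
  rewrite A3. 2:{ unfold inI; simpl. split. lra. nra. } rewrite E2. apply form; auto.
  + unfold th. destruct (mx2 u ltac:(lra)) as [-> ->]. rewrite Rmult_1_l.
  rewrite B3. 2:{ unfold inI; simpl. lra. } rewrite P2. rewrite <- Cmult_assoc, <- Cexp_plus.
  replace (Im (h1 (2, T)) + Im (h2 (2 - 3 / 2 * (u - 1), T))) with (Im (h1 (2, T) + h2 ((2 - 3 / 2 * (u - 1))%R, T))%C) by apply im_plus. apply form; auto.
Qed.

(** Write [zeta(1/2 + i T) = m exp(i a)]. The functional equation on the line gives
    [exp(2 i a) = chi], and [e (a / PI)] is this same square. *)
Lemma conj_e_S_arg T : 1 <= T -> ~ zero_ordinate T -> Cconj (e (S_arg T)) = Cconj (chi (hl T)).
Proof. intros HT HnT. note (epsilon_spec (inhabits 0) (is_arg_zeta T) (is_arg_exists T HT HnT)) as (th & _ & _ & H3 & H4).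
 specialize (H3 2 ltac:(lra)). unfold arg_path in H3. destruct (Rle_dec 2 1) as [|_]. lra.
 replace (2 - 3 / 2 * (2 - 1), T) with (hl T) in H3 by (unfold hl; f_equal; field).
 unfold S_arg. set (a := epsilon (inhabits 0) (is_arg_zeta T)) in *. rewrite H4 in H3.
 assert (NZ : zeta (hl T) <> RtoC 0). { intros E. apply HnT. exists (hl T). split; auto. apply zeta_zero_nontrivial; auto. unfold UH, hl; simpl; lra. }
 note (func_eq_line T HT) as F. set (z := zeta (hl T)) in *. set (m := Cmod z) in *.
 assert (Hm : RtoC m <> 0). { intros X. apply (f_equal Re) in X. simpl in X. apply NZ. apply Cmod_eq_0. exact X. }
 f_equal. assert (E : e (/ PI * a) = (Cexp (0%R, a) * Cexp (0%R, a))%C).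
 { unfold e. rewrite <- Cexp_plus. f_equal. note PI_RGT_0. apply Ceq_intro; simpl; field. lra. }
 rewrite E. rewrite H3 in F at 1. rewrite H3 in F. rewrite Cmult_conj, Cconj_Cexp in F.
 replace (Cconj (RtoC m)) with (RtoC m) in F by Ceq. replace (Cconj (0, a)) with (- (0, a))%C in F by Ceq. rewrite Cexp_opp in F.
 note (Cexp_neq0 (0, a)) as NE. set (q := Cexp (0, a)) in *.
 assert (Ef : (RtoC m * (q * q - chi (hl T)))%C = 0).
 { replace (RtoC m * (q * q - chi (hl T)))%C with (q * (m * q - chi (hl T) * (m * / q)))%C by (field; auto). rewrite <- F. ring. }
 apply Ceq_minus. apply NNPP. intros X. apply (Cmult_neq_0 _ _ Hm X). exact Ef.
Qed.

(** [chi] is continuous on the line, so the limit exists; it is unique because points [t + h] that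
    are not ordinates accumulate at [t]. *)
Lemma calZ_eq t : 2 <= t -> calZ (hl t) = Cconj (chi (hl t)).
Proof. intros Ht. unfold calZ. change (Im (hl t)) with t.
 set (F := within (fun T => 0 < T /\ ~ zero_ordinate T) (locally t)).
 assert (L0 : filterlim (fun T => Cconj (e (S_arg T))) F (locally (T := C_UniformSpace) (Cconj (chi (hl t))))).
 { intros P HP. apply locally_C_Cmod in HP. destruct HP as (d & D & HP).
  assert (Cc : contR (fun T => chi (hl T)) t).
  { apply (contR_comp chi hl). eapply hol_contC. apply hol_chi. unfold strip, hl; simpl; lra. eapply RD_contR. apply (RD_ver (1 / 2)). }
  destruct (Cc d D) as (d' & D' & K). assert (Dm : 0 < Rmin d' 1) by (apply Rmin_pos; lra). exists (mkposreal _ Dm). intros T HT [_ HnT].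
  assert (HT' : Rabs (T - t) < Rmin d' 1) by exact HT. note (Rmin_l d' 1). note (Rmin_r d' 1).
  assert (A : Rabs (T - t) < 1) by lra. apply Rabs_def2 in A. apply HP. rewrite conj_e_S_arg by (auto; lra). rewrite <- Cminus_conj, Cmod_conj. apply K. lra. }
 note (epsilon_spec (inhabits (RtoC 0)) (fun z => filterlim (fun T => Cconj (e (S_arg T))) F (locally (T := C_UniformSpace) z)) (ex_intro (fun z => filterlim (fun T => Cconj (e (S_arg T))) F (locally (T := C_UniformSpace) z)) _ L0)) as L1.
 set (z1 := epsilon _ _) in *. apply Cmod_small_eq. intros eps He.
 specialize (L0 (fun z => Cmod (z - Cconj (chi (hl t))) < eps / 2)). specialize (L1 (fun z => Cmod (z - z1) < eps / 2)).
 destruct L0 as [d0 K0]. { apply locally_C_Cmod. exists (eps / 2). split. lra. auto. }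
 destruct L1 as [d1 K1]. { apply locally_C_Cmod. exists (eps / 2). split. lra. auto. }
 destruct (nonordinate_room t ltac:(lra)) as (eta & Heta & Hroom).
 set (h := Rmin (Rmin d0 d1) eta / 2). assert (Hm : 0 < Rmin (Rmin d0 d1) eta) by (repeat apply Rmin_pos; try apply cond_pos; lra).
 min_le (Rmin d0 d1) eta. min_le d0 d1.
 assert (Hh : 0 < h) by (unfold h; lra).
 assert (Eh : Rabs (t + h - t) = h). { replace (t + h - t) with h by ring. apply Rabs_pos_eq; lra. }
 assert (Hno : 0 < t + h /\ ~ zero_ordinate (t + h)).
 { split. lra. intros (r & [_ [Hr _]] & Hi). assert (Im r = t). { apply Hroom; auto. rewrite Hi, Eh. unfold h. lra. } lra. }
 assert (Bk : forall d : posreal, h < d -> ball t d (t + h)). { intros d Hd. change (Rabs (t + h - t) < d). rewrite Eh. auto. }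
 specialize (K0 (t + h) (Bk d0 ltac:(unfold h; lra)) Hno). specialize (K1 (t + h) (Bk d1 ltac:(unfold h; lra)) Hno). cbv beta in K0, K1.
 rewrite Cmod_minus_sym in K1. note (Cmod_triangle3 z1 (Cconj (e (S_arg (t + h)))) (Cconj (chi (hl t)))). lra.
Qed.

End WithRH.

Local Arguments INR n : simpl never.

(** * The von Mangoldt function and the logarithmic derivative of zeta *)

Definition nprime (p : nat) : Prop := prime (Z.of_nat p).

Lemma nprime_gt1 p : nprime p -> (1 < p)%nat.
Proof. intros [H _]. lia. Qed.

Lemma nprime_div p a : nprime p -> Nat.divide a p -> a = 1%nat \/ a = p.
Proof. intros H [k Hk]. note (nprime_gt1 p H). assert (D : (Z.of_nat a | Z.of_nat p)%Z) by (exists (Z.of_nat k); lia).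
 apply prime_divisors in D; auto. lia.
Qed.

Lemma nprime_not_div_pow p q k : nprime p -> nprime q -> p <> q -> ~ Nat.divide p (q ^ k).
Proof. intros Hp Hq N. note (nprime_gt1 p Hp). note (nprime_gt1 q Hq).
 assert (G : Nat.gcd p q = 1%nat).
 { destruct (nprime_div p (Nat.gcd p q) Hp (Nat.gcd_divide_l p q)) as [E|E]; auto. destruct (nprime_div q (Nat.gcd p q) Hq (Nat.gcd_divide_r p q)) as [E'|E']; lia. }
 induction k; simpl; intros D. apply Nat.divide_1_r in D. lia. apply IHk. apply (Nat.gauss p q); auto.
Qed.

Lemma nprime_gcd_pow p q k : nprime p -> nprime q -> p <> q -> Nat.gcd (q ^ k) p = 1%nat.
Proof. intros Hp Hq N. destruct (nprime_div p (Nat.gcd (q ^ k) p) Hp (Nat.gcd_divide_r _ _)) as [E|E]; auto.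
 exfalso. apply (nprime_not_div_pow p q k Hp Hq N). rewrite <- E. apply Nat.gcd_divide_l.
Qed.

Lemma nprime_pow_inj p q k j : nprime p -> nprime q -> (1 <= k)%nat -> (p ^ k = q ^ j)%nat -> p = q.
Proof. intros Hp Hq Hk E. destruct (Nat.eq_dec p q) as [|N]; auto. exfalso. apply (nprime_not_div_pow p q j Hp Hq N). rewrite <- E.
 destruct k. lia. exists (p ^ k)%nat. simpl. lia.
Qed.

Lemma von_Mangoldt_pow p k : nprime p -> (1 <= k)%nat -> von_Mangoldt (p ^ k) = ln (INR p).
Proof. intros Hp Hk. unfold von_Mangoldt. destruct excluded_middle_informative as [H|H].
 - destruct constructive_indefinite_description as [q (Hq & j & Hj & E)]. simpl. rewrite (nprime_pow_inj p q k j Hp Hq Hk E). reflexivity.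
 - exfalso. apply H. exists p. split; auto. exists k. auto.
Qed.

Lemma von_Mangoldt_cases n : von_Mangoldt n = 0 \/ exists p k, nprime p /\ (1 <= k)%nat /\ n = (p ^ k)%nat.
Proof. unfold von_Mangoldt. destruct excluded_middle_informative as [(p & Hp & k & Hk)|]; auto. right. exists p, k. tauto.
Qed.

Lemma von_Mangoldt_bounds n : 0 <= von_Mangoldt (S n) <= ln (INR (S n)).
Proof. assert (L : 0 <= ln (INR (S n))). { rewrite <- ln_1. note (INR_S_ge1 n). destruct (Req_dec 1 (INR (S n))) as [<-|]. lra. left; apply ln_increasing; lra. }
 destruct (von_Mangoldt_cases (S n)) as [->|(p & k & Hp & Hk & E)]. lra.
 rewrite E, von_Mangoldt_pow by auto. rewrite <- E. note (nprime_gt1 p Hp).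
 assert (1 < INR p) by (apply (lt_INR 1); auto).
 assert ((p <= S n)%nat). { rewrite E. destruct k. lia. simpl. assert (p ^ k <> 0)%nat by (apply Nat.pow_nonzero; lia). nia. }
 apply le_INR in H1. split. rewrite <- ln_1. left; apply ln_increasing; lra.
 destruct H1 as [H1| ->]. left; apply ln_increasing; lra. lra.
Qed.

Lemma prime_divisor_exists n : (2 <= n)%nat -> exists p m, nprime p /\ n = (p * m)%nat.
Proof. induction n as [n IH] using lt_wf_ind. intros Hn. destruct (prime_dec (Z.of_nat n)) as [P|P].
 - exists n, 1%nat. split; auto. lia.
 - apply not_prime_divide in P; [|lia]. destruct P as (d & Hd & [k Hk]).
  destruct (IH (Z.to_nat d)) as (p & m & Hp & E); try lia. exists p, (m * Z.to_nat k)%nat. split; auto. nia.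
Qed.

Lemma p_valuation p m : nprime p -> (1 <= m)%nat -> exists v, Nat.divide (p ^ v) m /\ ~ Nat.divide (p ^ S v) m.
Proof. intros Hp Hm. note (nprime_gt1 p Hp).
 assert (A : forall k, ~ Nat.divide (p ^ k) m -> exists v, Nat.divide (p ^ v) m /\ ~ Nat.divide (p ^ S v) m).
 { induction k; intros Hk. exfalso. apply Hk. simpl. apply Nat.divide_1_l.
  destruct (classic (Nat.divide (p ^ k) m)) as [D|D]; eauto. }
 apply (A m). intros D. apply Nat.divide_pos_le in D; [|lia]. note (Nat.pow_gt_lin_r p m ltac:(lia)). lia.
Qed.

(** The range [N] is independent of [n], so that the divisor sums of [m] and [p m] can be compared
    term by term. *)
Definition Dsum (n N : nat) : R := Rsum (fun d => if decb (Nat.divide (S d) n) then von_Mangoldt (S d) else 0) N.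

Lemma Rsum_single f N k0 : (k0 < N)%nat -> (forall k, (k < N)%nat -> k <> k0 -> f k = 0) -> Rsum f N = f k0.
Proof. assert (Z : forall f N, (forall k, (k < N)%nat -> f k = 0) -> Rsum f N = 0).
 { clear. intros f N. induction N; simpl; intros H; auto. rewrite IHN, H by auto. ring. }
 induction N; intros H1 H2. lia. simpl. destruct (Nat.eq_dec k0 N) as [->|Ne].
 - rewrite Z. ring. intros; apply H2; lia.
 - rewrite IHN by (try lia; intros; apply H2; lia). rewrite (H2 N) by lia. ring.
Qed.

Lemma Rsum_minus f g n : Rsum f n - Rsum g n = Rsum (fun k => f k - g k) n.
Proof. induction n; simpl. ring. rewrite <- IHn. ring. Qed.

(** Passing from [m] to [p m] creates exactly one new prime power divisor, [p ^ (v + 1)] with [v]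
    the exponent of [p] in [m]. *)
Lemma Dsum_step p m N : nprime p -> (1 <= m)%nat -> (p * m <= N)%nat -> Dsum (p * m) N = Dsum m N + ln (INR p).
Proof. intros Hp Hm HN. note (nprime_gt1 p Hp). destruct (p_valuation p m Hp Hm) as (v & V1 & V2).
 assert (Pv : (p ^ S v <> 0)%nat) by (apply Nat.pow_nonzero; lia).
 assert (Dv : Nat.divide (p ^ S v) (p * m)). { destruct V1 as [c Hc]. exists c. simpl. nia. }
 assert (Lv : (p ^ S v <= p * m)%nat) by (apply Nat.divide_pos_le; auto; nia).
 enough (E : Dsum (p * m) N - Dsum m N = ln (INR p)) by lra.
 unfold Dsum. rewrite Rsum_minus. rewrite (Rsum_single _ N (p ^ S v - 1)); try lia.
 - replace (S (p ^ S v - 1)) with (p ^ S v)%nat by lia. rewrite (proj2 (decb_true _) Dv), (proj2 (decb_false _) V2). rewrite von_Mangoldt_pow by (auto; lia). ring.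
 - intros k Hk Nk. destruct (decb (Nat.divide (S k) (p * m))) eqn:E1; destruct (decb (Nat.divide (S k) m)) eqn:E2; try ring.
  + undec E1. undec E2.
  destruct (von_Mangoldt_cases (S k)) as [->|(q & j & Hq & Hj & E)]. ring. exfalso. rewrite E in *.
  destruct (Nat.eq_dec p q) as [->|Npq].
  * apply Nk. replace j with (S v) in E. lia. destruct j as [|j]. lia. f_equal.
  assert (D1 : Nat.divide (q ^ j) m). { destruct E1 as [c Hc]. exists c. simpl in Hc. nia. }
  destruct (Nat.lt_trichotomy j v) as [L|[L|L]]; auto; exfalso.
  -- apply E2. eapply Nat.divide_trans; [|exact V1]. exists (q ^ (v - S j))%nat. rewrite <- Nat.pow_add_r. f_equal. lia.
  -- apply V2. eapply Nat.divide_trans; [|exact D1]. exists (q ^ (j - S v))%nat. rewrite <- Nat.pow_add_r. f_equal. lia.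
  * apply E2. apply (Nat.gauss (q ^ j) p); auto. apply nprime_gcd_pow; auto.
  + undec E1. undec E2. exfalso. apply E1. apply Nat.divide_mul_r. auto.
Qed.

Lemma Dsum_ln n N : (1 <= n)%nat -> (n <= N)%nat -> Dsum n N = ln (INR n).
Proof. revert N. induction n as [n IH] using lt_wf_ind. intros N H1 HN. destruct (Nat.eq_dec n 1) as [->|Nn].
 - change (INR 1) with 1. rewrite ln_1. unfold Dsum. rewrite (Rsum_single _ N 0); try lia.
  + destruct decb; auto. note (von_Mangoldt_bounds 0). change (INR 1) with 1 in H. rewrite ln_1 in H. lra.
  + intros k Hk Nk. destruct decb eqn:E; auto. undec E. apply Nat.divide_1_r in E. lia.
 - destruct (prime_divisor_exists n) as (p & m & Hp & E). lia. subst n. note (nprime_gt1 p Hp). assert (1 <= m)%nat by nia.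
  rewrite Dsum_step by auto. rewrite IH by nia. rewrite mult_INR, ln_mult by (apply lt_0_INR; lia). ring.
Qed.

Lemma divisor_sum_powers s d N : Csum (fun n => if decb (Nat.divide (S d) (S n)) then rcpow (INR (S n)) (- s) else RtoC 0) N =
 (rcpow (INR (S d)) (- s) * Csum (fun m => rcpow (INR (S m)) (- s)) (N / S d))%C.
Proof. induction N. rewrite Nat.Div0.div_0_l. cbn [Csum]. ring. cbn [Csum]. rewrite IHN. destruct (decb (Nat.divide (S d) (S N))) eqn:E.
 - undec E. destruct E as [c Hc].
  assert (Ec : (S N / S d = c)%nat). { rewrite Hc. apply Nat.div_mul. lia. }
  assert (EN : (N / S d = c - 1)%nat). { destruct c. lia. symmetry. apply (Nat.div_unique N (S d) (S c - 1) d); lia. }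
  rewrite Ec, EN. destruct c. lia. replace (S c - 1)%nat with c by lia. cbn [Csum]. rewrite Hc, mult_INR, rcpow_mult_base by apply INR_S_pos. ring.
 - undec E. replace (S N / S d)%nat with (N / S d)%nat. ring.
  note (Nat.div_mod N (S d) ltac:(lia)) as DM. note (Nat.mod_upper_bound N (S d) ltac:(lia)).
  destruct (Nat.eq_dec (N mod S d) d) as [Em|Em].
  + exfalso. apply E. exists (N / S d + 1)%nat. lia.
  + apply (Nat.div_unique (S N) (S d) (N / S d) (S (N mod S d))); lia.
Qed.

Lemma Csum_bounded f A sg N : 1 < sg -> 0 <= A -> dominated f A sg -> Cmod (Csum f N) <= A * Ksig sg.
Proof. intros Hs HA H. note (Csum_tail f A sg Hs HA H 0 N) as T. simpl in T. replace (Csum f N - 0)%C with (Csum f N) in T by ring.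
 eapply Rle_trans. exact T. note (Ksig_pos sg Hs). assert (0 <= A * Ksig sg) by pos. note (Rpower_pos (INR (S N)) (1 - sg)).
 change (INR 1) with 1. assert (Rpower 1 (1 - sg) = 1) by (unfold Rpower; rewrite ln_1, Rmult_0_r; apply exp_0). rewrite H3. nra.
Qed.

(** With the exponent [1/8] the terms of the von Mangoldt series on [Re s = 3/2] are dominated by
    [n^(-11/8)]. *)
Lemma ln_le_pow8 x : 1 <= x -> ln x <= 8 * Rpower x (1 / 8).
Proof. intros Hx. set (y := Rpower x (1 / 8)). assert (Py : 0 < y) by apply Rpower_pos.
 assert (E : ln x = 8 * ln y). { unfold y, Rpower. rewrite ln_exp. field. }
 rewrite E. mul_le_l. lra. apply exp_le_inv. rewrite exp_ln by auto. note (exp_ineq1 y ltac:(lra)). lra.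
Qed.

Definition Lser (s : C) (n : nat) : C := (RtoC (von_Mangoldt (S n)) * rcpow (INR (S n)) (- s))%C.

Lemma Lser_bound s n : 3 / 2 <= Re s -> Cmod (Lser s n) <= 8 * Rpower (INR (S n)) (- (11 / 8)).
Proof. intros Hs. unfold Lser. rewrite Cmod_mult, Cmod_rcpow, Cmod_R, re_opp. destruct (von_Mangoldt_bounds n). note (INR_S_ge1 n). rewrite Rabs_pos_eq by lra.
 note (ln_le_pow8 (INR (S n)) H1). set (x := INR (S n)) in *.
 le_mid (8 * Rpower x (1 / 8) * Rpower x (- (3 / 2))). apply Rmult_le_compat; try lra. pos. apply Rpower_mono_exp; lra.
 rewrite Rmult_assoc, <- Rpower_plus. right. f_equal. f_equal. field.
Qed.

Definition Lsum (s : C) : C := Clim_ser (Lser s).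

Lemma Lsum_Cser s : 3 / 2 <= Re s -> Cser (Lser s) (Lsum s).
Proof. intros Hs. destruct (Cser_exists (Lser s) 8 (11 / 8)) as [L HL]; try lra. intros n; apply Lser_bound; auto. eapply Clim_ser_spec; eauto.
Qed.

Local Notation ln_term s := (fun n => RtoC (ln (INR (S n))) * rcpow (INR (S n)) (- s))%C.

(** The logarithm is a divisor sum of [von_Mangoldt]. In the partial sum up to [N] the inner sum
    over multiples of [d] stops at [N / d], and its distance from [zeta] is a tail of the Dirichlet
    series. *)
Lemma log_zeta_series s : Re s = 3 / 2 -> Cser (ln_term s) (zD s * Lsum s)%C.
Proof. intros Hs. note (Lsum_Cser s ltac:(lra)) as HL. set (K := Ksig (3 / 2)). assert (PK : 0 < K) by (apply Ksig_pos; lra).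
 assert (Id : forall N, Csum (ln_term s) N = Csum (fun d => Lser s d * Csum (fun m => rcpow (INR (S m)) (- s)) (N / S d))%C N).
 { intros N. transitivity (Csum (fun n => Csum (fun d => RtoC (von_Mangoldt (S d)) * (if decb (Nat.divide (S d) (S n)) then rcpow (INR (S n)) (- s) else RtoC 0))%C N) N).
  - apply Csum_ext. intros n Hn. rewrite <- (Dsum_ln (S n) N) by lia. unfold Dsum.
  assert (Q : forall M, (RtoC (Rsum (fun d => if decb (Nat.divide (S d) (S n)) then von_Mangoldt (S d) else 0) M) * rcpow (INR (S n)) (- s))%C =
  Csum (fun d => RtoC (von_Mangoldt (S d)) * (if decb (Nat.divide (S d) (S n)) then rcpow (INR (S n)) (- s) else RtoC 0))%C M).
  { induction M; cbn [Rsum Csum]. ring. rewrite <- IHM, RtoC_plus. destruct decb; ring. }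
  apply Q.
  - rewrite Csum_swap. apply Csum_ext. intros d Hd. rewrite Csum_scal, divisor_sum_powers. unfold Lser. ring. }
 assert (Bd : forall N, (1 <= N)%nat -> Cmod (Csum (ln_term s) N - zD s * Csum (Lser s) N) <= K * 8 * Rpower (INR N) (- (1 / 8)) * Ksig (5 / 4)).
 { intros N HN. assert (PN : 1 <= INR N) by (apply (le_INR 1); auto). rewrite Id, <- Csum_scal.
  set (ff := fun d => if decb (S d <= N)%nat then (Lser s d * (Csum (fun m => rcpow (INR (S m)) (- s)) (N / S d) - zD s))%C else RtoC 0).
  replace (Csum (fun d => Lser s d * Csum (fun m => rcpow (INR (S m)) (- s)) (N / S d))%C N - Csum (fun k => zD s * Lser s k)%C N)%C with (Csum ff N).
  2:{ transitivity (Csum (fun d => Lser s d * Csum (fun m => rcpow (INR (S m)) (- s)) (N / S d) + -(1) * (zD s * Lser s d))%C N).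
  - apply Csum_ext. intros k Hk. unfold ff. rewrite (proj2 (decb_true (S k <= N)%nat)) by lia. ring.
  - rewrite Csum_plus, (Csum_scal (-(1))%C). ring. }
  apply Csum_bounded. lra. apply Rmult_le_pos; [lra|left; apply Rpower_pos].
  intros d. unfold ff. destruct (decb (S d <= N)%nat) eqn:E.
  2:{ rewrite Cmod_0. apply Rmult_le_pos; [apply Rmult_le_pos; [lra|]|]; left; apply Rpower_pos. }
  undec E. rewrite Cmod_mult. note (INR_S_ge1 d) as Pd. apply le_INR in E. set (x := INR (S d)) in *. set (y := INR N) in *.
  assert (T : Cmod (Csum (fun m => rcpow (INR (S m)) (- s)) (N / S d) - zD s) <= 1 * K * Rpower (INR (S (N / S d))) (1 - 3 / 2)).
  { apply (Cser_tail (fun m => rcpow (INR (S m)) (- s)) 1 (3 / 2)); try lra. intros n; apply zD_term_bound; lra. apply zD_Cser; lra. }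
  assert (Fl : y / x <= INR (S (N / S d))).
  { apply Rmult_le_reg_r with x. lra. div_cancel. unfold x, y. rewrite <- mult_INR. apply le_INR.
  note (Nat.div_mod N (S d) ltac:(lia)). note (Nat.mod_upper_bound N (S d) ltac:(lia)). nia. }
  assert (Yx : 1 <= y / x). { apply Rmult_le_reg_r with x. lra. unfold Rdiv. rewrite Rmult_assoc, Rinv_l; lra. }
  (* Weakening the exponent [-1/2] of [N / d] to [-1/8] leaves a summable power of [d] together with
     a decay [N^(-1/8)]. *)
  assert (T2 : Rpower (INR (S (N / S d))) (1 - 3 / 2) <= Rpower y (- (1 / 8)) * Rpower x (1 / 8)).
  { le_mid (Rpower (y / x) (1 - 3 / 2)). apply Rpower_antimono; lra. le_mid (Rpower (y / x) (- (1 / 8))). apply Rpower_mono_exp; lra.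
  right. unfold Rdiv. rewrite <- Rpower_mult_distr; try lra. 2: apply Rinv_0_lt_compat; lra. f_equal. rewrite Rpower_Rinv_base by lra. f_equal. ring. }
  note (Lser_bound s d ltac:(lra)) as LB. fold x in LB.
  le_mid (8 * Rpower x (- (11 / 8)) * (K * (Rpower y (- (1 / 8)) * Rpower x (1 / 8)))).
  - mul_le. eapply Rle_trans. exact T. rewrite Rmult_1_l. mul_le_l; lra.
  - right. replace (- (5 / 4)) with (- (11 / 8) + 1 / 8) by field. rewrite Rpower_plus. ring. }
 intros eps He. note (Cmod_ge_0 (zD s)) as Pz.
 destruct (HL (eps / 2 / (Cmod (zD s) + 1))) as [N1 H1]. pos.
 assert (PK2 : 0 < Ksig (5 / 4)) by (apply Ksig_pos; lra).
 destruct (Rpower_small (9 / 8) (eps / 2 / (K * 8 * Ksig (5 / 4)))) as [N2 H2]. lra. apply Rdiv_lt_0_compat. lra. pos.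
 exists (N1 + N2 + 1)%nat. intros n Hn. specialize (H1 n ltac:(lia)). specialize (Bd n ltac:(lia)).
 specialize (H2 (n - 1)%nat ltac:(lia)). replace (S (n - 1)) with n in H2 by lia. replace (1 - 9 / 8) with (- (1 / 8)) in H2 by field.
 assert (B1 : K * 8 * Rpower (INR n) (- (1 / 8)) * Ksig (5 / 4) <= eps / 2).
 { le_mid (K * 8 * Ksig (5 / 4) * (eps / 2 / (K * 8 * Ksig (5 / 4)))). replace (K * 8 * Rpower (INR n) (- (1 / 8)) * Ksig (5 / 4)) with (K * 8 * Ksig (5 / 4) * Rpower (INR n) (- (1 / 8))) by ring. mul_le_l; auto. pos. right; field; lra. }
 assert (B2 : Cmod (zD s) * Cmod (Csum (Lser s) n - Lsum s) <= eps / 2).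
 { le_mid ((Cmod (zD s) + 1) * (eps / 2 / (Cmod (zD s) + 1))). apply Rmult_le_compat; auto using Cmod_ge_0; lra. right; field; lra. }
 match goal with |- Cmod (?a - _) <= _ => replace (a - zD s * Lsum s)%C with ((a - zD s * Csum (Lser s) n) + zD s * (Csum (Lser s) n - Lsum s))%C by ring end.
 le_via Cmod_triangle. rewrite Cmod_mult. lra.
Qed.

Lemma Cder_zeta_series s : 1 < Re s -> Cser (ln_term s) (- Cder zeta s)%C.
Proof. intros Hs. assert (Ez : Cder zeta s = Cder zD s).
 { apply Cder_eq. assert (N1 : s <> RtoC 1) by (intros ->; simpl in Hs; lra).
  apply Cdiff_ext_loc with zD. destruct (opn_Hp 1 s Hs) as (d & D & K). exists d; split; auto. intros w Hw. symmetry. apply zeta_zD. apply K; auto.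
  apply (hol_Cdiff (Hp 1)). apply hol_zD. exact Hs. }
 rewrite Ez. intros eps He.
 assert (Hn : forall n, hol (Hp 1) (fun s => Csum (fun n => rcpow (INR (S n)) (- s)) n)).
 { intros N. apply (hol_Csum _ (fun n s => rcpow (INR (S n)) (- s))). intros n. apply hol_rcpow. apply hol_opp, hol_id. }
 destruct (locunif_Cder (Hp 1) _ zD s (opn_Hp 1) Hn zD_locunif Hs eps He) as [N HN]. exists N. intros n Hle. specialize (HN n Hle).
 rewrite (Cder_eq _ s (- Csum (ln_term s) n)%C) in HN.
 - rewrite <- Cmod_opp. match goal with |- Cmod ?x <= _ => match type of HN with Cmod ?y <= _ => replace x with y by ring end end. auto.
 - clear. induction n; cbn [Csum]. eapply Cdiff_eq. apply Cdiff_const. ring.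
  eapply Cdiff_eq. apply Cdiff_plus. exact IHn. apply (Cdiff_comp (fun s => rcpow (INR (S n)) s) (fun s => - s)%C). apply Cdiff_rcpow. apply Cdiff_opp, Cdiff_id. ring.
Qed.

Lemma logder_zeta (RH : Riemann_hypothesis) s : Re s = 3 / 2 -> (Cder zeta s / zeta s)%C = (- Lsum s)%C.
Proof. intros Hs. note (Cser_unique _ _ _ (log_zeta_series s Hs) (Cder_zeta_series s ltac:(lra))) as E.
 assert (N : zeta s <> RtoC 0). { apply zeta_RH_neq0; auto; try lra. intros ->. simpl in Hs. lra. }
 rewrite <- zeta_zD in E by lra. replace (Cder zeta s) with (- (zeta s * Lsum s))%C by (rewrite E; ring). field. auto.
Qed.

(** * Test functions *)

Lemma Derive_n_zero (f : R -> R) (U : R -> Prop) : (forall x, U x -> locally x U) -> (forall x, U x -> f x = 0) ->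
 forall n x, U x -> Derive_n f n x = 0 /\ is_derive (Derive_n f n) x 0.
Proof. intros HU Hf n. assert (K : forall g : R -> R, (forall x, U x -> g x = 0) -> forall x, U x -> is_derive g x 0).
 { intros g Hg x Ux. apply is_derive_ext_loc with (fun _ => 0). 2: apply (is_derive_const (V := R_N)).
  apply filter_imp with (2 := HU x Ux). intros y Uy. symmetry; auto. }
 assert (Z : forall x, U x -> Derive_n f n x = 0). { induction n; intros x Ux. simpl; auto. simpl. apply is_derive_unique, K; auto. }
 intros x Ux. auto.
Qed.

Lemma locally_lt (x d : R) : x < d -> locally x (fun y => y < d).
Proof. intros H. apply (open_lt d x H). Qed.
Lemma locally_gt (x d : R) : d < x -> locally x (fun y => d < y).
Proof. intros H. apply (open_gt d x H). Qed.

(** What the analysis uses of a test function: two derivatives, as the estimates integrate by parts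
    at most twice, an interval away from 0 that carries it, and one common bound. *)
Record test_data (B B1 B2 : R -> C) (al be M : R) : Prop := {
 td_al : 0 < al; td_be : al < be; td_M : 0 <= M;
 td_D1 : forall x, RD B x (B1 x);
 td_D2 : forall x, RD B1 x (B2 x);
 td_c2 : forall x, contR B2 x;
 td_zero : forall x, x <= al \/ be <= x -> B x = RtoC 0 /\ B1 x = RtoC 0 /\ B2 x = RtoC 0;
 td_bd : forall x, Cmod (B x) <= M /\ Cmod (B1 x) <= M /\ Cmod (B2 x) <= M }.

Arguments td_al {_ _ _ _ _ _}. Arguments td_be {_ _ _ _ _ _}. Arguments td_M {_ _ _ _ _ _}. Arguments td_D1 {_ _ _ _ _ _}.
Arguments td_D2 {_ _ _ _ _ _}. Arguments td_c2 {_ _ _ _ _ _}. Arguments td_zero {_ _ _ _ _ _}. Arguments td_bd {_ _ _ _ _ _}.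
Ltac td_facts TD := note (td_be TD) as Hbe; note (td_al TD) as Hal; note (td_M TD) as PM.

Lemma Cc_infty_test_data B : Cc_infty_pos B -> exists B1 B2 al be M, test_data B B1 B2 al be M.
Proof. intros (H0 & Hs & Hc & Hp).
 assert (L : exists d, 0 < d /\ forall x, x < d -> B x = RtoC 0).
 { apply NNPP. intros N. assert (S0 : support B 0).
  { intros V [d Hd]. apply NNPP. intros N2. apply N. exists d. split. apply cond_pos. intros x Hx.
  destruct (Rle_dec x 0) as [|P]. auto. apply NNPP. intros Nz. apply N2. exists x. split; auto. apply Hd. unfold disc. rewrite Rminus_0_r, Rabs_pos_eq; lra. }
  apply Hp in S0. lra. }
 destruct L as (d & Pd & Hd). destruct (compact_P1 _ Hc) as (m & b & Hb).
 assert (Hb' : forall x, b < x -> B x = RtoC 0).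
 { intros x Hx. apply NNPP. intros Nz. assert (S1 : support B x). { intros V [r Hr]. exists x. split; auto. apply Hr. unfold disc. rewrite Rminus_diag, Rabs_R0. apply cond_pos. }
  apply Hb in S1. lra. }
 set (al := d / 2). set (be := Rmax (b + 1) d). assert (al < be) by (unfold al, be; note (Rmax_r (b + 1) d); lra).
 set (f := fun y => Re (B y)). set (g := fun y => Im (B y)).
 assert (Zf : forall n x, x < d \/ b < x -> (Derive_n f n x = 0 /\ is_derive (Derive_n f n) x 0) /\ (Derive_n g n x = 0 /\ is_derive (Derive_n g n) x 0)).
 { intros n x Hx. assert (HU : forall x, x < d \/ b < x -> locally x (fun x => x < d \/ b < x)).
  { intros y [Hy|Hy]. apply filter_imp with (2 := locally_lt y d Hy). auto. apply filter_imp with (2 := locally_gt y b Hy). auto. }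
  split; refine (Derive_n_zero _ (fun x => x < d \/ b < x) HU _ n x Hx); intros y [Hy|Hy]; unfold f, g; rewrite ?Hd, ?Hb' by auto; reflexivity. }
 assert (D : forall n x, is_derive (Derive_n f n) x (Derive_n f (S n) x) /\ is_derive (Derive_n g n) x (Derive_n g (S n) x)).
 { intros n x. destruct (Rlt_dec x d) as [Hx|Hx].
  - destruct (Zf n x (or_introl Hx)) as [[_ A1] [_ A2]]. destruct (Zf (S n) x (or_introl Hx)) as [[A3 _] [A4 _]]. rewrite A3, A4. auto.
  - destruct (Hs x ltac:(lra) (S n)) as [A1 A2]. split; apply Derive_correct; [exact A1|exact A2]. }
 set (Bn := fun n x => (Derive_n f n x, Derive_n g n x) : C).
 assert (DB : forall n x, RD (Bn n) x (Bn (S n) x)) by (intros n x; destruct (D n x); apply RD_pair; auto).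
 assert (Z : forall n x, x <= al \/ be <= x -> Bn n x = RtoC 0).
 { intros n x Hx. destruct (Zf n x) as [[A1 _] [A2 _]]. unfold al, be in Hx. note (Rmax_l (b + 1) d). lra. unfold Bn. rewrite A1, A2. reflexivity. }
 assert (Bd : forall n, exists M, 0 <= M /\ forall x, Cmod (Bn n x) <= M).
 { intros n. destruct (contI_bounded (Bn n) al be) as (M & PM & HM). intros x _. eapply RD_contR, DB. exists M. split; auto. intros x.
  destruct (Rle_dec al x); [destruct (Rle_dec x be); [apply HM; lra|]|]; rewrite Z by lra; rewrite Cmod_0; auto. }
 destruct (Bd 0%nat) as (M0 & P0 & Q0). destruct (Bd 1%nat) as (M1 & P1 & Q1). destruct (Bd 2%nat) as (M2 & P2 & Q2).
 assert (EB : forall x, Bn 0%nat x = B x) by (intros x; unfold Bn; simpl; symmetry; apply surjective_pairing).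
 exists (Bn 1%nat), (Bn 2%nat), al, be, (M0 + M1 + M2). split; try lra. unfold al; lra.
 - intros x. apply RD_ext with (Bn 0%nat). auto. apply DB.
 - intros x. apply DB.
 - intros x. eapply RD_contR, DB.
 - intros x Hx. rewrite <- EB. auto.
 - intros x. rewrite <- EB. specialize (Q0 x). specialize (Q1 x). specialize (Q2 x). lra.
Qed.

Lemma CInt_zero f a b : a <= b -> (forall x, a < x < b -> f x = RtoC 0) -> CInt f a b = 0.
Proof. intros Hab H. rewrite (CInt_ext f (fun _ => RtoC 0)); auto. rewrite (CInt_ftc (fun _ => RtoC 0) (fun _ => RtoC 0)); auto. ring. intros; apply RD_const. intros x _; apply contR_const.
Qed.

Lemma CInt_extend f a b a' b' : a' <= a -> a <= b -> b <= b' -> contI f a' b' -> (forall x, a' <= x <= b' -> x <= a \/ b <= x -> f x = RtoC 0) -> CInt f a' b' = CInt f a b.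
Proof. intros H1 H2 H3 Hf Hz. rewrite (CInt_Chasles f a' a b'), (CInt_Chasles f a b b') by (auto; try lra; eapply contI_sub; eauto; lra).
 rewrite (CInt_zero f a' a), (CInt_zero f b b'); try lra. ring. all: intros x Hx; apply Hz; lra.
Qed.

(** At [s = sigma + i t] the phase of the integrand is [t ln v - Y v], stationary at [v = t / Y];
    later [Y = 2 PI xi X]. *)
Definition Mel (B : R -> C) (al be Y : R) (s : C) : C := CInt (fun v => B v * Cexp (0%R, - (Y * v))%R * rcpow v (s - 1))%C al be.

Lemma RD_Cexp_phase Y x : RD (fun v => Cexp (0%R, Y * v)%R) x (Ci * RtoC Y * Cexp (0%R, Y * x)%R)%C.
Proof. apply RD_ext with (fun t => Cexp (RtoC t * (Ci * RtoC Y)))%C. intros t. f_equal. Ceq.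
 eapply RD_eq. apply RD_Cexp_line. f_equal. f_equal. Ceq.
Qed.

Lemma RD_Cexp_phase_neg Y x : RD (fun v => Cexp (0%R, - (Y * v))%R) x (- (Ci * RtoC Y) * Cexp (0%R, - (Y * x))%R)%C.
Proof. apply RD_ext with (fun v => Cexp (0%R, (- Y) * v)%R). intros; f_equal; f_equal; ring. eapply RD_eq. apply RD_Cexp_phase. rewrite RtoC_opp. replace (- Y * x) with (- (Y * x)) by ring. ring.
Qed.

Lemma Cmod_Cexp_im y : Cmod (Cexp (0%R, y)) = 1.
Proof. rewrite Cmod_Cexp. apply exp_0. Qed.

Lemma rcpow_pred v s : 0 < v -> rcpow v (s - 1) = (rcpow v s / RtoC v)%C.
Proof. intros Hv. unfold Cminus. rewrite rcpow_plus, rcpow_opp, rcpow_1 by auto. reflexivity. Qed.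

Section Mellin.
Variables (B B1 B2 : R -> C) (al be M : R).
Hypothesis TD : test_data B B1 B2 al be M.

Lemma Mel_contI Y s a b : 0 < a -> contI (fun v => B v * Cexp (0%R, - (Y * v))%R * rcpow v (s - 1))%C a b.
Proof. intros Ha x Hx. apply contR_mult; [apply contR_mult|apply contR_rcpow; lra]. eapply RD_contR, (td_D1 TD). eapply RD_contR, RD_Cexp_phase_neg.
Qed.

Lemma Mel_extend Y s a b : 0 < a <= al -> be <= b -> Mel B al be Y s = CInt (fun v => B v * Cexp (0%R, - (Y * v))%R * rcpow v (s - 1))%C a b.
Proof. intros Ha Hb. note (td_be TD). symmetry. apply CInt_extend; try lra. apply Mel_contI; lra. intros x Hx Hz. rewrite (proj1 (td_zero TD x Hz)). ring.
Qed.

Lemma Mel_Cdiff Y s : exists l, Cdiff (Mel B al be Y) s l.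
Proof. note (td_be TD). note (td_al TD).
 eexists. unfold Mel. apply (Cdiff_comp (fun s => CInt (fun v => B v * Cexp (0%R, - (Y * v))%R * rcpow v s)%C al be) (fun s => s - 1)%C).
 apply (Cdiff_CInt_rcpow (fun v => B v * Cexp (0%R, - (Y * v))%R)%C). lra.
 intros x Hx. apply contR_mult. eapply RD_contR, (td_D1 TD). eapply RD_contR, RD_Cexp_phase_neg.
 apply (Cdiff_minus (fun s => s) (fun _ => RtoC 1)). apply Cdiff_id. apply Cdiff_const.
Qed.

Lemma Rpower_bounded_on x v : Rabs x <= 4 -> al <= v <= be -> Rpower v x <= exp (4 * (Rabs (ln al) + Rabs (ln be))).
Proof. intros Hx Hv. note (td_al TD). apply exp_le.
 assert (L : Rabs (ln v) <= Rabs (ln al) + Rabs (ln be)).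
 { assert (ln al <= ln v) by (destruct (Req_dec al v) as [<-|]; [lra|left; apply ln_increasing; lra]).
  assert (ln v <= ln be) by (destruct (Req_dec v be) as [->|]; [lra|left; apply ln_increasing; lra]).
  unfold Rabs; repeat destruct Rcase_abs; lra. }
 le_via Rle_abs. rewrite Rabs_mult. apply Rmult_le_compat; auto using Rabs_pos.
Qed.

Let P := exp (4 * (Rabs (ln al) + Rabs (ln be))).

Lemma Mel_trivial Y s : -1 <= Re s <= 2 -> Cmod (Mel B al be Y s) <= (be - al) * (M * P).
Proof. intros Hs. note (td_be TD). note (td_al TD). rewrite Rmult_comm. apply CInt_bound. lra. apply Mel_contI; lra.
 intros v Hv. rewrite !Cmod_mult, Cmod_Cexp_im, Rmult_1_r, Cmod_rcpow. mul_le. pos. apply (td_bd TD).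
 apply Rpower_bounded_on; auto. unfold Cminus. rewrite re_plus, re_opp, re_RtoC. apply Rabs_le. lra.
Qed.

(* [q' = iYq^2], so each of the two integrations by parts gains a factor [|q|]. *)
Lemma Mel_nonstationary Y s q0 k : -1 <= Re s <= 2 -> 0 <= Y -> 0 < q0 -> Y <= k * q0 -> (forall v, al <= v <= be -> q0 <= Rabs (Im s - Y * v)) ->
 Cmod (Mel B al be Y s) <= (be - al) * (P * M * (1 + k + be * (1 + 3 * k + 3 * k * k))) / (q0 * q0).
Proof. intros Hs HY Hq Hk Hph. td_facts TD.
 assert (Pk : 0 <= k) by nra.
 set (dn := fun v : R => (s - Ci * RtoC Y * RtoC v)%C). set (q := fun v => (/ dn v)%C).
 assert (Dn : forall v, al <= v <= be -> q0 <= Cmod (dn v)).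
 { intros v Hv. le_via (Hph v Hv). eapply Rle_trans. 2: apply (Im_le_Cmod (dn v)). right. f_equal. unfold dn, Im, Re; simpl. ring. }
 assert (Nz : forall v, al <= v <= be -> dn v <> RtoC 0) by (intros v Hv; apply Cmod_lt_neq0; specialize (Dn v Hv); lra).
 assert (Qb : forall v, al <= v <= be -> Cmod (q v) <= / q0 /\ Y * Cmod (q v) <= k).
 { intros v Hv. specialize (Dn v Hv). unfold q. rewrite Cmod_inv by (apply Nz; auto). assert (/ Cmod (dn v) <= / q0) by (apply Rinv_le_contravar; lra). split. auto.
  le_mid (Y * / q0). mul_le_l; auto. apply Rmult_le_reg_r with q0. auto. rewrite Rmult_assoc, Rinv_l; lra. }
 assert (Dq : forall v, al <= v <= be -> RD q v (Ci * Y * (q v * q v))%C).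
 { intros v Hv. unfold q. eapply RD_eq. apply (RD_comp (fun z => / z)%C dn). apply Cdiff_inv_id. apply Nz; auto. unfold dn. apply (RD_minus (fun _ => s)). apply RD_const. apply RD_scal, RD_id.
  assert (dn v <> RtoC 0) by (apply Nz; auto). unfold dn in *. field. auto. }
 set (iY := (Ci * Y)%C) in *.
 set (E := fun v => (Cexp (0%R, - (Y * v))%R * rcpow v s)%C).
 assert (DE : forall v, al <= v <= be -> RD E v (dn v / v * E v)%C).
 { intros v Hv. unfold E. eapply RD_eq. apply RD_mult. apply RD_Cexp_phase_neg. apply RD_rcpow; lra. rewrite rcpow_pred by lra. unfold dn, iY. field. RtoC_nz. }
 assert (DB : forall v, RD B v (B1 v)) by apply (td_D1 TD). assert (DB1 : forall v, RD B1 v (B2 v)) by apply (td_D2 TD).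
 set (W := fun v : R => (v * (B1 v * (q v * q v) + iY * (B v * (q v * (q v * q v)))))%C).
 set (W' := fun v : R => (B1 v * (q v * q v) + iY * (B v * (q v * (q v * q v))) + v * (B2 v * (q v * q v) + 3 * (iY * (B1 v * (q v * (q v * q v)))) + 3 * (iY * iY * (B v * (q v * q v * (q v * q v))))))%C).
 assert (DW : forall v, al <= v <= be -> RD W v (W' v)).
 { intros v Hv. unfold W. specialize (Dq v Hv). eapply RD_eq. apply RD_mult. apply RD_id. apply RD_plus. apply RD_mult. apply DB1. apply RD_mult; apply Dq. apply RD_scal. apply RD_mult. apply DB. apply RD_mult. apply Dq. apply RD_mult; apply Dq.
  unfold W'. ring. }
 assert (cq : forall v, al <= v <= be -> contR q v) by (intros v Hv; eapply RD_contR, Dq; auto).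
 assert (cB : forall v, contR B v) by (intros v; eapply RD_contR, DB). assert (cB1 : forall v, contR B1 v) by (intros v; eapply RD_contR, DB1). assert (cB2 : forall v, contR B2 v) by apply (td_c2 TD).
 assert (cE : forall v, al <= v <= be -> contR E v) by (intros v Hv; eapply RD_contR, DE; auto).
 assert (cid : forall v, contR RtoC v) by (intros v; eapply RD_contR, RD_id).
 assert (cW' : contI W' al be).
 { intros v Hv. specialize (cq v Hv). unfold W'. repeat first [apply contR_plus|apply contR_mult|apply contR_const|apply cB|apply cB1|apply cB2|apply cq|apply cid]. }
 (* Both integrations by parts at once: the derivative of [G] is the Mellin integrand minus [W' E],
    and [G] vanishes at both ends together with [B] and [B1]. *)
 set (G := fun v => ((B v * q v - W v) * E v)%C).
 assert (DG : forall v, al <= v <= be -> RD G v (B v * Cexp (0%R, - (Y * v))%R * rcpow v (s - 1) - W' v * E v)%C).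
 { intros v Hv. unfold G. eapply RD_eq. apply RD_mult. apply RD_minus. apply RD_mult. apply DB. apply Dq; auto. apply DW; auto. apply DE; auto.
  rewrite rcpow_pred by lra. unfold W, q, E. fold iY. assert (dn v <> RtoC 0) by (apply Nz; auto). field. split; auto. RtoC_nz. }
 assert (cF : contI (fun v => W' v * E v)%C al be) by (intros v Hv; apply contR_mult; [apply cW'|apply cE]; auto).
 assert (Key : Mel B al be Y s = CInt (fun v => W' v * E v)%C al be).
 { unfold Mel. apply Ceq_minus. rewrite <- CInt_minus; auto; try lra. 2: apply Mel_contI; lra. rewrite (CInt_ftc G); try lra. 2: exact DG.
  unfold G, W. destruct (td_zero TD al ltac:(lra)) as (-> & -> & _). destruct (td_zero TD be ltac:(lra)) as (-> & -> & _). ring.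
  intros v Hv. apply contR_minus. apply (Mel_contI Y s al be); auto; lra. apply cF; auto. }
 rewrite Key. unfold Rdiv. rewrite Rmult_assoc, (Rmult_comm (be - al)). apply CInt_bound; auto; try lra.
 intros v Hv. destruct (Qb v Hv) as [Q1 Q2]. note (Cmod_ge_0 (q v)) as Q0.
 destruct (td_bd TD v) as (b0 & b1 & b2). note (Cmod_ge_0 (B v)). note (Cmod_ge_0 (B1 v)). note (Cmod_ge_0 (B2 v)).
 set (a := Cmod (q v)) in *. assert (MiY : Cmod iY = Y) by (unfold iY; rewrite Cmod_mult, Cmod_Ci, Cmod_RtoC_pos; lra).
 assert (Aq : a * a <= / (q0 * q0)). { rewrite Rinv_mult. apply Rmult_le_compat; auto. }
 assert (Ya : 0 <= Y * a) by (apply Rmult_le_pos; auto).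
 assert (T1 : Cmod (B1 v * (q v * q v) + iY * (B v * (q v * (q v * q v)))) <= M * (1 + k) * (a * a)).
 { le_via Cmod_triangle. rewrite !Cmod_mult, MiY. fold a. replace (Y * (Cmod (B v) * (a * (a * a)))) with (Cmod (B v) * (Y * a) * (a * a)) by ring.
  assert (Cmod (B v) * (Y * a) <= M * k) by (apply Rmult_le_compat; auto). assert (0 <= a * a) by (apply Rmult_le_pos; auto). nra. }
 assert (T2 : Cmod (B2 v * (q v * q v) + 3 * (iY * (B1 v * (q v * (q v * q v)))) + 3 * (iY * iY * (B v * (q v * q v * (q v * q v))))) <= M * (1 + 3 * k + 3 * k * k) * (a * a)).
 { le_via Cmod_triangle. eapply Rle_trans. apply Rplus_le_compat_r, Cmod_triangle. rewrite !Cmod_mult, MiY, Cmod_RtoC_pos by lra. fold a.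
  replace (3 * (Y * (Cmod (B1 v) * (a * (a * a))))) with (3 * (Cmod (B1 v) * (Y * a)) * (a * a)) by ring.
  replace (3 * (Y * Y * (Cmod (B v) * (a * a * (a * a))))) with (3 * (Cmod (B v) * ((Y * a) * (Y * a))) * (a * a)) by ring.
  assert (Cmod (B1 v) * (Y * a) <= M * k) by (apply Rmult_le_compat; auto).
  assert (Cmod (B v) * ((Y * a) * (Y * a)) <= M * (k * k)) by (apply Rmult_le_compat; auto; [apply Rmult_le_pos; auto|apply Rmult_le_compat; auto]).
  assert (0 <= a * a) by (apply Rmult_le_pos; auto). nra. }
 assert (T3 : Cmod (W' v) <= M * (1 + k + be * (1 + 3 * k + 3 * k * k)) * (a * a)).
 { unfold W'. le_via Cmod_triangle. rewrite (Cmod_mult (RtoC v)), (Cmod_RtoC_pos v) by lra.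
  le_via Rplus_le_compat. apply T1. apply Rmult_le_compat. lra. apply Cmod_ge_0. apply (proj2 Hv). apply T2. right; ring. }
 assert (T4 : Cmod (E v) <= P). { unfold E. rewrite Cmod_mult, Cmod_Cexp_im, Rmult_1_l, Cmod_rcpow. apply Rpower_bounded_on; auto. apply Rabs_le; lra. }
 rewrite Cmod_mult. le_mid (M * (1 + k + be * (1 + 3 * k + 3 * k * k)) * / (q0 * q0) * P).
 mul_le. le_via T3. mul_le_l; auto. apply Rmult_le_pos; auto. assert (0 <= be * (1 + 3 * k + 3 * k * k)) by (apply Rmult_le_pos; nra). lra.
 right; ring.
Qed.

End Mellin.

(** * The factor [chi] as a limit of oscillatory integrals *)

Lemma CInt_conj f a b : a <= b -> contI f a b -> CInt (fun x => Cconj (f x)) a b = Cconj (CInt f a b).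
Proof. intros Hab Hf. apply CInt_is. destruct (is_RInt_components _ _ _ _ (CInt_correct f a b Hab Hf)) as [H1 H2].
 apply (is_RInt_fct_extend_pair (U := R_N) (V := R_N)); simpl. exact H1. apply (is_RInt_opp (V := R_N)). exact H2.
Qed.

Lemma Cw_conj w : -1 < Re w < 1 -> Cconj (Cw w) = Cw (Cconj w).
Proof. intros Hw. apply Cmod_small_eq. intros eps He. destruct (Cw_spec w Hw (eps / 2)) as [N1 H1]. lra. destruct (Cw_spec (Cconj w) Hw (eps / 2)) as [N2 H2]. lra.
 specialize (H1 (N1 + N2)%nat ltac:(lia)). specialize (H2 (N1 + N2)%nat ltac:(lia)). set (n := (N1 + N2)%nat) in *.
 assert (E : Iseq n (Cconj w) = Cconj (Iseq n w)).
 { unfold Iseq, Iw. note (inv_INR_S n). note (INR_S_ge1 n). rewrite <- CInt_conj. 2: lra. 2: apply Iw_contI; lra.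
  apply CInt_ext. lra. intros x _. rewrite Cmult_conj, Cconj_rcpow. f_equal. Ceq. f_equal. Ceq. }
 rewrite <- Cmod_conj, Cminus_conj, <- E in H1. rewrite Cmod_minus_sym in H1.
 le_via (Cmod_triangle3 _ (Iseq n (Cconj w))). lra.
Qed.

Lemma chi_conj w : -1 < Re w < 1 -> Cconj (chi w) = chi (Cconj w).
Proof. intros Hw. unfold chi, Cdiv. rewrite !Cmult_conj, Cw_conj, Cplus_conj by auto. f_equal. f_equal. f_equal. f_equal. Ceq.
 rewrite Cinv_conj. f_equal. Ceq. intros X. apply (f_equal Re) in X. simpl in X. note PI_RGT_0. nra.
Qed.

(** [G] collects the boundary terms of the two integrations by parts that lead from the cosine
    integral to [Iw]; the two powers on the right bound it at the cut-offs [a] and [b]. *)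
Lemma chi_cos_rep w a b : Re w = 1 / 2 -> 0 < a <= b -> a <= 1 <= b ->
 Cmod (CInt (fun x => RtoC (2 * cos (2 * PI * x)) * rcpow x (- w))%C a b - chi w) <=
 (Cmod w + 2) * (Rpower a (1 / 2) + Rpower b (- (1 / 2))) + Cmod (w * (w + 1) / (2 * PI * PI)) * rate (1 / 2) (1 / 2) a b.
Proof. intros Hw Hab H1. note PI_RGT_0 as PP. assert (NPI : RtoC PI <> 0) by (RtoC_nz). note C2_neq0 as N2.
 set (G := fun x => (- (w / (2 * PI * PI)) * (RtoC (1 - cos (2 * PI * x)) * rcpow x (- w - 1)) - / PI * (RtoC (sin (2 * PI * x)) * rcpow x (- w)))%C).
 set (c := (w * (w + 1) / (2 * PI * PI))%C).
 assert (DG : forall x, a <= x <= b -> RD G x (c * (RtoC (1 - cos (2 * PI * x)) * rcpow x (- w - 2)) - RtoC (2 * cos (2 * PI * x)) * rcpow x (- w))%C).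
 { intros x Hx. unfold G. eapply RD_eq. apply RD_minus.
  - apply RD_scal. apply RD_mult. apply (RD_RtoC (fun x => 1 - cos (2 * PI * x)) x (2 * PI * sin (2 * PI * x))). auto_derive; auto; ring. apply RD_rcpow; lra.
  - apply RD_scal. apply RD_mult. apply (RD_RtoC (fun x => sin (2 * PI * x)) x (2 * PI * cos (2 * PI * x))). auto_derive; auto; ring. apply RD_rcpow; lra.
  - unfold c. replace (- w - 1 - 1)%C with (- w - 2)%C by Ceq. rewrite !RtoC_mult. field. auto. }
 assert (c1 : contI (fun x => RtoC (1 - cos (2 * PI * x)) * rcpow x (- w - 2))%C a b) by (apply Iw_contI; lra).
 assert (c2 : contI (fun x => RtoC (2 * cos (2 * PI * x)) * rcpow x (- w))%C a b).
 { intros x Hx. apply contR_mult. apply contR_RtoC. apply ex_derive_cont. auto_derive; auto. apply contR_rcpow; lra. }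
 assert (Key : (c * Iw a b w - CInt (fun x => RtoC (2 * cos (2 * PI * x)) * rcpow x (- w)) a b)%C = (G b - G a)%C).
 { unfold Iw. rewrite <- CInt_scal, <- CInt_minus; auto; try lra. apply CInt_ftc; auto; try lra. intros x Hx. apply contR_minus; auto. apply contR_scal; auto. intros x Hx. apply contR_scal; auto. }
 assert (Q : forall x, Cmod (G x) <= Cmod w / (2 * PI * PI) * ((1 - cos (2 * PI * x)) * Rpower x (- (3 / 2))) + / PI * (Rabs (sin (2 * PI * x)) * Rpower x (- (1 / 2)))).
 { intros x. unfold G. le_via Cmod_triangle_minus. rewrite !Cmod_mult, Cmod_opp, !Cmod_R, !Cmod_rcpow. note (COS_bound (2 * PI * x)).
  rewrite (Rabs_pos_eq (1 - _)) by lra. unfold Cdiv. rewrite Cmod_mult, <- !RtoC_mult, <- !RtoC_inv, !Cmod_R by nra.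
  replace (Re (- w - 1)%C) with (- (3 / 2)) by (unfold Cminus; rewrite re_plus, !re_opp, re_RtoC; lra). rewrite re_opp, Hw.
  rewrite (Rabs_pos_eq (/ PI)), (Rabs_pos_eq (/ (2 * PI * PI))). right; reflexivity. left; apply Rinv_0_lt_compat; nra. pos. }
 note (Cmod_ge_0 w) as Pw.
 assert (Ga : Cmod (G a) <= (Cmod w + 2) * Rpower a (1 / 2)).
 { le_via Q. note (one_minus_cos_bound (2 * PI * a)) as O1. 
  assert (O2 : Rabs (sin (2 * PI * a)) <= 2 * PI * a). { apply Rabs_le. assert (0 < 2 * PI * a) by pos. note (sin_lt_x _ H). note (SIN_bound (2 * PI * a)).
  destruct (Rle_dec 1 (2 * PI * a)). lra. note (PI2_1). assert (0 <= sin (2 * PI * a)) by (apply sin_ge_0; lra). lra. }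
  note (Rpower_pos a (- (3 / 2))) as p1. note (Rpower_pos a (- (1 / 2))) as p2.
  assert (E1 : Rpower a (1 / 2) = a * a * Rpower a (- (3 / 2))). { rewrite <- (Rpower_1 a) at 2 3 by lra. rewrite <- !Rpower_plus. f_equal. field. }
  assert (E2 : Rpower a (1 / 2) = a * Rpower a (- (1 / 2))). { rewrite <- (Rpower_1 a) at 2 by lra. rewrite <- !Rpower_plus. f_equal. field. }
  le_mid (Cmod w / (2 * PI * PI) * ((2 * PI * a) ^ 2 / 2 * Rpower a (- (3 / 2))) + / PI * (2 * PI * a * Rpower a (- (1 / 2)))).
  apply Rplus_le_compat; mul_le_l. apply Rdiv_le_0_compat; nra. mul_le_r; lra. pos. mul_le_r; lra.
  rewrite Rmult_plus_distr_r. rewrite E1 at 1. rewrite E2. right. field. lra. }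
 assert (Gb : Cmod (G b) <= (Cmod w + 2) * Rpower b (- (1 / 2))).
 { le_via Q. note (COS_bound (2 * PI * b)). assert (O2 : Rabs (sin (2 * PI * b)) <= 1) by (apply Rabs_le; apply SIN_bound).
  assert (Rpower b (- (3 / 2)) <= Rpower b (- (1 / 2))) by (apply Rpower_mono_exp; lra). note (Rpower_pos b (- (3 / 2))). set (r := Rpower b (- (1 / 2))) in *.
  le_mid (Cmod w / (2 * PI * PI) * (2 * r) + / PI * (1 * r)).
  apply Rplus_le_compat; mul_le_l. apply Rdiv_le_0_compat; nra. apply Rmult_le_compat; lra. pos. mul_le_r; lra.
  note PI2_1. assert (/ PI <= 1) by (rewrite <- Rinv_1; apply Rinv_le_contravar; lra). assert (0 < / PI) by (apply Rinv_0_lt_compat; auto).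
  replace (Cmod w / (2 * PI * PI) * (2 * r) + / PI * (1 * r)) with ((Cmod w * (/ PI * / PI) + / PI) * r) by (field; lra). mul_le_r. lra. assert (/ PI * / PI <= 1) by nra. nra. }
 replace (CInt (fun x => RtoC (2 * cos (2 * PI * x)) * rcpow x (- w))%C a b - chi w)%C with (G a - G b + c * (Iw a b w - Cw w))%C.
 2:{ unfold chi. fold c. replace (G a - G b)%C with (- (G b - G a))%C by ring. rewrite <- Key. ring. }
 le_via Cmod_triangle. apply Rplus_le_compat. le_via Cmod_triangle_minus. lra.
 rewrite Cmod_mult. mul_le_l. apply Cmod_ge_0. apply Cw_rate; lra.
Qed.

(** Rescaling by [k] and conjugating brings [chi_cos_rep] into the form met in stationary phase: a
    cosine of frequency [k] against [v^(s - 1)] at [s = 1/2 + i g]. *)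
Lemma chi_cos_limit k g eps : 0 < k -> 0 < eps -> exists x0, 0 < x0 /\ forall a b, 0 < a <= x0 -> / x0 <= b ->
 Cmod (rcpow k (hl g) * CInt (fun v => RtoC (2 * cos (2 * PI * (k * v))) * rcpow v (hl g - 1))%C a b - Cconj (chi (hl g))) <= eps.
Proof. intros Hk He. rewrite chi_conj by (simpl; lra). set (w := Cconj (hl g)). assert (Ew : (- w)%C = (hl g - 1)%C) by (unfold w, hl; Ceq; field).
 set (D := Cmod (w * (w + 1) / (2 * PI * PI))). note (Cmod_ge_0 w) as Pw. assert (PD : 0 <= D) by apply Cmod_ge_0.
 destruct (rate_small (1 / 2) (1 / 2) (eps / 2 / (D + 1))) as (x1 & X1 & R1); try lra. pos.
 destruct (Rpower_small0 (1 / 2) (eps / 4 / (Cmod w + 2))) as (x2 & X2 & R2); try lra. pos.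
 set (x3 := Rmin 1 (Rmin x1 x2)). assert (X3 : 0 < x3) by (unfold x3; repeat apply Rmin_pos; lra).
 assert (L1 : x3 <= 1) by apply Rmin_l. assert (L2 : x3 <= x1) by (eapply Rle_trans; [apply Rmin_r|apply Rmin_l]). assert (L3 : x3 <= x2) by (eapply Rle_trans; [apply Rmin_r|apply Rmin_r]).
 exists (Rmin (x3 / k) (x3 * k)). assert (0 < x3 / k) by pos. assert (0 < x3 * k) by pos. split. apply Rmin_pos; auto.
 intros a b Ha Hb. set (m := Rmin (x3 / k) (x3 * k)) in *. assert (Pm : 0 < m) by (apply Rmin_pos; auto).
 assert (Ha' : k * a <= x3). { le_mid (k * (x3 / k)). mul_le_l. lra. le_via (proj2 Ha). apply Rmin_l. right; field; lra. }
 assert (Hb' : / x3 <= k * b). { le_mid (k * / (x3 * k)). right; field; lra. mul_le_l. lra. eapply Rle_trans. 2: apply Hb. apply Rinv_le_contravar; auto. apply Rmin_r. }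
 assert (1 <= / x3) by (rewrite <- Rinv_1 at 1; apply Rinv_le_contravar; lra).
 assert (Hab : a <= b) by (apply Rmult_le_reg_l with k; lra). assert (0 < k * a) by pos.
 note (chi_cos_rep w (k * a) (k * b) ltac:(reflexivity) ltac:(lra) ltac:(lra)) as K. fold D in K.
 replace (rcpow k (hl g) * CInt (fun v => RtoC (2 * cos (2 * PI * (k * v))) * rcpow v (hl g - 1)) a b)%C with (CInt (fun x => RtoC (2 * cos (2 * PI * x)) * rcpow x (- w))%C (k * a) (k * b)).
 2:{ assert (c2 : forall a b, 0 < a -> contI (fun x => RtoC (2 * cos (2 * PI * x)) * rcpow x (- w))%C a b).
  { intros a' b' P' x Hx. apply contR_mult. apply contR_RtoC. apply ex_derive_cont. auto_derive; auto. apply contR_rcpow; lra. }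
  rewrite CInt_subst_lin; auto. rewrite <- CInt_scal; auto.
  2:{ intros x Hx. apply contR_mult. apply contR_RtoC. apply ex_derive_cont. auto_derive; auto. apply contR_rcpow; lra. }
  assert (Ek : rcpow k (hl g) = (rcpow k (hl g - 1) * RtoC k)%C). { replace (hl g) with ((hl g - 1) + 1)%C at 1 by ring. rewrite rcpow_plus, rcpow_1; auto. }
  apply CInt_ext. auto. intros x Hx. rewrite Ew, rcpow_mult_base, Ek by lra. ring. }
 assert (I1 : / (k * b) <= x3). { rewrite <- (Rinv_inv x3). apply Rinv_le_contravar; auto. apply Rinv_0_lt_compat; auto. }
 assert (I2 : 0 < / (k * b)) by pos.
 le_via K. specialize (R1 (k * a) (k * b) ltac:(lra) ltac:(lra)). note (R2 (k * a) ltac:(lra)) as R3. note (R2 (/ (k * b)) ltac:(lra)) as R4. rewrite Rpower_Rinv_base in R4 by lra.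
 le_mid ((Cmod w + 2) * (eps / 4 / (Cmod w + 2) + eps / 4 / (Cmod w + 2)) + (D + 1) * (eps / 2 / (D + 1))).
 apply Rplus_le_compat. mul_le_l; lra. le_mid (D * (eps / 2 / (D + 1))). mul_le_l; lra. mul_le_r. left; apply Rdiv_lt_0_compat; lra. lra.
 right. field. lra.
Qed.

(** Integration by parts against a bounded phase [E]. The derivative of the amplitude is integrable
    because [2 atan (sqrt v)] is a primitive of [1 / (sqrt v (1 + v))]; with [PI <= 4] the two
    boundary terms and the integral add up to [6 A]. *)
Lemma osc_bound p p' E E' A a b : 0 < a <= b -> 0 <= A -> (forall v, a <= v <= b -> RD p v (p' v)) -> (forall v, a <= v <= b -> RD E v (E' v)) -> contI p' a b -> contI E' a b ->
 (forall v, a <= v <= b -> Cmod (E v) <= 1) -> (forall v, a <= v <= b -> Cmod (p v) <= A) -> (forall v, a <= v <= b -> Cmod (p' v) <= A * / (sqrt v * (1 + v))) ->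
 Cmod (CInt (fun v => p v * E' v)%C a b) <= 6 * A.
Proof. intros Hab PA Dp DE cp' cE' bE bp bp'.
 assert (cE : contI E a b) by (intros v Hv; eapply RD_contR, DE; auto). assert (cp : contI p a b) by (intros v Hv; eapply RD_contR, Dp; auto).
 assert (c1 : contI (fun v => p' v * E v)%C a b) by (intros v Hv; apply contR_mult; auto).
 assert (c2 : contI (fun v => p v * E' v)%C a b) by (intros v Hv; apply contR_mult; auto).
 assert (Key : CInt (fun v => p v * E' v)%C a b = (p b * E b - p a * E a - CInt (fun v => p' v * E v) a b)%C).
 { replace (p b * E b - p a * E a)%C with (CInt (fun v => p' v * E v + p v * E' v)%C a b). rewrite CInt_plus; auto; try lra. ring.
  apply (CInt_ftc (fun v => p v * E v)%C); try lra. intros v Hv. apply RD_mult; auto. intros v Hv. apply contR_plus; auto. }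
 assert (I : Cmod (CInt (fun v => p' v * E v)%C a b) <= 2 * A * atan (sqrt b) - 2 * A * atan (sqrt a)).
 { apply (CInt_bound_prim _ (fun v => 2 * A * atan (sqrt v)) (fun v => A * / (sqrt v * (1 + v)))); try lra; auto.
  - intros v Hv. assert (0 < sqrt v) by (apply sqrt_lt_R0; lra). auto_derive. lra. replace (sqrt v * (sqrt v * 1)) with v by (rewrite Rmult_1_r, sqrt_sqrt; lra). field. split; lra.
  - intros v Hv. assert (0 < sqrt v) by (apply sqrt_lt_R0; lra). apply ex_derive_cont. auto_derive. split. lra. split; auto. apply Rgt_not_eq, Rmult_lt_0_compat; lra.
  - intros v Hv. rewrite Cmod_mult. le_mid (Cmod (p' v) * 1). mul_le_l; auto using Cmod_ge_0. rewrite Rmult_1_r; auto. }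
 assert (0 <= atan (sqrt a)). { rewrite <- atan_0. destruct (sqrt_pos a) as [L|<-]. left; apply atan_increasing; auto. lra. }
 destruct (atan_bound (sqrt b)) as [_ Ab]. note PI_4.
 rewrite Key. le_via Cmod_triangle_minus. le_via Rplus_le_compat_r. apply Cmod_triangle_minus. rewrite !Cmod_mult.
 assert (J : forall v, a <= v <= b -> Cmod (p v) * Cmod (E v) <= A). { intros v Hv. le_mid (A * 1). mul_le. lra. }
 note (J a ltac:(lra)). note (J b ltac:(lra)). nra.
Qed.

Lemma rcpow_half v g : 0 < v -> rcpow v (hl g - 1) = (RtoC (/ sqrt v) * rcpow v (0%R, g))%C.
Proof. intros Hv. replace (hl g - 1)%C with (RtoC (- (/ 2)) + (0%R, g))%C by (unfold hl; Ceq; field). rewrite rcpow_plus. f_equal.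
 unfold rcpow. rewrite <- RtoC_mult, <- RtoC_exp. f_equal. change (Rpower v (- / 2) = / sqrt v). rewrite Rpower_Ropp, Rpower_sqrt; auto.
Qed.

Lemma RD_phase_pow Y g v : 0 < v -> RD (fun v => Cexp (0%R, Y * v)%R * rcpow v (0%R, g))%C v (Ci * RtoC ((Y * v + g) / v) * (Cexp (0%R, Y * v)%R * rcpow v (0%R, g)))%C.
Proof. intros Hv. eapply RD_eq. apply RD_mult. apply RD_Cexp_phase. apply RD_rcpow; auto. rewrite rcpow_pred by auto.
 replace ((0%R, g) : C) with (Ci * RtoC g)%C by Ceq. rewrite RtoC_div, RtoC_plus, RtoC_mult by lra. field. RtoC_nz.
Qed.

Lemma sqrt_le_1p v : 0 <= v -> sqrt v <= 1 + v.
Proof. intros H. note (sqrt_pos v). note (sqrt_sqrt v H). nra. Qed.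

Lemma cos_as_exp x : RtoC (2 * cos x) = (Cexp (0%R, - x)%R + Cexp (0%R, x))%C.
Proof. unfold Cexp. apply Ceq_intro; unfold Re, Im; simpl; rewrite ?exp_0, ?cos_neg, ?sin_neg; ring. Qed.

(** * Stationary phase *)

Section Stationary.
Variables (B B1 B2 : R -> C) (al be M : R).
Hypothesis TD : test_data B B1 B2 al be M.
Variables (Y v0 : R).
Hypothesis PY : 0 < Y.
Hypothesis Pv0 : 0 < v0.

Let kk := 1 + 2 * be + / (2 * be).
(** Subtracting [B v0] makes the amplitude vanish at the stationary point [v0], so the quotient by
    [v - v0] stays bounded and cancels the zero of the phase derivative. [H1] is the derivative of
    [H]. *)
Let H v := ((B v - B v0) / RtoC (v - v0))%C.
Let H1 v := ((B1 v * RtoC (v - v0) - (B v - B v0)) / (RtoC (v - v0) * RtoC (v - v0)))%C.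

(** For [v <= 2 be] the mean value inequality bounds both quotients. Beyond that [B v = 0], and
    either [B v0 = 0] or [v - v0 >= v / 2], which gives the decay in [v]. *)
Lemma quotient_bounds v : 0 < v -> v <> v0 -> Cmod (H v) <= 4 * M * (kk * kk) / (1 + v) /\ Cmod (H1 v) <= 4 * M * (kk * kk) / ((1 + v) * (1 + v)).
Proof. intros Hv Nv. td_facts TD.
 assert (Pi : 0 < / (2 * be)) by pos. assert (Pk : 1 <= kk) by (unfold kk; lra).
 set (h := Rabs (v - v0)). assert (Ph : 0 < h) by (apply Rabs_pos_lt; lra).
 assert (EH : Cmod (H v) = Cmod (B v - B v0) / h). { unfold H. rewrite Cmod_div, Cmod_R; auto. RtoC_nz. }
 assert (EH1 : Cmod (H1 v) = Cmod (B1 v * RtoC (v - v0) - (B v - B v0)) / (h * h)).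
 { unfold H1. rewrite Cmod_div, Cmod_mult, Cmod_R; auto. intros X. apply Cmod_eq_0_inv in X || (apply (f_equal Re) in X; simpl in X; nra). }
 rewrite EH, EH1. destruct (Rle_dec v (2 * be)) as [L|L].
 - assert (A1 : Cmod (B v - B v0) <= M * h).
  { apply (RD_mean_ineq_sym B B1 v0 v). intros; apply (td_D1 TD). intros; apply (td_bd TD). }
  assert (A2 : Cmod (B1 v * RtoC (v - v0) - (B v - B v0)) <= M * h * h).
  { replace (B1 v * RtoC (v - v0) - (B v - B v0))%C with ((B1 v * RtoC v - B v) - (B1 v * RtoC v0 - B v0))%C by (rewrite RtoC_minus; ring).
  apply (RD_mean_ineq_sym (fun u => B1 v * RtoC u - B u)%C (fun u => B1 v * 1 - B1 u)%C v0 v).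
  - intros x Hx. apply RD_minus. apply RD_scal, RD_id. apply (td_D1 TD).
  - intros x Hx. replace (B1 v * 1 - B1 x)%C with (B1 v - B1 x)%C by ring. le_mid (M * Rabs (v - x)).
  apply (RD_mean_ineq_sym B1 B2 x v). intros; apply (td_D2 TD). intros; apply (td_bd TD).
  mul_le_l; auto. unfold h. unfold Rmin, Rmax in Hx. destruct Rle_dec; unfold Rabs; repeat destruct Rcase_abs; lra. }
  assert (Kv : 1 + v <= kk) by (unfold kk; lra). split.
  + le_mid M. apply Rmult_le_reg_r with h; auto. unfold Rdiv. rewrite Rmult_assoc, Rinv_l; lra.
  apply Rmult_le_reg_r with (1 + v). lra. unfold Rdiv. rewrite (Rmult_assoc (4 * M * (kk * kk))), Rinv_l, Rmult_1_r by lra. assert (1 + v <= 4 * (kk * kk)) by nra. nra.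
  + le_mid M. apply Rmult_le_reg_r with (h * h). nra. unfold Rdiv. rewrite (Rmult_assoc (Cmod _)), Rinv_l; nra.
  assert ((1 + v) * (1 + v) <= 4 * (kk * kk)) by nra. apply Rmult_le_reg_r with ((1 + v) * (1 + v)). nra. unfold Rdiv. rewrite (Rmult_assoc (4 * M * (kk * kk))), Rinv_l, Rmult_1_r by nra. nra.
 - destruct (td_zero TD v ltac:(lra)) as (-> & -> & _).
  assert (A : Cmod (B v0) <= M /\ (Cmod (B v0) = 0 \/ v <= 2 * h)).
  { split. apply (td_bd TD). destruct (Rle_dec v0 be). right. unfold h. rewrite Rabs_pos_eq; lra. left. rewrite (proj1 (td_zero TD v0 ltac:(lra))). apply Cmod_0. }
  replace (0 - B v0)%C with (- B v0)%C by ring. replace (0 * RtoC (v - v0) - - B v0)%C with (B v0) by ring. rewrite Cmod_opp. destruct A as [A1 A2]. note (Cmod_ge_0 (B v0)).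
  assert (Kv : 1 + v <= kk * v). { assert (1 <= / (2 * be) * v). { apply Rmult_le_reg_l with (2 * be). lra. rewrite <- Rmult_assoc, Rinv_r; lra. } unfold kk. nra. }
  destruct A2 as [-> | A2]. unfold Rdiv; rewrite !Rmult_0_l. split; apply Rmult_le_pos; try (repeat apply Rmult_le_pos; lra); left; apply Rinv_0_lt_compat; nra.
  assert (Z : 1 + v <= 2 * kk * h) by nra. split.
  + apply Rmult_le_reg_r with (h * (1 + v)). nra. replace (Cmod (B v0) / h * (h * (1 + v))) with (Cmod (B v0) * (1 + v)) by (field; lra). replace (4 * M * (kk * kk) / (1 + v) * (h * (1 + v))) with (M * (4 * (kk * kk) * h)) by (field; lra).
  apply Rmult_le_compat; try lra. nra.
  + apply Rmult_le_reg_r with (h * h * ((1 + v) * (1 + v))). apply Rmult_lt_0_compat; nra. replace (Cmod (B v0) / (h * h) * (h * h * ((1 + v) * (1 + v)))) with (Cmod (B v0) * ((1 + v) * (1 + v))) by (field; lra). replace (4 * M * (kk * kk) / ((1 + v) * (1 + v)) * (h * h * ((1 + v) * (1 + v)))) with (M * ((2 * kk * h) * (2 * kk * h))) by (field; lra).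
  apply Rmult_le_compat; try lra. nra. apply Rmult_le_compat; lra.
Qed.

Let g := Y * v0.
Let F v := ((B v - B v0) * Cexp (0%R, - (Y * v))%R * rcpow v (hl g - 1))%C.

Lemma F_contR v : 0 < v -> contR F v.
Proof. intros Hv. apply contR_mult; [apply contR_mult|apply contR_rcpow; lra]. apply contR_minus. eapply RD_contR, (td_D1 TD). apply contR_const. eapply RD_contR, RD_Cexp_phase_neg.
Qed.

(** The unimodular function [exp(-i Y v) v^(i g)] has logarithmic derivative [-i Y (v - v0) / v].
    Dividing by it writes [F] as an amplitude times the derivative of this function, with amplitude
    proportional to [H v sqrt v / Y], and [osc_bound] applies. *)
Lemma F_away a b : 0 < a <= b -> v0 < a \/ b < v0 -> Cmod (CInt F a b) <= 6 * (8 * M * (kk * kk) / Y).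
Proof. intros Hab Hv0. td_facts TD.
 assert (NY : RtoC Y <> 0) by (RtoC_nz).
 set (E := fun v => (Cexp (0%R, (- Y) * v)%R * rcpow v (0%R, g))%C). set (E' := fun v => (Ci * RtoC ((- Y * v + g) / v) * E v)%C).
 set (p := fun v => (Ci / Y * (H v * RtoC (sqrt v)))%C). set (p' := fun v => (Ci / Y * (H1 v * RtoC (sqrt v) + H v * RtoC (/ (2 * sqrt v))))%C).
 assert (DE : forall v, a <= v <= b -> RD E v (E' v)) by (intros v Hv; apply RD_phase_pow; lra).
 assert (Nz : forall v, a <= v <= b -> RtoC (v - v0) <> 0) by (intros v Hv X; apply (f_equal Re) in X; simpl in X; lra).
 assert (sq : forall v, a <= v <= b -> 0 < sqrt v) by (intros; apply sqrt_lt_R0; lra).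
 assert (DH : forall v, a <= v <= b -> RD H v (H1 v)).
 { intros v Hv. unfold H, Cdiv. eapply RD_eq. apply RD_mult. apply RD_minus. apply (td_D1 TD). apply RD_const.
  apply (RD_comp (fun z => / z)%C (fun v => RtoC (v - v0))). apply Cdiff_inv_id. auto. apply (RD_RtoC (fun v => v - v0) v 1). auto_derive; auto; ring. unfold H1. field. auto. }
 assert (Ds : forall v, a <= v <= b -> RD (fun v => RtoC (sqrt v)) v (RtoC (/ (2 * sqrt v)))). { intros v Hv. specialize (sq v Hv). apply RD_RtoC. auto_derive. lra. field. lra. }
 assert (Dp : forall v, a <= v <= b -> RD p v (p' v)). { intros v Hv. unfold p, p'. apply RD_scal. apply (RD_mult H (fun v => RtoC (sqrt v))); auto. }
 assert (cH1 : contI H1 a b).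
 { intros v Hv. unfold H1, Cdiv. assert (c0 : contR (fun v => RtoC (v - v0)) v) by (eapply RD_contR, (RD_RtoC (fun v => v - v0) v 1); auto_derive; auto; ring).
  apply contR_mult. apply contR_minus. apply contR_mult; auto. eapply RD_contR, (td_D2 TD). apply contR_minus. eapply RD_contR, (td_D1 TD). apply contR_const.
  apply contR_inv. apply Cmult_neq_0; auto. apply contR_mult; auto. }
 assert (PA : 0 <= 8 * M * (kk * kk) / Y) by (apply Rdiv_le_0_compat; auto; repeat apply Rmult_le_pos; try lra; unfold kk; assert (0 < / (2 * be)) by pos; lra).
 assert (CY : Cmod (Ci / Y) = / Y) by (rewrite Cmod_div, Cmod_Ci, Cmod_RtoC_pos by (auto; lra); unfold Rdiv; ring).
 rewrite (CInt_ext F (fun v => p v * E' v)%C); try lra.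
 - apply (osc_bound p p' E E'); auto.
  + intros v Hv. specialize (sq v Hv). unfold p'. apply contR_scal. apply contR_plus; apply contR_mult. auto. eapply RD_contR, Ds; auto. eapply RD_contR, DH; auto.
  apply contR_RtoC. apply ex_derive_cont. auto_derive. split. lra. split; auto. lra.
  + intros v Hv. unfold E'. apply contR_mult. 2: eapply RD_contR, DE; auto. apply contR_scal. apply contR_RtoC. apply ex_derive_cont. auto_derive. lra.
  + intros v Hv. unfold E. rewrite Cmod_mult, Cmod_Cexp_im, Cmod_rcpow. simpl Re. rewrite Rpower_O by lra. lra.
  + intros v Hv. unfold p. rewrite !Cmod_mult, CY, Cmod_RtoC_pos by apply sqrt_pos. destruct (quotient_bounds v ltac:(lra) ltac:(lra)) as [q1 _]. note (sqrt_le_1p v ltac:(lra)). note (sqrt_pos v).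
  unfold Rdiv. rewrite (Rmult_comm _ (/ Y)). mul_le_l. pos.
  le_mid (4 * M * (kk * kk) / (1 + v) * (1 + v)). mul_le. assert (0 <= 4 * M * (kk * kk)) by nra. unfold Rdiv. rewrite Rmult_assoc, Rinv_l by lra. nra.
  + intros v Hv. specialize (sq v Hv). unfold p'. rewrite Cmod_mult, CY. destruct (quotient_bounds v ltac:(lra) ltac:(lra)) as [q1 q2]. assert (S2 : sqrt v * sqrt v = v) by (apply sqrt_sqrt; lra).
  unfold Rdiv. rewrite (Rmult_comm _ (/ Y)), Rmult_assoc. mul_le_l. pos.
  le_via Cmod_triangle. rewrite !Cmod_mult, !Cmod_RtoC_pos. 2: left; apply Rinv_0_lt_compat; lra. 2: lra.
  set (D := 4 * M * (kk * kk)) in *. assert (PD : 0 <= D) by (unfold D; nra).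
  le_mid (D / ((1 + v) * (1 + v)) * sqrt v + D / (1 + v) * / (2 * sqrt v)).
  apply Rplus_le_compat; mul_le_r; auto; try lra. pos.
  replace (8 * M * (kk * kk)) with (2 * D) by (unfold D; ring).
  apply Rmult_le_reg_r with (sqrt v * ((1 + v) * (1 + v))). apply Rmult_lt_0_compat; nra.
  replace ((D / ((1 + v) * (1 + v)) * sqrt v + D / (1 + v) * / (2 * sqrt v)) * (sqrt v * ((1 + v) * (1 + v)))) with (D * (sqrt v * sqrt v) + D * (1 + v) / 2) by (field; lra).
  replace (2 * D * / (sqrt v * (1 + v)) * (sqrt v * ((1 + v) * (1 + v)))) with (2 * D * (1 + v)) by (field; lra). rewrite S2. nra.
 - intros v Hv. unfold F, p, E', E, H. rewrite rcpow_half by lra. assert (0 < sqrt v) by (apply sq; lra). assert (Sn : RtoC (sqrt v) <> 0) by (RtoC_nz).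
  replace (- Y * v) with (- (Y * v)) by ring. replace ((- (Y * v) + g) / v) with (- (Y * (v - v0)) / (sqrt v * sqrt v)) by (rewrite sqrt_sqrt by lra; unfold g; field; lra).
  rewrite RtoC_inv, RtoC_div, RtoC_opp, !RtoC_mult by nra. replace Ci with Ci by auto. transitivity (- (Ci * Ci) * (((B v - B v0) * Cexp (0%R, (- (Y * v))%R)) * (/ RtoC (sqrt v) * rcpow v (0%R, g))))%C.
  replace (Ci * Ci)%C with (- (1))%C by Ceq. ring. specialize (Nz v ltac:(lra)). field. auto.
Qed.

(** A window around [v0] is cut out and shrunk; the bounds on its two sides do not depend on its
    width. *)
Lemma F_total a b : 0 < a < v0 -> v0 < b -> Cmod (CInt F a b) <= 96 * M * (kk * kk) / Y.
Proof. intros Ha Hb. note (td_M TD) as PM. apply Rle_plus_epsilon. intros eps He.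
 assert (cF : forall x y, a <= x -> contI F x y) by (intros x y Hx v Hv; apply F_contR; lra).
 destruct (contI_bounded F a b (cF a b ltac:(lra))) as (N & PN & HN).
 set (et := Rmin (Rmin (v0 - a) (b - v0)) (eps / (2 * (N + 1)))). assert (Pe : 0 < et) by (unfold et; repeat apply Rmin_pos; try lra; apply Rdiv_lt_0_compat; lra).
 assert (e1 : et <= v0 - a) by (eapply Rle_trans; [apply Rmin_l|apply Rmin_l]). assert (e2 : et <= b - v0) by (eapply Rle_trans; [apply Rmin_l|apply Rmin_r]).
 assert (e3 : N * (2 * et) <= eps). { assert (E0 : et <= eps / (2 * (N + 1))) by apply Rmin_r. apply Rmult_le_compat_r with (r := 2 * (N + 1)) in E0; [|lra]. unfold Rdiv in E0. rewrite Rmult_assoc, Rinv_l in E0 by lra. nra. }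
 rewrite (CInt_Chasles F a (v0 - et) b), (CInt_Chasles F (v0 - et) (v0 + et) b) by (try lra; apply cF; lra).
 assert (I2 : Cmod (CInt F (v0 - et) (v0 + et)) <= N * (2 * et)). { replace (2 * et) with (v0 + et - (v0 - et)) by ring. apply CInt_bound. lra. apply cF; lra. intros; apply HN; lra. }
 note (F_away a (v0 - et) ltac:(lra) ltac:(lra)) as I1. note (F_away (v0 + et) b ltac:(lra) ltac:(lra)) as I3.
 le_via Cmod_triangle. le_via Rplus_le_compat_l. apply Cmod_triangle. replace (96 * M * (kk * kk) / Y) with (2 * (6 * (8 * M * (kk * kk) / Y))) by (field; lra). lra.
Qed.

(** The opposite exponential has no stationary point on the positive axis, as [Y v + g > 0], so it
    contributes only [O(1 / Y)]. *)
Lemma plus_phase a b : 0 < a <= b -> al <= v0 -> Cmod (CInt (fun v => Cexp (0%R, Y * v)%R * rcpow v (hl g - 1))%C a b) <= 6 * (2 / (Y * Rmin 1 al)).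
Proof. intros Hab Hv0. note (td_al TD) as Hal. set (m := Rmin 1 al). assert (Pm : 0 < m) by (unfold m; apply Rmin_pos; lra).
 assert (m1 : m <= 1) by apply Rmin_l. assert (m2 : m <= al) by apply Rmin_r.
 set (E := fun v => (Cexp (0%R, Y * v)%R * rcpow v (0%R, g))%C). set (E' := fun v => (Ci * RtoC ((Y * v + g) / v) * E v)%C).
 set (p := fun v => (- Ci * RtoC (sqrt v / (Y * v + g)))%C). set (p' := fun v => (- Ci * RtoC (/ (2 * sqrt v) / (Y * v + g) - sqrt v * Y / (Y * v + g) ^ 2))%C).
 assert (sq : forall v, a <= v <= b -> 0 < sqrt v) by (intros; apply sqrt_lt_R0; lra).
 assert (dn : forall v, a <= v <= b -> Y * m * (1 + v) <= Y * v + g). { intros v Hv. unfold g. rewrite Rmult_assoc, <- Rmult_plus_distr_l. mul_le_l; nra. }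
 assert (PYm : 0 < Y * m) by (apply Rmult_lt_0_compat; auto). assert (dp : forall v, a <= v <= b -> 0 < Y * v + g) by (intros v Hv; specialize (dn v Hv); nra).
 assert (Ppos : 0 <= 2 / (Y * m)) by pos.
 rewrite (CInt_ext _ (fun v => p v * E' v)%C); try lra.
 - apply (osc_bound p p' E E'); auto.
  + intros v Hv. specialize (sq v Hv). specialize (dp v Hv). unfold p, p'. apply RD_scal. apply RD_RtoC. auto_derive. split. lra. split; auto. lra. field. lra.
  + intros v Hv. apply RD_phase_pow; lra.
  + intros v Hv. specialize (sq v Hv). specialize (dp v Hv). unfold p'. apply contR_scal. apply contR_RtoC. apply ex_derive_cont. auto_derive. repeat split; try lra; apply Rgt_not_eq; nra.
  + intros v Hv. unfold E'. apply contR_mult. 2: eapply RD_contR, RD_phase_pow; lra. apply contR_scal. apply contR_RtoC. apply ex_derive_cont. auto_derive. lra.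
  + intros v Hv. unfold E. rewrite Cmod_mult, Cmod_Cexp_im, Cmod_rcpow. simpl Re. rewrite Rpower_O by lra. lra.
  + intros v Hv. specialize (sq v Hv). specialize (dp v Hv). specialize (dn v Hv). unfold p. rewrite Cmod_mult, Cmod_opp, Cmod_Ci, Cmod_RtoC_pos by pos. rewrite Rmult_1_l.
  note (sqrt_le_1p v ltac:(lra)). apply Rmult_le_reg_r with (Y * v + g). auto. div_cancel.
  le_mid (2 * / (Y * m) * (Y * m * (1 + v))). replace (2 * / (Y * m) * (Y * m * (1 + v))) with (2 * (1 + v)) by (field; lra). lra. mul_le_l; lra.
  + intros v Hv. specialize (sq v Hv). specialize (dp v Hv). specialize (dn v Hv). assert (S2 : sqrt v * sqrt v = v) by (apply sqrt_sqrt; lra).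
  unfold p'. rewrite Cmod_mult, Cmod_opp, Cmod_Ci, Cmod_R, Rmult_1_l. set (d := Y * v + g) in *. assert (Yv : Y * v <= d) by (unfold d, g; nra).
  assert (Q0 : 0 <= sqrt v * Y / d ^ 2 <= / (sqrt v * d)).
  { split. apply Rdiv_le_0_compat; nra. apply Rmult_le_reg_r with (sqrt v * d ^ 2). apply Rmult_lt_0_compat; nra. replace (sqrt v * Y / d ^ 2 * (sqrt v * d ^ 2)) with (sqrt v * sqrt v * Y) by (field; lra).
  replace (/ (sqrt v * d) * (sqrt v * d ^ 2)) with d by (field; lra). rewrite S2. lra. }
  assert (Q1 : 0 <= / (2 * sqrt v) / d <= / (sqrt v * d)). { split. apply Rdiv_le_0_compat; auto. pos. replace (/ (2 * sqrt v) / d) with (/ 2 * / (sqrt v * d)) by (field; lra). assert (0 < / (sqrt v * d)) by (apply Rinv_0_lt_compat, Rmult_lt_0_compat; auto). lra. }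
  le_mid (2 * / (sqrt v * d)). apply Rabs_le; lra.
  unfold Rdiv. rewrite Rmult_assoc. mul_le_l. lra. rewrite <- Rinv_mult. apply Rinv_le_contravar. apply Rmult_lt_0_compat; auto. apply Rmult_lt_0_compat; nra.
  replace (Y * m * (sqrt v * (1 + v))) with (sqrt v * (Y * m * (1 + v))) by ring. mul_le_l; lra.
 - intros v Hv. unfold p, E', E. rewrite rcpow_half by lra. assert (0 < sqrt v) by (apply sq; lra). assert (0 < Y * v + g) by (apply dp; lra).
  transitivity (- (Ci * Ci) * (RtoC (sqrt v / (Y * v + g) * ((Y * v + g) / v)) * (Cexp (0%R, (Y * v)%R) * rcpow v (0%R, g))))%C. 2: rewrite RtoC_mult; ring.
  replace (sqrt v / (Y * v + g) * ((Y * v + g) / v)) with (/ sqrt v). replace (Ci * Ci)%C with (- (1))%C by Ceq. ring.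
  transitivity (sqrt v / v). 2: field; lra. apply Rmult_eq_reg_r with (sqrt v); [|lra]. rewrite Rinv_l by lra. unfold Rdiv. rewrite Rmult_assoc, (Rmult_comm (/ v)), <- Rmult_assoc, sqrt_sqrt by lra. field; lra.
Qed.

(** Put [B v = B v0 + (B v - B v0)]. The second part is [F]. In the first, the exponential is
    [2 cos] minus its conjugate, and the cosine integral over the half-line gives [chi]; the
    cut-offs [a] and [b] are moved out until that limit is reached up to [eps]. *)
Lemma Mel_stationary k : 0 < k -> Y = 2 * PI * k ->
 Cmod (rcpow k (hl g) * Mel B al be Y (hl g) - B v0 * Cconj (chi (hl g))) <= Rpower k (1 / 2) * (96 * M * (kk * kk) / Y + M * (6 * (2 / (Y * Rmin 1 al)))).
Proof. intros Hk EY. td_facts TD.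
 apply Rle_plus_epsilon. intros eps He. destruct (chi_cos_limit k g (eps / (M + 1)) Hk) as (x0 & X0 & HX). pos.
 set (a := Rmin x0 (Rmin al (v0 / 2))). assert (Pa : 0 < a) by (unfold a; repeat apply Rmin_pos; lra). assert (a1 : a <= x0) by apply Rmin_l. assert (a2 : a <= al) by (eapply Rle_trans; [apply Rmin_r|apply Rmin_l]). assert (a3 : a <= v0 / 2) by (eapply Rle_trans; [apply Rmin_r|apply Rmin_r]).
 set (b := Rmax (/ x0) (Rmax be (v0 + 1))). assert (b1 : / x0 <= b) by apply Rmax_l. assert (b2 : be <= b) by (eapply Rle_trans; [apply Rmax_l|apply Rmax_r]). assert (b3 : v0 + 1 <= b) by (eapply Rle_trans; [apply Rmax_r|apply Rmax_r]).
 specialize (HX a b ltac:(lra) b1). rewrite (Mel_extend B B1 B2 al be M TD Y (hl g) a b) by lra.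
 set (J := CInt (fun v => RtoC (2 * cos (2 * PI * (k * v))) * rcpow v (hl g - 1))%C a b) in *. set (P2 := CInt (fun v => Cexp (0%R, Y * v)%R * rcpow v (hl g - 1))%C a b).
 assert (cm : contI (fun v => Cexp (0%R, - (Y * v))%R * rcpow v (hl g - 1))%C a b) by (intros v Hv; apply contR_mult; [eapply RD_contR, RD_Cexp_phase_neg|apply contR_rcpow; lra]).
 assert (cp : contI (fun v => Cexp (0%R, Y * v)%R * rcpow v (hl g - 1))%C a b) by (intros v Hv; apply contR_mult; [eapply RD_contR, RD_Cexp_phase|apply contR_rcpow; lra]).
 assert (Ident : CInt (fun v => B v * Cexp (0%R, - (Y * v))%R * rcpow v (hl g - 1))%C a b = (CInt F a b + B v0 * (J - P2))%C).
 { assert (EJ : (J - P2)%C = CInt (fun v => Cexp (0%R, - (Y * v))%R * rcpow v (hl g - 1))%C a b).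
  { unfold J. rewrite (CInt_ext _ (fun v => Cexp (0%R, - (Y * v))%R * rcpow v (hl g - 1) + Cexp (0%R, Y * v)%R * rcpow v (hl g - 1))%C); try lra. rewrite CInt_plus; auto; try lra. fold P2. ring.
  intros v Hv. replace (2 * PI * (k * v)) with (Y * v) by (rewrite EY; ring). rewrite cos_as_exp. ring. }
  rewrite EJ, <- CInt_scal, <- CInt_plus; auto; try lra. apply CInt_ext. lra. intros v Hv. unfold F. ring. intros v Hv; apply F_contR; lra. intros v Hv; apply contR_scal; auto. }
 rewrite Ident. replace (rcpow k (hl g) * (CInt F a b + B v0 * (J - P2)) - B v0 * Cconj (chi (hl g)))%C with (rcpow k (hl g) * (CInt F a b - B v0 * P2) + B v0 * (rcpow k (hl g) * J - Cconj (chi (hl g))))%C by ring.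
 le_via Cmod_triangle. apply Rplus_le_compat.
 - rewrite Cmod_mult, Cmod_rcpow. mul_le_l. pos. le_via Cmod_triangle_minus. apply Rplus_le_compat. apply F_total; lra.
  assert (0 < Rmin 1 al) by (apply Rmin_pos; lra). rewrite Cmod_mult. destruct (Rle_dec al v0) as [L|L].
  mul_le. apply (td_bd TD). apply plus_phase; lra.
  rewrite (proj1 (td_zero TD v0 ltac:(lra))), Cmod_0, Rmult_0_l. apply Rmult_le_pos; auto. apply Rmult_le_pos. lra. apply Rdiv_le_0_compat. lra. apply Rmult_lt_0_compat; auto.
 - rewrite Cmod_mult. le_mid ((M + 1) * (eps / (M + 1))). mul_le. destruct (td_bd TD v0); lra. right; field; lra.
Qed.

End Stationary.

(** * Fourier inversion *)

Lemma ibp_twice (q q1 q2 : R -> R) (G G1 G2 : R -> C) c d : c <= d ->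
 (forall u, c <= u <= d -> is_derive q u (q1 u)) -> (forall u, c <= u <= d -> is_derive q1 u (q2 u)) -> (forall u, c <= u <= d -> continuous q2 u) ->
 (forall u, c <= u <= d -> RD G u (G1 u)) -> (forall u, c <= u <= d -> RD G1 u (G2 u)) -> contI G2 c d ->
 CInt (fun u => RtoC (q u) * G2 u)%C c d = (RtoC (q d) * G1 d - RtoC (q1 d) * G d - (RtoC (q c) * G1 c - RtoC (q1 c) * G c) + CInt (fun u => RtoC (q2 u) * G u) c d)%C.
Proof. intros Hcd D0 D1 c2 DG DG1 cG2.
 assert (cA : contI (fun u => RtoC (q u) * G2 u)%C c d) by (intros u Hu; apply contR_mult; auto; eapply RD_contR, RD_RtoC, D0; auto).
 assert (cB : contI (fun u => RtoC (q2 u) * G u)%C c d) by (intros u Hu; apply contR_mult; [apply contR_RtoC; auto|eapply RD_contR, DG; auto]).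
 rewrite <- (CInt_ftc (fun u => RtoC (q u) * G1 u - RtoC (q1 u) * G u)%C (fun u => RtoC (q u) * G2 u - RtoC (q2 u) * G u)%C); auto.
 - rewrite CInt_minus; auto. ring.
 - intros u Hu. eapply RD_eq. apply RD_minus; apply RD_mult; [apply RD_RtoC, D0|apply DG1|apply RD_RtoC, D1|apply DG]; auto. cbv beta; ring.
 - intros u Hu. apply contR_minus; auto.
Qed.

Lemma SQ_even N x : SQ N (- x) = SQ N x.
Proof. apply Rsum_ext. intros k _. f_equal. f_equal. rewrite <- cos_neg. f_equal. ring. Qed.

(** [SQ N ((x - u) / P)] is integrated against [G2]. By parts, each cosine returns a Fourier
    coefficient of [G], while in the limit function the corner at [u = x] returns [G x]. Pairing
    with the second derivative makes the error as small as the one in [SQ_series]. *)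
Lemma period_series (G G1 G2 : R -> C) a b x M N : a < x < b -> (1 <= N)%nat ->
 (forall u, a <= u <= b -> RD G u (G1 u)) -> (forall u, a <= u <= b -> RD G1 u (G2 u)) -> contI G2 a b ->
 G a = RtoC 0 -> G b = RtoC 0 -> G1 a = RtoC 0 -> G1 b = RtoC 0 -> (forall u, a <= u <= b -> Cmod (G2 u) <= M) ->
 let P := b - a in
 Cmod (RtoC (2 * PI ^ 2 / P) * G x - RtoC (2 * PI ^ 2 / P ^ 2) * (CInt G a b + 2 * Csum (fun k => CInt (fun u => RtoC (cos (2 * PI * INR (S k) * ((x - u) / P))) * G u)%C a b) N)) <= 2 / INR N * M * P.
Proof. intros Hx HN DG DG1 cG2 Ga Gb G1a G1b HM P. assert (HP : 0 < P) by (unfold P; lra).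
 assert (cG : contI G a b) by (intros u Hu; eapply RD_contR, DG; auto).
 assert (PN : 1 <= INR N) by (apply (le_INR 1); auto).
 assert (cS : contI (fun u => RtoC (SQ N ((x - u) / P)) * G2 u)%C a b).
 { intros u Hu. apply contR_mult; auto. eapply RD_contR, RD_RtoC. apply (is_derive_comp (SQ N) (fun u => (x - u) / P)). apply is_derive_SQ. auto_derive; auto. }
 assert (S0 : CInt (fun u => RtoC (SQ N ((x - u) / P)) * G2 u)%C a b = (RtoC (4 * PI ^ 2 / P ^ 2) * Csum (fun k => CInt (fun u => RtoC (cos (2 * PI * INR (S k) * ((x - u) / P))) * G u)%C a b) N)%C).
 { clear cS HN PN. induction N.
  - cbn [Csum]. rewrite CInt_zero. ring. lra. intros; unfold SQ; simpl. ring.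
  - set (m := INR (S N)). assert (Pm : 0 < m) by apply INR_S_pos. set (w := 2 * PI * m / P).
  assert (T : CInt (fun u => RtoC ((1 - cos (2 * PI * m * ((x - u) / P))) / m ^ 2) * G2 u)%C a b = (RtoC (4 * PI ^ 2 / P ^ 2) * CInt (fun u => RtoC (cos (2 * PI * m * ((x - u) / P))) * G u)%C a b)%C).
  { rewrite (ibp_twice (fun u => (1 - cos (2 * PI * m * ((x - u) / P))) / m ^ 2) (fun u => - (2 * PI / (P * m)) * sin (2 * PI * m * ((x - u) / P))) (fun u => 4 * PI ^ 2 / P ^ 2 * cos (2 * PI * m * ((x - u) / P))) G G1 G2); auto; try lra.
  - rewrite Ga, Gb, G1a, G1b, <- CInt_scal; try lra. 2:{ intros u Hu. apply contR_mult; auto. apply contR_RtoC, ex_derive_cont. auto_derive; auto. }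
  rewrite (CInt_ext _ (fun u => RtoC (4 * PI ^ 2 / P ^ 2) * (RtoC (cos (2 * PI * m * ((x - u) / P))) * G u))%C). ring. lra. intros u _. rewrite RtoC_mult. ring.
  - intros u _. auto_derive. nra. unfold Rdiv, Rminus. field. lra.
  - intros u _. auto_derive. auto. unfold Rdiv, Rminus. field. lra.
  - intros u _. apply ex_derive_cont. auto_derive; auto. }
  cbn [Csum]. rewrite Cmult_plus_distr_l, <- IHN. fold m. rewrite <- T, <- CInt_plus; try lra.
  + apply CInt_ext. lra. intros u _. change (SQ (S N) ((x - u) / P)) with (SQ N ((x - u) / P) + (1 - cos (2 * PI * m * ((x - u) / P))) / m ^ 2). rewrite RtoC_plus. ring.
  + intros u Hu. apply contR_mult; auto. eapply RD_contR, RD_RtoC. apply (is_derive_comp (SQ N) (fun u => (x - u) / P)). apply is_derive_SQ. auto_derive; auto.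
  + intros u Hu. apply contR_mult; auto. apply contR_RtoC, ex_derive_cont. auto_derive; auto. }
 (* [sg = 1] and [sg = -1] give the two branches of the limit function, left and right of its corner
    at [u = x]. *)
 set (q := fun sg u : R => PI ^ 2 * (sg * (x - u) / P - ((x - u) / P) ^ 2)).
 assert (Q : forall sg c d, a <= c <= d -> d <= b -> CInt (fun u => RtoC (q sg u) * G2 u)%C c d =
  (RtoC (q sg d) * G1 d - RtoC (PI ^ 2 * (- sg / P + 2 * (x - d) / P ^ 2)) * G d - (RtoC (q sg c) * G1 c - RtoC (PI ^ 2 * (- sg / P + 2 * (x - c) / P ^ 2)) * G c) - RtoC (2 * PI ^ 2 / P ^ 2) * CInt G c d)%C).
 { intros sg c d Hc Hd. rewrite (ibp_twice (q sg) (fun u => PI ^ 2 * (- sg / P + 2 * (x - u) / P ^ 2)) (fun _ => - (2 * PI ^ 2 / P ^ 2)) G G1 G2); try lra; try (intros u Hu; apply DG || apply DG1 || apply cG2; lra).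
  - rewrite CInt_scal, RtoC_opp. ring. lra. eapply contI_sub; eauto; lra.
  - intros u _. unfold q. auto_derive. auto. change (INR 2) with (1 + 1). field. lra.
  - intros u _. auto_derive. auto. field. lra.
  - intros; apply continuous_const. }
 assert (cq : forall sg, contI (fun u => RtoC (q sg u) * G2 u)%C a b).
 { intros sg u Hu. apply contR_mult; auto. apply contR_RtoC, ex_derive_cont. unfold q. auto_derive; auto. }
 note (Q 1 a x ltac:(lra) ltac:(lra)) as QL. note (Q (-1) x b ltac:(lra) ltac:(lra)) as QR. rewrite Ga, G1a in QL. rewrite Gb, G1b in QR.
 assert (Main : (RtoC (2 * PI ^ 2 / P) * G x - RtoC (2 * PI ^ 2 / P ^ 2) * (CInt G a b + 2 * Csum (fun k => CInt (fun u => RtoC (cos (2 * PI * INR (S k) * ((x - u) / P))) * G u)%C a b) N))%C =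
  (CInt (fun u => RtoC (q 1%R u) * G2 u - RtoC (SQ N ((x - u) / P)) * G2 u) a x + CInt (fun u => RtoC (q (-1)%R u) * G2 u - RtoC (SQ N ((x - u) / P)) * G2 u) x b)%C).
 { rewrite !CInt_minus; try lra; try (eapply contI_sub; eauto; lra). rewrite QL, QR.
  assert (E0 : forall sg, q sg x = 0) by (intros; unfold q; field; lra). rewrite !E0.
  replace (PI ^ 2 * (- (1) / P + 2 * (x - x) / P ^ 2)) with (- (PI ^ 2 / P)) by (field; lra). replace (PI ^ 2 * (- -1 / P + 2 * (x - x) / P ^ 2)) with (PI ^ 2 / P) by (field; lra).
  rewrite (CInt_Chasles G a x b) by (auto; lra). rewrite (CInt_Chasles _ a x b) in S0 by (auto; lra).
  set (SL := CInt (fun u => RtoC (SQ N ((x - u) / P)) * G2 u)%C a x) in *. set (SR := CInt (fun u => RtoC (SQ N ((x - u) / P)) * G2 u)%C x b) in *.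
  set (CS := Csum _ N) in *. replace (2 * PI ^ 2 / P) with (2 * (PI ^ 2 / P)) by (field; lra). replace (4 * PI ^ 2 / P ^ 2) with (2 * (2 * PI ^ 2 / P ^ 2)) in S0 by (field; lra). rewrite !RtoC_mult, !RtoC_opp in *.
  transitivity (2 * RtoC (PI ^ 2 / P) * G x - RtoC (2 * PI ^ 2 / P ^ 2) * (CInt G a x + CInt G x b) - (SL + SR))%C. rewrite S0. ring. ring. }
 rewrite Main.
 assert (Bd : forall sg c d, a <= c <= d -> d <= b -> (forall u, c <= u <= d -> Rabs (q sg u - SQ N ((x - u) / P)) <= 2 / INR N) ->
  Cmod (CInt (fun u => RtoC (q sg u) * G2 u - RtoC (SQ N ((x - u) / P)) * G2 u)%C c d) <= 2 / INR N * M * (d - c)).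
 { intros sg c d Hc Hd K. apply CInt_bound. lra. intros u Hu. apply contR_minus; [apply cq|apply cS]; lra.
  intros u Hu. replace (RtoC (q sg u) * G2 u - RtoC (SQ N ((x - u) / P)) * G2 u)%C with (RtoC (q sg u - SQ N ((x - u) / P)) * G2 u)%C by (rewrite RtoC_minus; ring).
  rewrite Cmod_mult, Cmod_R. apply Rmult_le_compat; auto using Rabs_pos, Cmod_ge_0. apply HM; lra. }
 replace (2 / INR N * M * P) with (2 / INR N * M * (x - a) + 2 / INR N * M * (b - x)) by (unfold P; ring).
 le_via Cmod_triangle. apply Rplus_le_compat; [apply (Bd 1 a x)|apply (Bd (-1) x b)]; try lra.
 - intros u Hu. rewrite Rabs_minus_sym. unfold q. replace (1 * (x - u) / P) with ((x - u) / P) by (field; lra). apply SQ_series; auto. split. pos. apply Rmult_le_reg_r with P; auto. unfold Rdiv; rewrite Rmult_assoc, Rinv_l; unfold P in *; lra.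
 - intros u Hu. rewrite Rabs_minus_sym. unfold q. replace (-1 * (x - u) / P) with ((u - x) / P) by (field; lra). replace ((x - u) / P) with (- ((u - x) / P)) by (field; lra). rewrite SQ_even.
  replace ((- ((u - x) / P)) ^ 2) with (((u - x) / P) ^ 2) by ring. apply SQ_series; auto. split. pos. apply Rmult_le_reg_r with P; auto. unfold Rdiv; rewrite Rmult_assoc, Rinv_l; unfold P in *; lra.
Qed.

Lemma CInt_shift f c a b : a <= b -> contI f (a + c) (b + c) -> CInt (fun t => f (t + c)) a b = CInt f (a + c) (b + c).
Proof. intros Hab Hf. note (RInt_comp_lin (V := C_RN) f 1 c a b) as E. rewrite !Rmult_1_l in E. unfold CInt. rewrite <- E. 2: apply CInt_ex; auto; lra.
 apply (CInt_ext (fun t => f (t + c)) (fun y => @scal R_Ring C_RN 1 (f (1 * y + c))) a b Hab). intros y _. rewrite Rmult_1_l. symmetry. apply (scal_one (V := C_RN)).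
Qed.

Lemma CInt_Csum (f : nat -> R -> C) a b N : a <= b -> (forall k, contI (f k) a b) -> CInt (fun t => Csum (fun k => f k t) N) a b = Csum (fun k => CInt (f k) a b) N /\ contI (fun t => Csum (fun k => f k t) N) a b.
Proof. intros Hab Hf. induction N; cbn [Csum]. split. apply CInt_zero; auto. intros t _; apply contR_const.
 destruct IHN as [E c]. split. rewrite CInt_plus, E; auto. intros t Ht. apply contR_plus; auto. apply Hf; auto.
Qed.

Lemma Cexp_im_lip u t t' : Cmod (Cexp (0%R, t * u)%R - Cexp (0%R, t' * u)%R) <= Rabs u * Rabs (t - t').
Proof. rewrite (Rmult_comm t), (Rmult_comm t'). apply (RD_mean_ineq_sym (fun t => Cexp (0%R, u * t)%R) (fun t => Ci * RtoC u * Cexp (0%R, u * t)%R)%C). intros; apply RD_Cexp_phase.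
 intros. rewrite !Cmod_mult, Cmod_Ci, Cmod_R, Cmod_Cexp_im. lra.
Qed.

Lemma Cexp_im_plus s t : Cexp (0%R, s + t)%R = (Cexp (0%R, s) * Cexp (0%R, t))%C.
Proof. rewrite <- Cexp_plus. f_equal. Ceq. Qed.

(* The Fourier series of [g(u) e^{i theta (u-x)}] at [u = x], averaged over [theta] in a period. *)
Lemma Fourier_inversion (g g1 g2 : R -> C) a b x : a < x < b ->
 (forall u, a <= u <= b -> RD g u (g1 u)) -> (forall u, a <= u <= b -> RD g1 u (g2 u)) -> contI g2 a b ->
 g a = RtoC 0 -> g b = RtoC 0 -> g1 a = RtoC 0 -> g1 b = RtoC 0 ->
 let w := 2 * PI / (b - a) in
 exists K, 0 <= K /\ forall N, (1 <= N)%nat ->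
  Cmod (CInt (fun t => CInt (fun u => g u * Cexp (0%R, t * (u - x))%R)%C a b) (- (INR N * w)) (INR (S N) * w) - 2 * PI * g x) <= K / INR N.
Proof. intros Hx Dg Dg1 cg2 ga gb g1a g1b w. set (P := b - a). assert (HP : 0 < P) by (unfold P; lra). note PI_RGT_0 as PP. assert (Pw : 0 < w) by (apply Rdiv_lt_0_compat; unfold P in HP; lra).
 set (psi := fun t => CInt (fun u => g u * Cexp (0%R, t * (u - x))%R)%C a b).
 assert (cg : contI g a b) by (intros u Hu; eapply RD_contR, Dg; auto). assert (cg1 : contI g1 a b) by (intros u Hu; eapply RD_contR, Dg1; auto).
 assert (De : forall t u, RD (fun u => Cexp (0%R, t * (u - x))%R) u (Ci * RtoC t * Cexp (0%R, t * (u - x))%R)%C).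
 { intros t u. apply RD_ext with (fun u => Cexp (0%R, - (t * x))%R * Cexp (0%R, t * u)%R)%C. intros v. rewrite <- Cexp_im_plus. f_equal. f_equal. ring.
  eapply RD_eq. apply RD_scal, RD_Cexp_phase. replace (t * (u - x)) with (- (t * x) + t * u) by ring. rewrite Cexp_im_plus. ring. }
 assert (ce : forall t u, contR (fun u => Cexp (0%R, t * (u - x))%R) u) by (intros; eapply RD_contR, De).
 assert (cge : forall t, contI (fun u => g u * Cexp (0%R, t * (u - x))%R)%C a b) by (intros t u Hu; apply contR_mult; auto).
 destruct (contI_bounded g a b cg) as (M0 & P0 & B0). destruct (contI_bounded g1 a b cg1) as (M1 & P1 & B1). destruct (contI_bounded g2 a b cg2) as (M2 & P2 & B2).
 assert (cpsi : forall t, contR psi t).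
 { intros t eps He. exists (eps / (M0 * P * P + 1)). assert (0 <= M0 * P * P) by (repeat apply Rmult_le_pos; lra). split. pos. intros t' Ht'.
  unfold psi. rewrite <- CInt_minus; auto; try lra. apply Rle_lt_trans with (M0 * P * P * Rabs (t' - t)).
  - replace (M0 * P * P * Rabs (t' - t)) with (M0 * (P * Rabs (t' - t)) * (b - a)) by (unfold P; ring). apply CInt_bound. lra. intros u Hu. apply contR_minus; apply cge; auto.
  intros u Hu. replace (g u * Cexp (0%R, (t' * (u - x))%R) - g u * Cexp (0%R, (t * (u - x))%R))%C with (g u * (Cexp (0%R, (t' * (u - x))%R) - Cexp (0%R, (t * (u - x))%R)))%C by ring. rewrite Cmod_mult.
  mul_le. le_via Cexp_im_lip. mul_le_r. apply Rabs_pos. apply Rabs_le. unfold P; lra.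
  - apply Rle_lt_trans with ((M0 * P * P + 1) * Rabs (t' - t)). note (Rabs_pos (t' - t)). nra. apply Rmult_lt_compat_l with (r := M0 * P * P + 1) in Ht'; [|lra]. replace ((M0 * P * P + 1) * (eps / (M0 * P * P + 1))) with eps in Ht' by (field; lra). auto. }
 assert (cI : forall p q, contI psi p q) by (intros p q t _; apply cpsi).
 set (M := M2 + 2 * w * M1 + w * w * M0). assert (PM : 0 <= M) by (unfold M; assert (0 <= w * M1) by nra; assert (0 <= w * w * M0) by nra; lra).
 assert (Ser : forall th N, 0 <= th <= w -> (1 <= N)%nat -> Cmod (RtoC P * g x - (psi th + Csum (fun k => psi (th + INR (S k) * w)%R + psi (th + - (INR (S k) * w))%R)%C N))%C <= M * P ^ 3 / INR N).
 { intros th N Hth HN. assert (PN : 1 <= INR N) by (apply (le_INR 1); auto). set (E := fun u => Cexp (0%R, th * (u - x))%R).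
  set (G := fun u => (g u * E u)%C). set (G1 := fun u => (g1 u * E u + g u * (Ci * th * E u))%C). set (G2 := fun u => (g2 u * E u + 2 * (g1 u * (Ci * th * E u)) + g u * (Ci * th * (Ci * th * E u)))%C).
  assert (S := period_series G G1 G2 a b x M N Hx HN). cbv zeta in S. fold P in S.
  assert (S' : Cmod (RtoC (2 * PI ^ 2 / P) * G x - RtoC (2 * PI ^ 2 / P ^ 2) * (CInt G a b + 2 * Csum (fun k => CInt (fun u => RtoC (cos (2 * PI * INR (Datatypes.S k) * ((x - u) / P))) * G u)%C a b) N)) <= 2 / INR N * M * P).
  { apply S.
  - intros u Hu. apply RD_mult; auto. apply De.
  - intros u Hu. unfold G1, G2. eapply RD_eq. apply RD_plus. apply RD_mult. apply Dg1; auto. apply De. apply RD_mult. apply Dg; auto. apply RD_scal, De. unfold E. ring.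
  - intros u Hu. unfold G2, E. repeat first [apply contR_plus|apply contR_mult|apply contR_const|apply ce|apply cg; lra|apply cg1; lra|apply cg2; lra].
  - unfold G; rewrite ga; ring.
  - unfold G; rewrite gb; ring.
  - unfold G1; rewrite ga, g1a; ring.
  - unfold G1; rewrite gb, g1b; ring.
  - intros u Hu. unfold G2. le_via Cmod_triangle. eapply Rle_trans. apply Rplus_le_compat_r, Cmod_triangle. rewrite !Cmod_mult, !Cmod_Ci, !Cmod_RtoC_pos by lra.
  assert (E1 : Cmod (E u) = 1) by (unfold E; apply Cmod_Cexp_im). rewrite E1. specialize (B0 u Hu). specialize (B1 u Hu). specialize (B2 u Hu). note (Cmod_ge_0 (g u)). note (Cmod_ge_0 (g1 u)).
  assert (Cmod (g1 u) * th <= M1 * w) by (apply Rmult_le_compat; lra). assert (th * th <= w * w) by (apply Rmult_le_compat; lra). assert (0 <= th * th) by pos. assert (Cmod (g u) * (th * th) <= M0 * (w * w)) by (apply Rmult_le_compat; lra). unfold M. lra. }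
  assert (EG : G x = g x). { unfold G, E. rewrite Rminus_diag, Rmult_0_r. change ((0, 0)%R : C) with (RtoC 0). rewrite Cexp_0. ring. }
  assert (EC : (2 * Csum (fun k => CInt (fun u => RtoC (cos (2 * PI * INR (Datatypes.S k) * ((x - u) / P))) * G u)%C a b) N)%C = Csum (fun k => psi (th + INR (Datatypes.S k) * w)%R + psi (th + - (INR (Datatypes.S k) * w))%R)%C N).
  { rewrite <- Csum_scal. apply Csum_ext. intros k _. unfold psi. rewrite <- CInt_scal, <- CInt_plus; auto; try lra.
  - apply CInt_ext. lra. intros u _. transitivity (RtoC (2 * cos (2 * PI * INR (Datatypes.S k) * ((x - u) / P))) * G u)%C. rewrite RtoC_mult; ring. rewrite cos_as_exp. unfold G, E. set (m := INR (Datatypes.S k)).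
  replace ((th + m * w) * (u - x)) with (- (2 * PI * m * ((x - u) / P)) + th * (u - x)) by (unfold w, P in *; field; lra).
  replace ((th + - (m * w)) * (u - x)) with (2 * PI * m * ((x - u) / P) + th * (u - x)) by (unfold w, P in *; field; lra). rewrite !Cexp_im_plus. ring.
  - intros u Hu. unfold G, E. apply contR_mult. apply contR_RtoC, ex_derive_cont. auto_derive; auto. apply cge; auto. }
  rewrite EG, EC in S'. change (CInt G a b) with (psi th) in S'. clear S EC. set (CS := Csum _ N) in *.
  replace (RtoC P * g x - (psi th + CS))%C with (RtoC (P ^ 2 / (2 * PI ^ 2)) * (RtoC (2 * PI ^ 2 / P) * g x - RtoC (2 * PI ^ 2 / P ^ 2) * (psi th + CS)))%C.
  2:{ transitivity (RtoC (P ^ 2 / (2 * PI ^ 2) * (2 * PI ^ 2 / P)) * g x - RtoC (P ^ 2 / (2 * PI ^ 2) * (2 * PI ^ 2 / P ^ 2)) * (psi th + CS))%C. rewrite !RtoC_mult. ring.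
  replace (P ^ 2 / (2 * PI ^ 2) * (2 * PI ^ 2 / P)) with P by (field; lra). replace (P ^ 2 / (2 * PI ^ 2) * (2 * PI ^ 2 / P ^ 2)) with 1 by (field; lra). ring. }
  assert (Pc : 0 <= P ^ 2 / (2 * PI ^ 2) <= P ^ 2 / 2). { note PI2_1. assert (1 <= PI ^ 2) by nra. assert (0 <= P ^ 2) by nra. split. pos. mul_le_l; auto. apply Rinv_le_contravar; lra. }
  rewrite Cmod_mult, Cmod_RtoC_pos by lra. le_mid (P ^ 2 / 2 * (2 / INR N * M * P)). apply Rmult_le_compat; try lra. apply Cmod_ge_0. right. field. lra. }
 exists (M * P ^ 3 * w). split. apply Rmult_le_pos; [apply Rmult_le_pos; auto; apply pow_le; lra|lra]. intros N HN. assert (PN : 1 <= INR N) by (apply (le_INR 1); auto).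
 assert (cs : forall c, contI (fun th => psi (th + c)) 0 w). { intros c t _ eps He. destruct (cpsi (t + c) eps He) as (d & D & K). exists d; split; auto. intros y Hy. apply K. replace (y + c - (t + c)) with (y - t) by ring. auto. }
 assert (Pieces : forall N, CInt psi (- (INR N * w)) (INR (S N) * w) = (CInt psi 0 w + Csum (fun k => CInt (fun th => psi (th + INR (S k) * w)%R + psi (th + - (INR (S k) * w))%R)%C 0 w) N)%C).
 { induction N0. cbn [Csum]. rewrite INR_0, INR_1, Rmult_0_l, Rmult_1_l, Ropp_0. ring. cbn [Csum]. rewrite Cplus_assoc, <- IHN0.
  rewrite CInt_plus, !CInt_shift; auto; try lra. note (pos_INR N0). rewrite (S_INR (S N0)), (S_INR N0). assert (0 <= INR N0 * w) by nra.
  rewrite (CInt_Chasles psi (- ((INR N0 + 1) * w)) (- (INR N0 * w)) ((INR N0 + 1 + 1) * w)) by (auto; nra). rewrite (CInt_Chasles psi (- (INR N0 * w)) ((INR N0 + 1) * w) ((INR N0 + 1 + 1) * w)) by (auto; nra).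
  replace (0 + (INR N0 + 1) * w) with ((INR N0 + 1) * w) by ring. replace (w + (INR N0 + 1) * w) with ((INR N0 + 1 + 1) * w) by ring. replace (0 + - ((INR N0 + 1) * w)) with (- ((INR N0 + 1) * w)) by ring. replace (w + - ((INR N0 + 1) * w)) with (- (INR N0 * w)) by ring. ring. }
 change (fun t => CInt (fun u => g u * Cexp (0%R, (t * (u - x))%R))%C a b) with psi.
 rewrite Pieces. destruct (CInt_Csum (fun k th => psi (th + INR (S k) * w)%R + psi (th + - (INR (S k) * w))%R)%C 0 w N) as [E c]. lra. intros k t Ht. apply contR_plus; apply cs; auto.
 rewrite <- E, <- CInt_plus; auto; try lra.
 replace (2 * PI * g x)%C with (CInt (fun _ => RtoC P * g x)%C 0 w).
 2:{ rewrite (CInt_ftc (fun t => RtoC t * (RtoC P * g x))%C). 2: lra. rewrite <- RtoC_mult. replace (2 * PI) with (w * P) by (unfold w, P; field; unfold P in HP; lra). rewrite RtoC_mult. ring.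
  intros t _. eapply RD_eq. apply (RD_mult RtoC (fun _ => RtoC P * g x)%C). apply RD_id. apply RD_const. ring. intros t _; apply contR_const. }
 rewrite Cmod_minus_sym, <- CInt_minus; try lra. 2: intros t _; apply contR_const. 2: intros t Ht; apply contR_plus; auto.
 replace (M * P ^ 3 * w / INR N) with (M * P ^ 3 / INR N * (w - 0)) by (field; lra). apply CInt_bound. lra. intros t Ht. apply contR_minus. apply contR_const. apply contR_plus; auto. intros t Ht. apply Ser; auto.
Qed.

Lemma RD_comp_real (f : R -> C) (phi : R -> R) u l d : RD f (phi u) l -> is_derive phi u d -> RD (fun t => f (phi t)) u (RtoC d * l)%C.
Proof. intros Hf Hp. apply RD_ext with (fun t => (Re (f (phi t)), Im (f (phi t)))). intros; symmetry; apply surjective_pairing.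
 replace (RtoC d * l)%C with ((d * Re l, d * Im l)%R : C) by Ceq. apply RD_pair.
 apply (is_derive_comp (fun t => Re (f t)) phi). apply RD_Re; auto. auto. apply (is_derive_comp (fun t => Im (f t)) phi). apply RD_Im; auto. auto.
Qed.

Lemma CInt_subst_exp f a b : a <= b -> contI f (exp a) (exp b) -> CInt f (exp a) (exp b) = CInt (fun u => RtoC (exp u) * f (exp u))%C a b.
Proof. intros Hab Hf. symmetry. apply CInt_is. eapply is_RInt_ext. 2: apply (is_RInt_comp (V := C_RN) f exp exp a b).
 - intros u _. apply Ceq_intro; unfold Re, Im; simpl; unfold scal, mult; simpl; unfold mult; simpl; ring.
 - intros u Hu. rewrite Rmin_left, Rmax_right in Hu by auto. apply contR_continuous, Hf. split; apply exp_le; lra.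
 - intros u _. split. auto_derive; auto; ring. apply ex_derive_cont. auto_derive; auto.
Qed.

(** With [v = exp u] the Mellin transform on [Re s = 3/2] becomes a Fourier transform in [t]. The
    range is slightly asymmetric because [Fourier_inversion] assembles it from whole periods; it is
    enough that both ends lie beyond [T]. *)
Lemma Mel_inversion B B1 B2 al be M Y z eps T : test_data B B1 B2 al be M -> 0 < z -> 0 < eps -> exists L L', T <= L /\ T <= L' /\
 Cmod (CInt (fun t => rcpow z (- (3 / 2, t)%R) * Mel B al be Y (3 / 2, t)%R)%C (- L) L' - 2 * PI * (B z * Cexp (0%R, - (Y * z))%R)) <= eps.
Proof. intros TD Hz He. td_facts TD.
 set (x := ln z). set (a := Rmin x (ln al) - 1). set (b := Rmax x (ln be) + 1).
 assert (a1 : a < x /\ a < ln al) by (unfold a; note (Rmin_l x (ln al)); note (Rmin_r x (ln al)); lra).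
 assert (b1 : x < b /\ ln be < b) by (unfold b; note (Rmax_l x (ln be)); note (Rmax_r x (ln be)); lra).
 assert (ea : exp a <= al). { rewrite <- (exp_ln al Hal). apply exp_le; lra. } assert (eb : be <= exp b). { rewrite <- (exp_ln be) by lra. apply exp_le; lra. }
 set (E := fun v => Cexp (0%R, - (Y * v))%R). set (iY := (Ci * RtoC Y)%C).
 set (A := fun v => (B v * E v)%C). set (A1 := fun v => ((B1 v - iY * B v) * E v)%C). set (A2 := fun v => ((B2 v - 2 * (iY * B1 v) + iY * (iY * B v)) * E v)%C).
 assert (DE : forall v, RD E v (- iY * E v)%C) by (intros; apply RD_Cexp_phase_neg).
 assert (DB : forall v, RD B v (B1 v)) by apply (td_D1 TD). assert (DB1 : forall v, RD B1 v (B2 v)) by apply (td_D2 TD).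
 assert (DA : forall v, RD A v (A1 v)) by (intros v; eapply RD_eq; [apply RD_mult; auto|unfold A1; ring]).
 assert (DA1 : forall v, RD A1 v (A2 v)) by (intros v; eapply RD_eq; [apply RD_mult; [apply RD_minus; [auto|apply RD_scal; auto]|auto]|unfold A2; ring]).
 set (p := fun u => Cexp (RtoC u * RtoC (3 / 2))%C). assert (Dp : forall u, RD p u (RtoC (3 / 2) * p u)%C) by (intros; apply RD_Cexp_line).
 set (g := fun u => (A (exp u) * p u)%C). set (g1 := fun u => ((RtoC (exp u) * A1 (exp u) + RtoC (3 / 2) * A (exp u)) * p u)%C).
 set (g2 := fun u => ((RtoC (exp u) * RtoC (exp u) * A2 (exp u) + 4 * (RtoC (exp u) * A1 (exp u)) + RtoC (9 / 4) * A (exp u)) * p u)%C).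
 assert (dx : forall u, is_derive exp u (exp u)) by (intros; auto_derive; auto; ring).
 assert (cE : forall v, contR E v) by (intros; eapply RD_contR, DE).
 assert (cA : forall u, contR (fun u => A (exp u)) u) by (intros u; eapply RD_contR, RD_comp_real; eauto). assert (cA1 : forall u, contR (fun u => A1 (exp u)) u) by (intros u; eapply RD_contR, RD_comp_real; eauto).
 assert (cA2 : forall u, contR (fun u => A2 (exp u)) u).
 { intros u. assert (c0 : contR A2 (exp u)). { unfold A2. repeat first [apply contR_plus|apply contR_opp|apply contR_mult|apply contR_const|apply cE|eapply RD_contR, DB|eapply RD_contR, DB1|apply (td_c2 TD)]. }
  apply contR_continuous. apply (continuous_comp exp A2). eapply is_derive_continuous, dx. apply contR_continuous; auto. }
 assert (Zero : forall u, u = a \/ u = b -> A (exp u) = RtoC 0 /\ A1 (exp u) = RtoC 0).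
 { intros u Hu. destruct (td_zero TD (exp u)) as (Z0 & Z1 & _). destruct Hu as [-> | ->]; lra. unfold A, A1. rewrite Z0, Z1. split; ring. }
 destruct (Zero a (or_introl eq_refl)) as [Za Za1]. destruct (Zero b (or_intror eq_refl)) as [Zb Zb1].
 destruct (Fourier_inversion g g1 g2 a b x) as (K & PK & HK); try lra.
 { intros u _. unfold g, g1. eapply RD_eq. apply RD_mult. apply (RD_comp_real A exp); auto. apply Dp. cbv beta; ring. }
 { intros u _. unfold g1, g2. eapply RD_eq. apply RD_mult. apply RD_plus. apply RD_mult. apply RD_RtoC, dx. apply (RD_comp_real A1 exp); auto. apply RD_scal. apply (RD_comp_real A exp); auto. apply Dp.
  replace (9 / 4) with (3 / 2 * (3 / 2)) by field. replace (RtoC 4) with (1 + RtoC (3 / 2) + RtoC (3 / 2))%C by (rewrite <- !RtoC_plus; f_equal; field). rewrite RtoC_mult. cbv beta; ring. }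
 { intros u _. unfold g2. assert (ex : contR (fun u => RtoC (exp u)) u) by (eapply RD_contR, RD_RtoC, dx). apply contR_mult; [|eapply RD_contR, Dp]. apply contR_plus; [apply contR_plus|].
  apply contR_mult; [apply contR_mult|]; auto. apply contR_scal, contR_mult; auto. apply contR_scal; auto. }
 { unfold g; rewrite Za; ring. } { unfold g; rewrite Zb; ring. } { unfold g1; rewrite Za, Za1; ring. } { unfold g1; rewrite Zb, Zb1; ring. }
 set (w := 2 * PI / (b - a)) in *. note PI_RGT_0. assert (Pw : 0 < w) by pos.
 set (zz := Rpower z (- (3 / 2))). assert (Pz : 0 < zz) by apply Rpower_pos.
 assert (Psi : forall t, (rcpow z (- (3 / 2, t)%R) * Mel B al be Y (3 / 2, t)%R)%C = (RtoC zz * CInt (fun u => g u * Cexp (0%R, t * (u - x))%R) a b)%C).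
 { intros t. rewrite (Mel_extend B B1 B2 al be M TD Y (3 / 2, t) (exp a) (exp b)) by (try split; auto; apply exp_pos). note (exp_pos a).
  rewrite CInt_subst_exp by (try lra; apply (Mel_contI B B1 B2 al be M TD); auto). rewrite <- !CInt_scal; try lra.
  - apply CInt_ext. lra. intros u _. unfold g, A, E. rewrite rcpow_pred by apply exp_pos. assert (RtoC (exp u) <> 0) by (intros X; apply (f_equal Re) in X; simpl in X; note (exp_pos u); lra).
  transitivity (B (exp u) * Cexp (0%R, (- (Y * exp u))%R) * (rcpow z (- (3 / 2, t)%R) * rcpow (exp u) (3 / 2, t)%R))%C. field; auto.
  rewrite <- !Cmult_assoc. rewrite (Cmult_comm (RtoC zz)). rewrite <- !Cmult_assoc. f_equal. f_equal. unfold zz, Rpower, rcpow, p. rewrite RtoC_exp, <- !Cexp_plus, ln_exp. f_equal. fold x. Ceq.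
  - intros u _. unfold g. apply contR_mult. apply contR_mult. apply cA. eapply RD_contR, Dp. apply contR_ext with (fun u => Cexp (0%R, - (t * x))%R * Cexp (0%R, t * u)%R)%C. intros v. rewrite <- Cexp_im_plus. f_equal. f_equal. ring. apply contR_scal. eapply RD_contR, RD_Cexp_phase.
  - intros u _. apply contR_mult. eapply RD_contR, RD_RtoC, dx. apply contR_mult. apply cA. apply contR_continuous. apply (continuous_comp exp (fun v => rcpow v ((3 / 2, t)%R - 1)%C)). eapply is_derive_continuous, dx. apply contR_continuous, contR_rcpow, exp_pos. }
 destruct (INR_archimed 1 (Rabs T / w + K * zz / eps + 1)) as [N HN]. lra. rewrite Rmult_1_r in HN.
 assert (0 <= K * zz / eps). { apply Rdiv_le_0_compat; auto. pos. }
 set (n := S N). assert (Hn : Rabs T / w + K * zz / eps + 1 < INR n) by (unfold n; rewrite S_INR; lra). assert (Pn : 1 <= INR n) by (apply (le_INR 1); unfold n; lia).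
 assert (PT : 0 <= Rabs T / w) by (apply Rdiv_le_0_compat; auto using Rabs_pos).
 assert (Tw : T <= INR n * w). { le_via Rle_abs. replace (Rabs T) with (Rabs T / w * w) by (field; lra). mul_le_r; lra. }
 exists (INR n * w), (INR (S n) * w). split; auto. split. rewrite S_INR. lra.
 rewrite (CInt_ext _ (fun t => RtoC zz * CInt (fun u => g u * Cexp (0%R, t * (u - x))%R) a b)%C). 3: intros; apply Psi. 2: rewrite S_INR; nra.
 assert (cp : contI (fun t => CInt (fun u => g u * Cexp (0%R, t * (u - x))%R)%C a b) (- (INR n * w)) (INR (S n) * w)).
 { intros t _. apply contR_ext with (fun t => / RtoC zz * (rcpow z (- (3 / 2, t)%R) * Mel B al be Y (3 / 2, t)%R))%C. intros y. rewrite Psi. field. RtoC_nz.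
  apply contR_scal. apply (contR_ver (fun s => rcpow z (- s) * Mel B al be Y s)%C). destruct (Mel_Cdiff B B1 B2 al be M TD Y (3 / 2, t)) as [l Hl].
  eapply Cdiff_contC, Cdiff_mult. apply (Cdiff_comp (fun s => rcpow z s) (fun s => - s)%C). apply Cdiff_rcpow. apply Cdiff_opp, Cdiff_id. apply Hl. }
 rewrite CInt_scal; auto. 2: rewrite S_INR; nra.
 assert (Gx : (RtoC zz * g x)%C = (B z * Cexp (0%R, (- (Y * z))%R))%C).
 { unfold g, A, E, p, zz, x. rewrite exp_ln by auto. unfold Rpower. rewrite RtoC_exp. rewrite (Cmult_comm (Cexp (RtoC _))), <- Cmult_assoc, <- Cexp_plus. replace (ln z * (3 / 2)%R + (- (3 / 2) * ln z)%R)%C with (RtoC 0). rewrite Cexp_0. ring. rewrite <- RtoC_mult, <- RtoC_plus. f_equal. ring. }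
 rewrite <- Gx. replace (2 * PI * (RtoC zz * g x))%C with (RtoC zz * (2 * PI * g x))%C by ring. 
 match goal with |- Cmod (?z0 * ?I - ?z0 * ?J) <= _ => replace (z0 * I - z0 * J)%C with (z0 * (I - J))%C by ring end.
 rewrite Cmod_mult, Cmod_RtoC_pos by lra. specialize (HK n ltac:(unfold n; lia)).
 le_mid (zz * (K / INR n)). mul_le_l; lra. apply Rmult_le_reg_r with (INR n). lra. replace (zz * (K / INR n) * INR n) with (K * zz) by (field; lra).
 assert (Q : K * zz / eps <= INR n) by lra.
 apply Rmult_le_compat_r with (r := eps) in Q; [|lra]. replace (K * zz / eps * eps) with (K * zz) in Q by (field; lra). lra.
Qed.

(** * The weighted Mellin transform *)

Definition Fx (B : R -> C) (al be xi X : R) (s : C) : C := (rcpow X s * Mel B al be (2 * PI * xi * X) s)%C.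

(** Of order 1 up to height [X] and decaying like [X^2 / t^2] beyond, as two integrations by parts
    allow; its integral over [t] is of order [X]. *)
Definition wt (X t : R) : R := X ^ 2 / (X + Rabs t) ^ 2.

Lemma wt_bounds X t : 0 < X -> 0 < wt X t <= 1.
Proof. intros HX. note (Rabs_pos t). assert (0 < (X + Rabs t) ^ 2) by (apply pow_lt; lra). unfold wt. split. apply Rdiv_lt_0_compat; auto. apply pow_lt; auto.
 apply Rmult_le_reg_r with ((X + Rabs t) ^ 2). auto. unfold Rdiv. rewrite Rmult_assoc, Rinv_l by lra. nra.
Qed.

Lemma wt_ge X t k : 0 < X -> 0 <= k -> Rabs t <= k * X -> / (1 + k) ^ 2 <= wt X t.
Proof. intros HX Hk Ht. note (Rabs_pos t). unfold wt. assert (0 < (X + Rabs t) ^ 2) by (apply pow_lt; lra). assert (0 < (1 + k) ^ 2) by (apply pow_lt; lra).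
 apply Rmult_le_reg_r with ((X + Rabs t) ^ 2); auto. apply Rmult_le_reg_l with ((1 + k) ^ 2); auto. unfold Rdiv. rewrite Rmult_assoc, Rinv_l, Rmult_1_r, <- Rmult_assoc, Rinv_r, Rmult_1_l by lra.
 rewrite <- Rpow_mult_distr. apply pow_incr. split. lra. nra.
Qed.

(** The second clause gains a factor [X^2] at heights where the phase has no stationary point for
    large [X]; it controls the bottom edge and the part of the line below the contour. The third is
    the stationary phase formula on the critical line. *)
Definition Fx_spec (B : R -> C) (al be xi K : R) : Prop := forall X, 10 <= X ->
 (forall s, -1 <= Re s <= 2 -> Cmod (Fx B al be xi X s) <= K * Rpower X (Re s) * wt X (Im s)) /\
 (forall s, -1 <= Re s <= 2 -> Im s <= 400 -> Cmod (Fx B al be xi X s) <= K * Rpower X (Re s) / (X + Rabs (Im s)) ^ 2) /\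
 (forall g, 0 < g -> Cmod (Fx B al be xi X (hl g) - rcpow xi (- (1 / 2), - g)%R * Cconj (chi (hl g)) * B (g / (2 * PI * xi * X))%R) <= K * Rpower X (- (1 / 2)) * wt X g).

Section Transform.
Variables (B B1 B2 : R -> C) (al be M xi : R).
Hypothesis TD : test_data B B1 B2 al be M.
Hypothesis Hxi : 0 < xi.
Let Fm := Fx B al be xi.

Lemma Fx_Cdiff X s : exists l, Cdiff (Fm X) s l.
Proof. destruct (Mel_Cdiff B B1 B2 al be M TD (2 * PI * xi * X) s) as [l Hl]. eexists. apply Cdiff_mult. apply Cdiff_rcpow. apply Hl. Qed.

Lemma rcpow_Fx_contR a X x t : contR (fun t => rcpow a (- (x, t)) * Fm X (x, t))%C t.
Proof. apply (contR_ver (fun s => rcpow a (- s) * Fm X s)%C). destruct (Fx_Cdiff X (x, t)) as [l Hl]. eapply Cdiff_contC, Cdiff_mult. apply (Cdiff_comp (fun s => rcpow a s) (fun s => - s)%C). apply Cdiff_rcpow. apply Cdiff_opp, Cdiff_id. apply Hl.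
Qed.

Lemma Mel_ns c : 0 < c -> exists K, 0 <= K /\ forall X s, 10 <= X -> -1 <= Re s <= 2 ->
 (forall v, al <= v <= be -> c * (X + Rabs (Im s)) <= Rabs (Im s - 2 * PI * xi * X * v)) ->
 Cmod (Mel B al be (2 * PI * xi * X) s) <= K / (X + Rabs (Im s)) ^ 2.
Proof. intros Hc. td_facts TD. note PI_RGT_0 as PP.
 set (k := 2 * PI * xi / c). assert (Pk : 0 <= k) by (apply Rdiv_le_0_compat; auto; apply Rmult_le_pos; lra).
 set (K0 := (be - al) * (exp (4 * (Rabs (ln al) + Rabs (ln be))) * M * (1 + k + be * (1 + 3 * k + 3 * k * k)))).
 assert (P0 : 0 <= K0). { unfold K0. apply Rmult_le_pos. lra. apply Rmult_le_pos. apply Rmult_le_pos; auto. pos. assert (0 <= be * (1 + 3 * k + 3 * k * k)) by (apply Rmult_le_pos; nra). lra. }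
 exists (K0 / (c * c)). split. apply Rdiv_le_0_compat; nra. intros X s HX Hs Hv. note (Rabs_pos (Im s)). set (N := X + Rabs (Im s)) in *.
 assert (PN : 0 < N) by (unfold N; lra).
 eapply Rle_trans. apply (Mel_nonstationary B B1 B2 al be M TD (2 * PI * xi * X) s (c * N) k); auto.
 - mulpos; lra.
 - apply Rmult_lt_0_compat; auto.
 - unfold k. replace (2 * PI * xi / c * (c * N)) with (2 * PI * xi * N) by (field; lra). mul_le_l. pos. unfold N; lra.
 - fold K0. right. field. lra.
Qed.

Lemma Fx_mod X s a : 0 < X -> Cmod (Mel B al be (2 * PI * xi * X) s) <= a -> Cmod (Fm X s) <= Rpower X (Re s) * a.
Proof. intros HX H. unfold Fm, Fx. rewrite Cmod_mult, Cmod_rcpow. mul_le_l; auto. pos. Qed.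

Let C0 := (be - al) * (M * exp (4 * (Rabs (ln al) + Rabs (ln be)))).
Let tau := 2 * (2 * PI * xi) * be.

Lemma C0_pos : 0 <= C0.
Proof. note (td_be TD). note (td_M TD). unfold C0. apply Rmult_le_pos. lra. apply Rmult_le_pos; auto. pos. Qed.

Lemma tau_pos : 0 < tau.
Proof. note (td_be TD). note (td_al TD). note PI_RGT_0. unfold tau. pos. Qed.

(** From height [tau X] on, the ordinate is at least twice the largest value of [2 PI xi X v] on the
    support, so at least half of it remains in the difference. *)
Lemma Mel_far : exists K, 0 <= K /\ forall X s, 10 <= X -> -1 <= Re s <= 2 -> tau * X <= Im s -> Cmod (Mel B al be (2 * PI * xi * X) s) <= K / (X + Rabs (Im s)) ^ 2.
Proof. note tau_pos as Pt. note PI_RGT_0 as PP. assert (0 < / tau) by (apply Rinv_0_lt_compat; auto). set (c := / (2 * (1 + / tau))).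
 assert (Pc : 0 < c) by pos. destruct (Mel_ns c Pc) as (K & PK & HK). exists K. split; auto. intros X s HX Hs Ht. apply HK; auto.
 intros v Hv. assert (0 <= tau * X) by pos. rewrite (Rabs_pos_eq (Im s)) by lra.
 assert (A : 2 * PI * xi * X * v <= Im s / 2). { le_mid (2 * PI * xi * X * be). mul_le_l. pos. lra. unfold tau in Ht. lra. }
 rewrite Rabs_pos_eq by lra. le_mid (Im s / 2); [|lra]. apply Rmult_le_reg_l with (2 * (1 + / tau)). lra. rewrite <- Rmult_assoc. unfold c. rewrite Rinv_r, Rmult_1_l by lra.
 assert (X <= / tau * Im s). { apply Rmult_le_reg_l with tau; auto. rewrite <- Rmult_assoc, Rinv_r; lra. } lra.
Qed.

(** For [Im s <= 400] the term [2 PI xi X v] dominates as soon as [X >= 800 / y]. Smaller [X] range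
    over a bounded set, where the trivial estimate is enough. *)
Lemma Mel_low : exists K, 0 <= K /\ forall X s, 10 <= X -> -1 <= Re s <= 2 -> Im s <= 400 -> Cmod (Mel B al be (2 * PI * xi * X) s) <= K / (X + Rabs (Im s)) ^ 2.
Proof. td_facts TD. note PI_RGT_0 as PP. note C0_pos as PC.
 set (y := 2 * PI * xi * al). assert (Py : 0 < y) by (unfold y; mulpos; lra).
 assert (YX : forall X v, 10 <= X -> al <= v -> y * X <= 2 * PI * xi * X * v). { intros X v HX Hv. unfold y. replace (2 * PI * xi * al * X) with (2 * PI * xi * X * al) by ring. mul_le_l; auto. pos. }
 (* [82] is twice [41]: here [X + Im s <= 41 X] because [X >= 10], and half of [y X] survives the
    subtraction. *)
 set (c := Rmin (Rmin y 1) (y / 82)). assert (Pc : 0 < c) by (unfold c; repeat apply Rmin_pos; lra).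
 assert (c1 : c <= y) by (eapply Rle_trans; [apply Rmin_l|apply Rmin_l]). assert (c2 : c <= 1) by (eapply Rle_trans; [apply Rmin_l|apply Rmin_r]). assert (c3 : c <= y / 82) by apply Rmin_r.
 destruct (Mel_ns c Pc) as (K & PK & HK). set (X1 := 800 / y). assert (P1 : 0 < X1) by pos.
 exists (K + C0 * (X1 + 400) ^ 2). assert (Pz : 0 <= C0 * (X1 + 400) ^ 2) by (apply Rmult_le_pos; auto; apply pow_le; lra). split. lra. intros X s HX Hs Ht. note (Rabs_pos (Im s)).
 assert (PN : 0 < (X + Rabs (Im s)) ^ 2) by (apply pow_lt; lra).
 assert (Go : (forall v, al <= v <= be -> c * (X + Rabs (Im s)) <= Rabs (Im s - 2 * PI * xi * X * v)) -> Cmod (Mel B al be (2 * PI * xi * X) s) <= (K + C0 * (X1 + 400) ^ 2) / (X + Rabs (Im s)) ^ 2).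
 { intros Hv. eapply Rle_trans. apply HK; auto. mul_le_r. pos. lra. }
 destruct (Rle_dec (Im s) 0) as [N|N].
 - apply Go. intros v Hv. specialize (YX X v HX (proj1 Hv)). rewrite (Rabs_left1 (Im s)) by auto. rewrite Rabs_left1 by nra. nra.
 - destruct (Rle_dec X1 X) as [L|L].
  + apply Go. intros v Hv. specialize (YX X v HX (proj1 Hv)). rewrite (Rabs_pos_eq (Im s)) by lra. assert (800 <= y * X). { replace 800 with (y * X1) by (unfold X1; field; lra). mul_le_l; lra. }
  rewrite Rabs_left1 by nra. le_mid (y / 82 * (41 * X)). apply Rmult_le_compat; lra. lra.
  + eapply Rle_trans. apply (Mel_trivial B B1 B2 al be M TD); auto. fold C0. rewrite (Rabs_pos_eq (Im s)) in * by lra. apply Rmult_le_reg_r with ((X + Im s) ^ 2); auto. unfold Rdiv. rewrite (Rmult_assoc (K + _)), Rinv_l, Rmult_1_r by lra.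
  le_mid (C0 * (X1 + 400) ^ 2); [|lra]. mul_le_l; auto. apply pow_incr. lra.
Qed.

(** At heights that are neither low nor far, [Im s <= tau X] keeps the weight bounded below, so the
    trivial bound, or stationary phase in the third clause, is enough; elsewhere the non-stationary
    bounds apply. *)
Lemma Fx_bounds : exists K, 0 <= K /\ Fx_spec B al be xi K.
Proof. td_facts TD. note PI_RGT_0 as PP. note C0_pos as PC. note tau_pos as Pt.
 destruct Mel_far as (K1 & PK1 & H1). destruct Mel_low as (K2 & PK2 & H2).
 set (kk := 1 + 2 * be + / (2 * be)). assert (Pm : 0 < Rmin 1 al) by (apply Rmin_pos; lra).
 set (D := 96 * M * (kk * kk) + M * (12 / Rmin 1 al)). assert (PD : 0 <= D). { unfold D. assert (0 <= kk * kk) by nra. assert (0 <= M * (kk * kk)) by (apply Rmult_le_pos; auto). assert (0 <= 12 / Rmin 1 al) by pos. assert (0 <= M * (12 / Rmin 1 al)) by (apply Rmult_le_pos; auto). lra. }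
 assert (Pt2 : 0 < (1 + tau) ^ 2) by (apply pow_lt; lra).
 set (D3 := D / (2 * PI * xi) * (1 + tau) ^ 2). assert (PD3 : 0 <= D3). { apply Rmult_le_pos; [|lra]. apply Rdiv_le_0_compat; auto. pos. }
 assert (PC3 : 0 <= C0 * (1 + tau) ^ 2) by pos.
 exists (K1 + K2 + C0 * (1 + tau) ^ 2 + D3). set (K := K1 + K2 + C0 * (1 + tau) ^ 2 + D3). assert (PK : 0 <= K) by (unfold K; lra). split; auto.
 intros X HX. change (Fx B al be xi) with Fm. assert (PX : 0 < X) by lra.
 assert (Inv : forall s k, 0 <= k <= K -> k / (X + Rabs (Im s)) ^ 2 <= K / (X + Rabs (Im s)) ^ 2).
 { intros s k Hk. note (Rabs_pos (Im s)). mul_le_r. left; apply Rinv_0_lt_compat, pow_lt; lra. lra. }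
 assert (Inw : forall s, K / (X + Rabs (Im s)) ^ 2 = K * / X ^ 2 * wt X (Im s)). { intros s. unfold wt. note (Rabs_pos (Im s)). field. split; lra. }
 assert (X2 : / X ^ 2 <= 1) by (rewrite <- Rinv_1; apply Rinv_le_contravar; nra). assert (X2' : 0 < / X ^ 2) by (apply Rinv_0_lt_compat; nra).
 split; [|split].
 - intros s Hs. destruct (wt_bounds X (Im s) PX) as [w1 w2].
  assert (G : Cmod (Mel B al be (2 * PI * xi * X) s) <= K / (X + Rabs (Im s)) ^ 2 -> Cmod (Fm X s) <= K * Rpower X (Re s) * wt X (Im s)).
  { intros G. apply Fx_mod in G; auto. le_via G. rewrite Inw. replace (K * Rpower X (Re s) * wt X (Im s)) with (Rpower X (Re s) * (K * 1 * wt X (Im s))) by ring. mul_le_l. pos.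
  mul_le_r. lra. mul_le_l; lra. }
  destruct (Rle_dec (Im s) 400) as [L|L]. apply G. eapply Rle_trans. apply H2; auto. apply Inv. unfold K; lra.
  destruct (Rle_dec (tau * X) (Im s)) as [L2|L2]. apply G. eapply Rle_trans. apply H1; auto. apply Inv. unfold K; lra.
  assert (Wg := wt_ge X (Im s) tau PX ltac:(lra) ltac:(rewrite Rabs_pos_eq; lra)).
  le_via (Fx_mod X s C0 PX). apply (Mel_trivial B B1 B2 al be M TD); auto. replace (K * Rpower X (Re s) * wt X (Im s)) with (Rpower X (Re s) * (K * wt X (Im s))) by ring. mul_le_l. pos.
  le_mid (C0 * (1 + tau) ^ 2 * / (1 + tau) ^ 2). right; field; lra. apply Rmult_le_compat; auto. pos. unfold K; lra.
 - intros s Hs L. le_via (Fx_mod X s (K2 / (X + Rabs (Im s)) ^ 2) PX). apply H2; auto. specialize (Inv s K2 ltac:(unfold K; lra)). replace (K * Rpower X (Re s) / (X + Rabs (Im s)) ^ 2) with (Rpower X (Re s) * (K / (X + Rabs (Im s)) ^ 2)) by (unfold Rdiv; ring).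
  mul_le_l; auto. pos.
 - intros g Hg. set (Y := 2 * PI * xi * X). assert (PY : 0 < Y) by (unfold Y; mulpos; lra).
  destruct (wt_bounds X g PX) as [w1 w2]. destruct (Rle_dec (tau * X) g) as [L|L].
  + assert (Z : B (g / Y) = RtoC 0). { apply (td_zero TD). right. apply Rmult_le_reg_r with Y; auto. div_cancel. unfold tau in L. fold Y. unfold Y. assert (0 <= 2 * PI * xi * be * X) by pos. lra. }
  fold Y. rewrite Z. replace (Fm X (hl g) - rcpow xi (- (1 / 2), - g)%R * Cconj (chi (hl g)) * 0)%C with (Fm X (hl g)) by ring.
  le_via (Fx_mod X (hl g) (K / (X + Rabs (Im (hl g))) ^ 2) PX). eapply Rle_trans. apply H1; auto; simpl; lra. apply Inv. unfold K; lra. rewrite Inw. change (Im (hl g)) with g. change (Re (hl g)) with (1 / 2).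
  replace (Rpower X (1 / 2) * (K * / X ^ 2 * wt X g)) with (K * (Rpower X (1 / 2) * / X ^ 2) * wt X g) by ring. mul_le_r. lra. mul_le_l; auto.
  replace (X ^ 2) with (Rpower X 2) by (change 2 with (INR 2); apply Rpower_pow; auto). rewrite <- Rpower_Ropp, <- Rpower_plus. apply Rpower_mono_exp; lra.
  + assert (Kp : 0 < xi * X) by (apply Rmult_lt_0_compat; auto). assert (E0 : Y * (g / Y) = g) by (field; lra).
  assert (St := Mel_stationary B B1 B2 al be M TD Y (g / Y) PY ltac:(apply Rdiv_lt_0_compat; auto) (xi * X) Kp ltac:(unfold Y; ring)). rewrite E0 in St. fold kk in St.
  fold Y. replace (Fm X (hl g) - rcpow xi (- (1 / 2), - g)%R * Cconj (chi (hl g)) * B (g / Y)%R)%C with (rcpow xi (- hl g) * (rcpow (xi * X) (hl g) * Mel B al be Y (hl g) - B (g / Y)%R * Cconj (chi (hl g))))%C.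
  2:{ unfold Fm, Fx. fold Y. rewrite rcpow_mult_base by auto. replace ((- (1 / 2), - g)%R : C) with (- hl g)%C by (unfold hl; Ceq). rewrite rcpow_opp. note (rcpow_neq0 xi (hl g)). field. auto. }
  rewrite Cmod_mult, Cmod_rcpow, re_opp. change (Re (hl g)) with (1 / 2). le_via Rmult_le_compat_l. pos. apply St.
  rewrite <- Rpower_mult_distr by auto. rewrite <- Rmult_assoc, <- Rmult_assoc, <- Rpower_plus. replace (- (1 / 2) + 1 / 2) with 0 by ring. rewrite Rpower_O, Rmult_1_l by auto.
  replace (96 * M * (kk * kk) / Y + M * (6 * (2 / (Y * Rmin 1 al)))) with (D / Y) by (unfold D; field; lra).
  assert (Wg := wt_ge X g tau PX ltac:(lra) ltac:(rewrite Rabs_pos_eq; lra)).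
  le_mid (Rpower X (- (1 / 2)) * (D / (2 * PI * xi))). replace (Rpower X (1 / 2)) with (Rpower X (- (1 / 2)) * X). right. unfold Y. field. lra. rewrite <- (Rpower_1 X) at 2 by auto. rewrite <- Rpower_plus. f_equal. field.
  replace (K * Rpower X (- (1 / 2)) * wt X g) with (Rpower X (- (1 / 2)) * (K * wt X g)) by ring. mul_le_l. pos. 
  le_mid (D3 * / (1 + tau) ^ 2). unfold D3. right; field. repeat split; lra. apply Rmult_le_compat; auto. pos. unfold K; lra.
Qed.

End Transform.

(** * Zeros and the logarithmic derivative at large height *)

Lemma ln_ge_1 U : 3 <= U -> 1 <= ln U.
Proof. intros H. rewrite <- (ln_exp 1). note exp_le_3. note (exp_pos 1). destruct (Req_dec (exp 1) U) as [->|]. lra. left; apply ln_increasing; lra. Qed.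

(** Growth relative to the value at [2 + i t], as the Landau bounds require. They are applied with
    [r = 40]: the square of half-side [5 r = 200] stays in [Im z >= 1] for [t >= 201], and the inner
    square of half-side [40/16] still covers the real parts in [[-1/4, 3/2]]. *)
Definition zeta_growth (c0 : R) : Prop := forall t U z, 201 <= t <= U -> sqR (2, t) 200 z -> Cmod (zeta z) <= Cmod (zeta (2, t)) * exp (c0 * ln U).

(** The square reaches left to real part [-198], hence the polynomial bound on the half-plane of
    index 200; below, [|zeta(2 + i t)| >= 1/4]. *)
Lemma zeta_growth_exists : exists c0, 1 <= c0 /\ zeta_growth c0.
Proof. destruct (zeta_poly 200) as (A & m & PA & HA). set (la := ln (4 * (A + 1))). assert (Pla : 0 <= la). { unfold la. rewrite <- ln_1. left. apply ln_increasing; lra. }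
 note (pos_INR m) as Pm. exists (1 + 3 * INR m + la). split. lra. intros t U z Ht [H1 H2]. simpl in H1, H2.
 assert (LU : 1 <= ln U) by (apply ln_ge_1; lra).
 assert (Hz : Cmod (zeta z) <= A * (4 * U) ^ m).
 { le_via HA. lra. replace (INR 200) with 200 by (rewrite INR_IZR_INZ; reflexivity). lra. mul_le_l; auto. apply pow_incr. note (Cmod_ge_0 z). split. lra.
  note (Cmod_le_Re_Im z). assert (Rabs (Re z) <= 202) by (apply Rabs_le; lra). assert (Rabs (Im z) <= t + 200) by (apply Rabs_le; lra). lra. }
 note (zeta_2_lower (2, t) eq_refl) as L2. le_via Hz.
 le_mid (1 / 4 * exp ((1 + 3 * INR m + la) * ln U)). 2: mul_le_r; auto; left; apply exp_pos.
 rewrite <- Rpower_pow by lra. unfold Rpower. rewrite ln_mult by lra.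
 assert (l4 : ln 4 <= 2). { replace 4 with (2 * 2) by ring. rewrite ln_mult by lra. assert (ln 2 <= 1). { rewrite <- (ln_exp 1). left. apply ln_increasing. lra. note (exp_ineq1 1). lra. } lra. }
 le_mid (1 / 4 * exp (la + INR m * (ln 4 + ln U))).
 - rewrite exp_plus. unfold la. rewrite exp_ln by lra. note (exp_pos (INR m * (ln 4 + ln U))). nra.
 - mul_le_l. lra. apply exp_le. nra.
Qed.

Lemma suml_bound l z d : 0 < d -> (forall r, In r l -> d <= Cmod (z - r)) -> Cmod (suml l z) <= INR (length l) / d.
Proof. intros Hd. induction l as [|a l IH]; intros H; simpl. rewrite Cmod_0, INR_0. lra. rewrite S_INR. le_via Cmod_triangle.
 assert (Ha : d <= Cmod (z - a)) by (apply H; left; auto). rewrite Cmod_inv' by lra. assert (/ Cmod (z - a) <= / d) by (apply Rinv_le_contravar; lra).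
 specialize (IH (fun r Hr => H r (or_intror Hr))). replace ((INR (length l) + 1) / d) with (/ d + INR (length l) / d) by (field; lra). lra.
Qed.

Lemma disjoint_cells_length (cell : nat -> C -> Prop) : (forall i j z, cell i z -> cell j z -> i = j) ->
 forall m l, (forall j, (j < m)%nat -> exists z, In z l /\ cell j z) -> (m <= length l)%nat.
Proof. intros Hd. induction m; intros l H. lia. destruct (H m ltac:(lia)) as (z & Hz & Cz). apply in_split in Hz. destruct Hz as (l1 & l2 & ->).
 assert (K : (m <= length (l1 ++ l2))%nat). { apply IHm. intros j Hj. destruct (H j ltac:(lia)) as (y & Hy & Cy). exists y. split; auto. apply in_app_iff in Hy. apply in_app_iff. destruct Hy as [|[<-|]]; auto. exfalso. specialize (Hd _ _ _ Cy Cz). lia. }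
 rewrite length_app in *. simpl. lia.
Qed.

(** A unit interval is cut into [n + 1] open cells against [n] listed zeros: some cell holds no
    ordinate, and its midpoint is half a cell away from all of them. *)
Lemma avoid_ordinates (l : list C) V : exists T, V <= T <= V + 1 /\ forall z, In z l -> / (2 * (INR (length l) + 1)) <= Rabs (Im z - T).
Proof. set (n := INR (length l)). assert (Pn : 0 <= n) by apply pos_INR. set (h := / (n + 1)). assert (Ph : 0 < h) by pos. assert (Eh : (n + 1) * h = 1) by (apply Rinv_r; lra).
 set (cell := fun (j : nat) z => V + INR j * h < Im z < V + (INR j + 1) * h).
 assert (Hd : forall i j z, cell i z -> cell j z -> i = j).
 { intros i j z Hi Hj. unfold cell in *. destruct (Nat.lt_trichotomy i j) as [L|[L|L]]; auto; exfalso; apply le_INR in L; rewrite S_INR in L; nra. }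
 apply NNPP. intros N. assert (K : (S (length l) <= length l)%nat). 2: lia.
 apply (disjoint_cells_length cell Hd). intros j Hj. apply NNPP. intros N2. apply N. exists (V + (INR j + 1 / 2) * h). note (pos_INR j). assert (INR j <= n) by (apply le_INR; lia). split. nra.
 intros z Hz. replace (/ (2 * (n + 1))) with (h / 2) by (unfold h; field; lra). apply Rnot_lt_le. intros L. apply N2. exists z. split; auto. apply Rabs_def2 in L. unfold cell. lra.
Qed.

Lemma contC_plus f g z : contC f z -> contC g z -> contC (fun w => f w + g w)%C z.
Proof. intros Hf Hg eps He. destruct (Hf (eps / 2)) as (d1 & D1 & K1). lra. destruct (Hg (eps / 2)) as (d2 & D2 & K2). lra. exists (Rmin d1 d2). split. apply Rmin_pos; auto. intros w Hw.
 min_le d1 d2. specialize (K1 w ltac:(lra)). specialize (K2 w ltac:(lra)). replace (f w + g w - (f z + g z))%C with ((f w - f z) + (g w - g z))%C by ring.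
 eapply Rle_lt_trans. apply Cmod_triangle. lra.
Qed.

Lemma Rect_suml F l a b c d : a <= b -> c <= d -> (forall z, exists k, Cdiff F z k) -> (forall r, In r l -> inI a b c d r) ->
 Rect (fun z => F z * suml l z)%C a b c d = (2 * PI * Ci * list_sum F l)%C /\ forall z, onB a b c d z -> contC (fun z => F z * suml l z)%C z.
Proof. intros Hab Hcd HF. assert (cF : forall z, contC F z) by (intros z; destruct (HF z); eapply Cdiff_contC; eauto).
 induction l as [|r l IH]; intros Hl; simpl list_sum.
 - split. rewrite (Rect_ext a b c d Hab Hcd _ (fun z => 0 * F z)%C). rewrite Rect_scal; auto. ring. intros z _. simpl. ring.
  intros z _. apply contC_ext_loc with (fun _ => RtoC 0). exists 1; split; [lra|]. intros; simpl; ring. apply contC_const.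
 - destruct IH as [E c0]. intros; apply Hl; right; auto. assert (Ir : inI a b c d r) by (apply Hl; left; auto).
  assert (c1 : forall z, onB a b c d z -> contC (fun z => F z / (z - r))%C z). { intros z Hz. apply contC_div; auto. eapply onB_neq; eauto. eapply Cdiff_contC, Cdiff_sub_const. }
  assert (Ex : forall z, (F z / (z - r) + F z * suml l z = F z * suml (r :: l) z)%C) by (intros z; simpl; unfold Cdiv; ring).
  split. rewrite <- (Rect_ext a b c d Hab Hcd (fun z => F z / (z - r) + F z * suml l z)%C) by auto. rewrite Rect_plus, E, Cauchy_formula by (auto; intros z _; auto). ring.
  intros z Hz. apply contC_ext_loc with (fun z => F z / (z - r) + F z * suml l z)%C. exists 1; split; [lra|auto]. apply (contC_plus (fun z => F z / (z - r))%C); auto.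
Qed.

Section Height.
Hypothesis RH : Riemann_hypothesis.
Variable c0 : R.
Hypothesis Hc0 : 1 <= c0.
Hypothesis HG : zeta_growth c0.

Lemma sq_UH t z : 201 <= t -> sqR (2, t) (5 * 40) z -> UH z.
Proof. intros Ht [_ H]. simpl in H. unfold UH. lra. Qed.

(** [ln 2 > 1/2] turns the bound for [2 ^ length l] of [Landau_count] into one for [length l]. *)
Lemma count_local l g t U : facl UH zeta l g -> 201 <= t <= U -> (forall z, In z l -> Rabs (Im z - t) <= 40) -> INR (length l) <= 2 * (c0 * ln U).
Proof. intros Hf Ht Hl. assert (LU : 1 <= ln U) by (apply ln_ge_1; lra). note (zeta_2_lower (2, t) eq_refl) as L2.
 assert (K := Landau_count UH zeta g l (2, t) 40 (Cmod (zeta (2, t)) * exp (c0 * ln U)) Hf ltac:(lra)).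
 assert (K2 : 2 ^ length l * Cmod (zeta (2, t)) <= Cmod (zeta (2, t)) * exp (c0 * ln U)).
 { apply K. intros z Hz. eapply sq_UH; eauto; lra. intros z Hz. apply HG; auto. replace 200 with (5 * 40) by ring. auto.
  intros z Hz. specialize (Hl z Hz). apply Rabs_le_between in Hl. assert (Uz : UH z) by (unfold UH; lra). note (RH_line RH z Uz (facl_zero l g z Hf Hz Uz)). unfold sqR, inR; simpl. lra. }
 assert (K3 : 2 ^ length l <= exp (c0 * ln U)) by (apply Rmult_le_reg_r with (Cmod (zeta (2, t))); lra).
 rewrite <- Rpower_pow in K3 by lra. apply exp_le_inv in K3. note ln_lt_2. note (pos_INR (length l)). nra.
Qed.

(** After division by the zeros within 40 of [t], the cofactor contributes at most [32 L / 40] by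
    [Landau_logder], where [L = c0 ln U], and each of the at most [2 L] zeros at most [1 / d]. *)
Lemma logder_local t U z d : 201 <= t <= U -> sqR (2, t) (40 / 16) z -> 0 < d <= 1 ->
 (forall r, UH r -> zeta r = 0 -> Rabs (Im r - t) <= 40 -> d <= Cmod (z - r)) -> zeta z <> RtoC 0 /\ Cmod (Cder zeta z / zeta z) <= 3 * (c0 * ln U) / d.
Proof. intros Ht Hz Hd Hr. assert (LU : 1 <= ln U) by (apply ln_ge_1; lra). set (L := c0 * ln U). assert (PL : 1 <= L) by (unfold L; nra).
 assert (Uz : UH z) by (destruct Hz as [_ Hz]; simpl in Hz; unfold UH; lra).
 assert (Nz : zeta z <> RtoC 0).
 { intros E. assert (D := Hr z Uz E). replace (z - z)%C with (RtoC 0) in D by ring. rewrite Cmod_0 in D. destruct Hz as [_ Hz]; simpl in Hz. assert (d <= 0). apply D. apply Rabs_le; lra. lra. }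
 split; auto. destruct (band_list RH (t - 40) (t + 40) ltac:(lra)) as (l & g & Hf & Hin & Hn).
 assert (Hl : forall q, In q l -> UH q /\ zeta q = 0 /\ Rabs (Im q - t) <= 40).
 { intros q Hq. note (Hin q Hq) as Bq. unfold band in Bq. assert (Uq : UH q) by (unfold UH; lra). split; auto. split. eapply facl_zero; eauto. apply Rabs_le; lra. }
 rewrite (logder_facl UH zeta l g z opn_UH Hf Uz Nz).
 assert (A1 : Cmod (Cder g z / g z) <= 32 * L / 40).
 { apply (Landau_logder UH zeta g l (2, t) 40 (Cmod (zeta (2, t)) * exp (c0 * ln U))); auto; try lra. apply opn_UH.
  - intros q Hq. eapply sq_UH; eauto; lra.
  - intros q Hq. apply HG; auto. replace 200 with (5 * 40) by ring. auto.
  - intros q Hq. destruct (Hl q Hq) as (Uq & Zq & Bq). apply Rabs_le_between in Bq. note (RH_line RH q Uq Zq). unfold sqR, inR; simpl. lra.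
  - right; reflexivity.
  - intros q [_ Hq]. simpl in Hq. apply Hn. unfold band. lra. }
 assert (A2 : Cmod (suml l z) <= INR (length l) / d). { apply suml_bound. lra. intros r Hq. destruct (Hl r Hq) as (Uq & Zq & Bq). auto. }
 assert (A3 : INR (length l) <= 2 * L). { apply (count_local l g t U); auto. intros q Hq. apply Hl; auto. }
 le_via Cmod_triangle. replace (3 * L / d) with (2 * L / d + L / d) by (field; lra). apply Rplus_le_compat.
 le_via A2. mul_le_r; auto. pos.
 le_mid L. lra. apply Rmult_le_reg_r with d. lra. unfold Rdiv. rewrite Rmult_assoc, Rinv_l; nra.
Qed.

(** Among [O(L)] zeros some [T] keeps a distance of order [1 / L] from all ordinates, whence the
    square of [L]. *)
Lemma good_height V U : 250 <= V -> V + 2 <= U -> exists T, V <= T <= V + 1 /\ (forall r, UH r -> zeta r = 0 -> Im r <> T) /\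
 forall x, -1 / 4 <= x <= 3 / 2 -> Cmod (Cder zeta (x, T) / zeta (x, T)) <= 18 * (c0 * ln U) ^ 2.
Proof. intros HV HU. assert (LU : 1 <= ln U) by (apply ln_ge_1; lra). set (L := c0 * ln U). assert (PL : 1 <= L) by (unfold L; nra).
 destruct (band_list RH (V - 1) (V + 2) ltac:(lra)) as (l & g & Hf & Hin & Hn). destruct (avoid_ordinates l V) as (T & HT & Ha). exists T. split; auto.
 assert (A3 : INR (length l) <= 2 * L). { apply (count_local l g V U); auto. lra. intros q Hq. apply Hin in Hq. unfold band in Hq. apply Rabs_le; lra. }
 note (pos_INR (length l)). set (d := / (2 * (INR (length l) + 1))) in *. assert (Pd : 0 < d) by pos. assert (d1 : d <= 1) by (unfold d; rewrite <- Rinv_1; apply Rinv_le_contravar; lra).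
 assert (Far : forall r, UH r -> zeta r = 0 -> d <= Rabs (Im r - T)).
 { intros r Ur Zr. destruct (classic (band (V - 1) (V + 2) r)) as [Br|Br]. apply Ha. apply (band_list_zero (V - 1) (V + 2) l g r); auto; lra. unfold band in Br. unfold Rabs. destruct Rcase_abs; lra. }
 split. intros r Ur Zr E. specialize (Far r Ur Zr). rewrite E, Rminus_diag, Rabs_R0 in Far. lra.
 intros x Hx. destruct (logder_local T U (x, T) d ltac:(lra)) as [_ K]. unfold sqR, inR; simpl; lra. lra.
 intros r Ur Zr _. specialize (Far r Ur Zr). rewrite Rabs_minus_sym in Far. destruct (Cmod_RI (x, T) r) as [_ K]. simpl in K. lra.
 fold L in K. le_via K. replace (3 * L / d) with (3 * L * (2 * (INR (length l) + 1))) by (unfold d; field; lra). nra.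
Qed.

Lemma logder_left t U : 201 <= t <= U -> Cmod (Cder zeta (-1 / 4, t) / zeta (-1 / 4, t)) <= 6 * (c0 * ln U).
Proof. intros Ht. destruct (logder_local t U (-1 / 4, t) (1 / 2) Ht) as [_ K]; try lra. unfold sqR, inR; simpl; lra.
 intros r Ur Zr _. note (RH_line RH r Ur Zr) as E. destruct (Cmod_RI (-1 / 4, t) r) as [K _]. simpl in K. rewrite E in K. rewrite Rabs_left in K; lra.
Qed.

(** [zeta'/zeta] is [suml l] plus [g'/g]. Cauchy's formula evaluates the first part at the listed
    zeros; the second is holomorphic on the rectangle and is removed by [Goursat]. Under RH the
    rectangle contains all zeros of the band. *)
Lemma contour_zeros F l g t0 T : 1 <= t0 <= T -> (forall z, exists k, Cdiff F z k) -> facl UH zeta l g -> (forall z, In z l -> band t0 T z) -> (forall z, band t0 T z -> g z <> RtoC 0) ->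
 (forall r, UH r -> zeta r = 0 -> Im r <> t0 /\ Im r <> T) ->
 Rect (fun z => F z * (Cder zeta z / zeta z))%C (-1 / 4) (3 / 2) t0 T = (2 * PI * Ci * list_sum F l)%C /\
 forall z, onB (-1 / 4) (3 / 2) t0 T z -> contC (fun z => F z * (Cder zeta z / zeta z))%C z.
Proof. intros Ht HF Hf Hin Hn Ho. assert (cF : forall z, contC F z) by (intros z; destruct (HF z); eapply Cdiff_contC; eauto).
 assert (UB : forall z, inR (-1 / 4) (3 / 2) t0 T z -> UH z) by (intros z [_ H]; unfold UH; lra).
 assert (NB : forall z, onB (-1 / 4) (3 / 2) t0 T z -> zeta z <> RtoC 0).
 { intros z Hz E. note (UB z (onB_inR _ _ _ _ _ Hz)) as Uz. note (RH_line RH z Uz E). destruct (Ho z Uz E). destruct Hz as [_ Hz]. lra. }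
 assert (Il : forall r, In r l -> inI (-1 / 4) (3 / 2) t0 T r).
 { intros r Hr. note (Hin r Hr) as Br. unfold band in Br. assert (Ur : UH r) by (unfold UH; lra). assert (Zr := facl_zero l g r Hf Hr Ur). note (RH_line RH r Ur Zr). destruct (Ho r Ur Zr). unfold inI. lra. }
 destruct (Rect_suml F l (-1 / 4) (3 / 2) t0 T) as [E c1]; auto; try lra. assert (Hf' := Hf). destruct Hf as [Hg Hz].
 assert (Dg : forall z, inR (-1 / 4) (3 / 2) t0 T z -> exists k, Cdiff (fun z => F z * (Cder g z / g z))%C z k).
 { intros z Hi. destruct (HF z) as [k1 K1]. destruct (hol_Cder UH g opn_UH Hg z (UB z Hi)) as [k2 K2]. destruct (Hg z (UB z Hi)) as [k3 K3]. eexists. apply Cdiff_mult. apply K1. apply Cdiff_div; eauto. apply Hn. destruct Hi; unfold band; lra. }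
 assert (c2 : forall z, onB (-1 / 4) (3 / 2) t0 T z -> contC (fun z => F z * (Cder g z / g z))%C z) by (intros z Hi; destruct (Dg z (onB_inR _ _ _ _ _ Hi)); eapply Cdiff_contC; eauto).
 split.
 - rewrite (Rect_ext (-1 / 4) (3 / 2) t0 T ltac:(lra) ltac:(lra) _ (fun z => F z * suml l z + F z * (Cder g z / g z))%C).
  rewrite Rect_plus, E, (Goursat (fun z => F z * (Cder g z / g z))%C) by (auto; lra). ring.
  intros z Hb. rewrite (logder_facl UH zeta l g z opn_UH Hf' (UB z (onB_inR _ _ _ _ _ Hb)) (NB z Hb)). ring.
 - intros z Hb. note (UB z (onB_inR _ _ _ _ _ Hb)) as Uz. destruct (HF z) as [k1 K1]. destruct (hol_Cder UH zeta opn_UH zeta_hol_UH z Uz) as [k2 K2]. destruct (zeta_hol_UH z Uz) as [k3 K3]. eapply Cdiff_contC. apply Cdiff_mult. apply K1. apply Cdiff_div; eauto.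
Qed.

End Height.

(** * The explicit formula *)

Lemma CInt_wt_bound f A X a b : 0 < X -> 0 <= A -> 0 <= a <= b -> contI f a b -> (forall t, a <= t <= b -> Cmod (f t) <= A * wt X t) -> Cmod (CInt f a b) <= A * X ^ 2 / (X + a).
Proof. intros HX HA Hab Hf H. le_mid (- (A * X ^ 2 / (X + b)) - - (A * X ^ 2 / (X + a))).
 - apply (CInt_bound_prim f (fun t => - (A * X ^ 2 / (X + t))) (fun t => A * X ^ 2 / (X + t) ^ 2)); try lra; auto.
  + intros t Ht. auto_derive. lra. field. lra.
  + intros t Ht. apply ex_derive_cont. auto_derive. apply Rgt_not_eq. nra.
  + intros t Ht. eapply Rle_trans. apply H; auto. unfold wt. rewrite Rabs_pos_eq by lra. right; field; lra.
 - assert (0 <= A * X ^ 2 / (X + b)) by (apply Rdiv_le_0_compat; [apply Rmult_le_pos; auto; apply pow_le|]; lra). lra.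
Qed.

Definition pterm (B : R -> C) (xi X : R) (n : nat) : C := (RtoC (von_Mangoldt (S n)) * e (- (INR (S n) * xi)) * B (INR (S n) / X)%R)%C.

Section Explicit.
Hypothesis RH : Riemann_hypothesis.
Variables (B B1 B2 : R -> C) (al be M xi K : R).
Hypothesis TD : test_data B B1 B2 al be M.
Hypothesis Hxi : 0 < xi.
Let Fm := Fx B al be xi.
Hypothesis PK : 0 <= K.
Hypothesis HK : Fx_spec B al be xi K.

Variables (X t0 T : R).
Hypothesis HX : 10 <= X.
Hypothesis Ht0 : 300 <= t0 <= 301.
Hypothesis HT : X ^ 3 <= T.

Lemma T_big : 1000 <= T.
Proof. assert (10 ^ 3 <= X ^ 3) by (apply pow_incr; lra). lra. Qed.

Lemma Fm_contC z : contC (Fm X) z.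
Proof. destruct (Fx_Cdiff B B1 B2 al be M xi TD X z). eapply Cdiff_contC; eauto. Qed.

Lemma Rpower_int_exp n a b : INR n = b - a -> Rpower X b = X ^ n * Rpower X a.
Proof. intros H. rewrite <- Rpower_pow, <- Rpower_plus by lra. f_equal. lra. Qed.

(** Mellin inversion runs over the whole line, and three ranges are discarded. In units of
    [K X^(1/2) (n + 1)^(-3/2)] they cost 1 below 0 and 31 on [[0, t0]], by the stronger bound for
    low heights and [t0 / X <= 301/10], and 1 above [T], where the weight integrates to at most
    [X^2 / T <= 1 / X]. *)
Lemma inversion_tails n : let ph := fun t => (rcpow (INR (S n)) (- (3 / 2, t)%R) * Fm X (3 / 2, t)%R)%C in
 Cmod (CInt ph t0 T - 2 * PI * (e (- (INR (S n) * xi)) * B (INR (S n) / X)%R)) <= 40 * K * Rpower X (1 / 2) * Rpower (INR (S n)) (- (3 / 2)).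
Proof. intros ph. note T_big as BT. note (INR_S_ge1 n) as Hn. set (m := INR (S n)) in *. assert (PX : 0 < X) by lra. destruct (HK X HX) as (D1 & D2 & _).
 set (q := Rpower m (- (3 / 2))). assert (Pq : 0 < q) by apply Rpower_pos. set (h := Rpower X (1 / 2)). assert (Ph : 0 < h) by apply Rpower_pos. assert (Eh : Rpower X (3 / 2) = X * h). { rewrite (Rpower_int_exp 1 (1 / 2)); [|rewrite INR_1; lra]. unfold h. ring. }
 apply Rle_plus_epsilon. intros eps He. destruct (Mel_inversion B B1 B2 al be M (2 * PI * xi * X) (m / X) eps (T + 1) TD) as (L & L' & HL & HL' & Inv); auto. pos.
 assert (cp : forall a b, contI ph a b) by (intros a b t _; apply (rcpow_Fx_contR B B1 B2 al be M xi TD)).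
 rewrite (CInt_ext _ ph) in Inv; try lra.
 2:{ intros t _. unfold ph, Fm, Fx. rewrite Cmult_assoc. f_equal. unfold Rdiv. rewrite rcpow_mult_base by (try apply Rinv_0_lt_compat; lra). f_equal. unfold rcpow. rewrite ln_Rinv by lra. f_equal. rewrite RtoC_opp. ring. }
 replace (B (m / X) * Cexp (0%R, (- (2 * PI * xi * X * (m / X)))%R))%C with (e (- (m * xi)) * B (m / X)%R)%C in Inv. 2:{ rewrite Cmult_comm. f_equal. unfold e. f_equal. f_equal. field. lra. }
 set (v := (2 * PI * (e (- (m * xi)) * B (m / X)%R))%C) in *.
 rewrite (CInt_Chasles ph (- L) 0 L'), (CInt_Chasles ph 0 t0 L'), (CInt_Chasles ph t0 T L') in Inv by (auto; lra).
 assert (Mph : forall t, Cmod (ph t) = q * Cmod (Fm X (3 / 2, t))). { intros t. unfold ph. rewrite Cmod_mult, Cmod_rcpow. f_equal. }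
 assert (I1 : Cmod (CInt ph (- L) 0) <= q * K * h).
 { le_mid (q * (K * (X * h)) / (X - 0) - q * (K * (X * h)) / (X - - L)).
  - apply (CInt_bound_prim ph (fun t => q * (K * (X * h)) / (X - t)) (fun t => q * (K * (X * h)) / (X - t) ^ 2)); try lra; auto.
  + intros t Ht. auto_derive. lra. unfold Rminus. field. lra.
  + intros t Ht. apply ex_derive_cont. auto_derive. apply Rgt_not_eq. nra.
  + intros t Ht. rewrite Mph. replace (q * (K * (X * h)) / (X - t) ^ 2) with (q * (K * (X * h) / (X - t) ^ 2)) by (unfold Rdiv; ring). mul_le_l. lra. eapply Rle_trans. apply D2; simpl; lra. simpl Re. simpl Im. rewrite Eh, (Rabs_left1 t) by lra. right. reflexivity.
  - assert (0 <= q * (K * (X * h)) / (X - - L)) by (apply Rdiv_le_0_compat; [mulpos; lra|lra]). replace (q * (K * (X * h)) / (X - 0)) with (q * K * h) by (field; lra). lra. }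
 assert (I2 : Cmod (CInt ph 0 t0) <= 31 * (q * K * h)).
 { le_mid (q * (K * h / X) * (t0 - 0)).
  - apply CInt_bound; auto; try lra. intros t Ht. rewrite Mph. mul_le_l. lra. eapply Rle_trans. apply D2; simpl; lra. simpl Re. simpl Im. rewrite Eh, (Rabs_pos_eq t) by lra.
  le_mid (K * (X * h) / X ^ 2). mul_le_l. pos. apply Rinv_le_contravar. apply pow_lt; lra. apply pow_incr; lra. right; field; lra.
  - replace (q * (K * h / X) * (t0 - 0)) with (q * K * h * (t0 / X)) by (field; lra). rewrite (Rmult_comm 31). mul_le_l. pos. apply Rmult_le_reg_r with X; auto. unfold Rdiv. rewrite Rmult_assoc, Rinv_l; lra. }
 assert (I3 : Cmod (CInt ph T L') <= q * K * h).
 { eapply Rle_trans. apply (CInt_wt_bound ph (q * (K * (X * h))) X); auto; try lra. pos. intros t Ht. rewrite Mph, Rmult_assoc. mul_le_l. lra. eapply Rle_trans. apply D1; simpl; lra. simpl Re. simpl Im. rewrite Eh. lra.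
  apply Rmult_le_reg_r with (X + T). lra. div_cancel. replace (q * (K * (X * h)) * X ^ 2) with (q * K * h * X ^ 3) by ring. mul_le_l. pos. lra. }
 replace (CInt ph t0 T - v)%C with ((CInt ph (- L) 0 + (CInt ph 0 t0 + (CInt ph t0 T + CInt ph T L')) - v) - (CInt ph (- L) 0 + CInt ph 0 t0 + CInt ph T L'))%C by ring.
 le_via Cmod_triangle_minus. assert (Cmod (CInt ph (- L) 0 + CInt ph 0 t0 + CInt ph T L') <= 33 * (q * K * h)). { le_via Cmod_triangle. note (Cmod_triangle (CInt ph (- L) 0) (CInt ph 0 t0)). lra. }
 assert (0 <= q * K * h) by pos. replace (40 * K * h * q) with (40 * (q * K * h)) by ring. lra.
Qed.

Lemma pterm_zero n : be * X <= INR (S n) -> pterm B xi X n = 0.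
Proof. intros H. unfold pterm. rewrite (proj1 (td_zero TD (INR (S n) / X)%R ltac:(right; apply Rmult_le_reg_r with X; [lra|unfold Rdiv; rewrite Rmult_assoc, Rinv_l; lra]))). ring.
Qed.

Lemma pterm_stable N k : be * X <= INR N -> Csum (pterm B xi X) (N + k) = Csum (pterm B xi X) N.
Proof. intros H. induction k. rewrite Nat.add_0_r; auto. rewrite Nat.add_succ_r. cbn [Csum]. rewrite IHk, pterm_zero. ring. le_via H. apply le_INR; lia.
Qed.

(** The Dirichlet series of [zeta'/zeta] is truncated so late, depending on [T], that its tail is
    negligible on the compact segment. Each remaining term is inverted, and the bound [8 n^(-11/8)]
    for its coefficient makes the errors summable. *)
Lemma prime_side N : be * X <= INR N ->
 Cmod (CInt (fun t => Fm X (3 / 2, t)%R * (Cder zeta (3 / 2, t)%R / zeta (3 / 2, t)%R))%C t0 T + 2 * PI * Csum (pterm B xi X) N) <= 320 * Ksig (11 / 8) * K * Rpower X (1 / 2).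
Proof. intros HN. note T_big as BT. assert (KS : 0 < Ksig (11 / 8)) by (apply Ksig_pos; lra). set (h := Rpower X (1 / 2)). assert (Ph : 0 < h) by apply Rpower_pos. destruct (HK X HX) as (D1 & _ & _).
 assert (cF : contI (fun t => Fm X (3 / 2, t)%R) t0 T) by (intros t _; apply (contR_ver (Fm X)), Fm_contC).
 assert (cZ : forall t, t0 <= t <= T -> contR (fun t => Cder zeta (3 / 2, t)%R / zeta (3 / 2, t)%R)%C t).
 { intros t Ht. apply (contR_ver (fun s => Cder zeta s / zeta s)%C). assert (Us : UH (3 / 2, t)) by (unfold UH; simpl; lra). apply contC_div. apply (zeta_RH_neq0 RH); simpl; try lra. intros E. apply (f_equal Im) in E. simpl in E. lra.
  apply (hol_contC UH). apply hol_Cder. apply opn_UH. apply zeta_hol_UH. auto. apply (hol_contC UH). apply zeta_hol_UH. auto. }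
 destruct (contI_bounded (fun t => Fm X (3 / 2, t)%R) t0 T cF) as (S0 & PS & HS).
 apply Rle_plus_epsilon. intros eps He. set (A := (T - t0) * S0 * (8 * Ksig (11 / 8)) + 1). assert (PA : 0 < A) by (unfold A; assert (0 <= (T - t0) * S0 * (8 * Ksig (11 / 8))) by pos; lra).
 destruct (Rpower_small (11 / 8) (eps / A)) as [N1 HN1]. lra. apply Rdiv_lt_0_compat; auto. set (n := (N + N1)%nat). specialize (HN1 n ltac:(unfold n; lia)).
 rewrite <- (pterm_stable N N1 HN). fold n.
 set (ph := fun k t => (rcpow (INR (S k)) (- (3 / 2, t)%R) * Fm X (3 / 2, t)%R)%C).
 assert (cph : forall k, contI (ph k) t0 T) by (intros k t _; apply (rcpow_Fx_contR B B1 B2 al be M xi TD)).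
 destruct (CInt_Csum (fun k t => RtoC (von_Mangoldt (S k)) * ph k t)%C t0 T n) as [E1 c1]. lra. intros k t Ht. apply contR_scal, cph; auto.
 set (S1 := Csum (fun k => CInt (fun t => RtoC (von_Mangoldt (S k)) * ph k t)%C t0 T) n) in *.
 replace (CInt (fun t => Fm X (3 / 2, t)%R * (Cder zeta (3 / 2, t)%R / zeta (3 / 2, t)%R))%C t0 T + 2 * PI * Csum (pterm B xi X) n)%C
  with ((CInt (fun t => Fm X (3 / 2, t)%R * (Cder zeta (3 / 2, t)%R / zeta (3 / 2, t)%R))%C t0 T + S1) + - (S1 - 2 * PI * Csum (pterm B xi X) n))%C by ring.
 le_via Cmod_triangle. rewrite Cmod_opp, Rplus_comm. apply Rplus_le_compat.
 - rewrite <- Csum_scal. unfold S1. replace (Csum (fun k => CInt (fun t => RtoC (von_Mangoldt (S k)) * ph k t)%C t0 T) n - Csum (fun k => 2 * PI * pterm B xi X k)%C n)%C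
  with (Csum (fun k => CInt (fun t => RtoC (von_Mangoldt (S k)) * ph k t)%C t0 T + -(1) * (2 * PI * pterm B xi X k))%C n) by (rewrite Csum_plus, (Csum_scal (-(1))%C); ring).
  replace (320 * Ksig (11 / 8) * K * h) with (320 * K * h * Ksig (11 / 8)) by ring. apply Csum_bounded. lra. pos.
  intros k. rewrite CInt_scal by (auto; lra). unfold pterm. note (inversion_tails k) as I. cbv zeta in I. fold (ph k) in I. set (v := (e (- (INR (S k) * xi)) * B (INR (S k) / X)%R)%C) in *.
  replace (RtoC (von_Mangoldt (S k)) * CInt (ph k) t0 T + - (1) * (2 * PI * (RtoC (von_Mangoldt (S k)) * e (- (INR (S k) * xi)) * B (INR (S k) / X)%R)))%C with (RtoC (von_Mangoldt (S k)) * (CInt (ph k) t0 T - 2 * PI * v))%C by (unfold v; ring).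
  destruct (von_Mangoldt_bounds k) as [V1 V2]. rewrite Cmod_mult, Cmod_RtoC_pos by auto.
  note (Lser_bound (RtoC (3 / 2)) k ltac:(simpl; lra)) as LB. unfold Lser in LB. rewrite Cmod_mult, Cmod_RtoC_pos, Cmod_rcpow in LB by auto. rewrite re_opp, re_RtoC in LB.
  eapply Rle_trans. mul_le_l; [auto|apply I]. fold h. replace (von_Mangoldt (S k) * (40 * K * h * Rpower (INR (S k)) (- (3 / 2)))) with (40 * K * h * (von_Mangoldt (S k) * Rpower (INR (S k)) (- (3 / 2)))) by ring.
  replace (320 * K * h * Rpower (INR (S k)) (- (11 / 8))) with (40 * K * h * (8 * Rpower (INR (S k)) (- (11 / 8)))) by ring. mul_le_l; auto. pos.
 - rewrite <- E1, <- CInt_plus; auto; try lra. 2: intros t Ht; apply contR_mult; auto.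
  le_mid (S0 * (8 * Ksig (11 / 8) * Rpower (INR (S n)) (1 - 11 / 8)) * (T - t0)).
  + apply CInt_bound. lra. intros t Ht. apply contR_plus; auto. apply contR_mult; auto. intros t Ht. rewrite (logder_zeta RH) by reflexivity.
  replace (Csum (fun k => RtoC (von_Mangoldt (S k)) * ph k t)%C n) with (Fm X (3 / 2, t)%R * Csum (Lser (3 / 2, t)%R) n)%C. 2:{ rewrite <- Csum_scal. apply Csum_ext. intros k _. unfold ph, Lser. ring. }
  replace (Fm X (3 / 2, t)%R * - Lsum (3 / 2, t)%R + Fm X (3 / 2, t)%R * Csum (Lser (3 / 2, t)%R) n)%C with (Fm X (3 / 2, t)%R * (Csum (Lser (3 / 2, t)%R) n - Lsum (3 / 2, t)%R))%C by ring.
  rewrite Cmod_mult. mul_le. apply (Cser_tail (Lser (3 / 2, t)%R) 8 (11 / 8)); try lra. intros k. apply Lser_bound. simpl; lra. apply Lsum_Cser. simpl; lra.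
  + le_mid (A * Rpower (INR (S n)) (1 - 11 / 8)). note (Rpower_pos (INR (S n)) (1 - 11 / 8)). unfold A. nra. replace eps with (A * (eps / A)) by (field; lra). mul_le_l; lra.
Qed.

Variables (c0 U : R).
Hypothesis Hc0 : 1 <= c0.
Hypothesis HG : zeta_growth c0.
Hypothesis HU : T <= U.
Let L := c0 * ln U.
Variables (l : list C) (g : C -> C).
Hypothesis Hf : facl UH zeta l g.
Hypothesis Hin : forall z, In z l -> band t0 T z.

Lemma L_ge1 : 1 <= L.
Proof. note T_big. assert (1 <= ln U) by (apply ln_ge_1; lra). unfold L. nra. Qed.

Definition wsum (l : list C) : R := fold_right (fun z acc => wt X (Im z) + acc) 0 l.

Lemma wsum_le l' w : (forall z, In z l' -> wt X (Im z) <= w) -> wsum l' <= INR (length l') * w.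
Proof. induction l'; intros H; simpl. rewrite INR_0; lra. rewrite S_INR. note (H a (or_introl eq_refl)). specialize (IHl' (fun z Hz => H z (or_intror Hz))). lra. Qed.

Lemma wsum_sel S l' : wsum l' = wsum (sel S l') + wsum (sel (fun z => ~ S z) l').
Proof. induction l'; simpl. lra. unfold sel in *. simpl. rewrite IHl'. destruct (decb (S a)) eqn:E; destruct (decb (~ S a)) eqn:E'; simpl; try lra.
 exfalso. undec E'; undec E; auto. exfalso. undec E'; undec E; auto.
Qed.

(** Each unit of height holds at most [2 L] zeros, and [1 / y^2 <= 1 / (y - 1) - 1 / y] makes the
    sum of the weights telescope. *)
Lemma wsum_band n : forall l' g', facl UH zeta l' g' -> (forall z, In z l' -> t0 <= Im z <= t0 + INR n /\ Im z <= T) -> wsum l' <= 2 * L * (1 + X ^ 2 * (/ (X + t0 - 1) - / (X + t0 + INR n - 1))).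
Proof. note L_ge1 as PL. note T_big as BT.
 assert (Cnt : forall t l' g', 300 <= t <= T -> facl UH zeta l' g' -> (forall z, In z l' -> t <= Im z <= t + 1) -> INR (length l') <= 2 * L).
 { intros t l' g' Ht F H. apply (count_local RH c0 HG l' g' t U); auto. lra. intros z Hz. specialize (H z Hz). apply Rabs_le; lra. }
 induction n; intros l' g' F H.
 - rewrite INR_0, Rplus_0_r, Rminus_diag, Rmult_0_r, Rplus_0_r, Rmult_1_r. le_via (wsum_le l' 1). intros z _. apply wt_bounds; lra. rewrite Rmult_1_r. apply (Cnt t0 l' g'); auto. lra. intros z Hz. specialize (H z Hz). rewrite INR_0 in H. lra.
 - rewrite (wsum_sel (fun z => Im z <= t0 + INR n) l'). note (pos_INR n) as Pn. rewrite S_INR in *.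
  assert (I1 := IHn _ _ (facl_sel _ _ _ _ (fun z => Im z <= t0 + INR n) F)). 
  assert (I2 : wsum (sel (fun z => ~ Im z <= t0 + INR n) l') <= 2 * L * (X ^ 2 * (/ (X + t0 + INR n - 1) - / (X + t0 + (INR n + 1) - 1)))).
  { set (l2 := sel (fun z => ~ Im z <= t0 + INR n) l'). assert (F2 := facl_sel _ _ _ _ (fun z => ~ Im z <= t0 + INR n) F). fold l2 in F2.
  assert (H2 : forall z, In z l2 -> t0 + INR n <= Im z <= t0 + INR n + 1 /\ Im z <= T) by (intros z Hz; apply sel_In in Hz; destruct Hz as [Hz N]; specialize (H z Hz); lra).
  destruct (Rle_dec (t0 + INR n) T) as [Le|Le].
  - le_via (wsum_le l2 (X ^ 2 * (/ (X + t0 + INR n - 1) - / (X + t0 + (INR n + 1) - 1)))).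
  + intros z Hz. specialize (H2 z Hz). set (y := X + t0 + INR n) in *. le_mid (X ^ 2 / y ^ 2). unfold wt. rewrite Rabs_pos_eq by lra. mul_le_l. nra. apply Rinv_le_contravar. apply pow_lt; unfold y; lra. apply pow_incr. unfold y; lra.
  mul_le_l. nra. replace (X + t0 + (INR n + 1) - 1) with y by (unfold y; ring). assert (Py : 1 < y) by (unfold y; lra). apply Rmult_le_reg_r with (y ^ 2 * (y - 1)). apply Rmult_lt_0_compat; nra.
  replace (/ y ^ 2 * (y ^ 2 * (y - 1))) with (y - 1) by (field; lra). replace ((/ (y - 1) - / y) * (y ^ 2 * (y - 1))) with y by (field; lra). lra.
  + mul_le_r. apply Rmult_le_pos. nra. assert (/ (X + t0 + (INR n + 1) - 1) <= / (X + t0 + INR n - 1)) by (apply Rinv_le_contravar; lra). lra. apply (Cnt (t0 + INR n) l2 _ ltac:(lra) F2). intros z Hz. specialize (H2 z Hz). lra.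
  - destruct l2 as [|z0 l2]. simpl. apply Rmult_le_pos. lra. apply Rmult_le_pos. nra. assert (/ (X + t0 + (INR n + 1) - 1) <= / (X + t0 + INR n - 1)) by (apply Rinv_le_contravar; lra). lra.
  specialize (H2 z0 (or_introl eq_refl)). lra. }
  assert (I1' : wsum (sel (fun z => Im z <= t0 + INR n) l') <= 2 * L * (1 + X ^ 2 * (/ (X + t0 - 1) - / (X + t0 + INR n - 1)))).
  { apply I1. intros z Hz. apply sel_In in Hz. destruct Hz as [Hz N]. specialize (H z Hz). lra. }
  nra.
Qed.

Definition zterm (z : C) : C := (rcpow xi ((- (1 / 2))%R, (- Im z)%R) * calZ z * B (Im z / (2 * PI * xi * X))%R)%C.

(** Each zero costs [K X^(-1/2)] times its weight, and the weights add up to [O(L X)]. [calZ_eq]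
    identifies the factor in the stationary phase formula. *)
Lemma zero_side : Cmod (list_sum (Fm X) l - list_sum zterm l) <= 4 * K * L * Rpower X (1 / 2).
Proof. note L_ge1 as PL. note T_big as BT. destruct (HK X HX) as (_ & _ & D3). set (q := Rpower X (- (1 / 2))). assert (Pq : 0 < q) by apply Rpower_pos.
 assert (Z : forall l', (forall z, In z l' -> In z l) -> Cmod (list_sum (Fm X) l' - list_sum zterm l') <= K * q * wsum l').
 { induction l'; intros Hl; simpl. replace (0 - 0)%C with (RtoC 0) by ring. rewrite Cmod_0. lra.
  assert (Ia : In a l) by (apply Hl; left; auto). note (Hin a Ia) as Ba. unfold band in Ba. assert (Ua : UH a) by (unfold UH; lra). note (RH_line RH a Ua (facl_zero l g a Hf Ia Ua)) as Ra.
  assert (Ea : a = hl (Im a)) by (apply Ceq_intro; auto).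
  replace (Fm X a + list_sum (Fm X) l' - (zterm a + list_sum zterm l'))%C with ((Fm X a - zterm a) + (list_sum (Fm X) l' - list_sum zterm l'))%C by ring.
  le_via Cmod_triangle. rewrite Rmult_plus_distr_l. apply Rplus_le_compat. 2: apply IHl'; intros; apply Hl; right; auto.
  unfold zterm. rewrite Ea at 1 3. rewrite (calZ_eq RH) by lra. apply D3. lra. }
 eapply Rle_trans. apply Z; auto. destruct (INR_archimed 1 (T - t0)) as [n Hn]. lra. rewrite Rmult_1_r in Hn.
 assert (W : wsum l <= 2 * L * (1 + X ^ 2 * (/ (X + t0 - 1) - / (X + t0 + INR n - 1)))). { apply (wsum_band n l g); auto. intros z Hz. specialize (Hin z Hz). unfold band in Hin. lra. }
 assert (W2 : X ^ 2 * (/ (X + t0 - 1) - / (X + t0 + INR n - 1)) <= X).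
 { note (pos_INR n). assert (0 < / (X + t0 + INR n - 1)) by pos. assert (/ (X + t0 - 1) <= / X) by (apply Rinv_le_contravar; lra). le_mid (X ^ 2 * / X). mul_le_l; nra. right; field; lra. }
 assert (W3 : wsum l <= 4 * L * X) by nra. le_mid (K * q * (4 * L * X)). mul_le_l; auto. pos.
 right. rewrite (Rpower_int_exp 1 (- (1 / 2)) (1 / 2)). fold q. ring. rewrite INR_1; field.
Qed.

Hypothesis Hn : forall z, band t0 T z -> g z <> RtoC 0.
Hypothesis Ho : forall r, UH r -> zeta r = 0 -> Im r <> t0 /\ Im r <> T.
Variable D0 : R.
Hypothesis Hbot : forall x, -1 / 4 <= x <= 3 / 2 -> Cmod (Cder zeta (x, t0) / zeta (x, t0)) <= D0.
Hypothesis Htop : forall x, -1 / 4 <= x <= 3 / 2 -> Cmod (Cder zeta (x, T) / zeta (x, T)) <= 18 * L ^ 2.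

Lemma explicit_estimate N : be * X <= INR N ->
 Cmod (Csum (pterm B xi X) N + list_sum zterm l) <= 320 * Ksig (11 / 8) * K * Rpower X (1 / 2) + 6 * K * L * Rpower X (3 / 4) + 2 * K * D0 + 36 * K * L ^ 2 + 4 * K * L * Rpower X (1 / 2).
Proof. intros HN. note L_ge1 as PL. note T_big as BT. assert (PX : 0 < X) by lra. destruct (HK X HX) as (D1 & D2 & _).
 set (F := fun z => (Fm X z * (Cder zeta z / zeta z))%C).
 destruct (contour_zeros RH (Fm X) l g t0 T ltac:(lra) (Fx_Cdiff B B1 B2 al be M xi TD X) Hf Hin Hn Ho) as [E cB]. fold F in E, cB.
 destruct (edges (-1 / 4) (3 / 2) t0 T ltac:(lra) ltac:(lra) F cB) as (e1 & e2 & e3 & e4). unfold Rect in E.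
 assert (PD0 : 0 <= D0) by (eapply Rle_trans; [apply Cmod_ge_0|apply (Hbot 0); lra]).
 assert (Rx : forall x, x <= 3 / 2 -> Rpower X x <= X ^ 2). { intros x Hx. rewrite <- Rpower_pow by auto. apply Rpower_mono_exp. lra. change (INR 2) with (1 + 1). lra. }
 assert (Bb : Cmod (CInt (fun x => F (x, t0)) (-1 / 4) (3 / 2)) <= K * D0 * (3 / 2 - -1 / 4)).
 { apply CInt_bound; auto; try lra. intros x Hx. unfold F. rewrite Cmod_mult. mul_le. eapply Rle_trans. apply D2; simpl; lra. simpl Re; simpl Im. rewrite Rabs_pos_eq by lra.
  apply Rmult_le_reg_r with ((X + t0) ^ 2). apply pow_lt; lra. unfold Rdiv. rewrite Rmult_assoc, Rinv_l, Rmult_1_r by (apply pow_nonzero; lra). mul_le_l; auto. eapply Rle_trans. apply Rx; lra. apply pow_incr; lra. }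
 (* On the top edge [X^x wt X T] is at most [X^4 / (X + T)^2 <= 1], so only the bound for
    [zeta'/zeta] remains. *)
 assert (Bt : Cmod (CInt (fun x => F (x, T)) (-1 / 4) (3 / 2)) <= K * (18 * L ^ 2) * (3 / 2 - -1 / 4)).
 { apply CInt_bound; auto; try lra. intros x Hx. unfold F. rewrite Cmod_mult. mul_le. eapply Rle_trans. apply D1; simpl; lra. simpl Re; simpl Im. rewrite Rmult_assoc. rewrite <- (Rmult_1_r K) at 2. mul_le_l; auto.
  unfold wt. rewrite Rabs_pos_eq by lra. unfold Rdiv. rewrite <- Rmult_assoc. apply Rmult_le_reg_r with ((X + T) ^ 2). apply pow_lt; lra. rewrite Rmult_assoc, Rinv_l, Rmult_1_r, Rmult_1_l by (apply pow_nonzero; lra).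
  le_mid (X ^ 2 * X ^ 2). mul_le_r. nra. apply Rx; lra. rewrite <- Rpow_mult_distr. apply pow_incr. split. nra. assert (X * X <= X ^ 3) by (assert (0 <= X * X) by nra; simpl; nra). lra. }
 assert (Bl : Cmod (CInt (fun y => F (-1 / 4, y)) t0 T) <= 6 * K * L * Rpower X (3 / 4)).
 { eapply Rle_trans. apply (CInt_wt_bound _ (K * Rpower X (-1 / 4) * (6 * L)) X); auto; try lra. note (Rpower_pos X (-1 / 4)). pos.
  - intros t Ht. unfold F. rewrite Cmod_mult. replace (K * Rpower X (-1 / 4) * (6 * L) * wt X t) with (K * Rpower X (-1 / 4) * wt X t * (6 * L)) by ring. mul_le. apply (D1 (-1 / 4, t)); simpl; lra. apply (logder_left RH c0 Hc0 HG); lra.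
  - rewrite (Rpower_int_exp 1 (-1 / 4) (3 / 4)) by (rewrite INR_1; field). note (Rpower_pos X (-1 / 4)). set (r4 := Rpower X (-1 / 4)) in *. apply Rmult_le_reg_r with (X + t0). lra. div_cancel.
  replace (K * r4 * (6 * L) * X ^ 2) with (6 * K * L * (X ^ 1 * r4) * X) by ring. mul_le_l; [|lra]. mulpos; try lra. }
 note (prime_side N HN) as Pr. change (CInt _ t0 T) with (CInt (fun y => F (3 / 2, y)) t0 T) in Pr. note zero_side as Zs.
 set (bb := CInt (fun x => F (x, t0)) (-1 / 4) (3 / 2)) in *. set (bt := CInt (fun x => F (x, T)) (-1 / 4) (3 / 2)) in *. set (bl := CInt (fun y => F (-1 / 4, y)) t0 T) in *. set (br := CInt (fun y => F (3 / 2, y)) t0 T) in *.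
 set (P := Csum (pterm B xi X) N) in *. set (ZF := list_sum (Fm X) l) in *. set (ZG := list_sum zterm l) in *.
 (* [W] is the contour integral with the right edge replaced by its deviation from [-2 PI P]. It
    equals [2 PI i (P + ZF)], and every one of its parts has been estimated. *)
 set (W := (Ci * (br + 2 * PI * P) + bb - bt - Ci * bl)%C).
 assert (EW : W = (2 * PI * Ci * (P + ZF))%C). { unfold W. replace (Ci * (br + 2 * PI * P) + bb - bt - Ci * bl)%C with (bb + Ci * br - bt - Ci * bl + 2 * PI * Ci * P)%C by ring. rewrite E. ring. }
 assert (MW : Cmod W <= 320 * Ksig (11 / 8) * K * Rpower X (1 / 2) + 6 * K * L * Rpower X (3 / 4) + 2 * K * D0 + 36 * K * L ^ 2).
 { unfold W. le_via Cmod_triangle_minus. eapply Rle_trans. apply Rplus_le_compat_r, Cmod_triangle_minus. eapply Rle_trans. apply Rplus_le_compat_r, Rplus_le_compat_r, Cmod_triangle. rewrite !Cmod_mult, Cmod_Ci, !Rmult_1_l.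
  assert (0 <= K * D0) by pos. assert (0 <= K * L ^ 2) by (mulpos; auto; nra). lra. }
 assert (MP : Cmod (P + ZF) <= Cmod W). { rewrite EW, !Cmod_mult, Cmod_Ci, !Cmod_RtoC_pos by (note PI_RGT_0; lra). note PI2_1. note (Cmod_ge_0 (P + ZF)). nra. }
 replace (P + ZG)%C with ((P + ZF) - (ZF - ZG))%C by ring. le_via Cmod_triangle_minus. lra.
Qed.

End Explicit.

(** * Multiplicities and sums over zeros *)

(** If [m < m'], cancelling [(s - z)^m] in a punctured neighbourhood leaves [g s = (s - z)^k g' s]
    with [k > 0], and continuity forces [g z = 0]. *)
Lemma has_order_unique f z m m' : has_order f z m -> has_order f z m' -> m = m'.
Proof. assert (K : forall m m', (m < m')%nat -> has_order f z m -> has_order f z m' -> False).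
 { clear. intros m m' Hm (g & Hg & Ng & Lg) (g' & Hg' & Ng' & Lg'). apply holomorphic_at_Cdiff in Hg, Hg'. destruct Hg as (d1 & D1 & K1). destruct Hg' as (d2 & D2 & K2).
  apply locally_C_Cmod in Lg, Lg'. destruct Lg as (d3 & D3 & K3). destruct Lg' as (d4 & D4 & K4).
  assert (Z0 : Cmod (z - z) = 0) by (replace (z - z)%C with (RtoC 0) by ring; apply Cmod_0).
  set (k := (m' - m)%nat). destruct (K1 z ltac:(lra)) as [a Ha]. destruct (K2 z ltac:(lra)) as [b Hb]. apply Ng. apply Cmod_small_eq. intros eps He.
  assert (c1 : contC (fun s => g s - (s - z) ^ k * g' s)%C z).
  { destruct (hol_pow (fun _ => True) (fun s => s - z)%C k) with (z := z) as [p Hp]; auto. intros s _. eexists. apply Cdiff_sub_const. eapply Cdiff_contC. apply Cdiff_minus. apply Ha. apply Cdiff_mult. apply Hp. apply Hb. }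
  destruct (c1 eps He) as (d5 & D5 & K5). set (d := Rmin (Rmin d3 d4) d5 / 2). assert (Pm : 0 < Rmin (Rmin d3 d4) d5) by (repeat apply Rmin_pos; auto).
  min_le (Rmin d3 d4) d5. min_le d3 d4.
  set (s := (z + RtoC d)%C). assert (Es : (s - z)%C = RtoC d) by (unfold s; ring). assert (Ms : Cmod (s - z) = d) by (rewrite Es; apply Cmod_RtoC_pos; unfold d; lra).
  specialize (K3 s ltac:(rewrite Ms; unfold d; lra)). specialize (K4 s ltac:(rewrite Ms; unfold d; lra)). specialize (K5 s ltac:(rewrite Ms; unfold d; lra)).
  assert (Nd : (s - z)%C <> 0). { rewrite Es. intros E. apply (f_equal Re) in E. simpl in E. unfold d in E. lra. }
  assert (Eq : (g s - (s - z) ^ k * g' s)%C = 0).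
  { rewrite K3 in K4. replace m' with (m + k)%nat in K4 by (unfold k; lia). rewrite Cpow_add_r in K4. note (Cpow_nz (s - z) m Nd) as N. apply Ceq_minus in K4.
  assert (E : ((s - z) ^ m * (g s - (s - z) ^ k * g' s))%C = 0) by (rewrite <- K4; ring). apply NNPP. intros N2. exact (Cmult_neq_0 _ _ N N2 E). }
  assert (E0 : (g z - (z - z) ^ k * g' z)%C = g z). { replace (z - z)%C with (RtoC 0) by ring. unfold k. replace (m' - m)%nat with (S (m' - m - 1)) by lia. cbn [Cpow]. ring. }
  rewrite Eq, E0 in K5. rewrite Cmod_minus_sym. lra. }
 intros H H'. destruct (Nat.lt_trichotomy m m') as [L|[L|L]]; auto; exfalso; eauto.
Qed.

Definition cnt (l : list C) (z : C) : nat := length (sel (eq z) l).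

(** The factors of [prodl l] belonging to other zeros do not vanish at [z], so the order is the
    number of occurrences of [z] in [l]. *)
Lemma multiplicity_cnt l g z : facl UH zeta l g -> UH z -> g z <> RtoC 0 -> multiplicity z = cnt l z.
Proof. intros [Hg Hf] Uz Nz.
 assert (O : has_order zeta z (cnt l z)).
 { exists (fun s => prodl (sel (fun w => ~ z = w) l) s * g s)%C. destruct (opn_UH z Uz) as (d & D & Hd).
  assert (H : hol UH (fun s => prodl (sel (fun w => ~ z = w) l) s * g s)%C) by (apply hol_mult; auto; apply hol_prodl). split; [|split].
  - apply holomorphic_at_Cdiff. exists d. split; auto.
  - apply Cmult_neq_0; auto. apply prodl_neq0. intros r Hr. apply sel_In in Hr. tauto.
  - apply locally_C_Cmod. exists d. split; auto. intros w Hw. rewrite (Hf w (Hd w Hw)), (prodl_sel (eq z) l w), Cmult_assoc. f_equal. f_equal.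
  unfold cnt. assert (A : forall r, In r (sel (eq z) l) -> z = r) by (intros r Hr; apply sel_In in Hr; tauto). induction (sel (eq z) l) as [|r l' IH]. reflexivity.
  simpl. rewrite <- (A r (or_introl eq_refl)), IH by (intros; apply A; right; auto). reflexivity. }
 apply (has_order_unique zeta z); auto. apply (epsilon_spec (inhabits 0%nat) (has_order zeta z)). exists (cnt l z). auto.
Qed.

Lemma list_sum_ext f f' l : (forall z, In z l -> f z = f' z) -> list_sum f l = list_sum f' l.
Proof. induction l; intros H; simpl; auto. rewrite (H a (or_introl eq_refl)), IHl; auto. intros; apply H; right; auto. Qed.

Lemma list_sum_plus f f' l : list_sum (fun z => f z + f' z)%C l = (list_sum f l + list_sum f' l)%C.
Proof. induction l; simpl. ring. rewrite IHl. ring. Qed.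

Lemma list_sum_delta (G : C -> C) x l : NoDup l -> In x l -> list_sum (fun z => if decb (z = x) then G z else RtoC 0) l = G x.
Proof. intros ND. induction ND as [|a l Na ND IH]; intros Hx. contradiction. simpl. destruct (decb (a = x)) eqn:E.
 - undec E. subst a. assert (Z : forall l', ~ In x l' -> list_sum (fun z => if decb (z = x) then G z else RtoC 0) l' = RtoC 0).
  { induction l'; intros H; simpl; auto. rewrite (proj2 (decb_false (a = x))) by (intros ->; apply H; left; auto). rewrite IHl'. ring. intros X; apply H; right; auto. }
  rewrite Z by auto. ring.
 - undec E. destruct Hx as [|Hx]. contradiction. rewrite IH by auto. ring.
Qed.

(** Connects the lists with repetitions, natural for the contour integral, with sums over distinct
    zeros weighted by multiplicity. *)
Lemma list_sum_cnt (G : C -> C) l l0 : NoDup l -> (forall z, In z l0 -> In z l) -> list_sum (fun z => RtoC (INR (cnt l0 z)) * G z)%C l = list_sum G l0.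
Proof. intros ND. induction l0 as [|x l0 IH]; intros H.
 - simpl. rewrite (list_sum_ext _ (fun _ => RtoC 0)). induction l; simpl; auto. inversion ND; subst. rewrite IHl by (auto; intros z []). ring. intros z _. unfold cnt, sel; simpl. rewrite INR_0. ring.
 - simpl. rewrite <- IH by (intros; apply H; right; auto). rewrite <- (list_sum_delta G x l) at 1 by (auto; apply H; left; auto). rewrite <- list_sum_plus. apply list_sum_ext. intros z _.
  unfold cnt, sel. simpl. destruct (decb (z = x)); simpl. rewrite S_INR, RtoC_plus. ring. ring.
Qed.

Lemma list_sum_bound f l A : (forall z, In z l -> Cmod (f z) <= A) -> Cmod (list_sum f l) <= INR (length l) * A.
Proof. induction l; intros H; simpl. rewrite Cmod_0, INR_0; lra. rewrite S_INR. le_via Cmod_triangle. note (H a (or_introl eq_refl)). specialize (IHl (fun z Hz => H z (or_intror Hz))). lra.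
Qed.

Lemma list_sum_sel f S l : list_sum f l = (list_sum f (sel S l) + list_sum f (sel (fun z => ~ S z) l))%C.
Proof. induction l; simpl. ring. unfold sel in *. simpl. rewrite IHl. destruct (decb (S a)) eqn:E; destruct (decb (~ S a)) eqn:E'; simpl; try ring.
 exfalso. undec E'; undec E; auto. exfalso. undec E'; undec E; auto.
Qed.

(** The summand vanishes at zeros outside the band, so the unconditional sum is finite; beyond the
    entries of [l] nothing changes any more. *)
Lemma has_sum_over_zeros_list (G : C -> C) l g a b : 0 < a -> facl UH zeta l g -> (forall z, In z l -> band a b z) -> (forall z, band a b z -> g z <> RtoC 0) ->
 (forall z, nontrivial_zero z -> ~ band a b z -> G z = RtoC 0) -> has_sum_over_zeros G (list_sum G l).
Proof. intros Ha Hf Hin Hn HG eps He. exists l. assert (UB : forall z, band a b z -> UH z) by (intros z Hz; unfold band, UH in *; lra). split.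
 - intros z Hz. apply zeta_zero_nontrivial. auto. eapply facl_zero; eauto.
 - intros l1 ND P1 Inc. rewrite (list_sum_ext _ (fun z => RtoC (INR (cnt l z)) * G z)%C). rewrite list_sum_cnt by auto. replace (list_sum G l - list_sum G l)%C with (RtoC 0) by ring. rewrite Cmod_0; auto.
  intros z Hz. destruct (classic (band a b z)) as [Bz|Bz]. rewrite (multiplicity_cnt l g z) by auto. reflexivity. rewrite (HG z (P1 z Hz) Bz). ring.
Qed.

Lemma ln_le_Rpower X : 1 <= X -> ln X <= 20 * Rpower X (1 / 20).
Proof. intros HX. unfold Rpower. note (exp_ineq1_le (1 / 20 * ln X)). lra.
Qed.

(** The zeros in the band and the factors [xi^(-1/2 - i gamma)] and [calZ] do not involve [X]; it
    enters only through the argument of the bounded function [B]. *)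
Lemma low_zeros_bound (RH : Riemann_hypothesis) B B1 B2 al be M xi h1 t0 : test_data B B1 B2 al be M -> 0 < h1 ->
 exists A, 0 <= A /\ forall X l g, facl UH zeta l g -> (forall z, In z l -> band h1 t0 z) -> Cmod (list_sum (zterm B xi X) l) <= A.
Proof. intros TD Hh. destruct (band_list RH h1 t0 Hh) as (l0 & g0 & Hf0 & Hin0 & Hn0). destruct (cntb_band RH h1 t0 Hh) as [N HN]. note (td_M TD) as PM.
 assert (Mx : exists A, 0 <= A /\ forall X z, In z l0 -> Cmod (zterm B xi X z) <= A).
 { clear - TD PM. induction l0 as [|a l IH]. exists 0. split. lra. intros X z []. destruct IH as (A & PA & HA). set (q := Cmod (rcpow xi ((- (1 / 2))%R, (- Im a)%R) * calZ a)). assert (Pq : 0 <= q * M) by (apply Rmult_le_pos; auto; apply Cmod_ge_0).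
  exists (A + q * M). split. lra. intros X z [<-|Hz]. unfold zterm. rewrite Cmod_mult. fold q. destruct (td_bd TD (Im a / (2 * PI * xi * X))) as [b _]. assert (q * Cmod (B (Im a / (2 * PI * xi * X))) <= q * M) by (mul_le_l; auto; apply Cmod_ge_0). lra.
  specialize (HA X z Hz). lra. }
 destruct Mx as (A & PA & HA). exists (INR N * A). split. apply Rmult_le_pos; auto. apply pos_INR. intros X l g Hf Hin.
 specialize (HN l g Hf). rewrite (sel_all (band h1 t0) l Hin) in HN. le_via (list_sum_bound _ l A).
 - intros z Hz. apply HA. note (Hin z Hz) as Bz. assert (Uz : UH z) by (unfold band, UH in *; lra). apply (band_list_zero h1 t0 l0 g0 z); auto. eapply facl_zero; eauto.
 - mul_le_r; auto. apply le_INR; auto.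
Qed.

Theorem theorem4p1
  (RH : Riemann_hypothesis)
  (xi : R) (hxi : 0 < xi)
  (B : R -> C) (hB : Cc_infty_pos B) :
  exists K : R, forall XB : R, admissible_threshold B XB ->
  forall X : R, XB < X ->
  exists sum_n sum_rho : C,
    is_series (K := C_AbsRing) (V := C_NormedModule)
      (fun m : nat => let n := S m in
         (RtoC (von_Mangoldt n) * e (- (INR n * xi)) * B (INR n / X)%R)%C)
      sum_n /\
    has_sum_over_zeros
      (fun rho => let gamma := Im rho in
         (rcpow xi ((- (1 / 2))%R, (- gamma)%R) * calZ rho
          * B (gamma / (2 * PI * xi * X))%R)%C)
      sum_rho /\
    Cmod (sum_n - (- sum_rho))%C <= K * Rpower X (9 / 10).
Proof. destruct (Cc_infty_test_data B hB) as (B1 & B2 & al & be & M & TD). td_facts TD. note PI_RGT_0 as PP.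
 destruct (Fx_bounds B B1 B2 al be M xi TD hxi) as (K & PK & HK). destruct zeta_growth_exists as (c0 & Hc0 & HG).
 (* The bottom edge is fixed once and for all between 300 and 301, so the bound [D0] on it does not
    depend on [X]. *)
 destruct (good_height RH c0 Hc0 HG 300 302 ltac:(lra) ltac:(lra)) as (t0 & Ht0 & No0 & Hbot). set (D0 := 18 * (c0 * ln 302) ^ 2) in *.
 (* For ordinates below [h1], negative ones included, the argument of [B] is at most [al], since
    [X >= 10]; such zeros contribute nothing. *)
 set (px := 2 * PI * xi). assert (Ppx : 0 < px) by (unfold px; mulpos; lra). set (h1 := Rmin 1 (px * 10 * al)). assert (Ph1 : 0 < h1) by (unfold h1; apply Rmin_pos; try lra; mulpos; lra).
 assert (h1a : h1 <= 1) by apply Rmin_l. assert (h1b : h1 <= px * 10 * al) by apply Rmin_r.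
 destruct (low_zeros_bound RH B B1 B2 al be M xi h1 t0 TD Ph1) as (A & PA & HA).
 set (tau := px * be). assert (Ptau : 0 < tau) by (unfold tau; mulpos; lra). set (cL := c0 * (64 + tau)). assert (PcL : 1 <= cL) by (unfold cL; nra).
 assert (KS : 0 < Ksig (11 / 8)) by (apply Ksig_pos; lra).
 assert (PD0 : 0 <= D0) by (unfold D0; assert (0 <= (c0 * ln 302) ^ 2) by apply pow2_ge_0; lra).
 (* One term for each error, with [L] replaced by [cL] because [L <= cL X^(1/20)]. *)
 exists (A + 320 * Ksig (11 / 8) * K + 6 * K * cL + 2 * K * D0 + 36 * K * cL ^ 2 + 4 * K * cL). intros XB [HXB _] X HX0. assert (HX : 10 <= X) by lra. clear HX0 HXB XB.
 (* [V >= X^3] serves the contour, and [V >= tau X] puts every zero above [T] outside the support of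
    [B]. *)
 set (V := (1 + tau) * X ^ 3). set (U := V + 2). assert (X3 : 1000 <= X ^ 3). { replace 1000 with (10 ^ 3) by ring. apply pow_incr; lra. } assert (XX : X <= X ^ 3). { replace (X ^ 3) with (X * (X * X)) by ring. assert (1 <= X * X) by nra. nra. }
 assert (V1 : X ^ 3 <= V) by (unfold V; nra). assert (V2 : tau * X <= V) by (unfold V; nra).
 destruct (good_height RH c0 Hc0 HG V U ltac:(lra) ltac:(unfold U; lra)) as (T & HT & NoT & Htop).
 destruct (band_list RH h1 T Ph1) as (lf & gf & Hf & Hin & Hn).
 (* Zeros above [t0] are those inside the contour; the finitely many others go to
    [low_zeros_bound]. *)
 set (hi := sel (fun z => t0 < Im z) lf). set (lo := sel (fun z => ~ t0 < Im z) lf). set (G := zterm B xi X).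
 destruct (INR_archimed 1 (be * X)) as [N HN]. lra. rewrite Rmult_1_r in HN.
 exists (Csum (pterm B xi X) N), (list_sum G lf). split; [|split].
 - apply Cser_is_series. intros eps He. exists N. intros n Hn'. replace n with (N + (n - N))%nat by lia. change (fun m : nat => _) with (pterm B xi X). rewrite (pterm_stable B B1 B2 al be M xi TD X HX) by lra.
  replace (Csum (pterm B xi X) N - Csum (pterm B xi X) N)%C with (RtoC 0) by ring. rewrite Cmod_0. lra.
 - apply (has_sum_over_zeros_list G lf gf h1 T); auto. intros z _ Hz. assert (Q : Im z / (2 * PI * xi * X) <= al \/ be <= Im z / (2 * PI * xi * X)). 2: unfold G, zterm; rewrite (proj1 (td_zero TD _ Q)); ring.
  fold px. assert (PpX : 0 < px * X) by pos. unfold band in Hz. destruct (Rle_dec h1 (Im z)) as [L|L].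
  + right. apply Rmult_le_reg_r with (px * X); auto. div_cancel. assert (T < Im z) by (apply Rnot_le_lt; intros L2; apply Hz; lra). unfold tau in V2. lra.
  + left. apply Rmult_le_reg_r with (px * X); auto. div_cancel. assert (px * 10 * al <= al * (px * X)) by nra. lra.
 - replace (Csum (pterm B xi X) N - - list_sum G lf)%C with ((Csum (pterm B xi X) N + list_sum G hi) + list_sum G lo)%C by (rewrite (list_sum_sel G (fun z => t0 < Im z) lf); fold hi lo; ring).
  assert (Fhi := facl_sel _ _ _ _ (fun z => t0 < Im z) Hf). fold hi in Fhi. assert (Flo := facl_sel _ _ _ _ (fun z => ~ t0 < Im z) Hf). fold lo in Flo.
  assert (Lo : Cmod (list_sum G lo) <= A). { eapply HA; eauto. intros z Hz. apply sel_In in Hz. destruct Hz as [Hz Hz']. specialize (Hin z Hz). unfold band in *. lra. }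
  set (L := c0 * ln U).
  assert (Hi : Cmod (Csum (pterm B xi X) N + list_sum G hi) <= 320 * Ksig (11 / 8) * K * Rpower X (1 / 2) + 6 * K * L * Rpower X (3 / 4) + 2 * K * D0 + 36 * K * L ^ 2 + 4 * K * L * Rpower X (1 / 2)).
  { refine (explicit_estimate RH B B1 B2 al be M xi K TD PK HK X t0 T HX ltac:(lra) ltac:(lra) c0 U Hc0 HG ltac:(unfold U; lra) hi _ Fhi _ _ _ D0 Hbot Htop N ltac:(lra)).
  - intros z Hz. apply sel_In in Hz. destruct Hz as [Hz Hz']. specialize (Hin z Hz). unfold band in *. lra.
  - intros z Hz. unfold band in Hz. apply Cmult_neq_0. 2: apply Hn; unfold band; lra. apply prodl_neq0. intros r Hr ->. apply sel_In in Hr. destruct Hr as [Hr Hr']. assert (Ur : UH r) by (unfold UH; lra). apply (No0 r Ur). apply (facl_zero lf gf r Hf Hr Ur). lra.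
  - intros r Ur Zr. split; auto. }
  assert (RX : 1 <= Rpower X (1 / 20)). { rewrite <- (Rpower_O X) at 1 by lra. apply Rpower_mono_exp; lra. }
  assert (LL : 0 <= L <= cL * Rpower X (1 / 20)).
  { assert (U1 : 1 <= U) by (unfold U; lra). assert (U2 : U <= (2 + tau) * X ^ 3) by (unfold U, V; nra).
  assert (lnU : ln U <= (2 + tau) + 3 * ln X).
  { le_mid (ln ((2 + tau) * X ^ 3)). destruct (Req_dec U ((2 + tau) * X ^ 3)) as [->|]. lra. left; apply ln_increasing; lra. rewrite ln_mult by lra. assert (ln (2 + tau) <= 2 + tau). { note (exp_ineq1_le (ln (2 + tau))). rewrite exp_ln in H by lra. lra. }
  assert (ln (X ^ 3) = 3 * ln X). { replace (X ^ 3) with (X * (X * X)) by ring. rewrite !ln_mult by nra. ring. } lra. }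
  note (ln_le_Rpower X ltac:(lra)). assert (0 <= ln U) by (rewrite <- ln_1; destruct (Req_dec 1 U) as [<-|]; [lra|left; apply ln_increasing; lra]).
  unfold L, cL. split. nra. rewrite Rmult_assoc. mul_le_l. lra. nra. }
  (* Everything is measured in [x = X^(1/20)]: [X^(1/2)], [X^(3/4)] and [X^(9/10)] are [x^10],
     [x^15] and [x^18], and each [L] costs one more [x]. *)
  set (x := Rpower X (1 / 20)) in *. assert (ex : forall k, Rpower X (INR k / 20) = x ^ k). { intros k. unfold x. rewrite <- Rpower_pow by apply Rpower_pos. rewrite Rpower_mult. f_equal. field. }
  assert (e1 : Rpower X (1 / 2) = x ^ 10). { rewrite <- ex. f_equal. rewrite INR_IZR_INZ; simpl; field. } assert (e2 : Rpower X (3 / 4) = x ^ 15). { rewrite <- ex. f_equal. rewrite INR_IZR_INZ; simpl; field. } assert (e3 : Rpower X (9 / 10) = x ^ 18). { rewrite <- ex. f_equal. rewrite INR_IZR_INZ; simpl; field. }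
  rewrite e1, e2 in Hi. rewrite e3. assert (mono : forall j, (j <= 18)%nat -> x ^ j <= x ^ 18) by (intros; apply Rle_pow; auto). note (mono 0%nat ltac:(lia)) as m0. rewrite pow_O in m0. note (mono 10%nat ltac:(lia)) as m10. note (mono 16%nat ltac:(lia)) as m16. note (mono 11%nat ltac:(lia)) as m11. note (mono 2%nat ltac:(lia)) as m2.
  set (y := x ^ 18) in *.
  assert (T1 : 320 * Ksig (11 / 8) * K * x ^ 10 <= 320 * Ksig (11 / 8) * K * y) by (mul_le_l; auto; mulpos; lra).
  assert (T2 : 6 * K * L * x ^ 15 <= 6 * K * cL * y). { le_mid (6 * K * (cL * x) * x ^ 15). mul_le_r. apply pow_le; lra. mul_le_l; lra. replace (6 * K * (cL * x) * x ^ 15) with (6 * K * cL * x ^ 16) by ring. mul_le_l; auto. pos. }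
  assert (T3 : 4 * K * L * x ^ 10 <= 4 * K * cL * y). { le_mid (4 * K * (cL * x) * x ^ 10). mul_le_r. apply pow_le; lra. mul_le_l; lra. replace (4 * K * (cL * x) * x ^ 10) with (4 * K * cL * x ^ 11) by ring. mul_le_l; auto. pos. }
  assert (T4 : 36 * K * L ^ 2 <= 36 * K * cL ^ 2 * y). { replace (36 * K * cL ^ 2 * y) with (36 * K * (cL ^ 2 * y)) by ring. mul_le_l. lra. le_mid ((cL * x) ^ 2). apply pow_incr; lra. rewrite Rpow_mult_distr. mul_le_l; auto. apply pow2_ge_0. }
  assert (T5 : 2 * K * D0 <= 2 * K * D0 * y). { rewrite <- (Rmult_1_r (2 * K * D0)) at 1. mul_le_l; auto. pos. }
  assert (T6 : A <= A * y) by nra.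
  le_via Cmod_triangle. rewrite !Rmult_plus_distr_r. lra.
Qed.
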